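(* Let $(\Gamma,X,\mathcal B)\in\hat{\mathcal G}$, let $B\in\mathcal B$, $e=|E(\Gamma_{\mathcal B})|$ and $\mu=|V(\Gamma_{\mathcal B})|$, and suppose $k=3$. Then $\Gamma_{\mathcal B}$ is $(X,2)$-arc-transitive if and only if one of the following occurs: (a) $(v,b,r)=(4,4,3)$ and $X_B^B\cong A_4$ or $S_4$; (b) $(v,b,r)=(6,4,2)$ and $X_B^B\cong A_4$ or $S_4$; (c) $(v,b,r)=(7,7,3)$ and $X_B^B\cong PSL(3,2)$; (d) $v=3b\ge 6$, $r=1$ and $X_B$ acts $2$-transitively on the blocks of $\mathcal D(B)$. Furthermore, let $C\in\Gamma_{\mathcal B}(B)$. If (a) occurs, then $\Gamma\cong\Xi(\Gamma_{\mathcal B},\Delta)$ for some self-paired $X$-orbit $\Delta$ on $Arc_3(\Gamma_{\mathcal B})$, $X$ acts faithfully on $\mathcal B$, and any connected tetravalent $(X,2)$-arc-transitive graph can occur as $\Gamma_{\mathcal B}$; moreover one of: (a.1) $\Gamma[B,C]\cong 3K_2$, $val(\Gamma)=3$, and there is an $X$-orbit $\mathcal E$ of $n$-cycles of $\Gamma_{\mathcal B}$ with $|\mathcal E|=m$ such that $\Delta=\bigcup_{C'\in\mathcal E}Arc_3(C')$ and $X_{[C']}^{[C']}\cong D_{2n}$ for each $C'\in\mathcal E$, where $m\ge6$, $n\ge girth(\Gamma_{\mathcal B})$ and $mn=3e=6\mu$; moreover either $\Gamma_{\mathcal B}\cong K_5$ or $\Gamma_{\mathcal B}$ is a near $n$-gonal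 graph with respect to $\mathcal E$; and either $X_B\cong A_4$, $\Gamma$ is $(X,1)$-arc-regular and $\Gamma_{\mathcal B}$ is $(X,2)$-arc-regular, or $X_B\cong S_4$ and $\Gamma$ is $(X,2)$-arc-regular; (a.2) $\Gamma[B,C]\cong K_{3,3}-3K_2$, $val(\Gamma)=6$, $X_B\cong S_4$, $\Gamma$ is connected and $(X,1)$-arc-regular; further $\Delta':=Arc_3(\Gamma_{\mathcal B})\setminus\Delta$ is a self-paired $X$-orbit on $Arc_3(\Gamma_{\mathcal B})$ and there is an $X$-orbit $\mathcal E$ of $n$-cycles of $\Gamma_{\mathcal B}$ with $|\mathcal E|=m$ such that $\Delta'=\bigcup_{C'\in\mathcal E}Arc_3(C')$, $X_{[C']}^{[C']}\cong D_{2n}$ for each $C'\in\mathcal E$, where $m\ge 6$, $n\ge girth(\Gamma_{\mathcal B})$, $mn=3e=6\mu$; moreover either $\Gamma_{\mathcal B}\cong K_5$ or $\Gamma_{\mathcal B}$ is a near $n$-gonal graph; (a.3) $\Gamma[B,C]\cong K_{3,3}$, $val(\Gamma)=9$, $\Gamma$ is connected and $(X,1)$-transitive, and $\Gamma_{\mathcal B}$ is $(X,3)$-arc-transitive. If (b) occurs, then $\Gamma\cong\gimel(\Gamma_{\mathcal B},\Delta)\cong\Psi(\Gamma_{\mathcal B},\Lambda)$ for some self-paired $X$-orbit $\Delta$ on $Arc_3(\Gamma_{\mathcal B})$ and some self-paired $X$-orbit $\Lambda$ on $J(\Gamma_{\mathcal B})$, $X$ acts faithfully on $\mathcal B$, and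 any connected tetravalent $(X,2)$-arc-transitive graph can occur as $\Gamma_{\mathcal B}$; moreover one of: (b.1) $\Gamma[B,C]\cong 3K_2$, $\Gamma\cong mC_n$, and there is an $X$-orbit $\mathcal E$ of $n$-cycles of $\Gamma_{\mathcal B}$ with $|\mathcal E|=m$, $\Delta=\bigcup_{C'\in\mathcal E}Arc_3(C')$, $X_{[C']}^{[C']}\cong D_{2n}$ for each $C'\in\mathcal E$, where $m\ge6$, $n\ge girth(\Gamma_{\mathcal B})$, $mn=3e=6\mu$; moreover either $\Gamma_{\mathcal B}\cong K_5$ or $\Gamma_{\mathcal B}$ is a near $n$-gonal graph with respect to $\mathcal E$; and either $X_B\cong A_4$, $\Gamma$ is $(X,1)$-arc-regular and $\Gamma_{\mathcal B}$ is $(X,2)$-arc-regular, or $X_B\cong S_4$ and $\Gamma$ is not $(X,1)$-arc-regular; (b.2) $\Gamma[B,C]\cong K_{3,3}-3K_2$, $val(\Gamma)=4$, $X_B\cong S_4$, $\Gamma$ is connected and $(X,1)$-arc-regular; further $\Delta':=Arc_3(\Gamma_{\mathcal B})\setminus\Delta$ is a self-paired $X$-orbit on $Arc_3(\Gamma_{\mathcal B})$ and there is an $X$-orbit $\mathcal E$ of $n$-cycles of $\Gamma_{\mathcal B}$ with $|\mathcal E|=m$, $\Delta'=\bigcup_{C'\in\mathcal E}Arc_3(C')$, $X_{[C']}^{[C']}\cong D_{2n}$ for each $C'\in\mathcal E$, where $m\ge6$, $n\ge girth(\Gamma_{\mathcal B})$, $mn=3e=6\mu$; moreover either $\Gamma_{\mathcal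 B}\cong K_5$ or $\Gamma_{\mathcal B}$ is a near $n$-gonal graph; (b.3) $\Gamma[B,C]\cong K_{3,3}$, $val(\Gamma)=6$, $\Gamma$ is connected and $(X,1)$-transitive, and $\Gamma_{\mathcal B}$ is $(X,3)$-arc-transitive. If (c) occurs, then $\Gamma\cong\Pi(\Gamma_{\mathcal B},\Theta)$ for some self-paired $X$-symmetric orbit $\Theta$ on $DSt^3(\Gamma_{\mathcal B})$, $X$ acts faithfully on $\mathcal B$, and a connected heptavalent $X$-symmetric graph $\Sigma$ can occur as $\Gamma_{\mathcal B}$ if and only if $X_\tau^{\Sigma(\tau)}\cong PSL(3,2)$ for $\tau\in V(\Sigma)$; further one of: (c.1) $\Gamma[B,C]\cong 3K_2$, $val(\Gamma)=3$, and $\Gamma$ is $(X,2)$-arc-transitive but not $(X,2)$-arc-regular; (c.2) $\Gamma[B,C]\cong K_{3,3}-3K_2$, $val(\Gamma)=6$, and $\Gamma$ is connected and $(X,1)$-transitive; (c.3) $\Gamma[B,C]\cong K_{3,3}$, $val(\Gamma)=9$, and $\Gamma$ is connected and $(X,1)$-transitive. If (d) occurs, then one of: (d.1) $\Gamma[B,C]\cong 3K_2$ and $\Gamma\cong 3eK_2$; (d.2) $\Gamma[B,C]\cong K_{3,3}-3K_2$ and $\Gamma\cong e(K_{3,3}-3K_2)$; (d.3) $\Gamma[B,C]\cong K_{3,3}$ and $\Gamma\cong eK_{3,3}$.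
   Context: Graphs are finite, simple, undirected; $\Sigma(\tau)$ is a neighbourhood, $val$ the valency, $girth$ the girth, $mC_n$ (resp. $eH$) the disjoint union of $m$ copies of the $n$-cycle (resp. $e$ copies of $H$). An $s$-arc is a sequence $(\alpha_0,\dots,\alpha_s)$ of vertices with consecutive ones adjacent and $\alpha_{i-1}\ne\alpha_{i+1}$; $Arc_s(\Sigma)$ is the set of $s$-arcs, $Arc=Arc_1$. An $s$-arc with distinct entries, identified with its reverse, is an $s$-path $[\alpha_0,\dots,\alpha_s]$; $Path_s(\Sigma)$ is the set of them. $\Delta\subseteq Arc_3(\Sigma)$ is self-paired if it is closed under reversal. For $X$ acting on $V(\Sigma)$ preserving adjacency: $\Sigma$ is $(X,s)$-arc-transitive (resp. $(X,s)$-arc-regular) if $X$ is vertex-transitive and transitive (resp. regular) on $Arc_s(\Sigma)$; $X$-symmetric means $(X,1)$-arc-transitive; $(X,s)$-transitive means $(X,s)$- but not $(X,s+1)$-arc-transitive. $X_\tau$, $X_S$, $X_{(S)}$ denote point, setwise and pointwise stabilisers; $X_S^S=X_S/X_{(S)}$; $X_\tau^{\Sigma(\tau)}$ is the group induced by $X_\tau$ on $\Sigma(\tau)$. For a subgraph $C$, $X_{[C]}$ is the subgroup of $X$ mapping $C$ onto itself and $X_{[C]}^{[C]}=X_{[C]}/X_{(V(C))}$; $D_{2n}$ is the dihedral group of order $2n$. Partitions: for $X$-symmetric $\Gamma$ and $X$-invariant partition $\mathcal B$ of $V(\Gamma)$, $\Gamma_{\mathcal B}$ is the quotient graph on $\mathcal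 B$ ($B\sim C$ iff some vertex of $B$ is adjacent to some vertex of $C$). $\Gamma(C)=\bigcup_{\mathfrak u\in C}\Gamma(\mathfrak u)$, $\Gamma_{\mathcal B}(B)$ is the neighbourhood of $B$ in $\Gamma_{\mathcal B}$, $\Gamma_{\mathcal B}(\mathfrak v)=\{C\in\mathcal B:\mathfrak v\in\Gamma(C)\}$. Parameters: $v=|B|$, $k=|\Gamma(C)\cap B|$ ($C\in\Gamma_{\mathcal B}(B)$), $r=|\Gamma_{\mathcal B}(\mathfrak v)|$, $b=val(\Gamma_{\mathcal B})$. $\mathcal D(B)$ has points $B$, blocks $\Gamma_{\mathcal B}(B)$, $\mathfrak v$ incident with $C$ iff $C\in\Gamma_{\mathcal B}(\mathfrak v)$. $\Gamma$ is a multicover of $\Gamma_{\mathcal B}$ if $k=v$. $\Gamma[B,C]$ is the bipartite subgraph induced on $(\Gamma(C)\cap B)\cup(\Gamma(B)\cap C)$. $\hat{\mathcal G}$ is the set of triples $(\Gamma,X,\mathcal B)$ with $\Gamma$ finite $X$-symmetric, $\mathcal B$ an $X$-invariant partition with $1<|B|<|V(\Gamma)|$, $\Gamma_{\mathcal B}$ connected of valency $\ge2$, $\Gamma$ not a multicover of $\Gamma_{\mathcal B}$, and $X$ faithful on $V(\Gamma)$. Constructions (for $\Sigma$ a graph, $X$ acting on it): $\gimel(\Sigma,\Delta)$ ($\Delta\subseteq Arc_3(\Sigma)$ self-paired) has vertex set $Path_2(\Sigma)$ and edges $\{[\alpha_0,\alpha_1,\alpha_2],[\alpha_1,\alpha_2,\alpha_3]\}$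 for $(\alpha_0,\alpha_1,\alpha_2,\alpha_3)\in\Delta$. The $3$-arc graph $\Xi(\Sigma,\Delta)$ has vertex set $Arc(\Sigma)$, with $(\tau,\tau_1)$ adjacent to $(\sigma,\sigma_1)$ iff $(\tau_1,\tau,\sigma,\sigma_1)\in\Delta$. $J(\Sigma)$ is the set of pairs $([\tau_1,\tau,\tau_2],[\sigma_1,\sigma,\sigma_2])$ of $2$-paths with $\sigma\in\Sigma(\tau)\setminus\{\tau_1,\tau_2\}$ and $\tau\in\Sigma(\sigma)\setminus\{\sigma_1,\sigma_2\}$; $\Lambda\subseteq J(\Sigma)$ is self-paired if closed under swapping the two coordinates; $\Psi(\Sigma,\Lambda)$ has vertex set $Path_2(\Sigma)$ with $\boldsymbol\tau,\boldsymbol\sigma$ adjacent iff $(\boldsymbol\tau,\boldsymbol\sigma)\in\Lambda$. For $S\subseteq\Sigma(\tau)$ with $|S|=\kappa$, the $\kappa$-star $\mathfrak s(\tau,S)=\{(\tau,\sigma):\sigma\in S\}$; $St^\kappa(\Sigma)$ is the set of $\kappa$-stars. A star $\mathfrak s(\tau,S)$ is symmetric if $X_\tau\cap X_S$ is transitive on $S$; a set of stars is $X$-symmetric if it is a single $X$-orbit containing a symmetric star. A $\kappa$-double star is a pair $(\mathfrak l,\mathfrak r)$ with $\mathfrak l=\mathfrak s(\tau,L)$, $\mathfrak r=\mathfrak s(\sigma,R)$ $\kappa$-stars, $\sigma\in L$, $\tau\in R$; $DSt^\kappa(\Sigma)$ is their set. An $X$-orbit $\Theta$ on $DSt^\kappa(\Sigma)$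 is $X$-symmetric if $St(\Theta)=\{\mathfrak l,\mathfrak r:(\mathfrak l,\mathfrak r)\in\Theta\}$ is $X$-symmetric, and self-paired if $(\mathfrak l,\mathfrak r)\in\Theta\Rightarrow(\mathfrak r,\mathfrak l)\in\Theta$. $\Pi(\Sigma,\Theta)$ has vertex set $St(\Theta)$, with $\mathfrak l\sim\mathfrak r$ iff $(\mathfrak l,\mathfrak r)\in\Theta$. A near $n$-gonal graph is a connected graph of girth at least $4$ with a set $\mathcal E$ of $n$-cycles such that every $2$-arc lies in a unique member of $\mathcal E$. A graph $\Sigma$ (with group $X$) ''can occur as $\Gamma_{\mathcal B}$'' in a case means there is $(\Gamma,X,\mathcal B)\in\hat{\mathcal G}$ with $k=3$ in that case and $\Gamma_{\mathcal B}\cong\Sigma$. *)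

(* Defs.v *)
From HB Require Import structures.
From mathcomp Require Import all_boot all_order all_algebra.
From mathcomp Require Import all_fingroup all_solvable.

Set Implicit Arguments.
Unset Strict Implicit.
Unset Printing Implicit Defensive.

Import GroupScope.

(* A finite simple graph whose vertices form a subset of the ambient finType.
   The ambient type lets quotient graphs (vertices in {set T}), graphs on
   2-paths, on arcs and on stars be handled without subtypes. *)
Record graph (T : finType) := Graph {
  vset : {set T};
  adj : rel T;
  adj_sym : symmetric adj;
  adj_irr : irreflexive adj;
  adj_vset : forall x y, adj x y -> x \in vset
}.

Section SimpleGraph.
Variables (T : finType) (V : {set T}) (r : rel T).

Definition sg_adj : rel T :=
  fun x y => [&& x \in V, y \in V, x != y & r x y || r y x].

Lemma sg_adj_sym : symmetric sg_adj.
Proof.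
by move=> x y; rewrite /sg_adj eq_sym orbC andbCA.
Qed.

Lemma sg_adj_irr : irreflexive sg_adj.
Proof. by move=> x; rewrite /sg_adj eqxx /= !andbF. Qed.

Lemma sg_adj_vset x y : sg_adj x y -> x \in V.
Proof. by case/andP. Qed.

(* r is symmetrised and loops are dropped, so that no side condition on r is
   needed to get a simple graph. *)
Definition simple_graph : graph T := Graph sg_adj_sym sg_adj_irr sg_adj_vset.

End SimpleGraph.

Section Basics.
Variable T : finType.
Implicit Types (G : graph T) (S : {set T}).

Definition nbr G (x : T) : {set T} := [set y | adj G x y].

Definition edges G : {set {set T}} :=
  [set [set x.1; x.2] | x : T * T & adj G x.1 x.2].

Definition has_val G (d : nat) : Prop :=
  forall x, x \in vset G -> #|nbr G x| = d.

Definition connected G : Prop :=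
  forall x y, x \in vset G -> y \in vset G -> connect (adj G) x y.

Definition induced G S : graph T := simple_graph (vset G :&: S) (adj G).

Definition rev_tup n (t : n.-tuple T) : n.-tuple T := [tuple of rev t].

Definition is_arc (s : nat) G (t : s.+1.-tuple T) : bool :=
  [&& [forall i, tnth t i \in vset G],
      [forall i : 'I_s.+1, forall j : 'I_s.+1,
        (j == i.+1 :> nat) ==> adj G (tnth t i) (tnth t j)]
    & [forall i : 'I_s.+1, forall j : 'I_s.+1,
        (j == i.+2 :> nat) ==> (tnth t i != tnth t j)]].

Definition Arc (s : nat) G : {set s.+1.-tuple T} := [set t | is_arc G t].

(* An s-path is an s-arc up to reversal: the unordered pair {t, rev t}. *)
Definition path_of n (t : n.-tuple T) : {set n.-tuple T} := [set t; rev_tup t].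

Definition Path (s : nat) G : {set {set s.+1.-tuple T}} :=
  [set path_of t | t in Arc s G & uniq t].

Definition self_paired_arcs n (D : {set n.-tuple T}) : Prop :=
  forall t, t \in D -> rev_tup t \in D.

(* An n-cycle, as a subgraph, is given by its set of edges. *)
Definition cycle_edges (c : seq T) : {set {set T}} :=
  [set [set x; next c x] | x in c].

Definition ncycles (n : nat) G : {set {set {set T}}} :=
  [set C | (2 < n) && [exists c : n.-tuple T,
             [&& uniq c, path.cycle (adj G) c & C == cycle_edges c]]].

Definition cycle_graph_of (C : {set {set T}}) : graph T :=
  simple_graph (cover C) (fun x y => [set x; y] \in C).

Definition is_girth G (g : nat) : Prop :=
  ncycles g G != set0 /\ (forall n, ncycles n G != set0 -> g <= n).

(* girth G >= g, a graph without cycles having infinite girth *)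
Definition girth_geq G (g : nat) : Prop :=
  forall n, ncycles n G != set0 -> g <= n.

Definition near_ngonal_wrt (n : nat) G (E : {set {set {set T}}}) : Prop :=
  [/\ connected G, girth_geq G 4, E \subset ncycles n G
    & forall t, t \in Arc 2 G ->
        exists! C, C \in E /\ t \in Arc 2 (cycle_graph_of C)].

Definition near_ngonal (n : nat) G : Prop := exists E, near_ngonal_wrt n G E.

End Basics.

Section Iso.
Variables (T U : finType) (G : graph T) (H : graph U).

Definition is_giso (f : T -> U) : Prop :=
  [/\ {in vset G &, injective f}, f @: vset G = vset H
    & {in vset G &, forall x y, adj H (f x) (f y) = adj G x y}].

Definition giso : Prop := exists f, is_giso f.

End Iso.

Notation "G ~=g H" := (giso G H) (at level 70, no associativity).

Definition complete (n : nat) : graph 'I_n :=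
  simple_graph setT (fun _ _ => true).

Definition K33 : graph (bool * 'I_3)%type :=
  simple_graph setT (fun x y => x.1 != y.1).

(* K_{3,3} minus the perfect matching {(false,i),(true,i)} *)
Definition K33_minus_3K2 : graph (bool * 'I_3)%type :=
  simple_graph setT (fun x y => (x.1 != y.1) && (x.2 != y.2)).

Definition cycle_graph (n : nat) : graph 'I_n :=
  simple_graph setT (fun i j : 'I_n => j == (i.+1 %% n)%N :> nat).

Definition copies (m : nat) (T : finType) (H : graph T)
  : graph ('I_m * T)%type :=
  simple_graph [set x | x.2 \in vset H]
    (fun x y => (x.1 == y.1) && adj H x.2 y.2).

Definition SL (n p : nat) : {set {'GL_n(p)}} := 
  [set u | (\det (GLval u) == 1)%R].

Fact SL_group_set (n p : nat) : group_set (SL n p).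
Proof.
apply/group_setP; split=> [|u v]; rewrite !inE ?GL_1E ?det1 //.
by move=> /eqP du /eqP dv; rewrite GL_MxE det_mulmx du dv GRing.mul1r.
Qed.

Canonical SL_group (n p : nat) := Group (SL_group_set n p).

Definition PSL (n p : nat) := (SL n p / 'Z(SL n p))%g.

Section PairAction.
Variables (aT : finGroupType) (T : finType) (to : {action aT &-> T}).

Definition pair_act (x : T * T) (a : aT) : T * T := (to x.1 a, to x.2 a).

Fact pair_act_is_action : is_action setT pair_act.
Proof.
apply: is_total_action => [[x y] | [x y] a b]; rewrite /pair_act /=.
  by rewrite !act1.
by rewrite !actM.
Qed.

Canonical pair_action := Action pair_act_is_action.

End PairAction.

Section GroupOnGraph.
Variables (aT : finGroupType) (T : finType).
Variables (X : {group aT}) (to : {action aT &-> T}).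
Implicit Types (G : graph T) (S : {set T}).

Definition acts_on_graph G : Prop :=
  [acts X, on vset G | to] /\
  (forall a x y, a \in X -> adj G (to x a) (to y a) = adj G x y).

Definition arc_transitive (s : nat) G : Prop :=
  [transitive X, on vset G | to] /\ [transitive X, on Arc s G | to * s.+1].

Definition arc_regular (s : nat) G : Prop :=
  arc_transitive s G /\
  (forall t, t \in Arc s G -> 'C_X[t | to * s.+1] = 1).

Definition symmetric_graph G : Prop := arc_transitive 1 G.

(* (X, s)-transitive *)
Definition s_transitive (s : nat) G : Prop :=
  arc_transitive s G /\ ~ arc_transitive s.+1 G.

(* X_S^S *)
Definition stab_induced S := ('N_X(S | to) / 'C_X(S | to))%g.

(* X_x^{G(x)} *)
Definition local_group G (x : T) :=
  ('C_X[x | to] / 'C_('C_X[x | to])(nbr G x | to))%g.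

(* X_[C]^[C] for a cycle C *)
Definition cycle_stab_induced (C : {set {set T}}) :=
  ('C_X[C | to^*^*] / 'C_X(cover C | to))%g.

Definition arc_orbit (s : nat) G (D : {set s.+1.-tuple T}) : Prop :=
  exists2 t, t \in Arc s G & D = orbit (to * s.+1)%act X t.

(* E is an X-orbit of m n-cycles of G, D is the set of 3-arcs lying in them,
   and the numerical conditions hold. *)
Definition cycle_orbit_for (m n : nat) G (D : {set 4.-tuple T})
    (E : {set {set {set T}}}) : Prop :=
  [/\ (exists2 C, C \in ncycles n G & E = orbit to^*^*%act X C) /\ #|E| = m,
      D = \bigcup_(C in E) Arc 3 (cycle_graph_of C),
      forall C, C \in E -> cycle_stab_induced C \isog 'D_(n.*2),
      6 <= m /\ (exists2 g, is_girth G g & g <= n)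
    & (m * n = 3 * #|edges G|)%N /\ (m * n = 6 * #|vset G|)%N].

End GroupOnGraph.

Section Quotient.
Variables (T : finType) (G : graph T) (P : {set {set T}}).
Implicit Types (B C : {set T}).

Definition quotient_graph : graph {set T} :=
  simple_graph P (fun B C => [exists x in B, exists y in C, adj G x y]).

Definition nbrs C : {set T} := \bigcup_(u in C) nbr G u.

(* Gamma_B(x) *)
Definition blocks_at (x : T) : {set {set T}} := [set C in P | x \in nbrs C].

(* the blocks of the design D(B) *)
Definition design_blocks B : {set {set T}} := nbr quotient_graph B.

Definition has_v (v : nat) : Prop := forall B, B \in P -> #|B| = v.

Definition has_k (k : nat) : Prop :=
  forall B C, B \in P -> C \in nbr quotient_graph B -> #|nbrs C :&: B| = k.

Definition has_r (r : nat) : Prop :=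
  forall x, x \in vset G -> #|blocks_at x| = r.

Definition has_b (b : nat) : Prop := has_val quotient_graph b.

Definition has_vbr (v b r : nat) : Prop := [/\ has_v v, has_b b & has_r r].

Definition multicover : Prop :=
  forall B C, B \in P -> C \in nbr quotient_graph B -> #|nbrs C :&: B| = #|B|.

(* Gamma[B, C] *)
Definition between B C : graph T :=
  induced G ((nbrs C :&: B) :|: (nbrs B :&: C)).

End Quotient.

Section Ghat.
Variables (aT : finGroupType) (T : finType) (G : graph T).
Variables (X : {group aT}) (to : {action aT &-> T}) (P : {set {set T}}).

Record in_Ghat : Prop := InGhat {
  Ghat_acts : acts_on_graph X to G;
  Ghat_sym : symmetric_graph X to G;
  Ghat_partition : partition P (vset G);
  Ghat_invariant : [acts X, on P | to^*];
  Ghat_nontrivial : forall B, B \in P -> (1 < #|B| < #|vset G|)%N;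
  Ghat_connected : connected (quotient_graph G P);
  Ghat_val : exists2 b, has_b G P b & 2 <= b;
  Ghat_not_multicover : ~ multicover G P;
  Ghat_faithful : [faithful X, on vset G | to]
}.

End Ghat.

Section Cases.
Variables (aT : finGroupType) (T : finType) (G : graph T).
Variables (X : {group aT}) (to : {action aT &-> T}) (P : {set {set T}}).
Variable B : {set T}.

Definition case_a : Prop := has_vbr G P 4 4 3 /\
  (stab_induced X to B \isog 'Alt_('I_4) \/
   stab_induced X to B \isog 'Sym_('I_4)).

Definition case_b : Prop := has_vbr G P 6 4 2 /\
  (stab_induced X to B \isog 'Alt_('I_4) \/
   stab_induced X to B \isog 'Sym_('I_4)).

Definition case_c : Prop := has_vbr G P 7 7 3 /\
  stab_induced X to B \isog PSL 3 2.

Definition case_d : Prop :=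
  (exists b, has_vbr G P (3 * b)%N b 1 /\ (6 <= 3 * b)%N) /\
  [transitive^2 'N_X(B | to), on design_blocks G P B | to^*].

End Cases.

Definition quotient_case : Type :=
  forall (aT : finGroupType) (T : finType) (G : graph T) (X : {group aT})
    (to : {action aT &-> T}) (P : {set {set T}}) (B : {set T}), Prop.

(* "S (with the group X) can occur as a quotient graph in a given case".  The
   isomorphism f of the quotient graph with S is X-equivariant.  Since the group
   of a triple is faithful on V(G), it is the image of X under a homomorphism
   phi (necessarily injective when X is faithful on V(S)). *)
Definition can_occur (case : quotient_case) (aT : finGroupType) (W : finType)
    (S : graph W) (X : {group aT}) (to : {action aT &-> W}) : Prop :=
  exists (aT' : finGroupType) (T : finType) (G : graph T) (X' : {group aT'})
    (to' : {action aT' &-> T}) (P : {set {set T}}),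
  [/\ in_Ghat G X' to' P, has_k G P 3,
      forall B, B \in P -> case aT' T G X' to' P B
    & exists (phi : {morphism X >-> aT'}) (f : {set T} -> W),
        [/\ phi @* X = X', is_giso (quotient_graph G P) S f
          & forall B a, B \in P -> a \in X ->
              f (to'^*%act B (phi a)) = to (f B) a]].

Section Constructions.
Variables (T : finType) (S : graph T).

Definition path2 (x y z : T) : {set 3.-tuple T} := path_of [tuple x; y; z].

(* The constructions below are meant for self-paired sets of 3-arcs, of pairs
   of 2-paths and of double stars; simple_graph then adds no adjacency. *)
Definition gimel (D : {set 4.-tuple T}) : graph {set 3.-tuple T} :=
  simple_graph (Path 2 S)
    (fun p q => [exists a0, exists a1, exists a2, exists a3,
       [&& [tuple a0; a1; a2; a3] \in D,
           p == path2 a0 a1 a2 & q == path2 a1 a2 a3]]).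

(* 3-arc graph; vertices are the arcs (t, t1) *)
Definition Xi (D : {set 4.-tuple T}) : graph (T * T)%type :=
  simple_graph [set x | adj S x.1 x.2]
    (fun x y => [tuple x.2; x.1; y.1; y.2] \in D).

Definition Jset : {set {set 3.-tuple T} * {set 3.-tuple T}} :=
  [set pq | [exists t1, exists t, exists t2, exists s1, exists s, exists s2,
    [&& pq == (path2 t1 t t2, path2 s1 s s2),
        [tuple t1; t; t2] \in Arc 2 S, [tuple s1; s; s2] \in Arc 2 S,
        s \in nbr S t :\: [set t1; t2] & t \in nbr S s :\: [set s1; s2]]]].

Definition Psi (L : {set {set 3.-tuple T} * {set 3.-tuple T}})
  : graph {set 3.-tuple T} :=
  simple_graph (Path 2 S) (fun p q => (p, q) \in L).

Definition star (t : T) (L : {set T}) : {set T * T} := [set (t, s) | s in L].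

Definition is_star (k : nat) (t : T) (L : {set T}) : bool :=
  [&& t \in vset S, L \subset nbr S t & #|L| == k].

Definition DSt (k : nat) : {set {set T * T} * {set T * T}} :=
  [set lr | [exists t, exists L : {set T}, exists s, exists R : {set T},
    [&& lr == (star t L, star s R), is_star k t L, is_star k s R,
        s \in L & t \in R]]].

Definition stars_of (Th : {set {set T * T} * {set T * T}}) : {set {set T * T}} :=
  [set lr.1 | lr in Th] :|: [set lr.2 | lr in Th].

Definition Pi (Th : {set {set T * T} * {set T * T}}) : graph {set T * T} :=
  simple_graph (stars_of Th) (fun l r => (l, r) \in Th).

Variables (aT : finGroupType) (X : {group aT}) (to : {action aT &-> T}).

Definition symmetric_star (t : T) (L : {set T}) : Prop :=
  [transitive 'C_X[t | to] :&: 'N_X(L | to), on L | to].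

(* a set of k-stars that is a single X-orbit containing a symmetric star *)
Definition symmetric_stars (k : nat) (A : {set {set T * T}}) : Prop :=
  exists t L, [/\ is_star k t L, symmetric_star t L
                & A = orbit (pair_action to)^*%act X (star t L)].

End Constructions.

Definition self_paired (U : finType) (L : {set U * U}) : Prop :=
  forall p q, (p, q) \in L -> (q, p) \in L.

Section PairOrbits.
Variables (aT : finGroupType) (T : finType) (S : graph T).
Variables (X : {group aT}) (to : {action aT &-> T}).

Definition J_orbit (L : {set {set 3.-tuple T} * {set 3.-tuple T}}) : Prop :=
  exists2 p, p \in Jset S & L = orbit (pair_action (to * 3)^*)%act X p.

Definition DSt_orbit (k : nat) (Th : {set {set T * T} * {set T * T}}) : Prop :=
  exists2 lr, lr \in DSt S k & Th = orbit (pair_action (pair_action to)^*)%act X lr.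

End PairOrbits.

Section Conclusions.
Variables (aT : finGroupType) (T : finType) (G : graph T).
Variables (X : {group aT}) (to : {action aT &-> T}) (P : {set {set T}}).
Variables (B C : {set T}).

Local Notation Q := (quotient_graph G P).
Local Notation toQ := (to^*)%act.
Local Notation H := (between G B C).
Local Notation XB := 'N_X(B | to).
Local Notation threeK2 := (copies 3 (complete 2)).

Definition case_a1 (D : {set 4.-tuple {set T}}) : Prop :=
  [/\ H ~=g threeK2, has_val G 3,
      exists m n (E : {set {set {set {set T}}}}), cycle_orbit_for X toQ m n Q D E /\
        (Q ~=g complete 5 \/ near_ngonal_wrt n Q E)
    & [/\ XB \isog 'Alt_('I_4), arc_regular X to 1 G & arc_regular X toQ 2 Q]
      \/ (XB \isog 'Sym_('I_4) /\ arc_regular X to 2 G)].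

Definition complement_cycles (D : {set 4.-tuple {set T}}) : Prop :=
  let D' := Arc 3 Q :\: D in
  [/\ self_paired_arcs D', arc_orbit X toQ Q D'
    & exists m n (E : {set {set {set {set T}}}}), cycle_orbit_for X toQ m n Q D' E /\
        (Q ~=g complete 5 \/ near_ngonal n Q)].

Definition case_a2 (D : {set 4.-tuple {set T}}) : Prop :=
  [/\ H ~=g K33_minus_3K2, has_val G 6, XB \isog 'Sym_('I_4),
      connected G /\ arc_regular X to 1 G & complement_cycles D].

Definition case_a3 : Prop :=
  [/\ H ~=g K33, has_val G 9, connected G, s_transitive X to 1 G
    & arc_transitive X toQ 3 Q].

Definition case_b1 (D : {set 4.-tuple {set T}}) : Prop :=
  [/\ H ~=g threeK2,
      exists m n (E : {set {set {set {set T}}}}), [/\ G ~=g copies m (cycle_graph n),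
        cycle_orbit_for X toQ m n Q D E
      & Q ~=g complete 5 \/ near_ngonal_wrt n Q E]
    & [/\ XB \isog 'Alt_('I_4), arc_regular X to 1 G & arc_regular X toQ 2 Q]
      \/ (XB \isog 'Sym_('I_4) /\ ~ arc_regular X to 1 G)].

Definition case_b2 (D : {set 4.-tuple {set T}}) : Prop :=
  [/\ H ~=g K33_minus_3K2, has_val G 4, XB \isog 'Sym_('I_4),
      connected G /\ arc_regular X to 1 G & complement_cycles D].

Definition case_b3 : Prop :=
  [/\ H ~=g K33, has_val G 6, connected G, s_transitive X to 1 G
    & arc_transitive X toQ 3 Q].

Definition case_c1 : Prop :=
  [/\ H ~=g threeK2, has_val G 3, arc_transitive X to 2 G
    & ~ arc_regular X to 2 G].

Definition case_c2 : Prop :=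
  [/\ H ~=g K33_minus_3K2, has_val G 6, connected G & s_transitive X to 1 G].

Definition case_c3 : Prop :=
  [/\ H ~=g K33, has_val G 9, connected G & s_transitive X to 1 G].

Definition case_d1 : Prop :=
  H ~=g threeK2 /\ G ~=g copies (3 * #|edges Q|)%N (complete 2).

Definition case_d2 : Prop :=
  H ~=g K33_minus_3K2 /\ G ~=g copies #|edges Q| K33_minus_3K2.

Definition case_d3 : Prop := H ~=g K33 /\ G ~=g copies #|edges Q| K33.

End Conclusions.

Definition all_tetravalent_occur (case : quotient_case) : Prop :=
  forall (aT : finGroupType) (W : finType) (S : graph W) (X : {group aT})
    (to : {action aT &-> W}),
  acts_on_graph X to S -> connected S -> has_val S 4 ->
  arc_transitive X to 2 S -> can_occur case S X to.

Definition heptavalent_occur_iff (case : quotient_case) : Prop :=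
  forall (aT : finGroupType) (W : finType) (S : graph W) (X : {group aT})
    (to : {action aT &-> W}),
  acts_on_graph X to S -> connected S -> has_val S 7 ->
  symmetric_graph X to S ->
  (can_occur case S X to <->
   forall x, x \in vset S -> local_group X to S x \isog PSL 3 2).

(* Main.v *)
From mathcomp Require Import zify.
Require Import Defs.
From mathcomp Require Import all_boot all_order all_algebra.
From mathcomp Require Import all_fingroup all_solvable.

(* Write N for the neighbourhood of B in the quotient Q and L x for the set of
   blocks meeting the neighbourhood of x.  Q is 2-arc-transitive exactly when X_B
   is 2-transitive on N.  In that case any two blocks of the design D(B) meet in
   a constant number l <= 2 of points (l = 3 would give a multicover), and
   counting gives (v,b,r,l) = (4,4,3,2), (6,4,2,1), (7,7,3,1) or (3b,b,1,0).
   When r > 1 the maps x |-> L x on B and C |-> Gamma(C) :&: B on N are injective,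
   so X_B has the same kernel on B as on N, and X_B^B can be read off the action
   on N: four points give A_4 or S_4, seven points carry a Fano plane.

   In cases (a) and (b) a vertex x of B with C in L x is determined by a label in
   N other than C, the block missed by x or the other block in L x.  Edges of
   Gamma then become 3-arcs of Q, and if d is the valency of Gamma[B, C], each
   2-arc of Q extends to exactly d of them.  For d = 1, or for d = 2 and the
   complementary 3-arcs, the extension is unique: following it traces out
   cycles of Q, and an element fixing B and N pointwise fixes everything, so that
   X_B is A_4 or S_4 and |X| is known.

   Conversely a graph occurs as a quotient by taking for Gamma a graph on pairs
   (t, S), t a vertex and S a set of neighbours of t: all 3-sets, all 2-sets, or the
   lines of a Fano plane on the neighbourhood. *)
Set Implicit Arguments.
Unset Strict Implicit.
Unset Printing Implicit Defensive.

Import GroupScope.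

(** * Arcs, transitivity and isomorphisms *)

(** Cases (a), (b) and (c) name only the abstract group induced on B, and the converse has to
    recover 2-transitivity on N from it. For four blocks it is enough that 3 divide the order of the
    group on N, a transitive group of degree 4 with this property being 2-transitive. In case (a)
    the kernels on B and on N agree. In case (b) they are not compared: if the group on N were a
    2-group, elements of order 3 in [A_4] would have to commute. In case (c) a transitive action of
    PSL(3,2) on seven points is shown to be that on the points or on the lines of the Fano plane,
    the two being exchanged by inverse transpose. In the other direction, a 2-transitive group on
    seven blocks preserving a Steiner triple system must be all of PSL(3,2); this rests on a
    transvection obtained from an involution. The obstacle in the occurrence statements is to find a
    self-paired edge orbit: an element reversing an arc of the given graph need not exchange two
    chosen stars. Exactly three stars at a vertex contain a given neighbour, and this small odd
    number lets the cube of that element do it. *)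

Section GraphBasics.
Variables (T : finType) (G : graph T).

Lemma adj_vset_r x y : adj G x y -> y \in vset G.
Proof. by rewrite adj_sym; apply: adj_vset. Qed.

Lemma adj_neq x y : adj G x y -> x != y.
Proof. by apply: contraTneq => ->; rewrite adj_irr. Qed.

Lemma simple_adjE (V : {set T}) (r : rel T) x y :
  adj (simple_graph V r) x y = [&& x \in V, y \in V, x != y & r x y || r y x].
Proof. by []. Qed.

Lemma arc1E x y : ([tuple x; y] \in Arc 1 G) = adj G x y.
Proof.
rewrite inE; apply/and3P/idP => [[_ /forallP h _]|xy].
  by have := implyP (forallP (h ord0) (Ordinal (isT : 1 < 2))) isT.
split.
- by apply/forallP => -[[|[|//]] ?];
    rewrite (tnth_nth x) /= ?(adj_vset xy) ?(adj_vset_r xy).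
- by apply/forallP => -[[|[|//]] ?]; apply/forallP => -[[|[|//]] ?];
    rewrite !(tnth_nth x).
- by apply/forallP => -[[|[|//]] ?]; apply/forallP => -[[|[|//]] ?];
    rewrite !(tnth_nth x).
Qed.

Lemma arc2E x y z :
  ([tuple x; y; z] \in Arc 2 G) = [&& adj G x y, adj G y z & x != z].
Proof.
rewrite inE; apply/and3P/and3P => [[_ /forallP h /forallP k]|[xy yz xz]].
  split.
  - exact: (implyP (forallP (h ord0) (Ordinal (isT : 1 < 3))) isT).
  - exact: (implyP (forallP (h (Ordinal (isT : 1 < 3))) (Ordinal (isT : 2 < 3))) isT).
  - exact: (implyP (forallP (k ord0) (Ordinal (isT : 2 < 3))) isT).
split.
- by apply/forallP => -[[|[|[|//]]] ?];
    rewrite (tnth_nth x) /= ?(adj_vset xy) ?(adj_vset yz) ?(adj_vset_r yz).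
- by apply/forallP => -[[|[|[|//]]] ?]; apply/forallP => -[[|[|[|//]]] ?];
    rewrite !(tnth_nth x).
- by apply/forallP => -[[|[|[|//]]] ?]; apply/forallP => -[[|[|[|//]]] ?];
    rewrite !(tnth_nth x).
Qed.

Lemma arc3E x y z w :
  ([tuple x; y; z; w] \in Arc 3 G)
  = [&& adj G x y, adj G y z, adj G z w, x != z & y != w].
Proof.
rewrite inE; apply/and3P/and5P => [[_ /forallP h /forallP k]|[xy yz zw xz yw]].
  split.
  - exact: (implyP (forallP (h ord0) (Ordinal (isT : 1 < 4))) isT).
  - exact: (implyP (forallP (h (Ordinal (isT : 1 < 4))) (Ordinal (isT : 2 < 4))) isT).
  - exact: (implyP (forallP (h (Ordinal (isT : 2 < 4))) (Ordinal (isT : 3 < 4))) isT).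
  - exact: (implyP (forallP (k ord0) (Ordinal (isT : 2 < 4))) isT).
  - exact: (implyP (forallP (k (Ordinal (isT : 1 < 4))) (Ordinal (isT : 3 < 4))) isT).
split.
- by apply/forallP => -[[|[|[|[|//]]]] ?];
    rewrite (tnth_nth x) /= ?(adj_vset xy) ?(adj_vset yz) ?(adj_vset zw)
      ?(adj_vset_r zw).
- by apply/forallP => -[[|[|[|[|//]]]] ?];
    apply/forallP => -[[|[|[|[|//]]]] ?]; rewrite !(tnth_nth x).
- by apply/forallP => -[[|[|[|[|//]]]] ?];
    apply/forallP => -[[|[|[|[|//]]]] ?]; rewrite !(tnth_nth x).
Qed.

Lemma tuple2P (t : 2.-tuple T) : exists x y, t = [tuple x; y].
Proof.
case/tupleP: t => x t; case/tupleP: t => y t; exists x, y.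
by apply: val_inj; rewrite /= (tuple0 t).
Qed.

Lemma tuple3P (t : 3.-tuple T) : exists x y z, t = [tuple x; y; z].
Proof.
case/tupleP: t => x t; have [y [z ->]] := tuple2P t; exists x, y, z.
exact: val_inj.
Qed.

Lemma tuple4P (t : 4.-tuple T) : exists x y z w, t = [tuple x; y; z; w].
Proof.
case/tupleP: t => x t; have [y [z [w ->]]] := tuple3P t; exists x, y, z, w.
exact: val_inj.
Qed.

Lemma tuple2_inj (x y x' y' : T) :
  [tuple x; y] = [tuple x'; y'] -> x = x' /\ y = y'.
Proof. by case. Qed.

Lemma tuple3_inj (x y z x' y' z' : T) :
  [tuple x; y; z] = [tuple x'; y'; z'] -> [/\ x = x', y = y' & z = z'].
Proof. by case. Qed.

Lemma tuple4_inj (x y z w x' y' z' w' : T) :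
  [tuple x; y; z; w] = [tuple x'; y'; z'; w'] ->
  [/\ x = x', y = y', z = z' & w = w'].
Proof. by case. Qed.

Lemma rev_tup3 (x y z : T) : rev_tup [tuple x; y; z] = [tuple z; y; x].
Proof. exact: val_inj. Qed.

Lemma rev_tup4 (x y z w : T) : rev_tup [tuple x; y; z; w] = [tuple w; z; y; x].
Proof. exact: val_inj. Qed.

Lemma card_Arc1 d : has_val G d -> #|Arc 1 G| = (#|vset G| * d)%N.
Proof.
move=> vd.
pose S := [set p : T * T | adj G p.1 p.2].
have -> : Arc 1 G = [set [tuple p.1; p.2] | p in S].
  apply/setP => t; have [x [y ->]] := tuple2P t; rewrite arc1E.
  apply/idP/imsetP => [xy|[[u v] /= + /tuple2_inj[-> ->]]]; last by rewrite inE.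
  by exists (x, y); rewrite ?inE.
rewrite card_imset; last by move=> [x y] [x' y'] /= /tuple2_inj[-> ->].
rewrite -sum1dep_card /= -(pair_big_dep predT (adj G) (fun _ _ => 1%N)) /=.
rewrite (bigID (mem (vset G))) /= [X in (_ + X)%N]big1 ?addn0 => [|x xV]; last first.
  by rewrite big_pred0 // => y; apply: contraNF xV; apply: adj_vset.
rewrite -sum_nat_const; apply: eq_bigr => x xV.
by rewrite sum1dep_card vd.
Qed.

(** The 2-arcs are grouped by their reversed initial arc [[tuple y; x]]; over each of these the last
    vertex runs through [nbr G y :\ x]. *)
Lemma card_Arc2 d : has_val G d -> #|Arc 2 G| = (#|vset G| * d * d.-1)%N.
Proof.
move=> vd; rewrite -(card_Arc1 vd).
pose f (t : 3.-tuple T) := [tuple tnth t (Ordinal (isT : 1 < 3)); tnth t ord0].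
rewrite -[LHS]sum1_card (partition_big f (mem (Arc 1 G))) /=; last first.
  move=> t; have [x [y [z ->]]] := tuple3P t; rewrite arc2E => /and3P[xy _ _].
  by rewrite /f !(tnth_nth x) /= arc1E adj_sym.
rewrite -sum_nat_const; apply: eq_bigr => p.
have [y [x ->]] := tuple2P p; rewrite arc1E => yx.
have /vd <- := adj_vset yx.
rewrite (cardsD1 x (nbr G y)) inE yx /= -(card_imset _ (_ : injective (fun z => [tuple x; y; z]))); last first.
  by move=> z z' /tuple3_inj[].
rewrite sum1dep_card; apply: eq_card => t; rewrite !inE.
apply/idP/imsetP => [|[z + ->]]; last first.
  rewrite !inE => /andP[zx yz]; rewrite -[is_arc _ _]in_set -/(Arc 2 G) arc2E.
  by rewrite adj_sym yx yz eq_sym zx /=; apply/eqP/val_inj.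
have [x' [y' [z ->]]] := tuple3P t.
rewrite -[is_arc _ _]in_set -/(Arc 2 G) arc2E /f !(tnth_nth x) /=.
move=> /andP[/and3P[xy yz xz] /eqP/tuple2_inj[ey ex]]; subst.
by exists z => //; rewrite !inE yz eq_sym xz.
Qed.

Lemma card_edges d : has_val G d -> (2 * #|edges G| = #|vset G| * d)%N.
Proof.
move=> vd; rewrite -(card_Arc1 vd) -[RHS]sum1_card.
pose f (t : 2.-tuple T) := [set tnth t ord0; tnth t (Ordinal (isT : 1 < 2))].
rewrite (partition_big f (mem (edges G))) /=; last first.
  move=> t; have [x [y ->]] := tuple2P t; rewrite arc1E => xy.
  by apply/imsetP; exists (x, y); rewrite ?inE // /f !(tnth_nth x).
rewrite mulnC -sum_nat_const; apply: eq_bigr => e /imsetP[[x y]]; rewrite inE /= => xy ->.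
have nxy := adj_neq xy.
transitivity #|[set [tuple x; y]; [tuple y; x]]|.
  by rewrite cards2; case: eqP => // /tuple2_inj[e1 _]; rewrite e1 eqxx in nxy.
rewrite sum1dep_card; apply: eq_card => t; rewrite !inE.
have [u [v ->]] := tuple2P t.
rewrite -[is_arc _ _]in_set -/(Arc 1 G) arc1E /f !(tnth_nth x) /=.
apply/orP/andP => [[]/eqP/tuple2_inj[-> ->]|[uv /eqP E]].
- by rewrite xy.
- by rewrite adj_sym xy setUC.
have : u \in [set x; y] by rewrite -E !inE eqxx.
have : v \in [set x; y] by rewrite -E !inE eqxx orbT.
rewrite !inE => /orP[]/eqP ? /orP[]/eqP ?; subst; rewrite ?adj_irr // in uv.
- by right.
- by left.
Qed.

End GraphBasics.

Section ElementaryTransitivity.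
Variables (aT : finGroupType) (T : finType) (G : graph T).
Variables (X : {group aT}) (to : {action aT &-> T}).
Hypothesis HX : acts_on_graph X to G.

Lemma acts_adj a x y : a \in X -> adj G (to x a) (to y a) = adj G x y.
Proof. by case: HX => _; apply. Qed.

Lemma acts_vset a x : a \in X -> (to x a \in vset G) = (x \in vset G).
Proof. by move=> aX; case: HX => /acts_act -> . Qed.

Lemma nact3E x y z a :
  n_act to [tuple x; y; z] a = [tuple to x a; to y a; to z a].
Proof. exact: val_inj. Qed.

Lemma nact4E x y z w a :
  n_act to [tuple x; y; z; w] a = [tuple to x a; to y a; to z a; to w a].
Proof. exact: val_inj. Qed.

Lemma nact2E x y a : n_act to [tuple x; y] a = [tuple to x a; to y a].
Proof. exact: val_inj. Qed.

Lemma transitiveI (hT : finGroupType) (U : finType) (A : {group hT})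
    (tt : {action hT &-> U}) (S : {set U}) x0 :
  x0 \in S -> (forall a x, a \in A -> x \in S -> tt x a \in S) ->
  (forall x, x \in S -> exists2 a, a \in A & tt x0 a = x) ->
  [transitive A, on S | tt].
Proof.
move=> Sx0 SA tr; apply/imsetP; exists x0 => //; apply/setP => x.
apply/idP/orbitP => [/tr[a aA <-]|[a aA <-]]; first by exists a.
exact: SA.
Qed.

Lemma transitive_Arc1 : [transitive X, on Arc 1 G | to * 2] <->
  (exists x y, adj G x y) /\
  (forall x y x' y', adj G x y -> adj G x' y' ->
     exists2 a, a \in X & to x a = x' /\ to y a = y').
Proof.
split=> [tr|[[x [y xy]] tr]].
  split=> [|x y x' y' xy xy'].
    have /imsetP[t] := tr; have [x [y ->]] := tuple2P t; rewrite arc1E => xy _.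
    by exists x, y.
  have := atransP2 tr; rewrite -(arc1E G) in xy; rewrite -(arc1E G) in xy'.
  move=> /(_ _ _ xy xy')[a aX /=]; rewrite nact2E => /tuple2_inj[-> ->].
  by exists a.
apply: (@transitiveI _ _ _ _ _ [tuple x; y]); first by rewrite arc1E.
  move=> a t aX; have [u [v ->]] := tuple2P t.
  by rewrite /= nact2E !arc1E acts_adj.
move=> t; have [u [v ->]] := tuple2P t; rewrite arc1E => uv.
have [a aX [<- <-]] := tr _ _ _ _ xy uv; exists a => //; exact: nact2E.
Qed.

Lemma transitive_Arc2 : [transitive X, on Arc 2 G | to * 3] <->
  (exists x y z, [/\ adj G x y, adj G y z & x != z]) /\
  (forall x y z x' y' z', adj G x y -> adj G y z -> x != z ->
     adj G x' y' -> adj G y' z' -> x' != z' ->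
     exists2 a, a \in X & [/\ to x a = x', to y a = y' & to z a = z']).
Proof.
split=> [tr|[[x [y [z [xy yz xz]]]] tr]].
  split=> [|x y z x' y' z' xy yz xz xy' yz' xz'].
    have /imsetP[t] := tr; have [x [y [z ->]]] := tuple3P t.
    rewrite arc2E => /and3P[xy yz xz] _.
    by exists x, y, z.
  have h1 : [tuple x; y; z] \in Arc 2 G by rewrite arc2E xy yz.
  have h2 : [tuple x'; y'; z'] \in Arc 2 G by rewrite arc2E xy' yz'.
  have [a aX /=] := atransP2 tr h1 h2; rewrite nact3E => /tuple3_inj[-> -> ->].
  by exists a.
apply: (@transitiveI _ _ _ _ _ [tuple x; y; z]); first by rewrite arc2E xy yz.
  move=> a t aX; have [u [v [w ->]]] := tuple3P t.
  by rewrite /= nact3E !arc2E !acts_adj // (inj_eq (act_inj _ _)).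
move=> t; have [u [v [w ->]]] := tuple3P t; rewrite arc2E => /and3P[uv vw uw].
have [a aX [<- <- <-]] := tr _ _ _ _ _ _ xy yz xz uv vw uw.
exists a => //; exact: nact3E.
Qed.

Lemma transitive_vset : [transitive X, on vset G | to] <->
  (exists x, x \in vset G) /\
  (forall x x', x \in vset G -> x' \in vset G -> exists2 a, a \in X & to x a = x').
Proof.
split=> [tr|[[x xV] tr]].
  split=> [|x x' xV xV']; first by have /imsetP[x xV _] := tr; exists x.
  by have [a aX ->] := atransP2 tr xV xV'; exists a.
apply: (@transitiveI _ _ _ _ _ x) => // [a y aX yV|y yV]; last exact: tr.
by rewrite acts_vset.
Qed.

(** Orbit-stabiliser turns regularity into a comparison of two numbers, so that later only the order
    of [X] and a number of arcs have to be known. *)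
Lemma regular_of_card s : [transitive X, on Arc s G | to * s.+1] ->
  #|Arc s G| = #|X| -> forall t, t \in Arc s G -> 'C_X[t | to * s.+1] = 1.
Proof.
move=> tr cX t tA; apply/eqP; rewrite trivg_card1.
have := card_orbit_stab (to * s.+1) X t; rewrite (atransP tr) // cX.
by move/eqP; rewrite -[X in _ == X]muln1 eqn_pmul2l.
Qed.

Lemma card_of_regular s : [transitive X, on Arc s G | to * s.+1] ->
  (forall t, t \in Arc s G -> 'C_X[t | to * s.+1] = 1) -> #|Arc s G| = #|X|.
Proof.
move=> tr st; have /imsetP[t tA _] := tr.
have := card_orbit_stab (to * s.+1) X t; rewrite (atransP tr) // st //.
by rewrite cards1 muln1.
Qed.

Lemma card_vertex_stab x : [transitive X, on vset G | to] -> x \in vset G ->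
  #|X| = (#|vset G| * #|'C_X[x | to]|)%N.
Proof. by move=> tr xV; rewrite -(atransP tr x xV) card_orbit_stab. Qed.

End ElementaryTransitivity.

Section IsoTools.

Lemma giso_trans (T1 T2 T3 : finType) (G1 : graph T1) (G2 : graph T2)
    (G3 : graph T3) : G1 ~=g G2 -> G2 ~=g G3 -> G1 ~=g G3.
Proof.
move=> [f [fi fV fa]] [g [gi gV ga]]; exists (g \o f).
have fin x : x \in vset G1 -> f x \in vset G2 by move=> xV; rewrite -fV imset_f.
split.
- by move=> x y xV yV /= /gi e; apply: fi => //; apply: e; apply: fin.
- by rewrite imset_comp fV.
- by move=> x y xV yV /=; rewrite ga ?fin // fa.
Qed.

(** The map of an isomorphism is defined on the whole type but injective only on [vset G1], so its
    inverse needs the default value [x0] off the image. *)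
Lemma giso_sym (T1 T2 : finType) (x0 : T1) (G1 : graph T1) (G2 : graph T2) :
  G1 ~=g G2 -> G2 ~=g G1.
Proof.
move=> [f [fi fV fa]].
pose g y := odflt x0 [pick x in vset G1 | f x == y].
have gP y : y \in vset G2 -> g y \in vset G1 /\ f (g y) = y.
  rewrite -fV => /imsetP[x xV ->]; rewrite /g.
  case: pickP => [z /andP[zV /eqP]|/(_ x)] //; by rewrite xV eqxx.
have fin x : x \in vset G1 -> f x \in vset G2 by move=> xV; rewrite -fV imset_f.
exists g; split.
- move=> y z /gP[_ e1] /gP[_ e2] e; by rewrite -e1 -e2 e.
- apply/setP => x; apply/imsetP/idP => [[y /gP[h _] ->] //|xV].
  exists (f x); first exact: fin.
  by have [h e] := gP _ (fin _ xV); apply: fi.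
- by move=> y z /gP[h1 e1] /gP[h2 e2]; rewrite -{2}e1 -{2}e2 fa.
Qed.

(** The pattern behind the isomorphisms with [Xi], [Psi] and [Pi]: the vertices of [G] are renamed
    by an injective label, and the symmetrised relation on labels is the old adjacency. *)
Lemma label_giso (T U : finType) (G : graph T) (h : T -> U) (V : {set U}) (r : rel U) :
  {in vset G &, injective h} -> h @: vset G = V ->
  {in vset G &, forall x y, r (h x) (h y) || r (h y) (h x) = adj G x y} ->
  G ~=g simple_graph V r.
Proof.
move=> hi hV hr; exists h; split=> // x y xV yV.
have hin z : z \in vset G -> h z \in V by move=> zV; rewrite -hV imset_f.
rewrite simple_adjE !hin //= (inj_in_eq hi) // hr //.
by case: eqP => [->|//]; rewrite adj_irr.
Qed.

Lemma copies_adjE m (U : finType) (H : graph U) (p q : 'I_m * U) :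
  adj (copies m H) p q = (p.1 == q.1) && adj H p.2 q.2.
Proof.
rewrite simple_adjE !inE [adj H q.2 _]adj_sym [q.1 == _]eq_sym orbb.
case: (boolP (adj H p.2 q.2)) => h; last by rewrite !andbF.
rewrite (adj_vset h) (adj_vset_r h) /= !andbT.
suff -> : p != q by [].
by apply: contraTneq h => ->; rewrite adj_irr.
Qed.

Lemma induced_adjE (T : finType) (G : graph T) S x y :
  adj (induced G S) x y = [&& x \in S, y \in S & adj G x y].
Proof.
rewrite simple_adjE !inE [adj G y x]adj_sym orbb.
case: (boolP (adj G x y)) => h; last by rewrite !andbF.
by rewrite (adj_vset h) (adj_vset_r h) (adj_neq h) /= !andbT.
Qed.

(* The isomorphisms between the copies of H and the parts are chosen independently. *)
Lemma copies_giso (T U I : finType) (G : graph T) (H : graph U)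
    (A : {set I}) (part : I -> {set T}) :
  (forall i, i \in A -> part i \subset vset G) ->
  (forall x, x \in vset G -> exists2 i, i \in A & x \in part i) ->
  (forall i j x, i \in A -> j \in A -> x \in part i -> x \in part j -> i = j) ->
  (forall i x y, i \in A -> x \in part i -> adj G x y -> y \in part i) ->
  (forall i, i \in A -> H ~=g induced G (part i)) ->
  copies #|A| H ~=g G.
Proof.
move=> sub cov dis conn iso.
have /fin_all_exists[F HF] : forall k : 'I_#|A|,
    exists f, is_giso H (induced G (part (enum_val k))) f.
  by move=> k; exact: (iso _ (enum_valP k)).
have vE (k : 'I_#|A|) : vset (induced G (part (enum_val k))) = part (enum_val k).
  by apply/setIidPr; exact: (sub _ (enum_valP k)).
have Fin k u : u \in vset H -> F k u \in part (enum_val k).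
  by move=> uH; rewrite -vE; have [_ <- _] := HF k; rewrite imset_f.
exists (fun p => F p.1 p.2); split.
- move=> [i u] [j v]; rewrite !inE /= => uH vH e.
  have eij : i = j.
    apply: enum_val_inj; apply: (dis _ _ (F i u)); rewrite ?enum_valP ?Fin //.
    by rewrite e Fin.
  by move: e; rewrite eij; have [inj _ _] := HF j => /inj ->.
- apply/setP => x; apply/imsetP/idP => [[[i u]]|xV].
    rewrite inE /= => uH ->.
    by apply: (subsetP (sub _ (enum_valP i))); rewrite Fin.
  have [i iA xi] := cov _ xV.
  pose k := enum_rank_in iA i.
  have ek : enum_val k = i by rewrite enum_rankK_in.
  have [_ fV _] := HF k.
  move: xi; rewrite -ek -vE -fV => /imsetP[u uH ->].
  by exists (k, u); rewrite ?inE.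
- move=> [i u] [j v] uH vH; rewrite copies_adjE; move: uH vH.
  rewrite !inE /= => uH vH; case: (altP (i =P j)) => [<-|nij] /=.
    have [_ _ <- //] := HF i; rewrite induced_adjE.
    by rewrite !Fin.
  apply/negP => h; case/negP: nij; apply/eqP/enum_val_inj.
  apply: (dis _ _ (F j v)); rewrite ?enum_valP ?Fin //.
  by apply: (conn _ (F i u)); rewrite ?enum_valP ?Fin.
Qed.

End IsoTools.

(** * Sets of 3-arcs extending each 2-arc uniquely *)

Section Path2.
Variables (T : finType).

Lemma path2_sym (x y z : T) : path2 x y z = path2 z y x.
Proof. by rewrite /path2 /path_of !rev_tup3 setUC. Qed.

Lemma path2_inj (x y z x' y' z' : T) : path2 x y z = path2 x' y' z' ->
  y = y' /\ (x = x' /\ z = z' \/ x = z' /\ z = x').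
Proof.
move=> e; have : [tuple x; y; z] \in path2 x' y' z' by rewrite -e !inE eqxx.
by rewrite !inE rev_tup3 => /orP[]/eqP/tuple3_inj[-> -> ->]; split; auto.
Qed.

Lemma path2P (G : graph T) p :
  reflect (exists x y z, [/\ adj G x y, adj G y z, x != z & p = path2 x y z])
    (p \in Path 2 G).
Proof.
apply: (iffP imsetP) => [[t]|[x [y [z [xy yz xz ->]]]]].
  have [x [y [z ->]]] := tuple3P t; rewrite inE arc2E => /andP[/and3P[xy yz xz] _] ->.
  by exists x, y, z.
exists [tuple x; y; z] => //; rewrite inE arc2E xy yz xz /= !inE negb_or xz.
by rewrite (adj_neq xy) (adj_neq yz).
Qed.

(** Self-pairedness absorbs the symmetrisation inside [simple_graph], and [D3] supplies the vertex
    and loop conditions. *)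
Lemma gimel_adjP (G : graph T) (D : {set 4.-tuple T}) p q :
  D \subset Arc 3 G -> self_paired_arcs D ->
  reflect (exists a0 a1 a2 a3, [/\ [tuple a0; a1; a2; a3] \in D,
             p = path2 a0 a1 a2 & q = path2 a1 a2 a3])
    (adj (gimel G D) p q).
Proof.
move=> D3 Dsp; rewrite simple_adjE; apply: (iffP idP).
  case/and4P=> _ _ _ /orP[]/existsP[a0 /existsP[a1 /existsP[a2 /existsP[a3]]]];
    case/and3P=> d /eqP -> /eqP ->.
    by exists a0, a1, a2, a3.
  exists a3, a2, a1, a0; split; [|exact: path2_sym|exact: path2_sym].
  by have := Dsp _ d; rewrite rev_tup4.
move=> [a0 [a1 [a2 [a3 [d -> ->]]]]].
have := subsetP D3 _ d; rewrite arc3E => /and5P[d01 d12 d23 n02 n13].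
apply/and4P; split.
- by apply/path2P; exists a0, a1, a2.
- by apply/path2P; exists a1, a2, a3.
- apply/eqP => /path2_inj[e _].
  by move: d12; rewrite e adj_irr.
apply/orP; left; apply/existsP; exists a0; apply/existsP; exists a1.
apply/existsP; exists a2; apply/existsP; exists a3.
by rewrite d !eqxx.
Qed.

Lemma complete_giso (G : graph T) n : #|vset G| = n.+1 ->
  {in vset G &, forall x y, x != y -> adj G x y} -> G ~=g complete n.+1.
Proof.
move=> cV all_adj; pose f x : 'I_n.+1 := inord (index x (enum (vset G))).
have fi : {in vset G &, injective f}.
  move=> x y xV yV /(congr1 val); rewrite /= !inordK; first last.
  - by rewrite -cV cardE index_mem mem_enum.
  - by rewrite -cV cardE index_mem mem_enum.
  by move/(congr1 (nth x (enum (vset G)))); rewrite !nth_index ?mem_enum.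
exists f; split=> //.
  by apply/eqP; rewrite eqEcard subsetT /= card_in_imset // cV cardsT card_ord.
move=> x y xV yV; rewrite simple_adjE !inE /= andbT (inj_in_eq fi) //.
by apply/idP/idP => [/all_adj ->|/adj_neq].
Qed.

Lemma girth_exists (G : graph T) n : ncycles n G != set0 ->
  exists2 g, is_girth G g & g <= n.
Proof.
move=> h; have ex : exists k, ncycles k G != set0 by exists n.
case: (ex_minnP ex) => g g0 gm; exists g; last exact: gm.
by split.
Qed.

Lemma triangle_free_girth (G : graph T) :
  (forall x y z, adj G x y -> adj G y z -> ~~ adj G z x) -> girth_geq G 4.
Proof.
move=> tf n /set0Pn[C]; rewrite inE => /andP[n2 /existsP[c /and3P[_ cc _]]].
case: (ltngtP 3 n) n2 => // n3 _.
by move: c cc; rewrite -n3 => c; have [x [y [z ->]]] := tuple3P c;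
  rewrite /= andbT => /and3P[xy yz zx]; have := tf _ _ _ xy yz; rewrite zx.
Qed.

End Path2.

Section UniqueExtension.
Variables (aT : finGroupType) (W : finType) (S : graph W).
Variables (X : {group aT}) (to : {action aT &-> W}).
Variable D : {set 4.-tuple W}.
Hypothesis HX : acts_on_graph X to S.
Hypothesis conS : connected S.
Hypothesis trV : [transitive X, on vset S | to].
Hypothesis tr2 : [transitive X, on Arc 2 S | to * 3].
Hypothesis D3 : D \subset Arc 3 S.
Hypothesis Dinv : forall a t, a \in X -> t \in D -> n_act to t a \in D.
Hypothesis Dsp : self_paired_arcs D.
Hypothesis Dext : forall x y z, adj S x y -> adj S y z -> x != z ->
  exists w, [tuple x; y; z; w] \in D.
Hypothesis Duniq : forall x y z w w',
  [tuple x; y; z; w] \in D -> [tuple x; y; z; w'] \in D -> w = w'.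

Local Notation dl x y z w := ([tuple x; y; z; w] \in D).

Lemma dl_act a x y z w : a \in X -> dl x y z w ->
  dl (to x a) (to y a) (to z a) (to w a).
Proof. by move=> aX /(Dinv aX); rewrite nact4E. Qed.

Lemma dl_rev x y z w : dl x y z w -> dl w z y x.
Proof. by move/Dsp; rewrite rev_tup4. Qed.

Lemma dlP x y z w : dl x y z w ->
  [/\ adj S x y, adj S y z, adj S z w, x != z & y != w].
Proof. by move/(subsetP D3); rewrite arc3E => /and5P. Qed.

(** Let [F] be a neighbour of [C] other than [B]. Extending [(F, C, B)] by [E] and reversing gives
    [(E, B, C, F)] in [D], whose first three entries are fixed by [a]; unique extension then fixes
    [F]. *)
Lemma kernel_step a B C : a \in X -> to B a = B ->
  (forall F, adj S B F -> to F a = F) -> adj S B C ->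
  to C a = C /\ (forall F, adj S C F -> to F a = F).
Proof.
move=> aX aB aN BC; split=> [|F CF]; first exact: aN.
have [->//|nFB] := eqVneq F B.
have [E dE] : exists E, dl F C B E by apply: Dext; rewrite // adj_sym.
have [_ _ BE _ _] := dlP dE.
have := dl_act aX (dl_rev dE); rewrite aB (aN _ BE) (aN _ BC) => d2.
exact: Duniq d2 (dl_rev dE).
Qed.

Lemma kernel_trivial a B : a \in X -> B \in vset S -> to B a = B ->
  (forall F, adj S B F -> to F a = F) -> {in vset S, forall C, to C a = C}.
Proof.
move=> aX BV aB aN C CV; have /connectP[p Bp ->] := conS BV CV.
elim: p B aB aN Bp {BV C CV} => //= E p IH B aB aN /andP[BE Ep].
by have [aE aNE] := kernel_step aX aB aN BE; apply: IH Ep.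
Qed.

(* By unique extension, an h with [shift h y] moves one step forward along the walk
   through y all of whose 3-arcs lie in D; this walk is the <[h]>-orbit of y. *)
Definition shift h y := h \in X /\ dl y (to y h) (to y (h ^+ 2)) (to y (h ^+ 3)).

Lemma shift_step h y : shift h y -> shift h (to y h).
Proof.
move=> [hX dh]; split=> //; have := dl_act hX dh.
by rewrite -!actM -!expgSr -!expgS.
Qed.

Lemma shift_iter h y j : shift h y -> shift h (to y (h ^+ j)).
Proof.
move=> sh; elim: j => [|j IH]; first by rewrite act1.
by rewrite expgSr actM; apply: shift_step.
Qed.

(** The next vertex of a walk is determined by the three before it, so the induction carries three
    consecutive equalities. *)
Lemma shift_flow h y h' y' k : shift h y -> shift h' y' -> k \in X ->
  to y k = y' -> to (to y h) k = to y' h' ->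
  to (to y (h ^+ 2)) k = to y' (h' ^+ 2) ->
  forall j, to (to y (h ^+ j)) k = to y' (h' ^+ j).
Proof.
move=> sh sh' kX k0 k1 k2 j.
suff [] : [/\ to (to y (h ^+ j)) k = to y' (h' ^+ j),
  to (to y (h ^+ j.+1)) k = to y' (h' ^+ j.+1) &
  to (to y (h ^+ j.+2)) k = to y' (h' ^+ j.+2)] by [].
elim: j => [|j [e0 e1 e2]]; first by rewrite !act1.
split=> //.
have [_ d] := shift_iter j sh; rewrite -!actM -expgSr -!expgD ?addn2 ?addn3 in d.
have [_ d'] := shift_iter j sh'; rewrite -!actM -expgSr -!expgD ?addn2 ?addn3 in d'.
by rewrite -e0 -e1 -e2 in d'; apply: Duniq (dl_act kX d) d'.
Qed.

Lemma act_conj y h a : to (to y a) (h ^ a) = to (to y h) a.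
Proof. by rewrite -!actM -conjgC. Qed.

Lemma shift_conj h y a : a \in X -> shift h y -> shift (h ^ a) (to y a).
Proof.
move=> aX [hX dh]; split; first by rewrite groupJ.
by rewrite -!conjXg !act_conj; apply: dl_act.
Qed.

(** Reversing the 3-arc at [y] and applying [h^-1] gives the 3-arc that starts at [to y (h ^+ 2)]
    and runs backwards; this choice of start makes the reversed walk begin with the same 2-path. *)
Lemma shift_inv h y : shift h y -> shift h^-1 (to y (h ^+ 2)).
Proof.
move=> sh; have [hX _] := sh; split; first by rewrite groupV.
have hVX : h^-1 \in X by rewrite groupV.
have [_ /dl_rev /(dl_act hVX)] := sh.
have e3 : to (to y (h ^+ 3)) h^-1 = to y (h ^+ 2) by rewrite expgSr actM actK.
have e2 : to (to y (h ^+ 2)) h^-1 = to y h by rewrite expgSr expg1 actM actK.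
have f2 : h^-1 ^+ 2 = h^-1 * h^-1 by [].
have f3 : h^-1 ^+ 3 = h^-1 * h^-1 * h^-1 by rewrite expgSr f2.
have e1 : to (to y h) h^-1 = y by rewrite actK.
by rewrite f2 f3 !(actM _ _ _ h^-1) e3 e2 e1.
Qed.

Lemma shift_adj h y : shift h y -> adj S y (to y h).
Proof. by case=> _ /dlP[]. Qed.

Definition pts h y : {set W} := orbit to <[h]> y.
(** Stored as an unordered edge set, the format of [ncycles], the closed walk forgets its starting
    point and its direction; see [cyc_step] and [cyc_inv]. *)
Definition cyc h y : {set {set W}} := [set [set z; to z h] | z in pts h y].

Lemma ptsP h y z : reflect (exists j, z = to y (h ^+ j)) (z \in pts h y).
Proof.
apply: (iffP orbitP) => [[_ /cycleP[j ->] <-]|[j ->]]; first by exists j.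
by exists (h ^+ j); rewrite // mem_cycle.
Qed.

Lemma pts_h h y z : z \in pts h y -> to z h \in pts h y.
Proof. by case/ptsP=> j ->; apply/ptsP; exists j.+1; rewrite expgSr actM. Qed.

Lemma pts_hV h y z : z \in pts h y -> to z h^-1 \in pts h y.
Proof.
case/orbitP=> a ah <-; apply/orbitP; exists (a * h^-1); rewrite ?actM //.
by rewrite groupM // groupV cycle_id.
Qed.

Lemma pts_step h y j : pts h (to y (h ^+ j)) = pts h y.
Proof. by apply/orbit_eqP; apply/ptsP; exists j. Qed.

Lemma pts_inv h y : pts h^-1 y = pts h y.
Proof. by rewrite /pts cycleV. Qed.

Lemma pts_conj h y a : pts (h ^ a) (to y a) = [set to z a | z in pts h y].
Proof.
apply/setP => z; apply/ptsP/imsetP => [[j ->]|[u /ptsP[j ->] ->]].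
  exists (to y (h ^+ j)); first by apply/ptsP; exists j.
  by rewrite -conjXg act_conj.
by exists j; rewrite -conjXg act_conj.
Qed.

Lemma cyc_step h y j : cyc h (to y (h ^+ j)) = cyc h y.
Proof. by rewrite /cyc pts_step. Qed.

Lemma cyc_inv h y : cyc h^-1 y = cyc h y.
Proof.
apply/setP => e; rewrite /cyc pts_inv; apply/imsetP/imsetP => [] [z zp ->].
  by exists (to z h^-1); rewrite ?pts_hV // actKV setUC.
by exists (to z h); rewrite ?pts_h // actK setUC.
Qed.

Lemma cyc_conj h y a : (to^*^*)%act (cyc h y) a = cyc (h ^ a) (to y a).
Proof.
rewrite [LHS]setactE /cyc pts_conj -!imset_comp; apply: eq_imset => z /=.
by rewrite [LHS]setactE imsetU !imset_set1 act_conj.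
Qed.

Lemma cyc_flow h y h' y' : shift h y -> shift h' y' ->
  y = y' -> to y h = to y' h' -> to y (h ^+ 2) = to y' (h' ^+ 2) ->
  cyc h y = cyc h' y'.
Proof.
move=> sh sh' k0 k1 k2.
have fl : forall j, to y (h ^+ j) = to y' (h' ^+ j).
  by move=> j; rewrite -(shift_flow sh sh' (group1 X)) ?act1.
apply/setP => e; apply/imsetP/imsetP => [] [z /ptsP[j ->] ->].
  exists (to y' (h' ^+ j)); first by apply/ptsP; exists j.
  by rewrite -!actM -!expgSr !fl.
exists (to y (h ^+ j)); first by apply/ptsP; exists j.
by rewrite -!actM -!expgSr !fl.
Qed.

Section Cycle.
Variables (h : aT) (y : W).
Hypothesis sh : shift h y.

Lemma pts_shift z : z \in pts h y -> shift h z.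
Proof. by case/ptsP=> j ->; apply: shift_iter. Qed.

Lemma pts_neq2 z : z \in pts h y -> z != to z (h ^+ 2).
Proof. by move/pts_shift => [_ /dlP[]]. Qed.

Lemma pts_vset : pts h y \subset vset S.
Proof. by apply/subsetP => z /pts_shift/shift_adj; apply: adj_vset. Qed.

Lemma cover_cyc : cover (cyc h y) = pts h y.
Proof.
apply/setP => z; apply/bigcupP/idP => [[_ /imsetP[u up ->]]|zp].
  by rewrite !inE => /orP[]/eqP ->; rewrite ?pts_h.
by exists [set z; to z h]; [apply/imsetP; exists z | rewrite !inE eqxx].
Qed.

Local Notation cg := (cycle_graph_of (cyc h y)).

Lemma cg_adjP u v :
  reflect (u \in pts h y /\ (v = to u h \/ v = to u h^-1)) (adj cg u v).
Proof.
have adjh z : z \in pts h y -> z != to z h.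
  by move/pts_shift/shift_adj/adj_neq.
rewrite simple_adjE cover_cyc [ [set v; u]]setUC orbb.
apply: (iffP and4P) => [[up vp nuv /imsetP[z zp e]]|[up [] ->]].
- have := adjh _ zp.
  have : u \in [set z; to z h] by rewrite -e !inE eqxx.
  have : v \in [set z; to z h] by rewrite -e !inE eqxx orbT.
  rewrite !inE => /orP[]/eqP ? /orP[]/eqP ? nz; subst; rewrite ?eqxx // in nuv *.
  - by split=> //; right; rewrite actK.
  - by split=> //; left.
- by rewrite up pts_h // adjh //; split=> //; apply/imsetP; exists u.
rewrite up pts_hV //; split=> //.
  by have := adjh _ (pts_hV up); rewrite actKV eq_sym.
by apply/imsetP; exists (to u h^-1); rewrite ?pts_hV // actKV setUC.
Qed.

(** The quantified [h'] covers both directions: a 2-arc of the cycle is the beginning of the walk of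
    [h] or of [h^-1]. *)
Lemma cg_arc2P u v w : reflect
  (exists h' y', [/\ shift h' y', cyc h' y' = cyc h y &
     [/\ u = y', v = to y' h' & w = to y' (h' ^+ 2)]])
  ([tuple u; v; w] \in Arc 2 cg).
Proof.
apply: (iffP idP).
  rewrite arc2E => /and3P[/cg_adjP[up uv] /cg_adjP[vp vw] nuw].
  case: uv nuw => ev; subst v; case: vw => ->; rewrite ?actK ?actKV ?eqxx // => _.
    exists h, u; split=> //; first exact: pts_shift.
      by have /ptsP[j ->] := up; rewrite cyc_step.
    by split=> //; rewrite expgS expg1 actM.
  exists h^-1, u; split.
  - have /pts_shift/shift_inv : to u (h^-1 ^+ 2) \in pts h y.
      by rewrite expgS expg1 actM !pts_hV.
    by rewrite expgVn actKV.
  - by have /ptsP[j ->] := up; rewrite cyc_inv cyc_step.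
  - by rewrite expgS expg1 actM.
move=> [h' [y' [sh' ec [-> -> ->]]]]; rewrite arc2E.
have adj' z : z \in pts h' y' -> adj cg z (to z h').
  move=> zp; rewrite -ec; rewrite simple_adjE.
  have zV : z \in cover (cyc h' y').
    by apply/bigcupP; exists [set z; to z h']; [apply/imsetP; exists z | rewrite !inE eqxx].
  have zhV : to z h' \in cover (cyc h' y').
    apply/bigcupP; exists [set z; to z h']; first by apply/imsetP; exists z.
    by rewrite !inE eqxx orbT.
  rewrite zV zhV /=; apply/andP; split.
    have /ptsP[j ->] := zp.
    by have := adj_neq (shift_adj (shift_iter j sh')).
  by apply/orP; left; apply/imsetP; exists z.
have y'p : y' \in pts h' y' by apply/ptsP; exists 0; rewrite act1.
apply/and3P; split; first exact: adj'.
  by rewrite expgS expg1 actM; apply/adj'/pts_h.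
by have [_ /dlP[]] := sh'.
Qed.

Lemma cg_arc3P u v w z : reflect
  (exists h' y', [/\ shift h' y', cyc h' y' = cyc h y &
     [/\ u = y', v = to y' h', w = to y' (h' ^+ 2) & z = to y' (h' ^+ 3)]])
  ([tuple u; v; w; z] \in Arc 3 cg).
Proof.
apply: (iffP idP).
  rewrite arc3E => /and5P[uv vw wz nuw nvz].
  have /cg_arc2P[h' [y' [sh' ec [eu ev ew]]]] : [tuple u; v; w] \in Arc 2 cg.
    by rewrite arc2E uv vw.
  exists h', y'; split=> //; split=> //.
  have /cg_arc2P[h1 [y1 [sh1 ec1 [ev1 ew1 ez1]]]] : [tuple v; w; z] \in Arc 2 cg.
    by rewrite arc2E vw wz.
  have : adj (cycle_graph_of (cyc h y)) w z by [].
  have wp : w \in pts h y.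
    by have := adj_vset wz; rewrite /= cover_cyc.
  move=> /cg_adjP[_ wz'].
  have : adj (cycle_graph_of (cyc h y)) w (to w h').
    have /cg_arc2P : exists h2 y2, [/\ shift h2 y2, cyc h2 y2 = cyc h y &
     [/\ to y' h' = y2, to y' (h' ^+ 2) = to y2 h2 &
         to y' (h' ^+ 3) = to y2 (h2 ^+ 2)]].
      exists h', (to y' h'); split; first exact: shift_step.
        by rewrite -ec -(cyc_step h' y' 1).
      by rewrite -!actM -!expgS.
    by rewrite arc2E ew -actM -expgSr => /and3P[].
  have nv : v != to w h'.
    have [_ /dlP[_ _ _ _]] := sh'; by rewrite ev ew -actM -expgSr.
  (* The vertex [w] has only two neighbours on the cycle. One is [v], and both [z] and [to w h']
     differ from it, so they coincide. *)
  have : adj (cycle_graph_of (cyc h y)) w v by rewrite adj_sym.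
  move=> /cg_adjP[_ wv] /cg_adjP[_ whp].
  have ew3 : to y' (h' ^+ 3) = to w h' by rewrite ew -actM -expgSr.
  rewrite ew3.
  case: wz' whp wv nvz nv => -> [] -> [] ->; rewrite ?eqxx //.
move=> [h' [y' [sh' ec [-> -> -> ->]]]]; rewrite arc3E.
have /cg_arc2P : exists h2 y2, [/\ shift h2 y2, cyc h2 y2 = cyc h y &
     [/\ to y' h' = y2, to y' (h' ^+ 2) = to y2 h2 &
         to y' (h' ^+ 3) = to y2 (h2 ^+ 2)]].
  exists h', (to y' h'); split; first exact: shift_step.
    by rewrite -ec -(cyc_step h' y' 1).
  by rewrite -!actM -!expgS.
have /cg_arc2P : exists h2 y2, [/\ shift h2 y2, cyc h2 y2 = cyc h y &
     [/\ y' = y2, to y' h' = to y2 h2 & to y' (h' ^+ 2) = to y2 (h2 ^+ 2)]].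
  by exists h', y'.
by rewrite !arc2E => /and3P[-> -> ->] /and3P[_ -> ->].
Qed.

Lemma cg_arc3_D : Arc 3 cg \subset D.
Proof.
apply/subsetP => t; have [u [v [w [z ->]]]] := tuple4P t.
by move/cg_arc3P => [h' [y' [[_ d'] _ [-> -> -> ->]]]].
Qed.

Lemma card_cg : #|Arc 2 cg| = #|pts h y|.*2.
Proof.
rewrite (@card_Arc2 _ _ 2) /=; last first.
  move=> z; rewrite /= cover_cyc => zp.
  have -> : nbr cg z = [set to z h; to z h^-1].
    apply/setP => v; rewrite !inE -[in RHS]/(adj cg) .
    apply/idP/orP => [/cg_adjP[_ []->]|[]/eqP->]; rewrite ?eqxx ?orbT; auto.
    - by apply/cg_adjP; split=> //; left.
    - by apply/cg_adjP; split=> //; right.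
  rewrite cards2; case: eqP => // e.
  by have := pts_neq2 zp; rewrite expgS expg1 actM e actKV eqxx.
by rewrite cover_cyc muln1 muln2.
Qed.

Lemma card_pts_gt2 : 2 < #|pts h y|.
Proof.
have y0 : y \in pts h y by apply/ptsP; exists 0; rewrite act1.
have -> : 2 = #|[set to y h; to y h^-1]|.
  rewrite cards2; case: eqP => // e.
  by have := pts_neq2 y0; rewrite expgS expg1 actM e actKV eqxx.
apply: proper_card; apply/properP; split.
  by apply/subsetP => z; rewrite !inE => /orP[]/eqP ->; rewrite ?pts_h ?pts_hV.
exists y => //; rewrite !inE negb_or.
have := adj_neq (shift_adj sh) => ->.
have := adj_neq (shift_adj (pts_shift (pts_hV y0))).
by rewrite actKV eq_sym.
Qed.

Lemma cyc_ncycles : cyc h y \in ncycles #|pts h y| S.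
Proof.
rewrite inE card_pts_gt2 /=.
pose f := to^~ h; have fi : injective f by apply: act_inj.
(* Listed without repetition, the orbit of [y] under [f] is the vertex sequence of the cycle, with
   [next] equal to [f]. *)
pose c := fingraph.orbit f y.
have cE : c =i pts h y.
  move=> z; apply/trajectP/ptsP => [[j _ ->]|[j ->]].
    by exists j; elim: j => [|j IH]; rewrite ?act1 //= IH expgSr actM.
  have : fconnect f y (to y (h ^+ j)).
    have -> : to y (h ^+ j) = iter j f y.
      by elim: j => [|j IH]; rewrite ?act1 //= -IH expgSr actM.
    exact: fconnect_iter.
  by rewrite fconnect_orbit => /trajectP.
have cu : uniq c by apply: orbit_uniq.
have sc : size c == #|pts h y|.
  by rewrite -(card_uniqP cu); apply/eqP/eq_card.
have fc : fcycle f c by apply: cycle_orbit.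
apply/existsP; exists (Tuple sc); rewrite /= cu /=; apply/andP; split.
  apply: (@sub_in_cycle _ (mem (pts h y)) (frel f)) fc.
    by move=> u v up vp /= /eqP <-; apply/shift_adj/pts_shift.
  by apply/allP => z; rewrite cE.
apply/eqP/setP => e; apply/imsetP/imsetP => [] [z]; rewrite ?cE => zp ->.
  by exists z; rewrite ?cE // (nextE fc) ?cE.
by exists z; rewrite ?cE // (nextE fc) ?cE.
Qed.

End Cycle.

Lemma cyc_arc2_inj h y h' y' t : shift h y -> shift h' y' ->
  t \in Arc 2 (cycle_graph_of (cyc h y)) ->
  t \in Arc 2 (cycle_graph_of (cyc h' y')) -> cyc h y = cyc h' y'.
Proof.
move=> sh sh'; have [u [v [w ->]]] := tuple3P t.
move=> /(cg_arc2P sh)[h1 [y1 [sh1 <- [e0 e1 e2]]]].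
move=> /(cg_arc2P sh')[h2 [y2 [sh2 <- [f0 f1 f2]]]].
by apply: cyc_flow => //; [rewrite -e0 | rewrite -e1 | rewrite -e2].
Qed.

(** 2-arc-transitivity moves [(x, y, z)] to [(y, z, w)], where [w] is the extension of the first;
    any such element is a shift. *)
Lemma exists_shift : exists g x, shift g x.
Proof.
have [[x [y [z [xy yz xz]]]] tr] := (transitive_Arc2 HX).1 tr2.
have [w dw] := Dext xy yz xz.
have [_ _ zw _ nyw] := dlP dw.
have [g gX [e0 e1 e2]] := tr _ _ _ _ _ _ xy yz xz yz zw nyw.
exists g, x; split=> //.
have f2 : to x (g ^+ 2) = z by rewrite expgSr expg1 actM e0 e1.
have f3 : to x (g ^+ 3) = w by rewrite expgSr actM f2 e2.
by rewrite e0 f2 f3.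
Qed.

Section Orbit.
Variables (g : aT) (x0 : W).
Hypothesis sg : shift g x0.
Local Notation n := #|pts g x0|.
Local Notation x1 := (to x0 g).
Local Notation x2 := (to x0 (g ^+ 2)).
Local Notation C0 := (cyc g x0).
Local Notation t0 := [tuple x0; x1; x2].
Local Notation toC := (to^*^*)%act.
Local Notation E := (orbit toC X C0).

Lemma base_adj : [/\ adj S x0 x1, adj S x1 x2 & x0 != x2].
Proof. by have [_ /dlP[]] := sg. Qed.

Lemma gX : g \in X. Proof. by case: sg. Qed.

(** Every shift yields a cycle in the orbit of [C0]: 2-arc-transitivity matches the initial 2-arcs
    and unique extension the rest. The orbit therefore does not depend on [g] and [x0]. *)
Lemma orbit_cycP C : reflect (exists h y, [/\ shift h y, C = cyc h y & #|pts h y| = n])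
  (C \in E).
Proof.
apply: (iffP orbitP) => [[a aX <-]|[h [y [sh -> _]]]].
  exists (g ^ a), (to x0 a); split; [exact: shift_conj | exact: cyc_conj |].
  by rewrite pts_conj card_imset //; apply: act_inj.
have [xx xxx nx] := base_adj.
have [_ /dlP[yy yyy _ ny _]] := sh.
have [_ tr] := (transitive_Arc2 HX).1 tr2.
have [a aX [e0 e1 e2]] := tr _ _ _ _ _ _ xx xxx nx yy yyy ny.
exists a => //; rewrite [LHS]cyc_conj; apply: cyc_flow => //.
- exact: shift_conj.
- by rewrite act_conj.
- by rewrite -conjXg act_conj.
Qed.

Lemma orbit_cyc_ncycles : E \subset ncycles n S.
Proof.
by apply/subsetP => C /orbit_cycP[h [y [sh -> <-]]]; apply: cyc_ncycles.
Qed.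

Lemma D_cycles : D = \bigcup_(C in E) Arc 3 (cycle_graph_of C).
Proof.
apply/setP => t; apply/idP/bigcupP => [|[C /orbit_cycP[h [y [sh -> _]]]]]; last first.
  exact: (subsetP (cg_arc3_D sh)).
have [u [v [w [z ->]]]] := tuple4P t => d.
have [xx xxx nx] := base_adj.
have [uv vw wz nuw _] := dlP d.
have [_ tr] := (transitive_Arc2 HX).1 tr2.
have [a aX [e0 e1 e2]] := tr _ _ _ _ _ _ xx xxx nx uv vw nuw.
have sga := shift_conj aX sg.
have f1 : to (to x0 a) (g ^ a) = v by rewrite act_conj.
have f2 : to (to x0 a) ((g ^ a) ^+ 2) = w by rewrite -conjXg act_conj.
exists (cyc (g ^ a) (to x0 a)).
  by apply/orbitP; exists a => //; apply: cyc_conj.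
apply/(cg_arc3P sga); exists (g ^ a), (to x0 a); split=> //; split=> //.
have [_] := sga; rewrite f1 f2 e0 => d'; exact: Duniq d d'.
Qed.

Lemma unique_cycle t : t \in Arc 2 S ->
  exists! C, C \in E /\ t \in Arc 2 (cycle_graph_of C).
Proof.
have [u [v [w ->]]] := tuple3P t; rewrite arc2E => /and3P[uv vw nuw].
have [xx xxx nx] := base_adj.
have [_ tr] := (transitive_Arc2 HX).1 tr2.
have [a aX [e0 e1 e2]] := tr _ _ _ _ _ _ xx xxx nx uv vw nuw.
have sga := shift_conj aX sg.
exists (cyc (g ^ a) (to x0 a)); split.
  split; first by apply/orbitP; exists a => //; apply: cyc_conj.
  apply/(cg_arc2P sga); exists (g ^ a), (to x0 a); split=> //.
  by rewrite -conjXg !act_conj.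
move=> C [/orbit_cycP[h [y [sh -> _]]] tC].
apply: (cyc_arc2_inj sga sh _ tC).
apply/(cg_arc2P sga); exists (g ^ a), (to x0 a); split=> //.
by rewrite -conjXg !act_conj.
Qed.

Local Notation A := ('C_X[C0 | toC]).
Local Notation K := ('C_X(cover C0 | to)).

Lemma t0_arc : t0 \in Arc 2 S.
Proof. by rewrite arc2E; apply/and3P; apply: base_adj. Qed.

Lemma stab_t0P a : reflect [/\ a \in X, to x0 a = x0, to x1 a = x1 & to x2 a = x2]
  (a \in 'C_X[t0 | to * 3]).
Proof.
apply: (iffP setIP) => [[aX /astab1P /=]|[aX e0 e1 e2]].
  by rewrite nact3E => /tuple3_inj[].
by split=> //; apply/astab1P; rewrite /= nact3E e0 e1 e2.
Qed.

(** The walk is determined by three consecutive vertices, so an element fixing the entries of [t0]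
    fixes the whole cycle pointwise. *)
Lemma stab_t0_K : 'C_X[t0 | to * 3] = K.
Proof.
apply/setP => a; apply/stab_t0P/setIP => [[aX e0 e1 e2]|[aX /astabP aC]].
  split=> //; apply/astabP => z; rewrite cover_cyc => /ptsP[j ->].
  exact: (shift_flow sg sg).
by split=> //; apply: aC; rewrite cover_cyc; apply/ptsP;
  [exists 0; rewrite act1 | exists 1%N | exists 2].
Qed.

Lemma mem_A a : a \in X ->
  (a \in A) = (n_act to t0 a \in Arc 2 (cycle_graph_of C0)).
Proof.
move=> aX; have sga := shift_conj aX sg.
have tC : n_act to t0 a \in Arc 2 (cycle_graph_of (cyc (g ^ a) (to x0 a))).
  rewrite nact3E; apply/(cg_arc2P sga); exists (g ^ a), (to x0 a); split=> //.
  by rewrite -conjXg !act_conj.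
rewrite inE aX; apply/astab1P/idP => [<-|tC']; first by rewrite [toC _ _]cyc_conj.
by rewrite [LHS]cyc_conj; apply: cyc_arc2_inj sga sg tC tC'.
Qed.

Lemma K_sub_A : K \subset A.
Proof.
rewrite -stab_t0_K; apply/subsetP => a /[dup] /stab_t0P[aX _ _ _] /setIP[_ /astab1P ea].
rewrite mem_A //; rewrite /= in ea; rewrite ea; apply/(cg_arc2P sg).
by exists g, x0; split.
Qed.

Lemma orbit_A : orbit (to * 3)%act A t0 = Arc 2 (cycle_graph_of C0).
Proof.
apply/setP => t; apply/orbitP/idP => [[a aA <-]|tC].
  by rewrite -mem_A //; case/setIP: aA.
have [u [v [w et]]] := tuple3P t.
have := tC; rewrite et => /(cg_arc2P sg)[h [y [[_ /dlP[yy yyy _ ny _]] _ [eu ev ew]]]].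
have [xx xxx nx] := base_adj.
have [_ tr] := (transitive_Arc2 HX).1 tr2.
have [a aX [e0 e1 e2]] := tr _ _ _ _ _ _ xx xxx nx yy yyy ny.
have ea : n_act to t0 a = t by rewrite nact3E et e0 e1 e2 eu ev ew.
exists a; last by rewrite -et; exact: ea.
by have := mem_A aX; rewrite ea tC => ->.
Qed.

(** The group [A] is transitive on the 2-arcs of the cycle, two for each vertex according to
    direction, and the stabiliser of one of them is [K]. *)
Lemma index_AK : #|A : K| = n.*2.
Proof.
rewrite -card_cg // -orbit_A card_orbit; congr #|_ : _|.
rewrite -stab_t0_K; apply/setP => a; apply/idP/idP => [aK|].
  by rewrite inE (subsetP K_sub_A) -?stab_t0_K //; case/setIP: aK.
by case/setIP=> /setIP[aX _] aC; apply/setIP.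
Qed.

Lemma A_norm_K : A \subset 'N(K).
Proof.
apply: normsI; first by rewrite (subset_trans (subsetIl _ _)) ?normG.
apply: subset_trans (astab_norm to _).
apply/subsetP => a /setIP[aX /astab1P aC].
rewrite -astab1_set; apply/astab1P.
by rewrite [LHS]setactE {1}cover_cyc -pts_conj -cover_cyc -cyc_conj; congr cover.
Qed.

Lemma exists_flip : exists2 k, k \in X & [/\ to x0 k = x2, to x1 k = x1 & to x2 k = x0].
Proof.
have [xx xxx nx] := base_adj.
have [_ tr] := (transitive_Arc2 HX).1 tr2.
by apply: tr => //; first [rewrite adj_sym | rewrite eq_sym].
Qed.

Lemma flip_flow k : k \in X -> to x0 k = x2 -> to x1 k = x1 -> to x2 k = x0 ->
  forall j, to (to x0 (g ^+ j)) k = to x2 (g^-1 ^+ j).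
Proof.
move=> kX k0 k1 k2.
have e1 : to x2 g^-1 = x1 by rewrite expgSr expg1 actM actK.
apply: (shift_flow sg (shift_inv sg)) => //; first by rewrite k1 e1.
have -> : g^-1 ^+ 2 = g^-1 * g^-1 by [].
by rewrite (actM _ _ g^-1 g^-1) e1 actK k2.
Qed.

(** In the abelian group [<[g]>] the stabiliser of [x0] is normal, and its index is the length of
    the orbit; that power of [g] therefore lies in it. *)
Lemma g_period : to x0 (g ^+ n) = x0.
Proof.
have : g ^+ #|<[g]> : 'C_<[g]>[x0 | to]| \in 'C_<[g]>[x0 | to].
  have ab : 'C_<[g]>[x0 | to] <| <[g]>.
    by rewrite -sub_abelian_normal ?cycle_abelian ?subsetIl.
  have gN : g \in 'N('C_<[g]>[x0 | to]) by apply: (subsetP (normal_norm ab)); apply: cycle_id.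
  rewrite -(card_quotient (normal_norm ab)).
  apply: coset_idr; first exact: groupX.
  rewrite morphX //; apply: expg_cardG; apply: mem_quotient; exact: cycle_id.
by rewrite -card_orbit => /setIP[_ /astab1P].
Qed.

Lemma mem_K a : a \in X -> to x0 a = x0 -> to x1 a = x1 -> to x2 a = x2 -> a \in K.
Proof. by move=> aX e0 e1 e2; rewrite -stab_t0_K; apply/stab_t0P. Qed.

(** An element of [A / K] is known from its effect on [t0], which reduces all computations in the
    quotient to three vertices. *)
Lemma coset_agree a b : a \in A -> b \in A -> to x0 a = to x0 b ->
  to x1 a = to x1 b -> to x2 a = to x2 b -> coset K a = coset K b.
Proof.
move=> aA bA e0 e1 e2.
have [aX _] := setIP aA; have [bX _] := setIP bA.
have abK : a * b^-1 \in K.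
  by apply: mem_K; rewrite ?groupM ?groupV // actM ?e0 ?e1 ?e2 actK.
have bN := subsetP A_norm_K _ bA.
have abN : a * b^-1 \in 'N(K) by apply: (subsetP (normG _)).
transitivity (coset K (a * b^-1 * b)); first by rewrite mulgKV.
by rewrite morphM // [X in X * _]coset_id // mul1g.
Qed.

(** The rotation [g] and the reflection [k] reversing [t0] satisfy the dihedral presentation and
    generate [A / K]; the order comes from [index_AK]. *)
Lemma cycle_stab_dihedral : cycle_stab_induced X to C0 \isog 'D_(n.*2).
Proof.
have n2 : 2 < n := card_pts_gt2 sg.
have n1 : 1 < n by apply: ltnW.
rewrite /cycle_stab_induced isogEcard card_dihedral //.
rewrite card_quotient ?A_norm_K // index_AK leqnn andbT.
have [k kX [k0 k1 k2]] := exists_flip.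
have gA : g \in A.
  rewrite mem_A ?gX // nact3E; apply/(cg_arc2P sg); exists g, x1; split.
  - exact: shift_step.
  - by rewrite -(cyc_step g x0 1).
  - by split=> //; rewrite -!actM -expgS -expgSr.
have kA : k \in A.
  rewrite mem_A ?kX // nact3E k0 k1 k2; apply/(cg_arc2P sg); exists g^-1, x2.
  have e1 : to x2 g^-1 = x1 by rewrite expgSr expg1 actM actK.
  split; first exact: shift_inv.
    by rewrite cyc_inv cyc_step.
  split=> //.
  have -> : g^-1 ^+ 2 = g^-1 * g^-1 by [].
  by rewrite (actM _ _ g^-1 g^-1) e1 actK.
have gN := subsetP A_norm_K _ gA; have kN := subsetP A_norm_K _ kA.
have fl := flip_flow kX k0 k1 k2.
have flK : forall j, to (to x2 (g^-1 ^+ j)) k^-1 = to x0 (g ^+ j).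
  by move=> j; rewrite -fl actK.
rewrite Grp_dihedral //; apply/existsP; exists (coset K g, coset K k).
rewrite /= !xpair_eqE; apply/and4P; split.
- rewrite eqEsubset; apply/andP; split.
    by rewrite join_subG !cycle_subG !mem_quotient.
  apply/subsetP => _ /morphimP[a aN aA ->] /=.
  have aX : a \in X by case/setIP: aA.
  have : n_act to t0 a \in Arc 2 (cycle_graph_of C0) by rewrite -mem_A.
  rewrite nact3E arc2E => /and3P[/(cg_adjP sg)[/ptsP[j ej] h1] /(cg_adjP sg)[_ h2] nn].
  have gj : coset K g ^+ j \in <[coset K g]> <*> <[coset K k]>.
    by apply: groupX; rewrite mem_gen // inE cycle_id.
  have kk : coset K k \in <[coset K g]> <*> <[coset K k]>.
    by rewrite mem_gen // inE cycle_id orbT.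
  have cj z : to (to z (g ^+ j)) g = to (to z g) (g ^+ j).
    by rewrite -!actM -expgSr expgS.
  case: h1 h2 nn => e1 [] e2; rewrite e1 ?actK ?actKV in e2; rewrite e2 ?eqxx // => _.
    rewrite (_ : coset K a = coset K (g ^+ j)); first by rewrite morphX.
    apply: coset_agree; rewrite ?groupX //.
    - by rewrite e1 ej cj.
    by rewrite e2 ej !cj [g ^+ 2]expgSr expg1 (actM _ x0 g g).
  have cj' z : to (to z (g ^+ j)) g^-1 = to (to z g^-1) (g ^+ j).
    by apply: (act_inj to g); rewrite actKV cj actKV.
  have ex1 : to x2 g^-1 = x1 by rewrite expgSr expg1 actM actK.
  (* The reflection sends [x0] to [x2], two backward steps return to [x0], and [g ^+ j] moves to the
     image of [x0] under [a]; the result runs backwards, as [a] does here. *)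
  pose b := k * g^-1 * g^-1 * g ^+ j.
  have bE z : to z b = to (to (to (to z k) g^-1) g^-1) (g ^+ j) by rewrite /b !actM.
  rewrite (_ : coset K a = coset K b); last first.
    apply: coset_agree; first by [].
    - by rewrite /b !groupM ?groupV ?groupX.
    - by rewrite bE k0 ex1 actK.
    - by rewrite bE k1 actK e1 ej cj'.
    - by rewrite bE k2 e2 ej !cj'.
  have gVN : g^-1 \in 'N(K) by rewrite groupV.
  have -> : coset K b = coset K k * coset K g^-1 * coset K g^-1 * coset K (g ^+ j).
    by rewrite /b morphM ?groupX ?groupM // morphM ?groupM // morphM.
  rewrite morphX // morphV //.
  by rewrite !groupM ?groupV // mem_gen // inE cycle_id.
- apply/eqP; rewrite -(morphX _ _ gN); apply: coset_id.
  apply: mem_K; first by rewrite groupX // gX.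
  + exact: g_period.
  + by rewrite -actM -expgS expgSr actM g_period.
  + by rewrite -actM -expgD addnC expgD actM g_period.
- apply/eqP; rewrite -(morphX _ _ kN); apply: coset_id.
  have -> : k ^+ 2 = k * k by [].
  by apply: mem_K; rewrite ?groupM // actM ?k0 ?k1 ?k2 // k0.
- apply/eqP; rewrite -(morphJ _ gN kN) -(morphV _ gN).
  have ex1 : to x2 g^-1 = x1 by rewrite expgSr expg1 actM actK.
  have f0 : to x0 k^-1 = x2 by apply: (act_inj to k); rewrite actKV k2.
  have f1 : to x1 k^-1 = x1 by apply: (act_inj to k); rewrite actKV k1.
  have f2 : to x2 k^-1 = x0 by apply: (act_inj to k); rewrite actKV k0.
  have cE z : to z (g ^ k) = to (to (to z k^-1) g) k by rewrite conjgE !actM.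
  apply: coset_agree; rewrite ?groupJ ?groupV // cE.
  + rewrite f0; have -> : to x2 g = to x0 (g ^+ 3) by rewrite -actM -expgSr.
    have f3 : g^-1 ^+ 3 = g^-1 * g^-1 * g^-1 by rewrite expgSr.
    by rewrite fl f3 !(actM _ _ _ g^-1) ex1 actK.
  + rewrite f1; have -> : to x1 g = x2 by rewrite -actM.
    by rewrite k2 actK.
  + by rewrite f2 k1 ex1.
Qed.

End Orbit.

(** * Counting and assembling the cycles in the tetravalent case *)

Section Tetravalent.
Hypothesis val4 : has_val S 4.

(** Each 2-arc lies on exactly one cycle, and a cycle has [2 n] of them, so [m * 2 n] is the number
    of 2-arcs, which is [12 |V|] for valency 4. The proof reads this as a product of indices along
    [K], [A], [X]. *)
Lemma card_cycle_orbit g x0 : shift g x0 ->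
  (#|orbit (to^*^*)%act X (cyc g x0)| * #|pts g x0| = 6 * #|vset S|)%N.
Proof.
move=> sg; apply/eqP; rewrite -(eqn_pmul2r (isT : 0 < 2)); apply/eqP.
rewrite -mulnA muln2 -index_AK // card_orbit.
have L := Lagrange_index (subsetIl X 'C[cyc g x0 | to^*^*]) (K_sub_A sg).
rewrite [LHS]L; transitivity #|Arc 2 S|; last by rewrite (card_Arc2 val4); lia.
by rewrite -(atransP tr2 _ (t0_arc sg)) card_orbit (stab_t0_K sg).
Qed.

(** A single triangle contains a 2-arc with adjacent ends. By 2-arc-transitivity all 2-arcs then
    close up, and a connected graph of this kind is complete. *)
Lemma K5_or_triangle_free : S ~=g complete 5 \/ girth_geq S 4.
Proof.
have [_ tr] := (transitive_Arc2 HX).1 tr2.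
case: (boolP [exists x, exists y, exists z, [&& adj S x y, adj S y z & adj S z x]]).
  case/existsP=> x /existsP[y /existsP[z /and3P[xy yz zx]]]; left.
  have closed u v w : adj S u v -> adj S v w -> u != w -> adj S u w.
    move=> uv vw nuw; have nxz : x != z by have := adj_neq zx; rewrite eq_sym.
    have [a aX [<- _ <-]] := tr _ _ _ _ _ _ xy yz nxz uv vw nuw.
    by rewrite (acts_adj HX) // adj_sym.
  have all_adj u v : u \in vset S -> v \in vset S -> u != v -> adj S u v.
    move=> uV vV; have /connectP[p + ->] := conS uV vV.
    elim/last_ind: p => [|p w IH]; first by rewrite eqxx.
    rewrite rcons_path last_rcons => /andP[up lw] nuw.
    have [e|nul] := eqVneq u (last u p); first by move: lw; rewrite -e.
    by apply: closed lw nuw; apply: IH.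
  apply: complete_giso; last by move=> u v; apply: all_adj.
  have xV := adj_vset xy.
  have <- : x |: nbr S x = vset S.
    apply/setP => u; rewrite !inE; apply/orP/idP => [[/eqP->//|]|uV].
      exact: adj_vset_r.
    by have [->|nux] := eqVneq u x; [left | right; apply: all_adj; rewrite // eq_sym].
  by rewrite cardsU1 inE adj_irr val4.
move=> nt; right; apply: triangle_free_girth => x y z xy yz.
apply: contraNN nt => zx; apply/existsP; exists x; apply/existsP; exists y.
by apply/existsP; exists z; rewrite xy yz.
Qed.

Lemma base_cycle_orbit g x0 : shift g x0 ->
  cycle_orbit_for X to #|orbit (to^*^*)%act X (cyc g x0)| #|pts g x0| S D
    (orbit (to^*^*)%act X (cyc g x0)).
Proof.
move=> sg; have cE := card_cycle_orbit sg.
have n2 : 2 < #|pts g x0| := card_pts_gt2 sg.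
have nV : #|pts g x0| <= #|vset S| := subset_leq_card (pts_vset sg).
split.
- by split=> //; exists (cyc g x0); first exact: cyc_ncycles.
- exact: D_cycles.
- by move=> C /(orbit_cycP sg)[h [y [sh -> <-]]]; apply: cycle_stab_dihedral.
- split; last by apply: girth_exists; apply/set0Pn; exists (cyc g x0); apply: cyc_ncycles.
  (* The bound [6 <= m] follows from [m n = 6 |V|] and [n <= |V|]. *)
  by rewrite -(leq_pmul2r (ltnW (ltnW n2))) cE leq_mul2l nV orbT.
- by rewrite cE; split=> //; have := card_edges val4; lia.
Qed.

Lemma base_near_ngonal g x0 : shift g x0 ->
  S ~=g complete 5 \/
  near_ngonal_wrt #|pts g x0| S (orbit (to^*^*)%act X (cyc g x0)).
Proof.
move=> sg; case: K5_or_triangle_free; [by left | move=> g4; right].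
split=> //; first exact: orbit_cyc_ncycles.
by move=> t /(unique_cycle sg).
Qed.

Lemma unique_extension_cycles : exists m n (E : {set {set {set W}}}),
  cycle_orbit_for X to m n S D E /\ (S ~=g complete 5 \/ near_ngonal_wrt n S E).
Proof.
have [g [x0 sg]] := exists_shift.
exists #|orbit (to^*^*)%act X (cyc g x0)|, #|pts g x0|, (orbit (to^*^*)%act X (cyc g x0)).
by split; [apply: base_cycle_orbit | apply: base_near_ngonal].
Qed.

(** The 2-paths lying on one cycle; these sets turn out to be the closed pieces into which
    [gimel S D] falls apart. *)
Definition cycle_part (C : {set {set W}}) : {set {set 3.-tuple W}} :=
  [set path_of t | t in Arc 2 (cycle_graph_of C)].

Lemma cycle_partP h y p : shift h y -> reflect
  (exists2 z, z \in pts h y & p = path2 z (to z h) (to z (h ^+ 2)))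
  (p \in cycle_part (cyc h y)).
Proof.
move=> sh; apply: (iffP imsetP) => [[t]|[z zp ->]].
  have [u [v [w ->]]] := tuple3P t; rewrite arc2E => /and3P[].
  move=> /(cg_adjP sh)[up uv] /(cg_adjP sh)[vp vw] nuw ->.
  case: uv vw nuw => -> [] ->; rewrite ?actK ?actKV ?eqxx // => _.
    by exists u; rewrite // expgSr expg1 actM.
  exists (to (to u h^-1) h^-1); first by rewrite !pts_hV.
  by rewrite expgSr expg1 actM !actKV -/(path2 _ _ _) path2_sym.
exists [tuple z; to z h; to z (h ^+ 2)] => //.
apply/(cg_arc2P sh); exists h, z; split=> //; first exact: pts_shift zp.
by have /ptsP[j ->] := zp; rewrite cyc_step.
Qed.

Lemma cycle_part_inj h y h' y' p : shift h y -> shift h' y' ->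
  p \in cycle_part (cyc h y) -> p \in cycle_part (cyc h' y') -> cyc h y = cyc h' y'.
Proof.
move=> sh sh' /(cycle_partP _ sh)[z zp ep] /imsetP[t tC ep'].
have sz : shift h z by exact: pts_shift zp.
have ec : cyc h z = cyc h y by have /ptsP[j ->] := zp; rewrite cyc_step.
have : t \in path_of t by rewrite !inE eqxx.
rewrite -ep' ep !inE rev_tup3 => et; rewrite -ec.
apply: (cyc_arc2_inj sz sh' _ tC); rewrite ec.
case/orP: et => /eqP ->; apply/(cg_arc2P sh).
  by exists h, z; split.
exists h^-1, (to z (h ^+ 2)); split; first exact: shift_inv.
  by rewrite cyc_inv cyc_step.
split=> //; first by rewrite expgSr expg1 actM actK.
by rewrite -actM expgVn mulgV act1.
Qed.

Lemma cycle_part_giso h y : shift h y ->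
  cycle_graph #|pts h y| ~=g induced (gimel S D) (cycle_part (cyc h y)).
Proof.
move=> sh; set n := #|pts h y|.
have n2 : 2 < n := card_pts_gt2 sh.
have n0 : 0 < n by lia.
(* The vertices are indexed by all natural numbers, with period [n], so that indices such as [i.+3]
   need no reduction. *)
pose c j := to y (h ^+ j).
have cS j : to (c j) h = c j.+1 by rewrite /c expgSr actM.
have cn j : c (j + n)%N = c j.
  by rewrite /c addnC expgD actM g_period.
have cmod j : c (j %% n) = c j.
  rewrite {2}(divn_eq j n); elim: (j %/ n) => [|q IH]; first by rewrite mul0n.
  by rewrite mulSnr addnAC cn.
have cmodD j k : c (j %% n + k)%N = c (j + k)%N by rewrite -cmod modnDml cmod.
have c2 j : to (c j) (h ^+ 2) = c j.+2 by rewrite expgSr expg1 actM !cS.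
have cinj i j : c i = c j -> (i %% n = j %% n)%N.
  have : injective (fun k : 'I_n => c k).
    suff E : [set c k | k : 'I_n] = pts h y.
      have /imset_injP inj : #|[set c k | k : 'I_n]| == #|'I_n| by rewrite E card_ord.
      by move=> k l; apply: inj.
    apply/setP => z; apply/imsetP/ptsP => [[k _ ->]|[k ->]]; first by exists k.
    by exists (Ordinal (ltn_pmod k n0)); rewrite //= cmod.
  move=> inj; rewrite -(cmod i) -(cmod j) => e.
  by have := inj (Ordinal (ltn_pmod i n0)) (Ordinal (ltn_pmod j n0)) e; case.
have cadj j : adj S (c j) (c j.+1) by rewrite -cS; apply/shift_adj/shift_iter.
have cneq j : c j != c j.+2 by rewrite -c2; apply: (pts_neq2 sh); apply/ptsP; exists j.
pose f (i : 'I_n) := path2 (c i) (c i.+1) (c i.+2).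
have fpart i : f i \in cycle_part (cyc h y).
  apply/(cycle_partP _ sh); exists (c i); first by apply/ptsP; exists i.
  by rewrite cS c2.
have fV i : f i \in Path 2 S by apply/path2P; exists (c i), (c i.+1), (c i.+2).
have dc j : dl (c j) (c j.+1) (c j.+2) (c j.+3).
  by have [_] := shift_iter j sh; rewrite -/(c j) cS c2 [h ^+ 3]expgSr actM c2 cS.
have modS i j : (i.+1 %% n = j.+1 %% n -> i %% n = j %% n)%N.
  by move=> /eqP; rewrite -(addn1 i) -(addn1 j) eqn_modDr => /eqP.
exists f; split.
- move=> i j _ _ /path2_inj[/cinj /modS + _].
  by rewrite !modn_small // => /val_inj.
- apply/setP => p; rewrite !inE; apply/imsetP/andP => [[i _ ->]|[_]]; first by split.
  case/(cycle_partP _ sh) => z /ptsP[j ->] ->; exists (Ordinal (ltn_pmod j n0)) => //.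
  rewrite /f /= -/(c j) cS c2 cmod; congr path2.
    by have := cmodD j 1%N; rewrite !addn1.
  by have := cmodD j 2; rewrite !addn2.
- move=> i j _ _; rewrite induced_adjE !fpart !andTb.
  have -> : adj (cycle_graph n) i j
      = (i != j) && ((j == (i.+1 %% n)%N :> nat) || (i == (j.+1 %% n)%N :> nat)).
    by rewrite simple_adjE !in_setT.
  have step k l : (l = k.+1 %[mod n])%N -> path2 (c l) (c l.+1) (c l.+2) =
      path2 (c k.+1) (c k.+2) (c k.+3).
    move=> e; congr path2; rewrite -cmod -[in RHS]cmod; congr c; first exact: e.
      by apply/eqP; rewrite -(addn1 l) -(addn1 k.+1) eqn_modDr e.
    by apply/eqP; rewrite -(addn2 l) -(addn2 k.+1) eqn_modDr e.
  have half k l : (l = k.+1 %[mod n])%N ->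
      adj (gimel S D) (path2 (c k) (c k.+1) (c k.+2)) (path2 (c l) (c l.+1) (c l.+2)).
    move=> e; apply/(gimel_adjP _ _ D3 Dsp).
    by exists (c k), (c k.+1), (c k.+2), (c k.+3); rewrite (step _ _ e).
  apply/(gimel_adjP _ _ D3 Dsp)/andP.
    move=> [a0 [a1 [a2 [a3 [d]]]]] /path2_inj[e1 e02] /path2_inj[e2 _].
    (* The 2-path of [i] can be read in either direction: forwards forces [j = i + 1], backwards
       [i = j + 1] modulo [n]. *)
    subst a1; case: e02 => [] [? ?]; subst a0 a2.
      have e3 : c i.+2 = c j.+1 by [].
      have ej : (j = i.+1 %[mod n])%N by apply: modS; rewrite (cinj _ _ e3).
      split; last by rewrite -{1}[nat_of_ord j](modn_small (ltn_ord j)) ej eqxx.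
      apply/eqP => eij; have := cneq i; rewrite -eij in e3.
      by move: (cadj i.+1); rewrite -e3 adj_irr.
    have e3 : c i = c j.+1 by [].
    have ej : (i = j.+1 %[mod n])%N by apply: cinj.
    split; last first.
      by rewrite -{2}[nat_of_ord i](modn_small (ltn_ord i)) ej eqxx orbT.
    apply/eqP => eij; rewrite -eij in e3.
    by move: (cadj i); rewrite -e3 adj_irr.
  move=> [nij /orP[]/eqP e].
    have h1 : (j = i.+1 %[mod n])%N by rewrite {1}e modn_mod.
    by have /(gimel_adjP _ _ D3 Dsp) := half _ _ h1.
  have h1 : (i = j.+1 %[mod n])%N by rewrite {1}e modn_mod.
  by have := half _ _ h1; rewrite adj_sym => /(gimel_adjP _ _ D3 Dsp).
Qed.

Lemma gimel_cycles g x0 : shift g x0 ->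
  gimel S D ~=g copies #|orbit (to^*^*)%act X (cyc g x0)| (cycle_graph #|pts g x0|).
Proof.
move=> sg; set E := orbit _ _ _.
have EP C : C \in E -> exists h y, [/\ shift h y, C = cyc h y & #|pts h y| = #|pts g x0|].
  by move/(orbit_cycP sg).
have C0E : cyc g x0 \in E by apply: orbit_refl.
have pt : 'I_#|E| * 'I_#|pts g x0|.
  split; first exact: (enum_rank_in C0E (cyc g x0)).
  by exists 0; have := card_pts_gt2 sg; lia.
apply: (giso_sym pt); apply: (@copies_giso _ _ _ _ _ E cycle_part).
- move=> C /EP[h [y [sh -> _]]]; apply/subsetP => p /(cycle_partP _ sh)[z zp ->].
  have [_ /dlP[a1 a2 _ n2 _]] := pts_shift sh zp.
  by apply/path2P; exists z, (to z h), (to z (h ^+ 2)).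
- move=> p /path2P[x [y [z [xy yz nxz ->]]]].
  have tA : [tuple x; y; z] \in Arc 2 S by rewrite arc2E xy yz.
  have [C [[CE tC] _]] := unique_cycle sg tA.
  by exists C => //; apply/imsetP; exists [tuple x; y; z].
- move=> C C' p /EP[h [y [sh -> _]]] /EP[h' [y' [sh' -> _]]].
  exact: cycle_part_inj.
- move=> C p q CE pC /(gimel_adjP _ _ D3 Dsp)[a0 [a1 [a2 [a3 [d ep eq]]]]].
  have := d; rewrite {1}(D_cycles sg) => /bigcupP[C' C'E].
  rewrite arc3E => /and5P[d01 d12 d23 n02 n13].
  have pC' : p \in cycle_part C'.
    by apply/imsetP; exists [tuple a0; a1; a2]; rewrite // arc2E d01 d12.
  have qC' : q \in cycle_part C'.
    by apply/imsetP; exists [tuple a1; a2; a3]; rewrite // arc2E d12 d23.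
  have [h [y [sh eC _]]] := EP _ CE; have [h' [y' [sh' eC' _]]] := EP _ C'E.
  by rewrite eC (cycle_part_inj sh sh' (p := p)) -?eC -?eC'.
- by move=> C /EP[h [y [sh -> <-]]]; apply: cycle_part_giso.
Qed.

Lemma unique_extension_gimel : exists m n (E : {set {set {set W}}}),
  [/\ gimel S D ~=g copies m (cycle_graph n), cycle_orbit_for X to m n S D E
    & S ~=g complete 5 \/ near_ngonal_wrt n S E].
Proof.
have [g [x0 sg]] := exists_shift.
exists #|orbit (to^*^*)%act X (cyc g x0)|, #|pts g x0|, (orbit (to^*^*)%act X (cyc g x0)).
by split; [apply: gimel_cycles | apply: base_cycle_orbit | apply: base_near_ngonal].
Qed.

End Tetravalent.

End UniqueExtension.

(** * Two-transitive groups on four points *)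

Section PermRep.
Variables (aT : finGroupType) (T : finType) (to : {action aT &-> T}).
Variables (H : {group aT}) (S : {set T}) (n : nat).
Hypothesis HS : [acts H, on S | to].
Hypothesis cS : #|S| = n.+1.

Lemma enum_set_bij : exists (e : 'I_n.+1 -> T) (e' : T -> 'I_n.+1),
  [/\ cancel e e', forall i, e i \in S & {in S, cancel e' e}].
Proof.
pose e (i : 'I_n.+1) := enum_val (cast_ord (esym cS) i).
have eS i : e i \in S by apply: enum_valP.
pose e' x := cast_ord cS (enum_rank_in (eS ord0) x).
exists e, e'; split=> //.
  by move=> i; rewrite /e /e' enum_valK_in cast_ordKV.
by move=> x xS; rewrite /e /e' cast_ordK enum_rankK_in.
Qed.

Lemma perm_rep : exists (e : 'I_n.+1 -> T) (rho : {morphism H >-> {perm 'I_n.+1}}),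
  [/\ injective e, forall i, e i \in S, forall x, x \in S -> exists i, x = e i,
      forall a i, a \in H -> e (rho a i) = to (e i) a
    & 'ker rho = 'C_H(S | to)].
Proof.
have [e [e' [eK eS e'K]]] := enum_set_bij.
have ei : injective e := can_inj eK.
(* The default 1 of [insubd] is taken only where the numbered map fails to be injective, which does
   not happen for [a] in [H]. *)
pose r a : {perm 'I_n.+1} := insubd (1 : {perm 'I_n.+1}) [ffun i => e' (to (e i) a)].
have rE a i : a \in H -> e (r a i) = to (e i) a.
  move=> aH; have aS j : to (e j) a \in S by rewrite (acts_act HS).
  have inj : injectiveb [ffun i => e' (to (e i) a)].
    apply/injectiveP => j k; rewrite !ffunE => /(congr1 e); rewrite !e'K //.
    by move/act_inj/ei.
  by rewrite -pvalE -[pval _]/(val _) insubdK ?ffunE ?e'K.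
have rM : {in H &, {morph r : a b / a * b}}.
  move=> a b aH bH; apply/permP => i; apply: ei.
  by rewrite permM !rE ?groupM // actM.
exists e, (Morphism rM); split=> //= [x xS|]; first by exists (e' x); rewrite e'K.
apply/setP => a; apply/idP/setIP => [ak|[aH /astabP ca]].
  have aH := dom_ker ak; split=> //; apply/astabP => x xS.
  by rewrite -(e'K _ xS) -rE // [r a](mker ak) perm1.
apply/kerP => //=; apply/permP => i; apply: ei.
by rewrite rE // perm1 ca.
Qed.

End PermRep.

Section FourPoints.

Local Notation o0 := (Ordinal (isT : 0 < 4)).
Local Notation o1 := (Ordinal (isT : 1 < 4)).

Lemma card_Sym4 : #|[set: {perm 'I_4}]| = 24.
Proof. by rewrite cardsT card_Sn. Qed.

Lemma card_Alt4 : #|'Alt_('I_4)| = 12.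
Proof. by have := @card_Alt 'I_4; rewrite card_ord => /(_ isT); rewrite !factS fact0; lia. Qed.

Lemma perm_orbit (n : nat) (K : {group {perm 'I_n}}) i :
  (forall j, exists2 p, p \in K & p i = j) -> (#|K| = n * #|'C_K[i | 'P]|)%N.
Proof.
move=> tr; rewrite -(card_orbit_stab 'P K i); congr (_ * _)%N.
rewrite -[RHS]card_ord -cardsT; apply: eq_card => j; rewrite [RHS]inE.
by have [p pK <-] := tr j; apply/orbitP; exists p.
Qed.

Lemma odd_perm_cube (n : nat) (p : {perm 'I_n}) : p ^+ 3 = 1 -> p \in 'Alt_('I_n).
Proof.
move=> p3; rewrite Alt_even.
have : odd_perm (p ^+ 3) = false by rewrite p3 odd_perm1.
by rewrite !expgS expg0 !odd_permM odd_perm1 addbF; case: (odd_perm p).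
Qed.

(** 2-transitivity makes the order a multiple of 12, and it divides 24. In order 12 the point
    stabilisers have order 3, hence consist of even permutations, and two of them already fill too
    much of [K] for the even part to be proper. *)
Lemma two_transitive_perm4 (K : {group {perm 'I_4}}) :
  (forall i j i' j', i != j -> i' != j' ->
     exists2 p : {perm 'I_4}, p \in K & p i = i' /\ p j = j') ->
  K :=: 'Alt_('I_4) \/ K :=: 'Sym_('I_4).
Proof.
move=> tr2.
have oth (i : 'I_4) : exists j, i != j.
  by case: (eqVneq i o0) => [->|h]; [exists o1 | exists o0].
have tr i j : exists2 p : {perm 'I_4}, p \in K & p i = j.
  have [i' h] := oth i; have [j' h'] := oth j.
  by have [p pK [pi _]] := tr2 _ _ _ _ h h'; exists p.
have cK i : (#|K| = 4 * #|'C_K[i | 'P]|)%N by exact: (perm_orbit (tr i)).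
have cKi i j : i != j -> (#|'C_K[i | 'P]| = 3 * #|'C_('C_K[i | 'P])[j | 'P]|)%N.
  move=> nij; rewrite -(card_orbit_stab 'P 'C_K[i | 'P] j); congr (_ * _)%N.
  have -> : orbit 'P 'C_K[i | 'P] j = [set~ i].
    apply/setP => k; rewrite in_setC1; apply/orbitP/idP => [[p]|nki].
      case/setIP=> _ /astab1P /= pi <- /=; rewrite /aperm in pi *.
      by rewrite -[X in _ != X]pi (inj_eq perm_inj) eq_sym.
    rewrite eq_sym in nki; have [p pK [pi pj]] := tr2 _ _ _ _ nij nki.
    by exists p => //; apply/setIP; split=> //; apply/astab1P.
  by rewrite cardsC1 card_ord.
have div24 : #|K| %| 24 by rewrite -card_Sym4; apply: cardSg; apply: subsetT.
have c12 : #|K| = 12 \/ #|K| = 24.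
  have := cK o0; rewrite (@cKi o0 o1) //; move: #|'C_(_)[_ | _]| => m e.
  have := dvdn_leq (isT : 0 < 24) div24; move: div24; rewrite e.
  by case: m {e} => [|[|[|m]]] //; auto; lia.
case: c12 => c; last first.
  by right; apply/eqP; rewrite eqEcard subsetT c card_Sym4.
have c3 i : #|'C_K[i | 'P]| = 3 by have := cK i; lia.
left; have Ksub i : 'C_K[i | 'P] \subset K :&: 'Alt_('I_4).
  apply/subsetP => p pK; have pKK : p \in K by case/setIP: pK.
  apply/setIP; split=> //; apply: odd_perm_cube.
  by have := expg_cardG pK; rewrite /= c3.
(* Two point stabilisers of order 3 meet trivially, so their product set has 9 elements; a divisor
   of 12 that is at least 9 is 12. *)
have c9 : 9 <= #|K :&: 'Alt_('I_4)|.
  have ci : #|'C_K[o0 | 'P] :&: 'C_K[o1 | 'P]| = 1%N.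
    have := @cKi o0 o1 isT; rewrite c3.
    have -> : 'C_('C_K[o0 | 'P])[o1 | 'P] = 'C_K[o0 | 'P] :&: 'C_K[o1 | 'P].
      apply/setP => p; rewrite !inE; by case: (p \in K); rewrite ?andbF.
    lia.
  have := mul_cardG 'C_K[o0 | 'P] 'C_K[o1 | 'P]; rewrite !c3 ci.
  have : #|'C_K[o0 | 'P] * 'C_K[o1 | 'P]| <= #|K :&: 'Alt_('I_4)|.
    by apply: subset_leq_card; rewrite mul_subG ?Ksub.
  by move=> h e; apply: leq_trans h; rewrite -(leq_pmul2r (isT : 0 < 1)) -e.
have d12 : #|K :&: 'Alt_('I_4)| %| 12 by rewrite -c; apply: cardSg; apply: subsetIl.
have e12 : #|K :&: 'Alt_('I_4)| = 12.
  have := dvdn_leq (isT : 0 < 12) d12.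
  by move: c9 d12; move: #|_| => m; do 13?[case: m => [|m] //].
have KA : K :&: 'Alt_('I_4) = K by apply/eqP; rewrite eqEcard subsetIl c e12.
by apply/eqP; rewrite eqEcard c card_Alt4 leqnn andbT -KA subsetIr.
Qed.

(** As the order is 4 times that of a point stabiliser, the stabiliser contains an element of order
    3, which must permute the other three points cyclically. *)
Lemma two_transitive_of_order3 (K : {group {perm 'I_4}}) :
  (forall i j, exists2 p : {perm 'I_4}, p \in K & p i = j) -> 3 %| #|K| ->
  forall i j i' j', i != j -> i' != j' ->
     exists2 p : {perm 'I_4}, p \in K & p i = i' /\ p j = j'.
Proof.
move=> tr d3.
have st i j j' : i != j -> i != j' ->
    exists2 p : {perm 'I_4}, p \in K & p i = i /\ p j = j'.
  move=> nij nij'; have cK := perm_orbit (tr i).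
  have d3' : 3 %| #|'C_K[i | 'P]| by move: d3; rewrite cK Gauss_dvdr.
  have [p pK op] := Cauchy (isT : prime 3) d3'.
  have [pKK /astab1P pi'] := setIP pK; have pi : p i = i := pi'.
  have orb k : #|orbit 'P <[p]> k| = 1%N \/ #|orbit 'P <[p]> k| = 3.
    have : #|orbit 'P <[p]> k| %| #[p] by rewrite card_orbit dvdn_indexg.
    rewrite op.
    by rewrite dvdn_divisors // => /predU1P[|/predU1P[]]; auto.
  have orbi k : i != k -> orbit 'P <[p]> k \subset [set~ i].
    move=> nik; apply/subsetP => _ /orbitP[_ /cycleP[m ->] <-] /=.
    rewrite in_setC1 /aperm; elim: m => [|m IH]; first by rewrite perm1 eq_sym.
    by rewrite expgSr permM -[X in _ != X]pi (inj_eq perm_inj).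
  have fix1 k : #|orbit 'P <[p]> k| = 1%N -> p k = k.
    move/eqP/cards1P => [z ez].
    have : p k \in orbit 'P <[p]> k by apply: (mem_orbit 'P); apply: cycle_id.
    have : k \in orbit 'P <[p]> k by apply: orbit_refl.
    by rewrite ez !inE => /eqP -> /eqP.
  have all3 k : i != k -> orbit 'P <[p]> k = [set~ i].
    move=> nik; case: (orb k) => ck; last first.
      by apply/eqP; rewrite eqEcard orbi // cardsC1 card_ord ck.
    (* With a second fixed point [k] only two points remain, too few for an orbit of size 3, so [p]
       would be the identity. *)
    have pk := fix1 _ ck; suff p1 : p = 1 by move: op; rewrite p1 order1.
    apply/permP => l; rewrite perm1.
    have [->//|nil] := eqVneq l i; have [->//|nkl] := eqVneq l k.
    case: (orb l) => cl; first exact: fix1.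
    suff : orbit 'P <[p]> l \subset [set~ i] :\ k.
      move/subset_leq_card; rewrite cl; have := cardsD1 k [set~ i].
      by rewrite cardsC1 card_ord in_setC1 [k == i]eq_sym nik /= add1n => -[<-].
    rewrite subsetD1 orbi 1?eq_sym //=; apply/orbitP => -[_ /cycleP[m ->]] /= e.
    case/negP: nkl; rewrite -(inj_eq (@perm_inj _ (p ^+ m))) -[X in _ == X]/(aperm k (p ^+ m)).
    rewrite -/(aperm l (p ^+ m)) e; apply/eqP; rewrite /aperm.
    by elim: m {e} => [|m IH]; rewrite ?perm1 // expgSr permM -IH pk.
  have : j' \in orbit 'P <[p]> j by rewrite all3 // in_setC1 eq_sym.
  case/orbitP=> q qp /= qj; exists q.
    by move: q qp {qj}; apply/subsetP; rewrite cycle_subG.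
  split=> //; have /cycleP[m ->] := qp.
  by elim: m => [|m IH]; rewrite ?perm1 // expgSr permM IH.
move=> i j i' j' nij nij'; have [p pK pi] := tr i i'.
have npj : i' != p j by rewrite -pi (inj_eq perm_inj).
have [q qK [qi qj]] := st _ _ _ npj nij'.
by exists (p * q); rewrite ?groupM // !permM pi qi qj.
Qed.

(** Permutations with trivial cube are even, and the alternating group of degree 3 is cyclic. Set
    against [Alt4_noncommuting], this gives the contradiction used in case (b). *)
Lemma Alt3_commute (s t : {perm 'I_3}) : s ^+ 3 = 1 -> t ^+ 3 = 1 -> s * t = t * s.
Proof.
move=> /odd_perm_cube sA /odd_perm_cube tA.
have c3 : #|'Alt_('I_3)| = 3.
  by have := @card_Alt 'I_3; rewrite card_ord => /(_ isT); rewrite !factS fact0; lia.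
have /cyclic_abelian/centsP ab : cyclic 'Alt_('I_3) by apply: prime_cyclic; rewrite c3.
exact: ab.
Qed.

Lemma Alt4_noncommuting : exists s t : {perm 'I_4},
  [/\ s \in 'Alt_('I_4), t \in 'Alt_('I_4), s ^+ 3 = 1, t ^+ 3 = 1 & s * t <> t * s].
Proof.
pose o2 := Ordinal (isT : 2 < 4); pose o3 := Ordinal (isT : 3 < 4).
pose s : {perm 'I_4} := tperm o0 o1 * tperm o1 o2.
pose t : {perm 'I_4} := tperm o0 o1 * tperm o1 o3.
have s3 : s ^+ 3 = 1.
  apply/permP => i; rewrite !expgS expg0 mulg1 /s !permM perm1.
  by case: i => [[|[|[|[|//]]]] h]; apply: val_inj; rewrite !permE /= ?permE.
have t3 : t ^+ 3 = 1.
  apply/permP => i; rewrite !expgS expg0 mulg1 /t !permM perm1.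
  by case: i => [[|[|[|[|//]]]] h]; apply: val_inj; rewrite !permE /= ?permE.
exists s, t; split=> //; try exact: odd_perm_cube.
move=> /permP/(_ o0); rewrite /s /t !permM !permE /=.
by rewrite ?permE.
Qed.

End FourPoints.

Section FourPointActions.
Variables (aT : finGroupType) (T : finType) (to : {action aT &-> T}).
Variables (H : {group aT}) (S : {set T}).
Hypothesis HS : [acts H, on S | to].

Definition two_trans := forall x y x' y', x \in S -> y \in S -> x' \in S -> y' \in S ->
  x != y -> x' != y' -> exists2 a, a \in H & to x a = x' /\ to y a = y'.

Lemma two_trans_A4_S4 : #|S| = 4 -> two_trans ->
  H / 'C_H(S | to) \isog 'Alt_('I_4) \/ H / 'C_H(S | to) \isog 'Sym_('I_4).
Proof.
move=> cS tt; have [e [rho [ei eS eT rE kr]]] := perm_rep HS cS.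
have iso : H / 'C_H(S | to) \isog rho @* H by rewrite -kr; apply: first_isog.
have [|<-|<-] := @two_transitive_perm4 [group of rho @* H]; [|by left|by right].
move=> i j i' j' nij nij'.
have [||a aH [ai aj]] := tt _ _ _ _ (eS i) (eS j) (eS i') (eS j'); rewrite ?(inj_eq ei) //.
by exists (rho a); [apply: mem_morphim | split; apply: ei; rewrite rE].
Qed.

Lemma two_trans_of_order3 : #|S| = 4 ->
  (forall x y, x \in S -> y \in S -> exists2 a, a \in H & to x a = y) ->
  3 %| #|H / 'C_H(S | to)| -> two_trans.
Proof.
move=> cS tr d3; have [e [rho [ei eS eT rE kr]]] := perm_rep HS cS.
have iso : H / 'C_H(S | to) \isog rho @* H by rewrite -kr; apply: first_isog.
rewrite (card_isog iso) in d3.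
have trK i j : exists2 p : {perm 'I_4}, p \in rho @* H & p i = j.
  have [a aH ai] := tr _ _ (eS i) (eS j); exists (rho a); first exact: mem_morphim.
  by apply: ei; rewrite rE.
have h := @two_transitive_of_order3 [group of rho @* H] trK d3.
move=> x y x' y' /eT[i ->] /eT[j ->] /eT[i' ->] /eT[j' ->]; rewrite !(inj_eq ei) => nij nij'.
have [_ /morphimP[a _ aH ->] [ai aj]] := h _ _ _ _ nij nij'.
by exists a => //; rewrite -!rE // ai aj.
Qed.

Lemma commute_on3 : #|S| = 3 -> forall u v, u \in H -> v \in H ->
  (forall x, x \in S -> to x (u ^+ 3) = x) -> (forall x, x \in S -> to x (v ^+ 3) = x) ->
  forall x, x \in S -> to x (u * v) = to x (v * u).
Proof.
move=> cS u v uH vH u3 v3; have [e [rho [ei eS eT rE kr]]] := perm_rep HS cS.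
have cube a : a \in H -> (forall x, x \in S -> to x (a ^+ 3) = x) -> rho a ^+ 3 = 1.
  move=> aH a3; rewrite -morphX //; apply/permP => i; apply: ei.
  by rewrite rE ?groupX // perm1 a3.
have com := Alt3_commute (cube _ uH u3) (cube _ vH v3).
move=> x /eT[i ->]; rewrite -!rE ?groupM //; congr (e _).
by rewrite !morphM // com.
Qed.

End FourPointActions.

Lemma A4_S4_noncommuting (gT : finGroupType) (G : {group gT}) :
  G \isog 'Alt_('I_4) \/ G \isog 'Sym_('I_4) ->
  exists u v, [/\ u \in G, v \in G, u ^+ 3 = 1, v ^+ 3 = 1 & u * v <> v * u].
Proof.
have [s [t [sA tA s3 t3 nst]]] := Alt4_noncommuting.
suff main (K : {group {perm 'I_4}}) : s \in K -> t \in K -> G \isog K ->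
  exists u v, [/\ u \in G, v \in G, u ^+ 3 = 1, v ^+ 3 = 1 & u * v <> v * u].
  by case; apply: main => //; rewrite inE.
move=> sK tK; rewrite isog_sym => /isogP[f fi fG].
exists (f s), (f t); rewrite -fG !mem_morphim // -!morphX // s3 t3 morph1; split=> //.
by rewrite -!morphM //; move/(injmP fi) => e; apply: nst; apply: e; rewrite groupM.
Qed.

Lemma A4_S4_order (gT : finGroupType) (G : {group gT}) :
  G \isog 'Alt_('I_4) \/ G \isog 'Sym_('I_4) -> 3 %| #|G|.
Proof. by case=> /card_isog ->; rewrite ?card_Alt4 ?card_Sym4. Qed.

(** * The group GL(3,2) and the Fano plane *)

Section GL3.
Import GRing.Theory.
Local Open Scope ring_scope.
Local Notation V := 'rV['F_2]_3.
Local Notation gG := {'GL_3(2)}.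
Implicit Types (u v w : V) (g h : gG).

Lemma F2P (a : 'F_2) : a = 0 \/ a = 1.
Proof. by case: a => [[|[|//]] h]; [left | right]; apply: val_inj. Qed.

Lemma rV2_addvv v : v + v = 0.
Proof. by apply/rowP => i; rewrite !mxE addrr_pchar2. Qed.

Lemma rV2_addK v w : v + w + w = v.
Proof. by rewrite -addrA rV2_addvv addr0. Qed.

Lemma rV2_add_eq0 v w : (v + w == 0) = (v == w).
Proof.
apply/eqP/eqP => [e|->]; last exact: rV2_addvv.
by rewrite -[v](rV2_addK _ w) e add0r.
Qed.

Lemma cardV : #|[set: V]| = 8%N.
Proof. by rewrite cardsT card_mx card_Fp. Qed.

Lemma cardV1 : #|[set~ (0 : V)]| = 7%N.
Proof. by have := cardsC1 (0 : V); rewrite -cardsT cardV. Qed.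

Definition rows3 u v w : 'M['F_2]_3 := \matrix_(i < 3) tnth [tuple u; v; w] i.

(** Over the field of two elements the seven conditions say that the seven nontrivial combinations
    of [u], [v], [w] do not vanish, which is linear independence. *)
Definition indep3 u v w :=
  [&& u != 0, v != 0, u != v, w != 0, w != u, w != v & w != u + v].

Lemma mul_rows3 (a : V) u v w :
  a *m rows3 u v w = a 0 ord0 *: u + a 0 (lift ord0 ord0) *: v + a 0 (lift ord0 (lift ord0 ord0)) *: w.
Proof.
by rewrite mulmx_sum_row !big_ord_recl big_ord0 !rowK addr0 !(tnth_nth 0) /= addrA.
Qed.

Lemma span3_eq0 u v w (a b c : 'F_2) : indep3 u v w ->
  a *: u + b *: v + c *: w = 0 -> [/\ a = 0, b = 0 & c = 0].
Proof.
case/and5P=> /negPf u0 /negPf v0 /negPf uv /negPf w0 /and3P[].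
rewrite eq_sym => /negPf wu; rewrite eq_sym => /negPf wv; rewrite eq_sym => /negPf wuv.
case: (F2P a) => ->; case: (F2P b) => ->; case: (F2P c) => ->.
all: rewrite ?scale1r ?scale0r ?add0r ?addr0 => /eqP.
all: by rewrite ?rV2_add_eq0 ?u0 ?v0 ?w0 ?uv ?wu ?wv ?wuv.
Qed.

Lemma rows3_unit u v w : indep3 u v w -> rows3 u v w \in unitmx.
Proof.
move=> ind; rewrite -row_free_unit -kermx_eq0; apply/rowV0P => a /sub_kermxP.
rewrite mul_rows3 => /(span3_eq0 ind)[a0 a1 a2].
apply/rowP => -[[|[|[|//]]] h]; rewrite mxE -[RHS]/(0 : 'F_2).
- by rewrite -[RHS]a0; congr (a _ _); apply: val_inj.
- by rewrite -[RHS]a1; congr (a _ _); apply: val_inj.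
- by rewrite -[RHS]a2; congr (a _ _); apply: val_inj.
Qed.

Lemma span3 u v w x : indep3 u v w ->
  exists a b c : 'F_2, x = a *: u + b *: v + c *: w.
Proof.
move=> /rows3_unit un; pose a := x *m invmx (rows3 u v w).
exists (a 0 ord0), (a 0 (lift ord0 ord0)), (a 0 (lift ord0 (lift ord0 ord0))).
by rewrite -mul_rows3 mulmxKV.
Qed.

Lemma extend_indep u v : u != 0 -> v != 0 -> u != v -> exists w, indep3 u v w.
Proof.
move=> u0 v0 uv.
have : ~~ ([set: V] \subset [set 0; u; v; u + v]).
  apply/negP => /subset_leq_card; rewrite cardV -!setUA !cardsU1 cards1.
  by do 3!case: (_ \notin _).
case/subsetPn=> w _; rewrite !inE !negb_or -!andbA => /and4P[w0 wu wv wuv].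
by exists w; rewrite /indep3 u0 v0 uv w0 wu wv.
Qed.

Lemma row_rows3 u v w (M : 'M['F_2]_3) u' v' w' :
  rows3 u v w *m M = rows3 u' v' w' -> [/\ u *m M = u', v *m M = v' & w *m M = w'].
Proof.
move=> e; have r i : tnth [tuple u; v; w] i *m M = tnth [tuple u'; v'; w'] i.
  by have := congr1 (row i) e; rewrite row_mul !rowK.
split; [exact: (r ord0) | exact: (r (Ordinal (isT : (1 < 3)%N))) | exact: (r (Ordinal (isT : (2 < 3)%N)))].
Qed.

Definition toGL (M : 'M['F_2]_3) (uM : M \in unitmx) : gG := FinRing.Unit uM.

Lemma toGLE (M : 'M['F_2]_3) (uM : M \in unitmx) : GLval (toGL uM) = M.
Proof. by []. Qed.

Lemma GL_ext g h : (forall v, v *m GLval g = v *m GLval h) -> g = h.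
Proof.
move=> e; apply: val_inj; apply/row_matrixP => i.
by have := e (delta_mx 0 i); rewrite -!rowE.
Qed.

Lemma GL_basis_eq g h u v w : indep3 u v w -> u *m GLval g = u *m GLval h ->
  v *m GLval g = v *m GLval h -> w *m GLval g = w *m GLval h -> g = h.
Proof.
move=> ind eu ev ew; apply: GL_ext => x.
by have [a [b [c ->]]] := span3 x ind; rewrite !mulmxDl -!scalemxAl eu ev ew.
Qed.

Lemma GL_transitive3 u v w u' v' w' : indep3 u v w -> indep3 u' v' w' ->
  exists g, [/\ u *m GLval g = u', v *m GLval g = v' & w *m GLval g = w'].
Proof.
move=> /rows3_unit un /rows3_unit un'.
have uM : invmx (rows3 u v w) *m rows3 u' v' w' \in unitmx.
  by rewrite unitmx_mul unitmx_inv un.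
have gE := toGLE uM; set g := toGL uM in gE; clearbody g; exists g; rewrite gE.
by apply: row_rows3; apply: (mulKVmx un).
Qed.

Lemma GL_transitive2 u v u' v' : u != 0 -> v != 0 -> u != v ->
  u' != 0 -> v' != 0 -> u' != v' ->
  exists g, u *m GLval g = u' /\ v *m GLval g = v'.
Proof.
move=> u0 v0 uv u0' v0' uv'.
have [w i] := extend_indep u0 v0 uv; have [w' i'] := extend_indep u0' v0' uv'.
by have [g [e1 e2 _]] := GL_transitive3 i i'; exists g.
Qed.

Lemma GLK g v : v *m GLval g *m GLval g^-1%g = v.
Proof.
by rewrite GL_VxE mulmxK ?GL_unitmx.
Qed.

Lemma GLKV g v : v *m GLval g^-1%g *m GLval g = v.
Proof.
by rewrite GL_VxE mulmxKV ?GL_unitmx.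
Qed.

Lemma GL_inj g u v : u *m GLval g = v *m GLval g -> u = v.
Proof. by move/(congr1 (mulmx^~ (invmx (GLval g)))); rewrite !mulmxK ?GL_unitmx. Qed.

Lemma GL_eq0 g v : (v *m GLval g == 0) = (v == 0).
Proof.
apply/eqP/eqP => [e|->]; last exact: mul0mx.
by apply: (@GL_inj g); rewrite e mul0mx.
Qed.

Lemma other_vector u : exists v, [/\ v != 0 & u != v].
Proof.
have : ~~ ([set: V] \subset [set 0; u]).
  by apply/negP => /subset_leq_card; rewrite cardV cards2; case: (_ != _).
by case/subsetPn=> w _; rewrite !inE negb_or eq_sym [w == u]eq_sym => /andP[? ?]; exists w; rewrite eq_sym.
Qed.

Lemma GL_transitive1 u v : u != 0 -> v != 0 -> exists g, u *m GLval g = v.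
Proof.
move=> u0 v0; have [u' [u1 uu]] := other_vector u; have [v' [v1 vv]] := other_vector v.
by have [g [e _]] := GL_transitive2 u0 u1 uu v0 v1 vv; exists g.
Qed.

Lemma card_GL32 : #|[set: gG]| = 168%N.
Proof.
have := @card_GL 'F_2 3 isT; rewrite card_Fp // => ->.
by do 3!rewrite big_ltn //; rewrite big_geq.
Qed.

Definition vact v g : V := v *m GLval g.

Fact vact_is_action : is_action setT vact.
Proof.
by apply: is_total_action => [v|v g h]; rewrite /vact ?GL_1E ?mulmx1 // GL_MxE mulmxA.
Qed.

Canonical vaction := Action vact_is_action.

Lemma SL32_full : SL 3 2 = [set: gG].
Proof.
apply/setP => g; rewrite !inE; have := GL_det g.
by have [->|->] := F2P (\det (GLval g)).
Qed.

(** If a central [z] moved [v], some [g] would fix [v] and move [v z] to a third vector, and could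
    not commute with [z]. *)
Lemma center_GL32 : 'Z([set: gG])%g = 1%g.
Proof.
apply/eqP; rewrite eqEsubset sub1G andbT; apply/subsetP => z /setIP[_ /centP zC].
rewrite inE; apply/eqP/GL_ext => v; rewrite GL_1E mulmx1.
have [->|v0] := eqVneq v 0; first by rewrite mul0mx.
have [//|nzv] := eqVneq (v *m GLval z) v; rewrite eq_sym in nzv.
have z0 : v *m GLval z != 0 by rewrite GL_eq0.
have [w /and5P[_ _ _ w0 /and3P[wv wz _]]] := extend_indep v0 z0 nzv.
rewrite eq_sym in wv; have [g [gv gz]] := GL_transitive2 v0 z0 nzv v0 w0 wv.
have : GLval (z * g)%g = GLval (g * z)%g by rewrite (zC g (in_setT _)).
rewrite !GL_MxE => /(congr1 (mulmx v)); rewrite !mulmxA gz gv => e.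
by rewrite e eqxx in wz.
Qed.

Lemma PSL32_isog : PSL 3 2 \isog [set: gG]%g.
Proof. by rewrite /PSL SL32_full center_GL32 isog_sym quotient1_isog. Qed.

(** * Subgroups of GL(3,2) that are 2-transitive on nonzero vectors *)

Section TwoTransitiveSubgroup.
Variable K : {group gG}.
Hypothesis K2 : forall u v u' v', u != 0 -> v != 0 -> u != v ->
  u' != 0 -> v' != 0 -> u' != v' ->
  exists2 g, g \in K & u *m GLval g = u' /\ v *m GLval g = v'.

Lemma nonzero_vector : exists v : V, v != 0.
Proof.
by exists (delta_mx 0 0); apply/eqP => /rowP/(_ 0); rewrite !mxE !eqxx.
Qed.

(** An element of [K] exchanging two vectors has even order, since an odd power of it still moves
    the first vector to the second; Cauchy's theorem applies. *)
Lemma exists_involution : exists2 t, t \in K & t != 1%g /\ (t * t = 1)%g.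
Proof.
have [u u0] := nonzero_vector; have [v [v0 uv]] := other_vector u.
have vu : v != u by rewrite eq_sym.
have [k kK [k1 k2]] := K2 u0 v0 uv v0 u0 vu.
have /(Cauchy (isT : prime 2))[t tK ot] : (2 %| #|K|)%N.
  apply: (@dvdn_trans #[k]%g); last exact: order_dvdG.
  rewrite dvdn2; apply/negP => odk.
  have even j : u *m GLval (k ^+ j.*2)%g = u.
    elim: j => [|j IH]; first by rewrite GL_1E mulmx1.
    by rewrite doubleS !expgSr !GL_MxE !mulmxA IH k1.
  have : u *m GLval (k ^+ #[k])%g = v.
    by rewrite -(odd_double_half #[k]%g) odk add1n expgSr GL_MxE mulmxA even.
  by rewrite expg_order GL_1E mulmx1 => e; rewrite e eqxx in uv.
exists t => //; split; first by rewrite -order_gt1 ot.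
by rewrite -[X in _ = X](expg_order t) ot.
Qed.

(** In characteristic 2 an involution [t] makes [N = t - 1] square to zero, so [N] has a kernel of
    dimension at least 2. Take [c = r N] nonzero and [p] in the kernel off the line of [c]. *)
Lemma exists_transvection : exists t c p r, [/\ t \in K, indep3 c p r &
  [/\ c *m GLval t = c, p *m GLval t = p & r *m GLval t = r + c]].
Proof.
have [t tK [t1 tt]] := exists_involution.
have ttv v : v *m GLval t *m GLval t = v.
  have e : GLval (t * t)%g = (1%:M : 'M['F_2]_3) by rewrite tt.
  by rewrite -mulmxA [X in _ *m X]e mulmx1.
pose N := GLval t - 1%:M : 'M['F_2]_3.
have NE v : v *m N = v *m GLval t + v.
  rewrite mulmxBr mulmx1; congr (_ + _).
  by apply/rowP => i; rewrite !mxE oppr_pchar2.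
have NN : N *m N = 0.
  apply/row_matrixP => i; rewrite row0 rowE mulmxA !NE mulmxDl ttv.
  by rewrite [X in X + _]addrC rV2_addvv.
have /rowV0Pn[_ /submxP[r ->] c0] : N != 0.
  apply: contraNneq t1 => N0; apply/eqP/GL_ext => v.
  apply/eqP; rewrite GL_1E mulmx1 -rV2_add_eq0 -NE N0 mulmx0 //.
pose c := r *m N.
have cN : c *m N = 0 by rewrite -mulmxA NN mulmx0.
have rk : (2 <= \rank (kermx N))%N.
  have := mulmx0_rank_max NN; rewrite mxrank_ker; lia.
have : ~~ (kermx N <= c)%MS.
  by apply/negP => /mxrankS; have := rank_leq_row c; lia.
case/row_subPn=> i; set p := row i _ => pc.
have pN : p *m N = 0 by apply/sub_kermxP; apply: row_sub.
have p0 : p != 0 by apply: contraNneq pc => ->; apply: sub0mx.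
have npc : c != p by apply: contraNneq pc => <-; apply: submx_refl.
exists t, c, p, r; split=> //.
  rewrite /indep3 c0 p0 npc /=; apply/and4P; split; apply: contraNneq c0.
  - by move=> ->; rewrite mul0mx.
  - by move=> rc; rewrite [X in X *m _]rc cN.
  - by move=> ->; rewrite pN.
  - by move=> rc; rewrite [X in X *m _]rc mulmxDl cN pN addr0.
split.
- by apply/eqP; rewrite -rV2_add_eq0 -NE cN.
- by apply/eqP; rewrite -rV2_add_eq0 -NE pN.
- by rewrite addrC /c NE rV2_addK.
Qed.

(** Given [g], some [k] in [K] agrees with it on [c] and [p]. The images [z] and [z1] of [r] then
    differ by a vector [d] of the plane spanned by [x] and [y], and a conjugate of the transvection
    fixing that plane and adding [d] corrects the difference. *)
Lemma two_transitive_GL : K :=: [set: gG]%g.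
Proof.
have [t [c [p [r [tK ind [tc tp tr]]]]]] := exists_transvection.
have /and5P[c0 p0 cp r0 /and3P[rc rp rcp]] := ind.
apply/eqP; rewrite eqEsubset subsetT /=; apply/subsetP => g _.
have nz v : v != 0 -> v *m GLval g != 0 by rewrite GL_eq0.
have ninj (h : gG) u v : u != v -> u *m GLval h != v *m GLval h.
  by apply: contraNneq => /GL_inj ->.
set x := c *m GLval g; set y := p *m GLval g.
have [k kK [kc kp]] := K2 c0 p0 cp (nz _ c0) (nz _ p0) (ninj g _ _ cp).
have indz (h : gG) : c *m GLval h = x -> p *m GLval h = y -> indep3 x y (r *m GLval h).
  move=> hc hp; rewrite /indep3 -hc -hp !GL_eq0 c0 p0 r0 -mulmxDl.
  by rewrite !ninj.
have indk := indz _ kc kp; have indg := indz g erefl erefl.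
set z := r *m GLval g in indg *; set z1 := r *m GLval k in indk *.
(* The transvection is conjugated by an [h] in [K] taking [(c, p)] to [(d, p')]; it then fixes the
   plane of [d] and [p'] and adds [d] to vectors outside it. *)
have trans (d p' : V) : d != 0 -> p' != 0 -> d != p' -> x \in [:: d; p'; d + p'] ->
   y \in [:: d; p'; d + p'] -> indep3 d p' z1 -> exists2 h, h \in K &
   [/\ x *m GLval h = x, y *m GLval h = y & z1 *m GLval h = z1 + d].
  move=> d0 p'0 dp' xs ys ind'; have [h hK [hc hp]] := K2 c0 p0 cp d0 p'0 dp'.
  have hVc : d *m GLval h^-1%g = c by rewrite -hc GLK.
  have hVp : p' *m GLval h^-1%g = p by rewrite -hp GLK.
  have tE v : v *m GLval (t ^ h)%g = v *m GLval h^-1%g *m GLval t *m GLval h.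
    by rewrite conjgE !GL_MxE !mulmxA.
  have fd : d *m GLval (t ^ h)%g = d by rewrite tE hVc tc hc.
  have fp : p' *m GLval (t ^ h)%g = p' by rewrite tE hVp tp hp.
  have fs v : v \in [:: d; p'; d + p'] -> v *m GLval (t ^ h)%g = v.
    by rewrite !inE => /or3P[]/eqP ->; rewrite ?mulmxDl ?fd ?fp.
  exists (t ^ h)%g; first by rewrite groupJ.
  rewrite (fs _ xs) (fs _ ys); split=> //.
  have /and5P[_ _ _ _ /and3P[zd zp zdp]] := ind'.
  have [al [be [ga e]]] := span3 (z1 *m GLval h^-1%g) ind.
  have z1E : z1 = al *: d + be *: p' + ga *: (r *m GLval h).
    by rewrite -hc -hp !scalemxAl -!mulmxDl -e GLKV.
  have ga1 : ga = 1.
    case: (F2P ga) => // ga0; move: zd zp zdp z1E; rewrite ga0 scale0r addr0.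
    have z10 : z1 != 0 by rewrite GL_eq0.
    by case: (F2P al) => ->; case: (F2P be) => ->;
      rewrite ?scale0r ?scale1r ?add0r ?addr0 => zd zp zdp e1;
      move: zd zp zdp z10; rewrite e1 eqxx.
  by rewrite tE e !mulmxDl -!scalemxAl tc tp tr ga1 !scale1r mulmxDl hc hp z1E ga1 scale1r addrA.
(* The four possible differences [z - z1] are 0, [y], [x] and [x + y]. *)
have zz : exists2 h, h \in K &
   [/\ x *m GLval h = x, y *m GLval h = y & z1 *m GLval h = z].
  have [al [be [ga e]]] := span3 z indk.
  have /and5P[x0 y0 xy z0 /and3P[zx zy zxy]] := indg.
  have ga1 : ga = 1.
    case: (F2P ga) => // ga0; move: zx zy zxy z0; rewrite e ga0 scale0r addr0.
    by case: (F2P al) => ->; case: (F2P be) => ->;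
      rewrite ?scale0r ?scale1r ?add0r ?addr0 ?eqxx.
  have /and5P[_ _ _ z10 /and3P[zx1 zy1 zxy1]] := indk.
  have xy0 : x + y != 0 by rewrite rV2_add_eq0.
  rewrite ga1 scale1r in e.
  case: (F2P al) e => ->; case: (F2P be) => ->; rewrite ?scale0r ?scale1r ?add0r ?addr0 => ->.
  - by exists 1%g; rewrite ?group1 // GL_1E !mulmx1.
  - have yx : y != x by rewrite eq_sym.
    have [|||h hK hE] := trans y x y0 x0 yx.
    + by rewrite !inE eqxx orbT.
    + by rewrite !inE eqxx.
    + by rewrite /indep3 x0 y0 eq_sym xy z10 zx1 zy1 addrC.
    + by exists h; rewrite // [y + z1]addrC.
  - have [|||h hK hE] := trans x y x0 y0 xy.
    + by rewrite !inE eqxx.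
    + by rewrite !inE eqxx orbT.
    + exact: indk.
    + by exists h; rewrite // [x + z1]addrC.
  - have xyx : x + y != x by rewrite -{2}[x]addr0 (inj_eq (addrI x)).
    have eyy : x + y + x = y by rewrite addrC addrA rV2_addvv add0r.
    have [|||h hK hE] := trans (x + y) x xy0 x0 xyx.
    + by rewrite !inE eqxx orbT.
    + by rewrite !inE eyy eqxx !orbT.
    + by rewrite /indep3 x0 xy0 xyx z10 zx1 zxy1 eyy zy1.
    + by exists h; rewrite // [x + y + z1]addrC.
have [h hK [hx hy hz]] := zz.
suff -> : g = (k * h)%g by rewrite groupM.
by apply: (GL_basis_eq ind); rewrite GL_MxE mulmxA ?kc ?kp ?hx ?hy ?hz.
Qed.

End TwoTransitiveSubgroup.

End GL3.

Lemma normal_astab (aT : finGroupType) (T : finType) (to : {action aT &-> T})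
    (H : {group aT}) (S : {set T}) : [acts H, on S | to] -> 'C_H(S | to) <| H.
Proof.
move=> HS; rewrite /normal subsetIl normsI ?normG //.
exact: subset_trans HS (astab_norm _ _).
Qed.

(** * Transitive actions of PSL(3,2) on seven points *)

Section SevenPoints.
Import GRing.Theory.
Local Open Scope ring_scope.
Local Notation V := 'rV['F_2]_3.
Local Notation gG := {'GL_3(2)}.
Implicit Types (u v w : V) (g h : gG).

Lemma quotient_morphism (aT rT : finGroupType) (H K : {group aT}) (G : {group rT}) :
  (K <| H)%g -> (H / K \isog G)%g ->
  exists f : {morphism H >-> rT}, 'ker f = K :> {set aT} /\ (f @* H)%g = G.
Proof.
move=> nKH /isogP[f fi fG]; have nK := subsetP (normal_norm nKH).
have rM : {in H &, {morph (fun a => f (coset K a)) : a b / (a * b)%g}}.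
  move=> a b aH bH /=; rewrite (morphM _ (nK _ aH) (nK _ bH)) morphM //.
    exact: mem_quotient.
  exact: mem_quotient.
have cH a : a \in H -> coset K a \in (H / K)%g by apply: mem_quotient.
exists (Morphism rM); split; apply/setP => x.
  apply/idP/idP => [xk|xK].
    have xH := dom_ker xk; have := mker xk => /= e.
    have : coset K x = 1%g.
      by apply: (injmP fi); rewrite ?group1 ?cH // morph1.
    by move/coset_idr; apply; apply: nK.
  have xH := subsetP (normal_sub nKH) _ xK.
  by apply/kerP => //=; rewrite coset_id // morph1.
rewrite -fG; apply/morphimP/morphimP => [[a _ aH ->]|[y _ /morphimP[a _ aH ->] ->]].
  by exists (coset K a); rewrite ?cH.
by exists a.
Qed.

Lemma itr_unit g : (GLval g^-1%g)^T \in unitmx.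
Proof. by rewrite unitmx_tr; apply: GL_unitmx. Qed.

(** The inverse transpose, an involutory automorphism exchanging the actions on points and on lines
    of the Fano plane. *)
Definition itr g : gG := toGL (itr_unit g).

Lemma itrM g h : itr (g * h)%g = (itr g * itr h)%g.
Proof.
apply: val_inj; rewrite [LHS]toGLE.
transitivity ((GLval g^-1%g)^T *m (GLval h^-1%g)^T); last by [].
by rewrite -trmx_mul invMg.
Qed.

Lemma itrK g : itr (itr g) = g.
Proof.
have e : itr (itr g) = (itr (itr g)^-1^-1)%g by rewrite invgK.
apply: val_inj; rewrite [LHS]toGLE.
have -> : ((itr g)^-1)%g = itr g^-1%g.
  have i1 : itr 1%g = 1%g by apply: val_inj; rewrite [LHS]toGLE invg1 trmx1.
  by apply: (mulIg (itr g)); rewrite mulVg -itrM mulVg i1.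
by rewrite toGLE invgK trmxK.
Qed.

Lemma itrE g v : v *m GLval (itr g) = v *m (GLval g^-1%g)^T.
Proof. by rewrite toGLE. Qed.

Section FixedVector.
Variable M : {group gG}.
Hypothesis cM : #|M| = 24%N.

Lemma vorbit_dvd v : (#|orbit vaction M v| %| 24)%N.
Proof. by rewrite -cM card_orbit dvdn_indexg. Qed.

(** The sum over an orbit is a fixed vector, which in the absence of nonzero fixed vectors makes
    every orbit sum vanish. *)
Lemma vorbit_sum v g : g \in M ->
  (\sum_(w in orbit vaction M v) w) *m GLval g = \sum_(w in orbit vaction M v) w.
Proof.
move=> gM; rewrite mulmx_suml.
rewrite [RHS](reindex_inj (act_inj vaction g)) /=.
by apply: eq_bigl => w; rewrite orbit_actr.
Qed.

(** Suppose there is no nonzero fixed vector. Orbit sizes divide 24 and are at most 7; size 2 is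
    excluded by the zero sum, and size 6 would leave a fixed vector. An orbit of size 4 leaves three
    vectors forming another orbit, so there is an orbit of size 3, and its zero sum makes it a line
    [u], [v], [u + v]. *)
Lemma fixed_or_triple : (exists2 v : V, v != 0 & forall g, g \in M -> v *m GLval g = v) \/
  (exists u v : V, [/\ u != 0, v != 0, u != v &
     forall (g : gG) (w : V), g \in M -> w \in [set u; v; u + v] -> w *m GLval g \in [set u; v; u + v]]).
Proof.
case: (boolP [exists v : V, (v != 0) && [forall g in M, v *m GLval g == v]]).
  by case/existsP=> v /andP[v0 /forall_inP h]; left; exists v => // g /h/eqP.
move=> nofix; right.
have nf v : (forall g, g \in M -> v *m GLval g = v) -> v = 0.
  move=> h; apply/eqP; apply: contraNT nofix => v0; apply/existsP; exists v.
  by rewrite v0; apply/forall_inP => g /h ->.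
pose O v := orbit vaction M v.
have sO v : \sum_(w in O v) w = 0 by apply: nf => g gM; apply: vorbit_sum.
have vO v : v \in O v by apply: orbit_refl.
have stO v g w : g \in M -> w \in O v -> w *m GLval g \in O v.
  by move=> gM; rewrite -[w *m _]/(vaction w g) orbit_actr.
have O0 v : v != 0 -> O v \subset [set~ 0].
  move=> v0; apply/subsetP => _ /orbitP[g _ <-]; rewrite in_setC1.
  by rewrite [vaction v g]/(v *m GLval g) GL_eq0.
have not1 v : v != 0 -> #|O v| != 1%N.
  apply: contraNneq => /eqP/cards1P[w e]; apply/eqP/nf => g gM.
  have := vO v; have := stO v g v gM (vO v).
  by rewrite e !inE => /eqP -> /eqP ->.
have not2 v : #|O v| != 2%N.
  apply/eqP => /eqP/cards2P[a [b [nab e]]].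
  have := sO v; rewrite e (big_setD1 a) ?inE ?eqxx //= setU1K ?inE //.
  by rewrite big_set1 => /eqP; rewrite rV2_add_eq0 (negPf nab).
have three v : #|O v| = 3%N -> v != 0 -> exists u v : V, [/\ u != 0, v != 0, u != v &
   forall (g : gG) (w : V), g \in M -> w \in [set u; v; u + v] -> w *m GLval g \in [set u; v; u + v]].
  move=> c v0; have := cardsD1 v (O v); rewrite c vO add1n => -[]/esym/eqP/cards2P[a [b [nab e]]].
  have eO : O v = v |: [set a; b] by rewrite -e setD1K.
  have [nva nvb] : v \notin [set a; b] /\ True by rewrite -e !inE eqxx.
  have := sO v; rewrite eO big_setU1 //= big_setU1 ?inE //= big_set1 => /eqP.
  rewrite rV2_add_eq0 => /eqP ev.
  have a0 : a != 0.
    by have := subsetP (O0 _ v0) a; rewrite eO !inE eqxx orbT => /(_ isT).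
  have b0 : b != 0.
    by have := subsetP (O0 _ v0) b; rewrite eO !inE eqxx !orbT => /(_ isT).
  exists a, b; split=> // g w gM; have -> : [set a; b; a + b] = O v.
    by rewrite eO ev setUC.
  exact: stO.
have small v : v != 0 -> #|O v| \in [:: 3; 4; 6]%N.
  move=> v0; have := subset_leq_card (O0 _ v0); rewrite cardV1.
  have := vorbit_dvd v; rewrite -/(O v); have := not1 _ v0; have := not2 v.
  have : (0 < #|O v|)%N by apply/card_gt0P; exists v.
  by move: #|O v| => n; do 8?[case: n => [|n] //].
have [v v0] := nonzero_vector.
have := small _ v0; rewrite !inE => /or3P[/eqP c|/eqP c|/eqP c]; first exact: three v0.
- have cD : #|[set~ (0 : V)] :\: O v| = 3%N.
    by rewrite cardsD (setIidPr (O0 _ v0)) cardV1 c.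
  have /card_gt0P[w wD] : (0 < #|[set~ (0%R : V)] :\: O v|)%N by rewrite cD.
  have /setDP[] := wD; rewrite in_setC1 => w0 nw.
  have sub : O w \subset [set~ 0] :\: O v.
    rewrite subsetD O0 // -setI_eq0; apply: contraNT nw.
    move=> /set0Pn[x /setIP[/orbit_eqP e1 /orbit_eqP e2]].
    by rewrite /O -e2 e1; apply: orbit_refl.
  have := subset_leq_card sub; rewrite cD => le3.
  by apply: three (w0); have := small _ w0; rewrite !inE => /or3P[]/eqP e; rewrite e in le3 *.
- have /eqP/cards1P[w ew] : #|[set~ (0 : V)] :\: O v| = 1%N.
    by rewrite cardsD (setIidPr (O0 _ v0)) cardV1 c.
  have : w \in [set~ (0 : V)] :\: O v by rewrite ew inE.
  case/setDP; rewrite in_setC1 => w0 nw.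
  suff wz : w = 0 by rewrite wz eqxx in w0.
  apply: nf => g gM; apply/set1P; rewrite -ew inE in_setC1 GL_eq0 w0 andbT.
  by apply: contra nw => /(stO _ _ _ (groupVr gM)); rewrite GLK.
Qed.

(** An invariant plane is the kernel of one nonzero linear form, which the group must fix; its
    transpose is a vector fixed under [itr]. *)
Lemma fixed_row_or_dual : (exists2 v : V, v != 0 & forall g, g \in M -> v *m GLval g = v) \/
  (exists2 v : V, v != 0 & forall g, g \in M -> v *m GLval (itr g) = v).
Proof.
case: fixed_or_triple => [|[u [v [u0 v0 uv st]]]]; [by left | right].
have [w ind] := extend_indep u0 v0 uv.
pose e3 : 'cV['F_2]_3 := delta_mx ord_max 0.
(* The third coordinate with respect to the basis [u], [v], [w]: it kills the plane of [u] and [v]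
   and is 1 on [w]. *)
pose phi := invmx (rows3 u v w) *m e3.
have Mphi : rows3 u v w *m phi = e3 by apply: mulKVmx; apply: rows3_unit.
have ent (f : 'cV['F_2]_3) : rows3 u v w *m f = \col_i (tnth [tuple u; v; w] i *m f) 0 0.
  by apply/colP => i; rewrite !mxE; apply: eq_bigr => j _; rewrite !mxE.
have uphi : u *m phi = 0.
  apply/rowP => j; rewrite ord1 [RHS]mxE.
  by have := congr1 (fun A : 'cV_3 => A ord0 0) Mphi; rewrite ent !mxE.
have vphi : v *m phi = 0.
  apply/rowP => j; rewrite ord1 [RHS]mxE.
  by have := congr1 (fun A : 'cV_3 => A (lift ord0 ord0) 0) Mphi; rewrite ent !mxE.
have phi0 : phi != 0.
  apply/eqP => z; have := congr1 (fun A : 'cV_3 => A ord_max 0) Mphi.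
  by rewrite z mulmx0 !mxE !eqxx.
have fixphi g : g \in M -> GLval g *m phi = phi.
  move=> gM.
  have kill x : x \in [set u; v; u + v] -> x *m phi = 0.
    by rewrite !inE => /orP[/orP[]|]/eqP ->; rewrite ?mulmxDl ?uphi ?vphi ?addr0.
  have ku : u *m (GLval g *m phi) = 0.
    by rewrite mulmxA kill // st // !inE eqxx.
  have kv : v *m (GLval g *m phi) = 0.
    by rewrite mulmxA kill // st // !inE eqxx orbT.
  have n0 : GLval g *m phi != 0.
    apply: contraNneq phi0 => z; have := congr1 (mulmx (GLval g^-1%g)) z.
    by rewrite mulmx0 GL_VxE mulKmx ?GL_unitmx // => ->.
  have un := rows3_unit ind.
  rewrite -[LHS](mulKmx un) -[RHS](mulKmx un) Mphi; congr (_ *m _).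
  have wn : (w *m (GLval g *m phi)) 0 0 = 1.
    case: (F2P ((w *m (GLval g *m phi)) 0 0)) => // z; case/eqP: n0.
    rewrite -[LHS](mulKmx un) ent (_ : \col_i _ = 0) ?mulmx0 //.
    apply/colP => i; rewrite [LHS]mxE [RHS]mxE; case: i => [[|[|[|//]]] h]; rewrite (tnth_nth 0) /=.
    - by rewrite ku mxE.
    - by rewrite kv mxE.
    - exact: z.
  rewrite ent; apply/colP => i; rewrite [LHS]mxE [RHS]mxE andbT.
  case: i => [[|[|[|//]]] h]; rewrite (tnth_nth 0) /=.
  - by rewrite ku mxE.
  - by rewrite kv mxE.
  - exact: wn.
exists phi^T => [|g gM]; first by rewrite trmx_eq0.
by rewrite itrE -(trmx_mul (GLval g^-1%g) phi) (fixphi _ (groupVr gM)).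
Qed.

End FixedVector.

End SevenPoints.

Section SevenPoints.
Import GRing.Theory.
Local Open Scope ring_scope.
Local Notation V := 'rV['F_2]_3.
Local Notation gG := {'GL_3(2)}.
Implicit Types (u v w : V) (g h : gG).

Section Equivalence.
Variables (aT : finGroupType) (T : finType) (to : {action aT &-> T}).
Variables (H : {group aT}) (S : {set T}).
Hypothesis HS : [acts H, on S | to].
Hypothesis cS : #|S| = 7%N.
Hypothesis tr : forall x y, x \in S -> y \in S -> exists2 a, a \in H & to x a = y.

(** A Fano plane structure on [S] on which [H] induces the full GL(3,2). The function [th] is kept
    bare because it arises both as a morphism and as its composite with [itr]. *)
Definition vector_labelling (e : T -> V) (th : aT -> gG) :=
  [/\ {in S &, injective e}, forall x, x \in S -> e x != 0,
      forall v, v != 0 -> exists2 x, x \in S & e x = v,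
      forall a x, a \in H -> x \in S -> e (to x a) = e x *m GLval (th a)
    & forall g, exists2 a, a \in H & th a = g].

(** The point [to x0 a] is labelled by the image of [v0] under [th a]; this is well defined since
    the stabiliser of [x0] fixes [v0]. Injectivity follows from surjectivity, both sides having
    seven elements. *)
Lemma fixed_labelling (th : aT -> gG) x0 v0 : x0 \in S -> v0 != 0 ->
  {in H &, {morph th : a b / (a * b)%g}} ->
  (forall g, exists2 a, a \in H & th a = g) ->
  (forall a, a \in H -> to x0 a = x0 -> v0 *m GLval (th a) = v0) ->
  exists e, vector_labelling e th.
Proof.
move=> x0S v00 thM ths fix0.
pose e x := v0 *m GLval (th (odflt 1%g [pick a in H | to x0 a == x])).
have th1 : th 1%g = 1%g.
  by apply: (mulgI (th 1%g)); rewrite -thM ?group1 // !mulg1.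
have thV a : a \in H -> th a^-1%g = (th a)^-1%g.
  by move=> aH; apply: (mulIg (th a)); rewrite -thM ?groupV // !mulVg th1.
have eE a : a \in H -> e (to x0 a) = v0 *m GLval (th a).
  move=> aH; rewrite /e; case: pickP => [b /andP[bH /eqP eb]|/(_ a)]; last first.
    by rewrite aH eqxx.
  have := fix0 (b * a^-1)%g; rewrite groupM ?groupV // actM eb actK => /(_ isT erefl).
  rewrite thM ?groupV // thV // GL_MxE mulmxA => h.
  by rewrite -[in RHS]h /= GLKV.
have eS x : x \in S -> exists2 a, a \in H & x = to x0 a.
  by move=> xS; have [a aH <-] := tr x0S xS; exists a.
have esurj v : v != 0 -> exists2 x, x \in S & e x = v.
  move=> v1; have [g <-] := GL_transitive1 v00 v1; have [a aH <-] := ths g.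
  by exists (to x0 a); rewrite ?eE // (acts_act HS).
have e0 x : x \in S -> e x != 0.
  by case/eS=> a aH ->; rewrite eE // GL_eq0.
exists e; split=> //.
- apply/imset_injP; rewrite cS -cardV1; apply/eqP/eq_card => v.
  rewrite in_setC1; apply/imsetP/idP => [[x xS ->]|/esurj[x xS <-]]; first exact: e0.
  by exists x.
- move=> a x aH /eS[b bH ->]; rewrite -actM !eE ?groupM // thM //.
  by rewrite GL_MxE mulmxA.
Qed.

(** The stabiliser of a point has index 7, so its image in GL(3,2) has order 24. By
    [fixed_row_or_dual] it fixes a vector, possibly after passing through [itr]. *)
Lemma PSL_labelling : (H / 'C_H(S | to) \isog PSL 3 2)%g ->
  exists e th, vector_labelling e th.
Proof.
move=> iso; have iso' := isog_trans iso PSL32_isog.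
have nK := normal_astab HS.
have [f [kf fH]] := quotient_morphism nK iso'.
have /card_gt0P[x0 x0S] : (0 < #|S|)%N by rewrite cS.
have fs g : exists2 a, a \in H & f a = g.
  have : g \in (f @* H)%g by rewrite fH inE.
  by case/morphimP=> a _ aH ->; exists a.
pose M := (f @* 'C_H[x0 | to])%g.
have cM : #|M| = 24%N.
  have kS : ('ker f \subset 'C_H[x0 | to])%g.
    rewrite kf; apply/subsetP => a /setIP[aH /astabP ac]; apply/setIP; split=> //.
    by apply/astab1P; apply: ac.
  have L := Lagrange_index (subsetIl H 'C[x0 | to]) kS.
  have c1 : (#|H : 'C_H[x0 | to]| = 7)%N.
    rewrite -card_orbit -cS; apply: eq_card => y; apply/orbitP/idP => [[a aH <-]|yS].
      by rewrite (acts_act HS).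
    by have [a aH <-] := tr x0S yS; exists a.
  have c2 : (#|H : 'ker f| = 168)%N.
    by rewrite -card_GL32 -fH card_morphim setIid.
  have c3 : #|M| = #|'C_H[x0 | to] : 'ker f|.
    by rewrite /M card_morphim (setIidPr (subsetIl _ _)).
  by move: L; rewrite c1 c2 -c3; lia.
case: (fixed_row_or_dual cM) => -[v v0 fv].
  have [|e he] := @fixed_labelling f x0 v x0S v0 (morphM f) fs; last by exists e, f.
  move=> a aH ax; apply: fv; apply: mem_morphim => //.
  by apply/setIP; split=> //; apply/astab1P.
have [|||e he] := @fixed_labelling (itr \o f) x0 v x0S v0; last by exists e, (itr \o f).
- by move=> a b aH bH /=; rewrite morphM // itrM.
- move=> g; have [a aH fa] := fs (itr g); exists a => //=.
  by rewrite fa itrK.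
- move=> a aH ax; apply: fv; apply: mem_morphim => //.
  by apply/setIP; split=> //; apply/astab1P.
Qed.

Lemma labelling_two_trans e th : vector_labelling e th -> two_trans to H S.
Proof.
move=> [ei e0 es eE ths] x y x' y' xS yS xS' yS' nxy nxy'.
have ne (z t : T) : z \in S -> t \in S -> z != t -> e z != e t.
  by move=> zS tS; rewrite (inj_in_eq ei).
have [g [g1 g2]] := GL_transitive2 (e0 _ xS) (e0 _ yS) (ne _ _ xS yS nxy)
  (e0 _ xS') (e0 _ yS') (ne _ _ xS' yS' nxy').
have [a aH ag] := ths g; exists a => //.
by split; apply: ei; rewrite ?(acts_act HS) // eE // ag.
Qed.

End Equivalence.

End SevenPoints.

Local Ltac neq := first [done | rewrite eq_sym; done].

(** * Steiner triple systems on seven points *)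

Section Steiner.
Import GRing.Theory.
Local Open Scope ring_scope.
Local Notation V := 'rV['F_2]_3.
Local Notation gG := {'GL_3(2)}.
Implicit Types (u v w : V) (g h : gG).

Variables (U : finType) (N : {set U}) (f : U -> U -> U).
Hypothesis cN : #|N| = 7%N.
Hypothesis fN : forall x y, x \in N -> y \in N -> x != y -> f x y \in N /\ f x y != x.
Hypothesis fC : forall x y, f x y = f y x.
Hypothesis fK : forall x y, x \in N -> y \in N -> x != y -> f x (f x y) = y.

Definition vec (a b c : 'F_2) : V := \row_j tnth [tuple a; b; c] j.

Lemma vecD a b c a' b' c' : vec a b c + vec a' b' c' = vec (a + a') (b + b') (c + c').
Proof.
by apply/rowP => i; rewrite !mxE; case: i => [[|[|[|//]]] h]; rewrite !(tnth_nth 0).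
Qed.

Lemma F2_11 : 1 + 1 = 0 :> 'F_2.
Proof. exact: val_inj. Qed.

Lemma vec_eq0 a b c : vec a b c = 0 -> [/\ a = 0, b = 0 & c = 0].
Proof.
move=> /rowP e; split.
- by have := e ord0; rewrite !mxE (tnth_nth 0).
- by have := e (Ordinal (isT : (1 < 3)%N)); rewrite !mxE (tnth_nth 0).
- by have := e (Ordinal (isT : (2 < 3)%N)); rewrite !mxE (tnth_nth 0).
Qed.

Definition tri x y z := [/\ f x y = z, f x z = y & f y z = x].

Lemma triI x y z : x \in N -> y \in N -> x != y -> f x y = z -> tri x y z.
Proof.
move=> xN yN xy e; split=> //; rewrite -e; first exact: fK.
by rewrite fC -[f x y]fC fC; apply: fK; rewrite // eq_sym.
Qed.

(** Start from three points [x], [y], [z] not on a line. The four further points [p], [q], [r], [s]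
    produced by [f] are distinct and exhaust [N], and the remaining lines are forced by elimination.
    The system is thus the Fano plane in coordinates. *)
Lemma sts7_labelling : exists e : U -> V,
  [/\ {in N &, injective e}, forall x, x \in N -> e x != 0
    & forall x y, x \in N -> y \in N -> x != y -> e (f x y) = e x + e y].
Proof.
have /card_gt0P[x xN] : (0 < #|N|)%N by rewrite cN.
have [y] : exists y, y \in N :\ x.
  by apply/card_gt0P; have := cardsD1 x N; rewrite cN xN; lia.
rewrite !inE eq_sym => /andP[xy yN].
have [pN px] := fN xN yN xy; set p := f x y in pN px.
have txy : tri x y p by apply: triI.
have py : p != y by rewrite /p fC; case: (fN yN xN); rewrite 1?eq_sym.
have [z] : exists z, z \in N :\: [set x; y; p].
  apply/card_gt0P; rewrite cardsD cN; apply: leq_trans (leq_sub2l _ (_ : _ <= 3)%N) => //.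
  apply: leq_trans (subset_leq_card (subsetIr _ _)) _.
  by rewrite -setUA !cardsU1 cards1; do 2!case: (_ \notin _).
rewrite !inE !negb_or -!andbA => /and4P[zx zy zp zN].
have xz : x != z by rewrite eq_sym.
have yz : y != z by rewrite eq_sym.
have pz : p != z by rewrite eq_sym.
have nn a b c : a \in N -> b \in N -> c \in N -> a != b -> a != c -> b != c ->
    f a b != f a c.
  by move=> aN bN cN' ab ac; apply: contraNneq => e; rewrite -(fK aN bN ab) e fK.
have [qN qx] := fN xN zN xz; set q := f x z in qN qx.
have txz : tri x z q by apply: triI.
have qz : q != z by rewrite /q fC; case: (fN zN xN); rewrite 1?eq_sym.
have qp : q != p by apply: nn; rewrite // eq_sym.
have qy : q != y.
  by case: txy txz => e1 e2 e3 [e4 e5 e6]; apply: contraNneq zp => eq; rewrite -e5 eq e1.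
have [rN ry] := fN yN zN yz; set r := f y z in rN ry.
have tyz : tri y z r by apply: triI.
have rz : r != z by rewrite /r fC; case: (fN zN yN); rewrite 1?eq_sym.
have rx : r != x.
  by case: txy tyz => e1 e2 e3 [e4 e5 e6]; apply: contraNneq zp => eq; rewrite -e5 eq fC e1.
have rp : r != p by rewrite /p [f x y]fC; apply: nn; rewrite // eq_sym.
have rq : r != q by rewrite /q /r ![f _ z]fC; apply: nn; rewrite // eq_sym.
have xr : x != r by rewrite eq_sym.
have [sN sx] := fN xN rN xr; set s := f x r in sN sx.
have txr : tri x r s by apply: triI.
have sr : s != r by rewrite /s fC; case: (fN rN xN); rewrite 1?eq_sym.
have sp : s != p by apply: nn; rewrite // eq_sym.
have sq : s != q by apply: nn; rewrite // eq_sym.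
have sy : s != y.
  by case: txy txr => e1 e2 e3 [e4 e5 e6]; apply: contraNneq rp => eq; rewrite -e5 eq e1.
have sz : s != z.
  by case: txz txr => e1 e2 e3 [e4 e5 e6]; apply: contraNneq rq => eq; rewrite -e5 eq e1.
have all7 c : c \in N -> [|| c == x, c == y, c == z, c == p, c == q, c == r | c == s].
  have un : uniq [:: s; r; q; p; z; y; x].
    rewrite /= !inE !negb_or sr sq sp sz sy sx rq rp rz ry rx qp qz qy qx pz py px.
    by rewrite zy zx eq_sym xy.
  have sub : {subset [:: s; r; q; p; z; y; x] <= enum N}.
    by move=> d; rewrite mem_enum !inE; do 6?[case/orP]; move/eqP => ->.
  have [|_ all] := uniq_min_size un sub; first by rewrite -cardE cN.
  move=> cN'; have : c \in enum N by rewrite mem_enum.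
  by rewrite -all !inE; do 6?[case/orP]; move=> ->; rewrite ?orbT.
have fne a b c : a \in N -> b \in N -> c \in N -> a != b -> a != c -> f a c != b -> f a b != c.
  move=> aN bN cN' ab ac; apply: contraNneq => e; by rewrite -e fK.
(* For this and the next two lines, six of the seven points are excluded as third point because each
   would share a second point with a known line. *)
have tyq : tri y q s.
  have yq : y != q by rewrite eq_sym.
  apply: triI => //; have [h1 h2] := fN yN qN yq; have := all7 _ h1.
  case: txy => x1 x2 x3; case: txz => x4 x5 x6; case: tyz => x7 x8 x9.
  have h3 : f y q != q by rewrite fC; case: (fN qN yN qy).
  have n1 : f y q != x by apply: fne; rewrite ?[f y x]fC ?x1; neq.
  have n2 : f y q != z by apply: fne; rewrite ?x7; neq.
  have n3 : f y q != p by apply: fne; rewrite ?x3; neq.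
  have n4 : f y q != r by apply: fne; rewrite ?x8; neq.
  by rewrite (negPf h2) (negPf h3) (negPf n1) (negPf n2) (negPf n3) (negPf n4) /= => /eqP.
have tzp : tri z p s.
  apply: triI => //; have [h1 h2] := fN zN pN zp; have := all7 _ h1.
  case: txy => x1 x2 x3; case: txz => x4 x5 x6; case: tyz => x7 x8 x9.
  have h3 : f z p != p by rewrite fC; case: (fN pN zN pz).
  have n1 : f z p != x by apply: fne; rewrite ?[f z x]fC ?x4; neq.
  have n2 : f z p != y by apply: fne; rewrite ?[f z y]fC ?x7; neq.
  have n3 : f z p != q by apply: fne; rewrite ?x6; neq.
  have n4 : f z p != r by apply: fne; rewrite ?x9; neq.
  by rewrite (negPf h2) (negPf h3) (negPf n1) (negPf n2) (negPf n3) (negPf n4) /= => /eqP.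
have tpq : tri p q r.
  have pq : p != q by rewrite eq_sym.
  apply: triI => //; have [h1 h2] := fN pN qN pq; have := all7 _ h1.
  case: txy => x1 x2 x3; case: txz => x4 x5 x6; case: tzp => x7 x8 x9.
  have h3 : f p q != q by rewrite fC; case: (fN qN pN qp).
  have n1 : f p q != x by apply: fne; rewrite ?[f p x]fC ?x2; neq.
  have n2 : f p q != y by apply: fne; rewrite ?[f p y]fC ?x3; neq.
  have n3 : f p q != z by apply: fne; rewrite ?[f p z]fC ?x7; neq.
  have n4 : f p q != s by apply: fne; rewrite ?x9; neq.
  by rewrite (negPf h2) (negPf h3) (negPf n1) (negPf n2) (negPf n3) (negPf n4) !orbF /= => /eqP.
(* The coordinates have basis [x], [y], [z]; the label of every other point is the sum along a line
   through it. *)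
pose e c := if c == x then vec 1 0 0 else if c == y then vec 0 1 0 else
  if c == z then vec 0 0 1 else if c == p then vec 1 1 0 else
  if c == q then vec 1 0 1 else if c == r then vec 0 1 1 else vec 1 1 1.
have ex : e x = vec 1 0 0 by rewrite /e eqxx.
have ey : e y = vec 0 1 0 by rewrite /e eq_sym (negPf xy) eqxx.
have ez : e z = vec 0 0 1 by rewrite /e (negPf zx) (negPf zy) eqxx.
have ep : e p = vec 1 1 0 by rewrite /e (negPf px) (negPf py) (negPf pz) eqxx.
have eq : e q = vec 1 0 1 by rewrite /e (negPf qx) (negPf qy) (negPf qz) (negPf qp) eqxx.
have er : e r = vec 0 1 1.
  by rewrite /e (negPf rx) (negPf ry) (negPf rz) (negPf rp) (negPf rq) eqxx.
have es : e s = vec 1 1 1.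
  by rewrite /e (negPf sx) (negPf sy) (negPf sz) (negPf sp) (negPf sq) (negPf sr).
have e0 c : c \in N -> e c != 0.
  move/all7; do 6?[case/orP]; move/eqP => ->;
  by rewrite ?ex ?ey ?ez ?ep ?eq ?er ?es; apply/eqP => /vec_eq0[].
have eD c d : c \in N -> d \in N -> c != d -> e (f c d) = e c + e d.
  case: txy => a1 a2 a3; case: txz => b1 b2 b3; case: tyz => c1 c2 c3; case: txr => d1 d2 d3.
  case: tyq => g1 g2 g3; case: tzp => h1 h2 h3; case: tpq => k1 k2 k3.
  move=> /all7 cc /all7 dd.
  move: cc; do 6?[case/orP]; move/eqP => ->; move: dd; do 6?[case/orP]; move/eqP => ->;
  rewrite ?eqxx // => _;
  first [rewrite (a1,a2,a3,b1,b2,b3,c1,c2,c3,d1,d2,d3,g1,g2,g3,h1,h2,h3,k1,k2,k3)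
   | rewrite fC (a1,a2,a3,b1,b2,b3,c1,c2,c3,d1,d2,d3,g1,g2,g3,h1,h2,h3,k1,k2,k3)];
  by rewrite ?(ex,ey,ez,ep,eq,er,es) ?vecD ?(addr0, add0r, F2_11).
exists e; split=> // c d cN' dN ecd; apply/eqP; apply: contraT => ncd.
have [fcN _] := fN cN' dN ncd.
by have := e0 _ fcN; rewrite eD // ecd rV2_addvv eqxx.
Qed.

End Steiner.

Section SteinerAction.
Import GRing.Theory.
Local Open Scope ring_scope.
Local Notation V := 'rV['F_2]_3.
Local Notation gG := {'GL_3(2)}.
Implicit Types (u v w : V) (g h : gG).

Variables (aT : finGroupType) (U : finType) (to : {action aT &-> U}).
Variables (H : {group aT}) (N : {set U}) (f : U -> U -> U).
Hypothesis HN : [acts H, on N | to].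
Hypothesis cN : #|N| = 7%N.
Hypothesis fN : forall x y, x \in N -> y \in N -> x != y -> f x y \in N /\ f x y != x.
Hypothesis fC : forall x y, f x y = f y x.
Hypothesis fK : forall x y, x \in N -> y \in N -> x != y -> f x (f x y) = y.
Hypothesis fH : forall a x y, a \in H -> x \in N -> y \in N -> x != y ->
  f (to x a) (to y a) = to (f x y) a.
Hypothesis H2 : two_trans to H N.

(** In the coordinates of [sts7_labelling] preserving [f] means being additive, hence linear, and
    [two_transitive_GL] identifies the image. *)
Lemma steiner_two_trans_PSL : (H / 'C_H(N | to) \isog PSL 3 2)%g.
Proof.
have [e [ei e0 eD]] := sts7_labelling cN fN fC fK.
have es v : v != 0 -> exists2 x, x \in N & e x = v.
  move=> v0; suff : v \in e @: N by case/imsetP=> x xN ->; exists x.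
  suff -> : e @: N = [set~ (0 : V)] by rewrite in_setC1.
  apply/eqP; rewrite eqEcard cardV1 card_in_imset // cN leqnn andbT.
  by apply/subsetP => _ /imsetP[x xN ->]; rewrite in_setC1 e0.
have toN a x : a \in H -> x \in N -> to x a \in N by move=> aH; rewrite (acts_act HN).
have [u u0] := nonzero_vector; have [v [v0 uv]] := other_vector u.
have [w ind] := extend_indep u0 v0 uv.
have /and5P[_ _ _ w0 /and3P[wu wv wuv]] := ind.
have [x xN ex] := es u u0; have [y yN ey] := es v v0; have [z zN ez] := es w w0.
have nxy : x != y by apply: contraNneq uv => xy; rewrite -ex -ey xy.
have nzx : z != x by apply: contraNneq wu => xy; rewrite -ex -ez xy.
have nzy : z != y by apply: contraNneq wv => xy; rewrite -ey -ez xy.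
have nzp : z != f x y by apply: contraNneq wuv => xy; rewrite -ez xy eD // ex ey.
have [pN _] := fN xN yN nxy.
(* The matrix is fixed by the images of the basis [x], [y], [z]; the other four points are reached
   by [f], which the action respects. *)
have lin a : a \in H -> exists g, forall t, t \in N -> e (to t a) = e t *m GLval g.
  move=> aH.
  have eDa s t : s \in N -> t \in N -> s != t -> e (to (f s t) a) = e (to s a) + e (to t a).
    by move=> sN tN st; rewrite -fH // eD ?toN // (inj_eq (act_inj to a)).
  have ne s t : s \in N -> t \in N -> s != t -> e (to s a) != e (to t a).
    by move=> sN tN; rewrite (inj_in_eq ei) ?toN // (inj_eq (act_inj to a)).
  have ind' : indep3 (e (to x a)) (e (to y a)) (e (to z a)).
    by rewrite /indep3 !e0 ?toN // -eDa // !ne.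
  have [g [g1 g2 g3]] := GL_transitive3 ind ind'; exists g => t tN.
  have [al [be [ga et]]] := span3 (e t) ind.
  case: (F2P al) et => ->; case: (F2P be) => ->; case: (F2P ga) => ->;
    rewrite ?scale1r ?scale0r ?add0r ?addr0 => et.
  - by have := e0 _ tN; rewrite et eqxx.
  - by rewrite et g3 (ei t z) // ez.
  - by rewrite et g2 (ei t y) // ey.
  - by rewrite et mulmxDl g2 g3 -eDa // 1?eq_sym // (ei t (f y z)) ?eD ?ey ?ez // 1?eq_sym //;
      case: (fN yN zN); rewrite 1?eq_sym.
  - by rewrite et g1 (ei t x) // ex.
  - by rewrite et mulmxDl g1 g3 -eDa // 1?eq_sym // (ei t (f x z)) ?eD ?ex ?ez // 1?eq_sym //;
      case: (fN xN zN); rewrite 1?eq_sym.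
  - by rewrite et mulmxDl g1 g2 -eDa // (ei t (f x y)) ?eD ?ex ?ey.
  - rewrite et !mulmxDl g1 g2 g3 -!eDa // 1?eq_sym //.
    rewrite (ei t (f (f x y) z)) // ?eD ?ex ?ey ?ez // 1?eq_sym //.
    by case: (fN pN zN); rewrite 1?eq_sym.
pose th a : gG := odflt 1%g [pick g : gG | [forall t in N, e (to t a) == e t *m GLval g]].
have thE a t : a \in H -> t \in N -> e (to t a) = e t *m GLval (th a).
  move=> aH tN; rewrite /th; case: pickP => [g /forall_inP/(_ _ tN)/eqP //|].
  have [g hg] := lin _ aH; move=> /(_ g)/negP[]; apply/forall_inP => s sN.
  by apply/eqP/hg.
have GLe g h : (forall t, t \in N -> e t *m GLval g = e t *m GLval h) -> g = h.
  move=> hh; apply: GL_ext => c; have [->|c0] := eqVneq c 0; first by rewrite !mul0mx.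
  by have [t tN <-] := es _ c0; apply: hh.
have thM : {in H &, {morph th : a b / (a * b)%g}}.
  move=> a b aH bH; apply: GLe => t tN.
  by rewrite -thE ?groupM // actM !thE ?toN // GL_MxE mulmxA.
have kth : 'ker (Morphism thM) = 'C_H(N | to).
  apply/setP => a; apply/idP/setIP => [ak|[aH /astabP ac]].
    have aH := dom_ker ak; split=> //; apply/astabP => t tN.
    apply: ei; rewrite ?toN // thE //.
    by have /= -> := mker ak; rewrite GL_1E mulmx1.
  apply/kerP => //=; apply: GLe => t tN.
  by rewrite -thE // ac // GL_1E mulmx1.
have full : (Morphism thM @* H)%g = [set: gG].
  apply: (@two_transitive_GL [group of (Morphism thM @* H)%g]).
  move=> c d c' d' c0 d0 cd c0' d0' cd'.
  have [s sN es1] := es _ c0; have [t tN et1] := es _ d0.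
  have [s' sN' es2] := es _ c0'; have [t' tN' et2] := es _ d0'.
  have st : s != t by apply: contraNneq cd => st; rewrite -es1 -et1 st.
  have st' : s' != t' by apply: contraNneq cd' => st'; rewrite -es2 -et2 st'.
  have [a aH [sa ta]] := H2 sN tN sN' tN' st st'.
  exists (th a); first by apply/morphimP; exists a.
  by rewrite -es1 -et1 -!thE // sa ta.
have := first_isog (Morphism thM); rewrite kth full => iso.
by apply: isog_trans iso _; rewrite isog_sym; apply: PSL32_isog.
Qed.

End SteinerAction.

(** * Graphs on stars and the graphs occurring as quotients *)

Lemma acts_onI (aT : finGroupType) (T : finType) (to : {action aT &-> T})
    (A : {set aT}) (V : {set T}) :
  (forall a x, a \in A -> x \in V -> to x a \in V) -> [acts A, on V | to].
Proof.
by move=> h; apply/subsetP => a aA; rewrite !inE /=; apply/subsetP => x xV; rewrite inE h.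
Qed.

(** A permutation of three points is trivial, a transposition or a 3-cycle, and its cube has a fixed
    point in each case. *)
Lemma cube_fixpoint (U : finType) (phi : U -> U) (O : {set U}) :
  injective phi -> (forall x, x \in O -> phi x \in O) -> #|O| = 3 ->
  exists2 x, x \in O & phi (phi (phi x)) = x.
Proof.
move=> inj st c; have /card_gt0P[x xO] : 0 < #|O| by rewrite c.
have [e1|n1] := eqVneq (phi x) x; first by exists x; rewrite // !e1.
have xO1 := st _ xO; have xO2 := st _ xO1; have xO3 := st _ xO2.
have c1 : #|O :\ x :\ phi x| = 1%N.
  have := cardsD1 x O; have := cardsD1 (phi x) (O :\ x); rewrite !inE xO xO1 n1 c /=; lia.
have /eqP/cards1P[y ey] := c1.
have : y \in O :\ x :\ phi x by rewrite ey inE.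
rewrite !inE => /and3P[ny1 ny yO].
have [e2|n2] := eqVneq (phi (phi x)) x.
  exists y => //; suff e : phi y = y by rewrite !e.
  apply/set1P; rewrite -ey !inE st // andbT (inj_eq inj) ny /=.
  by rewrite -[X in _ != X]e2 (inj_eq inj).
exists x => //; have y2 : phi (phi x) = y.
  by apply/set1P; rewrite -ey !inE xO2 (inj_eq inj) n1 n2.
have [//|n3] := eqVneq (phi (phi (phi x))) x.
have : phi (phi (phi x)) = y.
  by apply/set1P; rewrite -ey !inE xO3 n3 (inj_eq inj) n2.
by rewrite -y2 => /inj/inj e; rewrite e eqxx in n1.
Qed.

(** * The graph on pairs of a vertex and a line at it *)

Section StarGraph.
Variables (aT : finGroupType) (W : finType) (S : graph W).
Variables (X : {group aT}) (to : {action aT &-> W}).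
Variables (b v r : nat) (lin : W -> {set W} -> bool).
Hypothesis HX : acts_on_graph X to S.
Hypothesis conS : connected S.
Hypothesis exV : exists t, t \in vset S.
Hypothesis valS : has_val S b.
Hypothesis b2 : 2 <= b.
Hypothesis trA : forall t s t' s', adj S t s -> adj S t' s' ->
  exists2 a, a \in X & to t a = t' /\ to s a = s'.
Hypothesis linV : forall t L, lin t L -> t \in vset S.
Hypothesis linN : forall t L, lin t L -> L \subset nbr S t.
Hypothesis lin_act : forall a t L, a \in X -> lin t L -> lin (to t a) (to^*%act L a).
Hypothesis lin3 : forall t s, adj S t s -> #|[set L | lin t L & s \in L]| = 3.
Hypothesis lin_tr : forall t s L L', adj S t s -> lin t L -> lin t L' ->
  s \in L -> s \in L' ->
  exists2 a, a \in X & [/\ to t a = t, to s a = s & to^*%act L a = L'].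
Hypothesis lin_v : forall t, t \in vset S -> #|[set L | lin t L]| = v.
Hypothesis v3 : 3 < v.
Hypothesis lin_r : forall t L, lin t L -> #|L| = r.
Hypothesis r0 : 0 < r.
Hypothesis lin_sep : forall t s s', adj S t s -> adj S t s' ->
  (forall L, lin t L -> (s \in L) = (s' \in L)) -> s = s'.
Hypothesis faithX : forall a, a \in X -> {in vset S, forall w, to w a = w} -> a = 1.

Local Notation tS := (to^*)%act.
Local Notation tT := (pair_action tS).
Local Notation T := ({set W} * {set W})%type.

(** The vertex is stored as a singleton so that both components are sets, as [pair_action] applies
    one and the same action to both. *)
Definition lab t L : T := ([set t], L).

Lemma lab_act t L a : tT (lab t L) a = lab (to t a) (tS L a).
Proof. by rewrite /lab /= /pair_act /= /setact imset_set1. Qed.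

Lemma lab_inj t L t' L' : lab t L = lab t' L' -> t = t' /\ L = L'.
Proof. by case=> /set1_inj. Qed.

Lemma lin_adj t L s : lin t L -> s \in L -> adj S t s.
Proof. by move=> /linN/subsetP h /h; rewrite inE. Qed.

Lemma lin_nonempty t L : lin t L -> exists s, s \in L.
Proof. by move=> h; apply/card_gt0P; rewrite (lin_r h). Qed.

Lemma adj_exists t : t \in vset S -> exists s, adj S t s.
Proof.
move=> tV; have /card_gt0P[s] : 0 < #|nbr S t| by rewrite valS //; lia.
by rewrite inE; exists s.
Qed.

Lemma adj_line t s : adj S t s -> exists2 L, lin t L & s \in L.
Proof.
move=> ts; have /card_gt0P[L] : 0 < #|[set L | lin t L & s \in L]| by rewrite lin3.
by rewrite inE => /andP[]; exists L.
Qed.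

(* An element g swapping t and s induces g^2 on the three lines at t through s; some
   line L is fixed by g^6, and g^3 then swaps L with its image. *)
Lemma swapped_pair : exists t s L R h, [/\ h \in X, lin t L, s \in L, lin s R & t \in R] /\
  [/\ to t h = s, to s h = t, tS L h = R & tS R h = L].
Proof.
have [t tV] := exV; have [s ts] := adj_exists tV.
have st : adj S s t by rewrite adj_sym.
have [g gX [gt gs]] := trA ts st.
have [L] : exists2 L, L \in [set L | lin t L & s \in L] &
    tS (tS (tS L (g * g)) (g * g)) (g * g) = L.
  apply: (@cube_fixpoint _ (fun L => tS L (g * g))); last exact: lin3.
    exact: act_inj.
  move=> L; rewrite !inE => /andP[lL sL].
  have := lin_act (groupM gX gX) lL; rewrite actM gt gs => ->.
  have sgg : to s (g * g) = s by rewrite actM gs gt.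
  by rewrite -[X in X \in _]sgg; apply: mem_setact.
rewrite inE => /andP[lL sL] fL.
have e3 : g ^+ 3 = g * g * g by rewrite !expgS expg0 mulg1 mulgA.
have et : to t (g ^+ 3) = s by rewrite e3 !actM gt gs gt.
have es : to s (g ^+ 3) = t by rewrite e3 !actM gs gt gs.
exists t, s, L, (tS L (g ^+ 3)), (g ^+ 3); split; split=> //.
- exact: groupX.
- by rewrite -{1}et; apply: lin_act; rewrite ?groupX.
- by rewrite -es; apply: mem_setact.
- by rewrite -[RHS]fL e3 -!(actM tS) !mulgA.
Qed.

Definition star_vertices : {set T} :=
  [set p : T | [exists t, exists L, lin t L && (p == lab t L)]].

Lemma star_vertexP p : reflect (exists t L, lin t L /\ p = lab t L) (p \in star_vertices).
Proof.
rewrite inE; apply: (iffP existsP) => [[t /existsP[L /andP[h /eqP ->]]]|[t [L [h ->]]]].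
  by exists t, L.
by exists t; apply/existsP; exists L; rewrite h eqxx.
Qed.

Lemma lab_vertex t L : (lab t L \in star_vertices) = lin t L.
Proof.
apply/star_vertexP/idP => [[t' [L' [h /lab_inj[-> ->]]]] //|h].
by exists t, L.
Qed.

Section Base.
Variables (t s : W) (L R : {set W}) (h : aT).
Hypothesis hX : h \in X.
Hypothesis tL : lin t L.
Hypothesis sL : s \in L.
Hypothesis sR : lin s R.
Hypothesis tR : t \in R.
Hypothesis ht : to t h = s.
Hypothesis hs : to s h = t.
Hypothesis hL : tS L h = R.
Hypothesis hR : tS R h = L.

(** Adjacency is the single orbit of one pair of flags; the element [h] exchanging the pair makes
    the orbit symmetric, so no reversed pairs are added by [simple_graph]. *)
Definition star_rel (p q : T) := [exists a in X, (p == tT (lab t L) a) && (q == tT (lab s R) a)].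

Definition star_graph : graph T := simple_graph star_vertices star_rel.

Local Notation G := star_graph.

Let ts : adj S t s := lin_adj tL sL.

Lemma star_adjP p q : reflect
  (exists2 a, a \in X & p = tT (lab t L) a /\ q = tT (lab s R) a) (adj G p q).
Proof.
rewrite simple_adjE; apply: (iffP and4P) => [[_ _ _]|[a aX [-> ->]]].
  case/orP=> /exists_inP[a aX /andP[/eqP e1 /eqP e2]]; first by exists a.
  exists (h * a); first by rewrite groupM.
  by rewrite e1 e2 !lab_act !actM ht hs hL hR.
rewrite !lab_act !lab_vertex !lin_act //; split=> //.
  apply/eqP => /lab_inj[/act_inj e _].
  by move: ts; rewrite e adj_irr.
by apply/orP; left; apply/exists_inP; exists a; rewrite // !lab_act !eqxx.
Qed.

(** The element given by [trA] matches vertices but perhaps not lines; [lin_tr] corrects the line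
    inside the stabiliser of the arc. *)
Lemma star_flag_tr t' L' s' : lin t' L' -> s' \in L' ->
  exists2 a, a \in X & [/\ to t a = t', tS L a = L' & to s a = s'].
Proof.
move=> l' s'L; have t's' := lin_adj l' s'L.
have [a aX [at' as']] := trA ts t's'.
have la : lin t' (tS L a) by rewrite -at'; apply: lin_act.
have sa : s' \in tS L a by rewrite -as'; apply: mem_setact.
have [c cX [ct cs cL]] := lin_tr t's' la l' sa s'L.
by exists (a * c); rewrite ?groupM // (actM tS) !actM at' as'.
Qed.

Lemma star_acts : acts_on_graph X tT G.
Proof.
split.
  apply: acts_onI => a p aX /star_vertexP[t' [L' [l' ->]]].
  by rewrite lab_act [_ \in _]lab_vertex lin_act.
move=> a p q aX; apply/star_adjP/star_adjP => [[c cX [e1 e2]]|[c cX [-> ->]]].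
  exists (c * a^-1); first by rewrite groupM ?groupV.
  by rewrite !actM -e1 -e2 !actK.
by exists (c * a); rewrite ?groupM // !actM.
Qed.

Lemma star_symmetric : symmetric_graph X tT G.
Proof.
split.
  apply/(transitive_vset star_acts); split.
    by exists (lab t L); rewrite [_ \in _]lab_vertex.
  move=> _ _ /star_vertexP[t1 [L1 [l1 ->]]] /star_vertexP[t2 [L2 [l2 ->]]].
  have [s1 s1L] := lin_nonempty l1; have [s2 s2L] := lin_nonempty l2.
  have [a aX [a1 a2 _]] := star_flag_tr l1 s1L.
  have [c cX [c1 c2 _]] := star_flag_tr l2 s2L.
  exists (a^-1 * c); first by rewrite groupM ?groupV.
  by rewrite actM -a1 -a2 -lab_act actK lab_act c1 c2.
apply/(transitive_Arc1 star_acts); split.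
  by exists (lab t L), (lab s R); apply/star_adjP; exists 1; rewrite ?act1.
move=> p q p' q' /star_adjP[a aX [-> ->]] /star_adjP[c cX [-> ->]].
exists (a^-1 * c); first by rewrite groupM ?groupV.
by rewrite !actM !actK.
Qed.

Definition fib t' : {set T} := [set lab t' L' | L' in [set L' | lin t' L']].

Definition fibres : {set {set T}} := [set fib t' | t' in vset S].

Lemma fibP t' p : reflect (exists2 L', lin t' L' & p = lab t' L') (p \in fib t').
Proof.
apply: (iffP imsetP) => [[L' + ->]|[L' l' ->]]; first by rewrite inE; exists L'.
by exists L'; rewrite ?inE.
Qed.

Lemma lab_fib t' t'' L' : (lab t' L' \in fib t'') = (t' == t'') && lin t' L'.
Proof.
apply/fibP/andP => [[L1 l1 /lab_inj[-> ->]]|[/eqP <- l']]; first by rewrite eqxx.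
by exists L'.
Qed.

Lemma card_fib t' : t' \in vset S -> #|fib t'| = v.
Proof. by move=> tV; rewrite card_imset ?lin_v // => L1 L2 /lab_inj[]. Qed.

Lemma fib_nonempty t' : t' \in vset S -> exists2 L', lin t' L' & lab t' L' \in fib t'.
Proof.
move=> /adj_exists[s' /adj_line[L' l' _]]; exists L' => //.
by rewrite lab_fib eqxx.
Qed.

Lemma fib_inj : {in vset S &, injective fib}.
Proof.
move=> t1 t2 /fib_nonempty[L1 l1 h1] _ e.
by move: h1; rewrite e lab_fib => /andP[/eqP].
Qed.

Lemma fib_act t' a : a \in X -> (tT^*)%act (fib t') a = fib (to t' a).
Proof.
move=> aX; rewrite [LHS]setactE; apply/setP => p; apply/imsetP/fibP.
  move=> [_ /fibP[L' l' ->] ->]; exists (tS L' a); first exact: lin_act.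
  exact: lab_act.
move=> [L' l' ->]; exists (lab t' (tS L' a^-1)).
  apply/fibP; exists (tS L' a^-1) => //.
  by rewrite -(actK to a t'); apply: lin_act; rewrite ?groupV.
by rewrite lab_act actKV.
Qed.

Local Notation Q := (quotient_graph G fibres).

Lemma fib_mem t' : t' \in vset S -> fib t' \in fibres.
Proof. exact: imset_f. Qed.

Lemma star_quotient_adj t1 t2 : t1 \in vset S -> t2 \in vset S ->
  adj Q (fib t1) (fib t2) = adj S t1 t2.
Proof.
move=> v1 v2; rewrite simple_adjE !fib_mem //= (inj_in_eq fib_inj) //.
have half t3 t4 : [exists x in fib t3, exists y in fib t4, adj G x y] -> adj S t3 t4.
  case/exists_inP=> _ /fibP[L1 l1 ->] /exists_inP[_ /fibP[L2 l2 ->]] /star_adjP[a aX].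
  rewrite !lab_act => -[/lab_inj[-> _] /lab_inj[-> _]].
  by rewrite (acts_adj HX).
apply/idP/idP => [/andP[_ /orP[/half //|/half]]|a12]; first by rewrite adj_sym.
rewrite (adj_neq a12) /=; apply/orP; left.
have [a aX [<- <-]] := trA ts a12; apply/exists_inP; exists (lab (to t a) (tS L a)).
  by rewrite lab_fib eqxx lin_act.
apply/exists_inP; exists (lab (to s a) (tS R a)); first by rewrite lab_fib eqxx lin_act.
by apply/star_adjP; exists a; rewrite ?lab_act.
Qed.

(** The design on the fibre of [t'] is thus the incidence of the lines at [t'] with its neighbours,
    which gives all the parameters. *)
Lemma star_incidence t' L' s' : lin t' L' -> s' \in vset S ->
  (lab t' L' \in nbrs G (fib s')) = (s' \in L').
Proof.
move=> l' s'V; apply/bigcupP/idP => [[_ /fibP[R' lR ->]]|s'L].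
  rewrite inE => /star_adjP[a aX]; rewrite !lab_act => -[/lab_inj[-> _] /lab_inj[_ ->]].
  exact: mem_setact.
have [a aX [a1 a2 a3]] := star_flag_tr l' s'L.
exists (lab (to s a) (tS R a)); first by rewrite lab_fib a3 eqxx -a3 lin_act.
rewrite inE adj_sym; apply/star_adjP; exists a => //.
by rewrite !lab_act a1 a2.
Qed.

Lemma fibresP B : reflect (exists2 t', t' \in vset S & B = fib t') (B \in fibres).
Proof. exact: imsetP. Qed.

Lemma star_quotient_nbr t' C : t' \in vset S ->
  (C \in nbr Q (fib t')) -> exists2 s', adj S t' s' & C = fib s'.
Proof.
move=> tV; rewrite inE => hh; have /fibresP[s' sV eC] := adj_vset_r hh.
by exists s' => //; move: hh; rewrite eC star_quotient_adj.
Qed.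

Lemma star_quotient_nbrE t' : t' \in vset S -> nbr Q (fib t') = fib @: nbr S t'.
Proof.
move=> tV; apply/setP => C; apply/idP/imsetP => [/(star_quotient_nbr tV)[s' hh ->]|[s']].
  by exists s'; rewrite ?inE.
by rewrite !inE => hh ->; rewrite star_quotient_adj // (adj_vset_r hh).
Qed.

Lemma fib_inj_on (A : {set W}) : A \subset vset S -> {in A &, injective fib}.
Proof. by move=> /subsetP sub x y /sub xV /sub yV; apply: fib_inj. Qed.

Lemma nbr_vset t' : nbr S t' \subset vset S.
Proof. by apply/subsetP => s'; rewrite inE; apply: adj_vset_r. Qed.

Lemma star_nbrs t' s' : adj S t' s' ->
  nbrs G (fib s') :&: fib t' = [set lab t' L' | L' in [set L' | lin t' L' & s' \in L']].
Proof.
move=> a'; have sV := adj_vset_r a'; apply/setP => p; apply/setIP/imsetP.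
  move=> [hh /fibP[L' l' e]]; exists L' => //; rewrite inE l' -(star_incidence l' sV).
  by rewrite -e.
move=> [L' + ->]; rewrite inE => /andP[l' s'L].
by rewrite star_incidence // lab_fib eqxx.
Qed.

Lemma card_star_nbrs t' s' : adj S t' s' -> #|nbrs G (fib s') :&: fib t'| = 3.
Proof.
move=> a'; rewrite star_nbrs // card_imset ?lin3 // => L1 L2 /lab_inj[//].
Qed.

Lemma star_has_k : has_k G fibres 3.
Proof.
move=> _ C /fibresP[t' tV ->] /(star_quotient_nbr tV)[s' a' ->].
exact: card_star_nbrs.
Qed.

Lemma star_has_vbr : has_vbr G fibres v b r.
Proof.
split.
- by move=> _ /fibresP[t' tV ->]; apply: card_fib.
- move=> _ /fibresP[t' tV ->]; rewrite star_quotient_nbrE // card_in_imset ?valS //.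
  exact/fib_inj_on/nbr_vset.
- move=> p /star_vertexP[t' [L' [l' ->]]].
  have sub : L' \subset vset S := subset_trans (linN l') (nbr_vset t').
  rewrite -(lin_r l') -(card_in_imset (fib_inj_on sub)); apply: eq_card => C.
  rewrite inE; apply/andP/imsetP => [[/fibresP[s' sV ->]]|[s' s'L ->]].
    by rewrite star_incidence //; exists s'.
  have sV := subsetP sub _ s'L; split; first exact: fib_mem.
  by rewrite star_incidence.
Qed.

Lemma card_star_vertices B : B \in fibres -> #|B| < #|star_vertices|.
Proof.
move=> /fibresP[t' tV ->].
have [s' a'] := adj_exists tV; have sV := adj_vset_r a'.
apply: proper_card; apply/properP; split.
  by apply/subsetP => _ /fibP[L' l' ->]; rewrite lab_vertex.
have [L' l' _] := fib_nonempty sV; exists (lab s' L'); first by rewrite lab_vertex.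
by rewrite lab_fib eq_sym (negPf (adj_neq a')).
Qed.

Lemma star_Ghat : in_Ghat G X tT fibres.
Proof.
have [w wV] := exV; have [w' ww] := adj_exists wV.
split.
- exact: star_acts.
- exact: star_symmetric.
- apply/and3P; split.
  + apply/eqP/setP => p; apply/bigcupP/idP => [[_ /fibresP[t' tV ->] /fibP[L' l' ->]]|].
      by rewrite [_ \in _]lab_vertex.
    move=> /star_vertexP[t' [L' [l' ->]]]; exists (fib t').
      by apply: fib_mem; apply: linV l'.
    by rewrite lab_fib eqxx.
  + apply/trivIsetP => _ _ /fibresP[t1 v1 ->] /fibresP[t2 v2 ->] n12.
    rewrite -setI_eq0; apply: contraNT n12 => /set0Pn[_ /setIP[/fibP[L' l' ->]]].
    by rewrite lab_fib => /andP[/eqP ->].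
  + apply/fibresP => -[t' tV e]; have [L' _] := fib_nonempty tV.
    by rewrite -e inE.
- apply: acts_onI => a _ aX /fibresP[t' tV ->]; rewrite fib_act // fib_mem //.
  by rewrite (acts_vset HX).
- move=> B BP; rewrite card_star_vertices // andbT.
  by have /fibresP[t' tV ->] := BP; rewrite card_fib //; apply: leq_trans v3.
- move=> _ _ /fibresP[t1 v1 ->] /fibresP[t2 v2 ->].
  have /connectP[p + ->] := conS v1 v2.
  elim: p t1 v1 => [|t3 p IH] t1 v1 //= /andP[a13 p3].
  have aQ : adj Q (fib t1) (fib t3) by rewrite star_quotient_adj // (adj_vset_r a13).
  exact: connect_trans (connect1 aQ) (IH _ (adj_vset_r a13) p3).
- by exists b => //; have [] := star_has_vbr.
- move=> mc; have := mc (fib w) (fib w') (fib_mem wV).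
  rewrite inE star_quotient_adj ?(adj_vset_r ww) // => /(_ ww).
  by rewrite card_star_nbrs // card_fib //; lia.
- apply/subsetP => a /setIP[aX /astabP fa]; rewrite inE; apply/eqP/faithX => // t' tV.
  have [L' l' _] := fib_nonempty tV.
  have := fa (lab t' L'); rewrite [_ \in _]lab_vertex lab_act => /(_ l') /lab_inj[] //.
Qed.

Lemma star_stab t' : t' \in vset S -> 'N_X(fib t' | tT) = 'C_X[t' | to].
Proof.
move=> tV; apply/setP => a; rewrite -astab1_set; apply/setIP/setIP => -[aX /astab1P e];
  split=> //; apply/astab1P.
  by apply: fib_inj; rewrite ?(acts_vset HX) // -fib_act.
by rewrite [LHS]fib_act // e.
Qed.

(** By [lin_sep] a neighbour is known from the lines through it, so fixing all lines fixes all
    neighbours. The group induced on a block is therefore the local group of [S]. *)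
Lemma star_kernel t' : t' \in vset S ->
  'C_X(fib t' | tT) = 'C_('C_X[t' | to])(nbr S t' | to).
Proof.
move=> tV; have [L0 l0 _] := fib_nonempty tV.
apply/setP => a; apply/setIP/setIP => [[aX /astabP fa]|[/setIP[aX /astab1P at'] /astabP fa]].
  have fl L' : lin t' L' -> to t' a = t' /\ tS L' a = L'.
    move=> l'; have := fa (lab t' L'); rewrite lab_fib eqxx l' lab_act => /(_ isT).
    exact: lab_inj.
  have [at' _] := fl _ l0; split; first by apply/setIP; split=> //; apply/astab1P.
  apply/astabP => s'; rewrite inE => a'; apply: (@lin_sep t') => //.
    by rewrite -{1}at' (acts_adj HX).
  move=> L' l'; have [_ eL] := fl _ l'; rewrite -{1}eL.
  by apply/imsetP/idP => [[x xL /act_inj ->] //|s'L]; exists s'.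
split=> //; apply/astabP => _ /fibP[L' l' ->]; rewrite lab_act at'.
congr (lab _ _); rewrite [LHS]setactE.
rewrite (eq_in_imset (_ : {in L', to^~ a =1 id})) ?imset_id // => s' s'L.
by apply: fa; rewrite inE (lin_adj l' s'L).
Qed.

Lemma star_stab_isog t' (gT : finGroupType) (K : {group gT}) : t' \in vset S ->
  local_group X to S t' \isog K -> stab_induced X tT (fib t') \isog K.
Proof.
move=> tV; rewrite /local_group /stab_induced.
by rewrite -(star_kernel tV) -(star_stab tV).
Qed.

Lemma star_giso : exists f : {set T} -> W, is_giso Q S f /\
  forall t', t' \in vset S -> f (fib t') = t'.
Proof.
have [w wV] := exV.
pose f B := odflt w [pick t' in vset S | fib t' == B].
have fE t' : t' \in vset S -> f (fib t') = t'.
  move=> tV; rewrite /f; case: pickP => [t1 /andP[v1 /eqP e]|/(_ t')].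
    exact: fib_inj.
  by rewrite tV eqxx.
exists f; split=> //; split.
- by move=> _ _ /fibresP[t1 v1 ->] /fibresP[t2 v2 ->]; rewrite !fE // => ->.
- apply/setP => t'; apply/imsetP/idP => [[_ /fibresP[t1 v1 ->] ->]|tV]; rewrite ?fE //.
  by exists (fib t'); rewrite ?fE ?fib_mem.
- by move=> _ _ /fibresP[t1 v1 ->] /fibresP[t2 v2 ->]; rewrite !fE // star_quotient_adj.
Qed.

End Base.
End StarGraph.

(** The composite of [f] with the projection modulo [K'] has kernel exactly [K] on [A]; this allows
    [f] itself to have a kernel, as it has when [X] is not faithful. *)
Lemma quotient_image_isog (aT rT : finGroupType) (X A K : {group aT})
    (A' K' : {group rT}) (f : {morphism X >-> rT}) :
  A \subset X -> f @* A = A' -> K' <| A' -> K \subset A ->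
  (forall a, a \in A -> (f a \in K') = (a \in K)) -> A / K \isog A' / K'.
Proof.
move=> sAX fA nK sKA fK; have nK' := subsetP (normal_norm nK).
have XA a : a \in A -> a \in X by apply: subsetP.
have fA' a : a \in A -> f a \in A' by move=> aA; rewrite -fA mem_morphim ?XA.
have fN a : a \in A -> f a \in 'N(K') by move=> /fA' /nK'.
have rM : {in A &, {morph (fun a => coset K' (f a)) : a b / a * b}}.
  move=> a b aA bA /=; rewrite (morphM f (XA _ aA) (XA _ bA)).
  by rewrite (morphM _ (fN _ aA) (fN _ bA)).
have kM : 'ker (Morphism rM) = K.
  apply/setP => a; apply/idP/idP => [ak|aK].
    have aA := dom_ker ak; rewrite -fK //.
    by apply: coset_idr (mker ak); apply: fN.
  have aA := subsetP sKA _ aK; apply/kerP => //=.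
  by apply: coset_id; rewrite fK.
have iM : Morphism rM @* A = A' / K'.
  apply/setP => y; apply/morphimP/morphimP => [[a _ aA ->]|[z zN]].
    by exists (f a); rewrite ?fA' // fN.
  by rewrite -fA => /morphimP[a _ aA ->] ->; exists a.
by rewrite -kM -iM; apply: first_isog.
Qed.

Section Occurrence.
Variables (aT : finGroupType) (W : finType) (S : graph W).
Variables (X : {group aT}) (to : {action aT &-> W}).
Variables (b v r : nat) (lin : W -> {set W} -> bool).
Hypothesis HX : acts_on_graph X to S.
Hypothesis conS : connected S.
Hypothesis exV : exists t, t \in vset S.
Hypothesis valS : has_val S b.
Hypothesis b2 : 2 <= b.
Hypothesis trA : forall t s t' s', adj S t s -> adj S t' s' ->
  exists2 a, a \in X & to t a = t' /\ to s a = s'.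
Hypothesis linV : forall t L, lin t L -> t \in vset S.
Hypothesis linN : forall t L, lin t L -> L \subset nbr S t.
Hypothesis lin_act : forall a t L, a \in X -> lin t L -> lin (to t a) (to^*%act L a).
Hypothesis lin3 : forall t s, adj S t s -> #|[set L | lin t L & s \in L]| = 3.
Hypothesis lin_tr : forall t s L L', adj S t s -> lin t L -> lin t L' ->
  s \in L -> s \in L' ->
  exists2 a, a \in X & [/\ to t a = t, to s a = s & to^*%act L a = L'].
Hypothesis lin_v : forall t, t \in vset S -> #|[set L | lin t L]| = v.
Hypothesis v3 : 3 < v.
Hypothesis lin_r : forall t L, lin t L -> #|L| = r.
Hypothesis r0 : 0 < r.
Hypothesis lin_sep : forall t s s', adj S t s -> adj S t s' ->
  (forall L, lin t L -> (s \in L) = (s' \in L)) -> s = s'.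

(** A triple requires a faithful group, and [X] may not be one. It is replaced by its image in
    [{perm W}], each permutation being the identity outside [vset S]. *)
Let nVX : actby_cond X (vset S) to := HX.1.
Let phi := [morphism of actperm <[nVX]>].
Let X' := (phi @* X)%G.

Let phiE a w : a \in X -> w \in vset S -> ('P)%act w (phi a) = to w a.
Proof. by move=> aX wV; rewrite /= /aperm actpermE actbyE. Qed.

Let phiX p : p \in X' -> exists2 a, a \in X & p = phi a.
Proof. by case/morphimP=> a _ aX ->; exists a. Qed.

Let Xphi a : a \in X -> phi a \in X'.
Proof. by move=> aX; apply: mem_morphim. Qed.

Let phi_out a w : a \in X -> w \notin vset S -> phi a w = w.
Proof. by move=> aX wV; rewrite /= actpermE /= /actby (negPf wV). Qed.

Let phi_set a (L : {set W}) : a \in X -> L \subset vset S -> ('P^*)%act L (phi a) = to^*%act L a.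
Proof.
move=> aX /subsetP sub; rewrite [LHS]setactE [RHS]setactE.
by apply: eq_in_imset => w /sub wV; rewrite phiE.
Qed.

Let linVs t (L : {set W}) : lin t L -> L \subset vset S.
Proof.
move=> /linN/subsetP sub; apply/subsetP => s /sub; rewrite inE; exact: adj_vset_r.
Qed.

Let HX' : acts_on_graph X' 'P S.
Proof.
split.
  apply: (@acts_onI _ _ ('P)%act X') => p w /phiX[a aX ->] wV.
  by rewrite phiE // (acts_vset HX).
move=> p x y /phiX[a aX ->].
have [xV|xV] := boolP (x \in vset S); last first.
  rewrite [('P)%act x _]phi_out //; apply/idP/idP => /adj_vset h; by rewrite h in xV.
have [yV|yV] := boolP (y \in vset S); last first.
  rewrite [('P)%act y _]phi_out //; apply/idP/idP => /adj_vset_r h; by rewrite h in yV.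
by rewrite !phiE // (acts_adj HX).
Qed.

Let trA' t s t' s' : adj S t s -> adj S t' s' ->
  exists2 a, a \in X' & 'P%act t a = t' /\ 'P%act s a = s'.
Proof.
move=> h h'; have [a aX [e1 e2]] := trA h h'; exists (phi a); first exact: Xphi.
by rewrite !phiE // ?(adj_vset h) ?(adj_vset_r h).
Qed.

Let lin_act' a t L : a \in X' -> lin t L -> lin ('P%act t a) ('P^*%act L a).
Proof.
move=> /phiX[c cX ->] l; rewrite phiE // ?(linV l) // phi_set //; last exact: linVs l.
exact: lin_act.
Qed.

Let lin_tr' t s L L' : adj S t s -> lin t L -> lin t L' -> s \in L -> s \in L' ->
  exists2 a, a \in X' & [/\ 'P%act t a = t, 'P%act s a = s & 'P^*%act L a = L'].
Proof.
move=> h l l' sL sL'; have [a aX [e1 e2 e3]] := lin_tr h l l' sL sL'.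
exists (phi a); first exact: Xphi.
by rewrite !phiE ?(adj_vset h) ?(adj_vset_r h) // phi_set // (linVs l).
Qed.

Let faith' a : a \in X' -> {in vset S, forall w, 'P%act w a = w} -> a = 1.
Proof.
move=> /phiX[c cX ->] fx; apply/permP => w; rewrite perm1.
have [wV|wV] := boolP (w \in vset S); first exact: fx.
exact: phi_out.
Qed.

Let local_isog t : t \in vset S -> local_group X' 'P S t \isog local_group X to S t.
Proof.
move=> tV; rewrite /local_group isog_sym.
have nbrV w : w \in nbr S t -> w \in vset S by rewrite inE; apply: adj_vset_r.
apply: (@quotient_image_isog _ _ X 'C_X[t | to]%G 'C_('C_X[t | to])(nbr S t | to)%G
  'C_(X')[t | 'P]%G 'C_('C_(X')[t | 'P])(nbr S t | 'P)%G phi).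
- exact: subsetIl.
- apply/setP => p; apply/morphimP/setIP => [[a _ /setIP[aX /astab1P at'] ->]|].
    by split; [apply: Xphi | apply/astab1P; rewrite phiE].
  move=> [/phiX[a aX ->] /astab1P]; rewrite phiE // => at'.
  by exists a => //; apply/setIP; split=> //; apply/astab1P.
- apply: normal_astab; apply: acts_onI => p w /setIP[pX /astab1P pt].
  by have := acts_adj HX' t w pX; rewrite pt !inE => ->.
- exact: subsetIl.
- move=> a /[dup] aC /setIP[aX /astab1P at']; rewrite inE [RHS]inE aC.
  have -> : phi a \in 'C_(X')[t | 'P].
    by apply/setIP; split; [apply: Xphi | apply/astab1P; rewrite phiE].
  apply/astabP/astabP => fx w wN; last by rewrite phiE ?nbrV // fx.
  by rewrite -phiE ?nbrV // fx.
Qed.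

(** A case enters only through the parameters and the isomorphism type of the induced group, so the
    hypothesis on [case] speaks of an arbitrary triple and hides the construction. *)
Lemma occurs (case : quotient_case) :
  (forall (aT' : finGroupType) (T : finType) (G : graph T) (X' : {group aT'})
      (to' : {action aT' &-> T}) (P : {set {set T}}) (B : {set T}) t,
    has_vbr G P v b r -> B \in P -> t \in vset S ->
    (forall (gT : finGroupType) (K : {group gT}),
       local_group X to S t \isog K -> stab_induced X' to' B \isog K) ->
    case aT' T G X' to' P B) ->
  can_occur case S X to.
Proof.
move=> Hcase.
have := @swapped_pair _ _ S X' 'P b v r lin exV valS b2 trA' lin_act' lin3 v3 r0.
move=> [t [s [L [R [h [[hX tL sL sR tR] [ht hs hL hR]]]]]]].
pose G := star_graph X' 'P lin t s L R.
exists {perm W}, ({set W} * {set W})%type, G, X', (pair_action ('P^*))%act, (fibres S lin).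
split.
- by apply: (@star_Ghat _ _ S X' 'P b v r lin) => //; first exact: hX.
- by apply: (@star_has_k _ _ S X' 'P b v r lin) => //; first exact: hX.
- move=> _ /fibresP[t' tV ->]; apply: (Hcase _ _ _ _ _ _ _ t') => //.
  + by apply: (@star_has_vbr _ _ S X' 'P b v r lin) => //; first exact: hX.
  + exact: fib_mem.
  + move=> gT K iso; apply: (@star_stab_isog _ _ S X' 'P b v r lin) => //.
    exact: isog_trans (local_isog tV) iso.
have [f [fi fE]] : exists f : {set _} -> W, is_giso (quotient_graph G (fibres S lin)) S f /\
    forall t', t' \in vset S -> f (fib lin t') = t'.
  by apply: (@star_giso _ _ S X' 'P b v r lin) => //; first exact: hX.
exists phi, f; split=> // _ a /fibresP[t' tV ->] aX.
rewrite (@fib_act _ _ X' 'P lin lin_act') ?Xphi // !fE ?phiE //.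
by rewrite (acts_vset HX).
Qed.

End Occurrence.

Lemma setact_sub (aT : finGroupType) (T : finType) (to : {action aT &-> T})
    (L L' : {set T}) a : (to^*%act L a \subset to^*%act L' a) = (L \subset L').
Proof.
rewrite ![to^*%act _ a]setactE; apply/subsetP/subsetP => h x.
  move=> xL; have /h/imsetP[y yL' /act_inj ->] // : to x a \in [set to z a | z in L].
  exact: imset_f.
by case/imsetP=> y /h yL' ->; apply: imset_f.
Qed.

Lemma card_setact (aT : finGroupType) (T : finType) (to : {action aT &-> T})
    (L : {set T}) a : #|to^*%act L a| = #|L|.
Proof. by rewrite [to^*%act _ a]setactE card_imset //; apply: act_inj. Qed.

Lemma mem_setactE (aT : finGroupType) (T : finType) (to : {action aT &-> T})
    (L : {set T}) a x : (to x a \in to^*%act L a) = (x \in L).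
Proof. by apply/imsetP/idP => [[y yL /act_inj ->]|xL] //; exists x. Qed.

Lemma setact_nbr (aT : finGroupType) (T : finType) (G : graph T) (X : {group aT})
    (to : {action aT &-> T}) a x : acts_on_graph X to G -> a \in X ->
  to^*%act (nbr G x) a = nbr G (to x a).
Proof.
move=> HX aX; apply/setP => y; rewrite -{1}(actKV to a y) mem_setactE !inE.
by rewrite -(acts_adj HX _ _ aX) actKV.
Qed.

Lemma setactD1 (aT : finGroupType) (T : finType) (to : {action aT &-> T})
    (L : {set T}) a x : to^*%act (L :\ x) a = to^*%act L a :\ to x a.
Proof.
apply/setP => y; rewrite -(actKV to a y) inE !mem_setactE !inE.
by rewrite (inj_eq (act_inj to a)).
Qed.

Lemma setact_set2 (aT : finGroupType) (T : finType) (to : {action aT &-> T}) a x y :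
  to^*%act [set x; y] a = [set to x a; to y a].
Proof. by rewrite [LHS]setactE imsetU !imset_set1. Qed.

Lemma double_count (U : finType) (A : {set U}) (B : {set {set U}}) :
  (\sum_(L in B) #|A :&: L| = \sum_(u in A) #|[set L in B | u \in L]|)%N.
Proof.
transitivity (\sum_(L in B) \sum_(u in A) (u \in L : nat))%N.
  apply: eq_bigr => L _; rewrite -sum1_card.
  rewrite (eq_bigl (fun u => (u \in A) && (u \in L))); last by move=> u; rewrite inE.
  by rewrite big_mkcondr; apply: eq_bigr => u _; case: (u \in L).
rewrite exchange_big; apply: eq_bigr => u _ /=.
rewrite -sum1_card (eq_bigl (fun L => (L \in B) && (u \in L))); last by move=> L; rewrite inE.
rewrite [RHS]big_mkcondr /=; apply: eq_bigr => L _; by case: (u \in L).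
Qed.

(** * Tetravalent graphs in cases (a) and (b) *)

Section TetravalentOccurrence.
Variables (aT : finGroupType) (W : finType) (S : graph W).
Variables (X : {group aT}) (to : {action aT &-> W}).
Hypothesis HX : acts_on_graph X to S.
Hypothesis conS : connected S.
Hypothesis val4 : has_val S 4.
Hypothesis tr2 : arc_transitive X to 2 S.

Let arcs2 : forall x y z x' y' z', adj S x y -> adj S y z -> x != z ->
  adj S x' y' -> adj S y' z' -> x' != z' ->
  exists2 a, a \in X & [/\ to x a = x', to y a = y' & to z a = z'].
Proof. by have [_ h] := (transitive_Arc2 HX).1 tr2.2. Qed.

Let exV : exists t, t \in vset S.
Proof. by have [[x xV] _] := (transitive_vset HX).1 tr2.1; exists x. Qed.

Let other t s : adj S t s -> exists2 u, adj S t u & s != u.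
Proof.
move=> ts; have : 0 < #|nbr S t :\ s|.
  have := cardsD1 s (nbr S t); rewrite val4 ?(adj_vset ts) // inE ts; lia.
by case/card_gt0P=> u; rewrite !inE eq_sym => /andP[su tu]; exists u.
Qed.

Let trA t s t' s' : adj S t s -> adj S t' s' ->
  exists2 a, a \in X & to t a = t' /\ to s a = s'.
Proof.
move=> ts ts'; have [u tu su] := other ts; have [u' tu' su'] := other ts'.
have [a aX [e1 e2 _]] := arcs2 (etrans (adj_sym _ _ _) ts) tu su
  (etrans (adj_sym _ _ _) ts') tu' su'.
by exists a.
Qed.

Let nbr_tr t s u s' u' : adj S t s -> adj S t u -> s != u ->
  adj S t s' -> adj S t u' -> s' != u' ->
  exists2 a, a \in X & [/\ to t a = t, to s a = s' & to u a = u'].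
Proof.
move=> ts tu su ts' tu' su'.
have [a aX [e1 e2 e3]] := arcs2 (etrans (adj_sym _ _ _) ts) tu su
  (etrans (adj_sym _ _ _) ts') tu' su'.
by exists a.
Qed.

Let local t : t \in vset S -> local_group X to S t \isog 'Alt_('I_4) \/
  local_group X to S t \isog 'Sym_('I_4).
Proof.
move=> tV; apply: two_trans_A4_S4; last 2 first.
- exact: val4.
- move=> x y x' y'; rewrite !inE => tx ty tx' ty' nxy nxy'.
  have [a aX [e1 e2 e3]] := nbr_tr tx ty nxy tx' ty' nxy'.
  by exists a => //; apply/setIP; split=> //; apply/astab1P.
apply: acts_onI => a w /setIP[aX /astab1P at'].
by have := acts_adj HX t w aX; rewrite at' !inE => ->.
Qed.

Lemma case_a_occurs : can_occur case_a S X to.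
Proof.
(* The 3-subsets of a neighbourhood of size 4, written as complements of one neighbour: there are 4,
   and each neighbour lies in 3 of them. *)
pose lin t (L : {set W}) := [exists s, adj S t s && (L == nbr S t :\ s)].
have linP t L : reflect (exists2 s, adj S t s & L = nbr S t :\ s) (lin t L).
  apply: (iffP existsP) => [[s /andP[ts /eqP ->]]|[s ts ->]]; first by exists s.
  by exists s; rewrite ts eqxx.
have inj t : {in nbr S t &, injective (fun s => nbr S t :\ s)}.
  move=> s s' sN s'N /= e; apply/eqP; apply: contraT => nss.
  have : s \in nbr S t :\ s' by rewrite !inE nss; rewrite inE in sN.
  by rewrite -e !inE eqxx.
apply: (@occurs _ _ S X to 4 4 3 lin) => //.
- by move=> t L /linP[s ts _]; apply: adj_vset ts.
- by move=> t L /linP[s ts ->]; apply: subD1set.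
- move=> a t L aX /linP[s ts ->]; apply/linP; exists (to s a).
    by rewrite (acts_adj HX).
  by rewrite setactD1 (setact_nbr _ HX).
- move=> t s ts.
  have -> : [set L | lin t L & s \in L] = [set nbr S t :\ u | u in nbr S t :\ s].
    apply/setP => L; rewrite inE; apply/andP/imsetP => [[/linP[u tu ->]]|[u + ->]].
      by rewrite !inE => /andP[su _]; exists u; rewrite // !inE eq_sym su.
    rewrite !inE => /andP[us tu]; rewrite eq_sym us ts; split=> //.
    by apply/linP; exists u.
  rewrite card_in_imset; last by move=> u u' /setD1P[_ h] /setD1P[_ h']; apply: inj.
  by have := cardsD1 s (nbr S t); rewrite val4 ?(adj_vset ts) // inE ts; lia.
- move=> t s _ _ ts /linP[u tu ->] /linP[u' tu' ->]; rewrite !inE ts !andbT => su su'.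
  have [a aX [e1 e2 e3]] := nbr_tr ts tu su ts tu' su'.
  by exists a => //; split=> //; rewrite setactD1 (setact_nbr _ HX) // e1 e3.
- move=> t tV; rewrite -(val4 tV) -(card_in_imset (@inj t)); apply: eq_card => L.
  rewrite inE; apply/linP/imsetP => [[s ts ->]|[s + ->]]; first by exists s; rewrite ?inE.
  by rewrite inE => ts; exists s.
- move=> t L /linP[s ts ->]; have := cardsD1 s (nbr S t).
  by rewrite val4 ?(adj_vset ts) // inE ts; lia.
- move=> t s s' ts ts' e; apply/eqP; apply: contraT => nss.
  have := e (nbr S t :\ s); rewrite !inE eqxx ts' eq_sym nss /= => h.
  by have : false = true by apply: h; apply/linP; exists s.
- move=> aT' T G X' to' P B t vbr _ tV iso; split=> //.
  by case: (local tV) => h; [left | right]; apply: iso.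
Qed.

Lemma case_b_occurs : can_occur case_b S X to.
Proof.
(* The 2-subsets of a neighbourhood of size 4: there are 6, and each neighbour lies in 3 of them. *)
pose lin t (L : {set W}) := [&& t \in vset S, L \subset nbr S t & #|L| == 2].
have pairP t L s : lin t L -> s \in L -> exists u, [/\ adj S t s, adj S t u, s != u & L = [set s; u]].
  case/and3P=> tV sub /cards2P[x [y [nxy eL]]] sL.
  have tx : adj S t x by have := subsetP sub x; rewrite eL !inE eqxx => /(_ isT).
  have ty : adj S t y by have := subsetP sub y; rewrite eL !inE eqxx orbT => /(_ isT).
  move: sL; rewrite eL !inE => /orP[]/eqP ->; first by exists y.
  by exists x; rewrite eq_sym setUC.
have pairI t s u : adj S t s -> adj S t u -> s != u -> lin t [set s; u].
  move=> ts tu su; rewrite /lin (adj_vset ts) cards2 su eqxx andbT /=.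
  by apply/subsetP => x; rewrite !inE => /orP[]/eqP ->.
apply: (@occurs _ _ S X to 4 6 2 lin) => //.
- by move=> t L /and3P[].
- by move=> t L /and3P[].
- move=> a t L aX /and3P[tV sub c]; rewrite /lin (acts_vset HX) // tV card_setact c.
  by rewrite -(setact_nbr _ HX) // setact_sub sub.
- move=> t s ts.
  have -> : [set L | lin t L & s \in L] = [set [set s; u] | u in nbr S t :\ s].
    apply/setP => L; rewrite inE; apply/andP/imsetP => [[l sL]|[u + ->]].
      have [u [_ tu su ->]] := pairP _ _ _ l sL; exists u => //.
      by rewrite !inE eq_sym su.
    rewrite !inE eqxx => /andP[us tu]; split=> //; apply: pairI => //.
    by rewrite eq_sym.
  rewrite card_in_imset; last first.
    move=> u u' /setD1P[nu _] /setD1P[nu' _] /= e.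
    have : u \in [set s; u'] by rewrite -e !inE eqxx orbT.
    by rewrite !inE (negPf nu) => /eqP.
  by have := cardsD1 s (nbr S t); rewrite val4 ?(adj_vset ts) // inE ts; lia.
- move=> t s L L' ts l l' sL sL'.
  have [u [_ tu su ->]] := pairP _ _ _ l sL; have [u' [_ tu' su' ->]] := pairP _ _ _ l' sL'.
  have [a aX [e1 e2 e3]] := nbr_tr ts tu su ts tu' su'.
  by exists a => //; split=> //; rewrite setact_set2 e2 e3.
- move=> t tV; transitivity 'C(#|nbr S t|, 2); last by rewrite val4.
  by rewrite -cards_draws; apply: eq_card => L; rewrite !inE /lin tV.
- by move=> t L /and3P[_ _ /eqP].
- move=> t s s' ts ts' e; apply/eqP; apply: contraT => nss.
  have : 0 < #|nbr S t :\ s :\ s'|.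
    have := cardsD1 s (nbr S t); have := cardsD1 s' (nbr S t :\ s).
    by rewrite val4 ?(adj_vset ts) // !inE ts ts' eq_sym nss; lia.
  case/card_gt0P=> u; rewrite !inE => /and3P[us' us tu].
  have := e [set s; u]; rewrite !inE eqxx [s' == s]eq_sym (negPf nss) [s' == u]eq_sym (negPf us') /=.
  by move=> h; have : true = false by apply: h; apply: pairI; rewrite // eq_sym.
- move=> aT' T G X' to' P B t vbr _ tV iso; split=> //.
  by case: (local tV) => h; [left | right]; apply: iso.
Qed.

End TetravalentOccurrence.

Lemma all_tetravalent_occur_a : all_tetravalent_occur case_a.
Proof. by move=> aT W S X to *; apply: case_a_occurs. Qed.

Lemma all_tetravalent_occur_b : all_tetravalent_occur case_b.
Proof. by move=> aT W S X to *; apply: case_b_occurs. Qed.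

Lemma third_element (T : finType) (L : {set T}) x y : #|L| = 3 -> x \in L -> y \in L ->
  x != y -> exists u, [/\ u \in L, u != x & u != y].
Proof.
move=> c xL yL nxy; have : 0 < #|L :\ x :\ y|.
  have := cardsD1 x L; have := cardsD1 y (L :\ x).
  by rewrite c !inE xL yL [y == x]eq_sym nxy; lia.
by case/card_gt0P=> u; rewrite !inE => /and3P[? ? ?]; exists u.
Qed.

Lemma card_setD1 (T : finType) (L : {set T}) x n : #|L| = n.+1 -> x \in L -> #|L :\ x| = n.
Proof. by move=> c xL; have := cardsD1 x L; rewrite c xL => -[]. Qed.

(** * Lines of the Fano plane given by a vector labelling *)

Section FanoLines.
Import GRing.Theory.
Local Open Scope ring_scope.
Local Notation V := 'rV['F_2]_3.
Local Notation gG := {'GL_3(2)}.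

Variables (aT : finGroupType) (T : finType) (to : {action aT &-> T}).
Variables (H : {group aT}) (N : {set T}) (e : T -> V) (th : aT -> gG).
Hypothesis HN : [acts H, on N | to].
Hypothesis cN : #|N| = 7%N.
Hypothesis eL : vector_labelling to H N e th.

Definition line (L : {set T}) := [&& L \subset N, #|L| == 3%N & \sum_(x in L) e x == 0].

Let H2 : two_trans to H N := labelling_two_trans HN eL.

Lemma line_act a L : a \in H -> line L -> line (to^*%act L a).
Proof.
have [ei e0 es eA ths] := eL.
move=> aH /and3P[sub c /eqP s0]; apply/and3P; split.
- rewrite [to^*%act _ a]setactE; apply/subsetP => _ /imsetP[x /(subsetP sub) xN ->].
  by rewrite (acts_act HN).
- by rewrite card_setact.
rewrite [to^*%act _ a]setactE big_imset /=; last by move=> x y _ _ /act_inj.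
rewrite (eq_bigr (fun x => e x *m GLval (th a))); last first.
  by move=> x xL; rewrite eA // (subsetP sub).
by rewrite -mulmx_suml s0 mul0mx.
Qed.

Lemma line_through x y : x \in N -> y \in N -> x != y -> exists L,
  [/\ line L, x \in L, y \in L & forall L', line L' -> x \in L' -> y \in L' -> L' = L].
Proof.
have [ei e0 es eA ths] := eL.
move=> xN yN nxy; have exy : e x + e y != 0 by rewrite rV2_add_eq0 (inj_in_eq ei).
have [z zN ez] := es _ exy.
have nzx : z != x.
  apply: contraNneq (e0 _ yN) => zx; move: ez; rewrite zx => /eqP.
  by rewrite -[X in X == _]addr0 (inj_eq (addrI _)) eq_sym => /eqP ->.
have nzy : z != y.
  apply: contraNneq (e0 _ xN) => zy; move: ez; rewrite zy addrC => /eqP.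
  by rewrite -[X in X == _]addr0 (inj_eq (addrI _)) eq_sym => /eqP ->.
have xyn : x \notin [set y; z] by rewrite !inE negb_or nxy eq_sym.
have yzn : y \notin [set z] by rewrite inE eq_sym.
exists (x |: [set y; z]); rewrite !inE !eqxx orbT; split=> //.
  apply/and3P; split.
  - by apply/subsetP => w; rewrite !inE => /or3P[]/eqP ->.
  - by rewrite cardsU1 xyn cards2 [y == z]eq_sym nzy.
  - by rewrite big_setU1 //= big_setU1 //= big_set1 ez addrA rV2_addvv.
move=> L' /and3P[sub c /eqP s0] xL yL.
apply/eqP; rewrite eq_sym eqEcard cardsU1 xyn cards2 [y == z]eq_sym nzy (eqP c) leqnn andbT.
apply/subsetP => w; rewrite !inE => /or3P[]/eqP -> //.
have [u [uL ux uy]] := third_element (eqP c) xL yL nxy.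
have eL' : L' = x |: (y |: [set u]).
  apply/eqP; rewrite eq_sym eqEcard; apply/andP; split.
    by apply/subsetP => t; rewrite !inE => /or3P[]/eqP ->.
  rewrite !cardsU1 !inE negb_or nxy [x == u]eq_sym ux [y == u]eq_sym uy cards1.
  by rewrite (eqP c).
suff -> : z = u by [].
apply: ei => //; first exact: (subsetP sub).
apply/eqP; rewrite ez -rV2_add_eq0; move: s0.
rewrite eL' big_setU1 ?inE ?negb_or ?nxy 1?eq_sym ?ux //= big_setU1 ?inE 1?eq_sym //= big_set1.
by rewrite addrA => ->.
Qed.

(** Each of the six other points lies on one line with [x], and each line through [x] contains two
    of them. *)
Lemma line_lines x : x \in N -> #|[set L | line L & x \in L]| = 3%N.
Proof.
move=> xN; pose B := [set L | line L & x \in L].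
have := double_count (N :\ x) B.
rewrite (eq_bigr (fun _ => 2%N)) => [|L]; last first.
  rewrite inE => /andP[/and3P[sub /eqP c _] xL].
  have -> : (N :\ x) :&: L = L :\ x.
    apply/setP => y; rewrite !inE; case: (boolP (y \in L)) => yL; last by rewrite !andbF.
    by rewrite (subsetP sub _ yL) !andbT.
  exact: card_setD1.
rewrite [RHS](eq_bigr (fun _ => 1%N)) => [|y]; last first.
  rewrite !inE => /andP[yx yN]; rewrite eq_sym in yx.
  have [L [lL xL yL un]] := line_through xN yN yx.
  apply/eqP/cards1P; exists L; apply/setP => L'; rewrite !inE.
  apply/andP/eqP => [[/andP[l' xL'] yL']|->]; first exact: un.
  by rewrite lL xL yL.
by rewrite !sum_nat_const (card_setD1 cN xN) -/B; move: #|B|; lia.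
Qed.

Lemma card_lines : #|[set L | line L]| = 7%N.
Proof.
have := double_count N [set L | line L].
rewrite (eq_bigr (fun _ => 3%N)) => [|L]; last first.
  by rewrite inE => /and3P[/setIidPr -> /eqP].
rewrite [RHS](eq_bigr (fun _ => 3%N)) => [|x xN]; last first.
  rewrite -(line_lines xN); apply: eq_card => L; by rewrite !inE.
by rewrite !sum_nat_const cN; move: #|_|; lia.
Qed.

(** 2-transitivity moves [x] and a second point of [L] to [x] and a second point of [L']; two points
    determine the line. *)
Lemma line_flag_tr x L L' : x \in N -> line L -> line L' -> x \in L -> x \in L' ->
  exists2 a, a \in H & to x a = x /\ to^*%act L a = L'.
Proof.
move=> xN lL lL' xL xL'.
have other (M : {set T}) : line M -> x \in M -> exists y, [/\ y \in M, y \in N & x != y].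
  move=> /and3P[sub /eqP c _] xM; have : (0 < #|M :\ x|)%N.
    by rewrite (card_setD1 c xM).
  case/card_gt0P=> y; rewrite !inE eq_sym => /andP[nxy yM].
  by exists y; split=> //; apply: (subsetP sub).
have [y [yL yN nxy]] := other _ lL xL; have [y' [yL' yN' nxy']] := other _ lL' xL'.
have [a aH [ax ay]] := H2 xN yN xN yN' nxy nxy'.
exists a => //; split=> //.
have [M [_ _ _ un]] := line_through xN yN' nxy'.
rewrite [RHS]un //; apply: un; first exact: line_act.
  by rewrite -{1}ax mem_setactE.
by rewrite -ay mem_setactE.
Qed.

Lemma line_sep x y : x \in N -> y \in N ->
  (forall L, line L -> (x \in L) = (y \in L)) -> x = y.
Proof.
move=> xN yN same; apply/eqP; apply: contraT => nxy.
have [M [_ _ _ un]] := line_through xN yN nxy.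
have : [set L | line L & x \in L] \subset [set M].
  apply/subsetP => L; rewrite !inE => /andP[lL xL].
  by rewrite (un L lL xL) // -same.
by move/subset_leq_card; rewrite line_lines // cards1.
Qed.

End FanoLines.

Section HeptavalentOccurrence.
Variables (aT : finGroupType) (W : finType) (S : graph W).
Variables (X : {group aT}) (to : {action aT &-> W}).
Hypothesis HX : acts_on_graph X to S.
Hypothesis conS : connected S.
Hypothesis val7 : has_val S 7.
Hypothesis symS : symmetric_graph X to S.
Hypothesis loc : forall x, x \in vset S -> local_group X to S x \isog PSL 3 2.

Let trA t s t' s' : adj S t s -> adj S t' s' ->
  exists2 a, a \in X & to t a = t' /\ to s a = s'.
Proof. by have [_ h] := (transitive_Arc1 HX).1 symS.2; apply: h. Qed.

Let trV t t' : t \in vset S -> t' \in vset S -> exists2 a, a \in X & to t a = t'.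
Proof. by have [_ h] := (transitive_vset HX).1 symS.1; apply: h. Qed.

Lemma stab_acts_nbr t : [acts 'C_X[t | to], on nbr S t | to].
Proof.
apply: acts_onI => a w /setIP[aX /astab1P at'].
by have := acts_adj HX t w aX; rewrite at' !inE => ->.
Qed.

Lemma case_c_occurs : can_occur case_c S X to.
Proof.
have [[x0 x0V] _] := (transitive_vset HX).1 symS.1.
pose H := 'C_X[x0 | to]%G; pose N := nbr S x0.
have HN : [acts H, on N | to] := stab_acts_nbr x0.
have cN : #|N| = 7 by apply: val7.
have trN x y : x \in N -> y \in N -> exists2 a, a \in H & to x a = y.
  rewrite !inE => xN yN; have [a aX [ax ay]] := trA xN yN.
  by exists a => //; apply/setIP; split=> //; apply/astab1P.
have [e [th eL]] := PSL_labelling HN cN trN (loc x0V).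
pose ln := line N e.
(* The Fano plane is chosen at [x0] alone and carried to the other vertices by [X]. By [line_act]
   the stabiliser of [x0] preserves lines, so the choice of [a] is immaterial, which is [linE]. *)
pose lin t (L : {set W}) := [exists a in X, (to t a == x0) && ln (to^*%act L a)].
have HP a : a \in X -> to x0 a = x0 -> a \in H.
  by move=> aX ax; apply/setIP; split=> //; apply/astab1P.
have linE t L a : a \in X -> to t a = x0 -> lin t L = ln (to^*%act L a).
  move=> aX ta; apply/exists_inP/idP => [[c cX /andP[/eqP tc lc]]|l]; last first.
    by exists a; rewrite ?ta ?eqxx.
  have cah : c^-1 * a \in H.
    by apply: HP; rewrite ?groupM ?groupV // actM -{1}tc actK ta.
  by have := line_act HN eL cah lc; rewrite (actM to^*) actK.
have back t : t \in vset S -> exists2 a, a \in X & to t a = x0 by move=> tV; apply: trV.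
have linV t L : lin t L -> t \in vset S.
  by case/exists_inP=> a aX /andP[/eqP ta _]; rewrite -(acts_vset HX t aX) ta.
have adj0 t s a : a \in X -> to t a = x0 -> adj S t s -> to s a \in N.
  by move=> aX ta ts; rewrite inE -ta (acts_adj HX).
have linN t L : lin t L -> L \subset nbr S t.
  case/exists_inP=> a aX /andP[/eqP ta /and3P[sub _ _]].
  by rewrite -(setact_sub to _ _ a) (setact_nbr _ HX) // ta.
have cards a (P1 P2 : pred {set W}) : (forall L, P1 L = P2 (to^*%act L a)) ->
    #|[set L | P1 L]| = #|[set L | P2 L]|.
  move=> h; rewrite -(card_imset _ (act_inj to^* a)); apply: eq_card => L.
  rewrite inE; apply/imsetP/idP => [[M + ->]|p2].
    by rewrite inE h.
  by exists (to^*%act L a^-1); rewrite ?inE ?h actKV.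
apply: (@occurs _ _ S X to 7 7 3 lin) => //.
- by exists x0.
- move=> a t L aX l; have [c cX tc] := back _ (linV _ _ l).
  rewrite (linE _ _ (a^-1 * c)) ?groupM ?groupV // actM actK //.
  by rewrite -(linE t).
- move=> t s ts; have [a aX ta] := back _ (adj_vset ts).
  rewrite -(line_lines cN eL (adj0 _ _ _ aX ta ts)).
  apply: (@cards a (fun L => lin t L && (s \in L)) (fun L => ln L && (to s a \in L))) => L.
  by rewrite (linE _ _ a) // mem_setactE.
- move=> t s L L' ts l l' sL sL'; have [a aX ta] := back _ (adj_vset ts).
  rewrite (linE _ _ a) // in l; rewrite (linE _ _ a) // in l'.
  have [||c cH [cs cL]] := line_flag_tr HN eL (adj0 _ _ _ aX ta ts) l l'; rewrite ?mem_setactE //.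
  have [cX /astab1P c0] := setIP cH.
  exists (a * c * a^-1); first by rewrite !groupM ?groupV.
  split; rewrite !actM.
  - by rewrite ta c0 -ta actK.
  - by rewrite cs actK.
  - by rewrite cL actK.
- move=> t tV; have [a aX ta] := back _ tV.
  by rewrite -(card_lines cN eL); apply: (@cards a (lin t) ln) => L; rewrite (linE _ _ a).
- move=> t L l; have [a aX ta] := back _ (linV _ _ l).
  by move: l; rewrite (linE _ _ a) // => /and3P[_ /eqP c _]; rewrite -c card_setact.
- move=> t s s' ts ts' same; have [a aX ta] := back _ (adj_vset ts).
  apply: (act_inj to a); apply: (line_sep cN eL); rewrite ?(adj0 t) // => L lL.
  have := same (to^*%act L a^-1); rewrite (linE _ _ a) // actKV => /(_ lL).
  have mm z : (z \in to^*%act L a^-1) = (to z a \in L).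
    by rewrite -[LHS](mem_setactE to _ a) actKV.
  by rewrite !mm.
- by move=> aT' T G X' to' P B t vbr _ tV iso; split=> //; apply/iso/loc.
Qed.

End HeptavalentOccurrence.

(** * The design D(B) and the local actions *)

Lemma rel_count (U1 U2 : finType) (A : {set U1}) (B : {set U2}) (R : U1 -> U2 -> bool) :
  (\sum_(x in A) #|[set y in B | R x y]| = \sum_(y in B) #|[set x in A | R x y]|)%N.
Proof.
transitivity (\sum_(x in A) \sum_(y in B) (R x y : nat))%N.
  apply: eq_bigr => x _; rewrite -sum1dep_card big_mkcondr.
  by apply: eq_bigr => y _; case: (R x y).
rewrite exchange_big; apply: eq_bigr => y _ /=; rewrite -sum1dep_card big_mkcondr.
by apply: eq_bigr => x _; case: (R x y).
Qed.

Section Triple.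
Variables (aT : finGroupType) (T : finType) (G : graph T).
Variables (X : {group aT}) (to : {action aT &-> T}) (P : {set {set T}}).
Hypothesis HG : in_Ghat G X to P.
Hypothesis K3 : has_k G P 3.

Local Notation V := (vset G).
Local Notation Q := (quotient_graph G P).
Local Notation toB := (to^*)%act.
Local Notation pb := (pblock P).
Local Notation L := (blocks_at G P).

Let HX : acts_on_graph X to G := Ghat_acts HG.

Let tI : trivIset P.
Proof. by have /and3P[] := Ghat_partition HG. Qed.

Let cP : cover P = V.
Proof. by have /and3P[/eqP] := Ghat_partition HG. Qed.

Lemma block_in x : x \in V -> pb x \in P.
Proof. by rewrite -cP; apply: pblock_mem. Qed.

Lemma mem_block x : x \in V -> x \in pb x.
Proof. by rewrite mem_pblock cP. Qed.

Lemma block_eq B x : B \in P -> x \in B -> pb x = B.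
Proof. exact: def_pblock. Qed.

Lemma block_sub B x : B \in P -> x \in B -> x \in V.
Proof. by move=> BP xB; rewrite -cP; apply/bigcupP; exists B. Qed.

Lemma block_nonempty B : B \in P -> exists x, x \in B.
Proof. by move=> BP; apply/card_gt0P; have /andP[] := Ghat_nontrivial HG BP; lia. Qed.

Lemma arcs_tr x y x' y' : adj G x y -> adj G x' y' ->
  exists2 a, a \in X & to x a = x' /\ to y a = y'.
Proof. by have [_ h] := (transitive_Arc1 HX).1 (Ghat_sym HG).2; apply: h. Qed.

Lemma verts_tr x x' : x \in V -> x' \in V -> exists2 a, a \in X & to x a = x'.
Proof. by have [_ h] := (transitive_vset HX).1 (Ghat_sym HG).1; apply: h. Qed.

Lemma vertex_nbr x : x \in V -> exists y, adj G x y.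
Proof.
move=> xV; have [[u [w uw]] _] := (transitive_Arc1 HX).1 (Ghat_sym HG).2.
have [a aX <-] := verts_tr (adj_vset uw) xV.
by exists (to w a); rewrite (acts_adj HX).
Qed.

Lemma block_act_in a B : a \in X -> B \in P -> toB B a \in P.
Proof. by move=> aX BP; rewrite (acts_act (Ghat_invariant HG)). Qed.

Lemma block_act a x : a \in X -> x \in V -> pb (to x a) = toB (pb x) a.
Proof.
move=> aX xV; apply: block_eq; first by rewrite block_act_in ?block_in.
by rewrite mem_setactE mem_block.
Qed.

Lemma P_nonempty : exists B, B \in P.
Proof.
have [[x xV] _] := (transitive_vset HX).1 (Ghat_sym HG).1.
by exists (pb x); apply: block_in.
Qed.

Lemma quotient_adj0 B C : adj Q B C -> exists x y, [/\ adj G x y, x \in B & y \in C].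
Proof.
rewrite simple_adjE => /and4P[_ _ _ /orP[]] /exists_inP[x xB /exists_inP[y yC xy]].
  by exists x, y.
by exists y, x; rewrite adj_sym.
Qed.

(** The quotient has an edge, so some edge of [G] joins two different blocks; arc-transitivity
    extends this to all edges. *)
Lemma adj_blocks x y : adj G x y -> pb x != pb y.
Proof.
move=> xy; have [B BP] := P_nonempty; have [b vb b2] := Ghat_val HG.
have /card_gt0P[C] : 0 < #|nbr Q B| by rewrite vb //; lia.
rewrite inE => BC; have [u [w [uw uB wC]]] := quotient_adj0 BC.
have [a aX [ux wy]] := arcs_tr uw xy.
rewrite -ux -wy !block_act ?(adj_vset uw) ?(adj_vset_r uw) // (inj_eq (act_inj toB a)).
by rewrite (block_eq BP uB) (block_eq (adj_vset_r BC) wC) (adj_neq BC).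
Qed.

Lemma quotient_adj x y : adj G x y -> adj Q (pb x) (pb y).
Proof.
move=> xy; rewrite simple_adjE !block_in ?(adj_vset xy) ?(adj_vset_r xy) // adj_blocks //=.
apply/orP; left; apply/exists_inP; exists x; first by rewrite mem_block ?(adj_vset xy).
by apply/exists_inP; exists y; rewrite ?mem_block ?(adj_vset_r xy).
Qed.

Lemma quotient_adjP B C : adj Q B C -> exists x y, [/\ adj G x y, pb x = B & pb y = C].
Proof.
move=> BC; have [x [y [xy xB yC]]] := quotient_adj0 BC.
by exists x, y; rewrite (block_eq (adj_vset BC) xB) (block_eq (adj_vset_r BC) yC).
Qed.

Lemma quotient_acts : acts_on_graph X toB Q.
Proof.
have half a B C : a \in X -> adj Q B C -> adj Q (toB B a) (toB C a).
  move=> aX /quotient_adjP[x [y [xy <- <-]]].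
  by rewrite -!block_act ?(adj_vset xy) ?(adj_vset_r xy) // quotient_adj ?(acts_adj HX).
split; first exact: Ghat_invariant HG.
move=> a B C aX; apply/idP/idP; last exact: half.
by move/(half a^-1 _ _); rewrite groupV !actK; apply.
Qed.

Lemma quotient_arcs_tr B C B' C' : adj Q B C -> adj Q B' C' ->
  exists2 a, a \in X & toB B a = B' /\ toB C a = C'.
Proof.
move=> /quotient_adjP[x [y [xy <- <-]]] /quotient_adjP[x' [y' [xy' <- <-]]].
have [a aX [<- <-]] := arcs_tr xy xy'; exists a => //.
by rewrite !block_act ?(adj_vset xy) ?(adj_vset_r xy).
Qed.

Lemma blocks_tr : [transitive X, on P | toB].
Proof.
apply/(transitive_vset quotient_acts); split; first exact: P_nonempty.
move=> B B' BP BP'; have [x xB] := block_nonempty BP; have [x' xB'] := block_nonempty BP'.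
have [a aX xa] := verts_tr (block_sub BP xB) (block_sub BP' xB').
exists a => //; rewrite -(block_eq BP xB) -(block_eq BP' xB') -xa.
by rewrite block_act ?(block_sub BP xB).
Qed.

Lemma blocks_atP x C : reflect (exists2 y, adj G x y & pb y = C) (C \in L x).
Proof.
rewrite inE; apply: (iffP andP) => [[CP /bigcupP[y yC]]|[y xy <-]].
  by rewrite inE adj_sym => xy; exists y => //; apply: block_eq.
split; first by rewrite block_in ?(adj_vset_r xy).
by apply/bigcupP; exists y; rewrite ?mem_block ?(adj_vset_r xy) // inE adj_sym.
Qed.

Lemma blocks_at_act a x C : a \in X -> (toB C a \in L (to x a)) = (C \in L x).
Proof.
have half b y E : b \in X -> E \in L y -> toB E b \in L (to y b).
  move=> bX /blocks_atP[z yz <-]; apply/blocks_atP; exists (to z b).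
    by rewrite (acts_adj HX).
  by rewrite block_act // (adj_vset_r yz).
move=> aX; apply/idP/idP; last exact: half.
by move/(half a^-1 _ _); rewrite groupV !actK; apply.
Qed.

Lemma blocks_at_setact a x : a \in X -> L (to x a) = (toB^*)%act (L x) a.
Proof.
move=> aX; apply/setP => C; rewrite -(actKV toB a C).
by rewrite blocks_at_act // (mem_setactE toB).
Qed.

Lemma blocks_at_adj x C : C \in L x -> adj Q (pb x) C.
Proof. by case/blocks_atP=> y xy <-; apply: quotient_adj. Qed.

Lemma blocks_at_vset x C : C \in L x -> x \in V.
Proof. by case/blocks_atP=> y xy _; apply: adj_vset xy. Qed.

Lemma flag_tr x C x' C' : C \in L x -> C' \in L x' ->
  exists2 a, a \in X & to x a = x' /\ toB C a = C'.
Proof.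
move=> /blocks_atP[y xy <-] /blocks_atP[y' xy' <-].
have [a aX [xa ya]] := arcs_tr xy xy'; exists a => //; split=> //.
by rewrite -ya block_act // (adj_vset_r xy).
Qed.

Lemma blocks_at_nonempty x : x \in V -> exists C, C \in L x.
Proof. by move=> /vertex_nbr[y xy]; exists (pb y); apply/blocks_atP; exists y. Qed.

(** This is [nbrs G C :&: B] expressed through [blocks_at], which makes incidence a membership that
    the group visibly preserves; see [pts_nbrs]. *)
Definition block_pts (B C : {set T}) : {set T} := [set x in B | C \in L x].

Lemma pts_nbrs B C : C \in P -> block_pts B C = nbrs G C :&: B.
Proof. by move=> CP; apply/setP => x; rewrite !inE CP andbC. Qed.

Lemma card_pts3 B C : adj Q B C -> #|block_pts B C| = 3.
Proof.
move=> BC; rewrite pts_nbrs ?(adj_vset_r BC) //; apply: K3; first exact: adj_vset BC.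
by rewrite inE.
Qed.

Lemma blocks_at_sub B x : B \in P -> x \in B -> L x \subset nbr Q B.
Proof.
move=> BP xB; apply/subsetP => C /blocks_at_adj.
by rewrite (block_eq BP xB) inE.
Qed.

Lemma uniform_v B B' : B \in P -> B' \in P -> #|B| = #|B'|.
Proof.
move=> BP BP'; have [a aX <-] := ((transitive_vset quotient_acts).1 blocks_tr).2 _ _ BP BP'.
by rewrite card_setact.
Qed.

Lemma uniform_r x x' : x \in V -> x' \in V -> #|L x| = #|L x'|.
Proof.
move=> xV xV'; have [a aX <-] := verts_tr xV xV'.
by rewrite blocks_at_setact // card_setact.
Qed.

Lemma vr_3b v b r : has_vbr G P v b r -> (v * r = b * 3)%N.
Proof.
move=> [hv hb hr]; have [B BP] := P_nonempty.
rewrite -(hv B BP) -(hb B BP) -!sum_nat_const.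
have := rel_count B (nbr Q B) (fun x C => C \in L x).
rewrite (eq_bigr (fun=> r)) => [->|x xB].
  apply: eq_bigr => C; rewrite inE => BC; rewrite -(card_pts3 BC).
  by apply: eq_card => x; rewrite !inE.
rewrite -(hr x (block_sub BP xB)); apply: eq_card => C; rewrite inE.
by apply/andb_idl; apply: (subsetP (blocks_at_sub BP xB)).
Qed.

Local Notation XB B := ('N_X(B | to))%G.

Lemma stabB_P B a : reflect (a \in X /\ toB B a = B) (a \in XB B).
Proof.
rewrite /= -astab1_set; apply: (iffP setIP) => -[aX].
  by move/astab1P.
by move=> aB; split=> //; apply/astab1P.
Qed.

Lemma stabB_setwise B : 'C_X[B | toB] = 'N_X(B | to).
Proof. by rewrite astab1_set. Qed.

Lemma stabB_acts_nbr B : [acts XB B, on nbr Q B | toB].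
Proof.
apply: acts_onI => a C /stabB_P[aX aB].
by have := acts_adj quotient_acts B C aX; rewrite aB !inE => ->.
Qed.

Lemma stabB_acts B : [acts XB B, on B | to].
Proof. by apply: subsetIr. Qed.

Lemma stabB_tr B x y : B \in P -> x \in B -> y \in B -> exists2 a, a \in XB B & to x a = y.
Proof.
move=> BP xB yB; have [a aX xa] := verts_tr (block_sub BP xB) (block_sub BP yB).
exists a => //; apply/stabB_P; split=> //.
rewrite -(block_eq BP xB) -block_act ?(block_sub BP xB) // xa.
by rewrite (block_eq BP yB) (block_eq BP xB).
Qed.

Lemma stabB_nbr_tr B C D : C \in nbr Q B -> D \in nbr Q B ->
  exists2 a, a \in XB B & toB C a = D.
Proof.
rewrite !inE => BC BD; have [a aX [aB aC]] := quotient_arcs_tr BC BD.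
by exists a => //; apply/stabB_P.
Qed.

Lemma pts_act a B C : a \in X -> block_pts (toB B a) (toB C a) = toB (block_pts B C) a.
Proof.
move=> aX; apply/setP => x; rewrite -(actKV to a x) (mem_setactE to).
by rewrite [LHS]inE [RHS]inE (mem_setactE to) blocks_at_act.
Qed.

Lemma arc2_two_trans B : arc_transitive X toB 2 Q -> two_trans toB (XB B) (nbr Q B).
Proof.
case=> _ tr C D C' D'; rewrite !inE => BC BD BC' BD' CD CD'.
have [_ {}tr] := (transitive_Arc2 quotient_acts).1 tr.
rewrite adj_sym in BC; rewrite adj_sym in BC'.
have [a aX [aC aB aD]] := tr _ _ _ _ _ _ BC BD CD BC' BD' CD'.
by exists a => //; apply/stabB_P.
Qed.

Lemma val_ge2 B : B \in P -> 2 <= #|nbr Q B|.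
Proof. by move=> BP; have [b vb b2] := Ghat_val HG; rewrite vb. Qed.

Lemma two_trans_arc2 B : B \in P -> two_trans toB (XB B) (nbr Q B) ->
  arc_transitive X toB 2 Q.
Proof.
move=> BP tt; split; first exact: blocks_tr.
have bt := ((transitive_vset quotient_acts).1 blocks_tr).2.
apply/(transitive_Arc2 quotient_acts); split.
  have /card_gt0P[C CB] : 0 < #|nbr Q B| by have := val_ge2 BP; lia.
  have : 0 < #|nbr Q B :\ C| by have := val_ge2 BP; rewrite (cardsD1 C) CB; lia.
  case/card_gt0P=> D; rewrite !inE => /andP[DC BD]; rewrite inE in CB.
  by exists C, B, D; rewrite adj_sym eq_sym.
move=> C E D C' E' D' CE ED CD CE' ED' CD'.
have [a aX aE] := bt _ _ (adj_vset ED) BP; have [c cX cE] := bt _ _ (adj_vset ED') BP.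
have mem C1 E1 a1 : a1 \in X -> adj Q E1 C1 -> toB E1 a1 = B -> toB C1 a1 \in nbr Q B.
  by move=> a1X h <-; rewrite inE (acts_adj quotient_acts).
rewrite adj_sym in CE; rewrite adj_sym in CE'.
have [||d /stabB_P[dX dB] [d1 d2]] := tt _ _ _ _ (mem _ _ _ aX CE aE) (mem _ _ _ aX ED aE)
  (mem _ _ _ cX CE' cE) (mem _ _ _ cX ED' cE); rewrite ?(inj_eq (act_inj toB _)) //.
exists (a * d * c^-1); first by rewrite !groupM ?groupV.
by rewrite !actM aE dB d1 d2 -cE !actK.
Qed.

End Triple.

(* All fibres have the same size, which divides #|S|. *)
Lemma prime_fibres (aT : finGroupType) (U R : finType) (to : {action aT &-> U})
    (H : {group aT}) (S : {set U}) (f : U -> R) :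
  (forall x y, x \in S -> y \in S -> exists2 a, a \in H & to x a = y) ->
  (forall a x y, a \in H -> x \in S -> y \in S -> f x = f y -> f (to x a) = f (to y a)) ->
  (forall a x, a \in H -> x \in S -> to x a \in S) -> prime #|S| ->
  {in S &, injective f} \/ {in S &, forall x y, f x = f y}.
Proof.
move=> tr fH st pS; pose F x := [set y in S | f y == f x].
have /card_gt0P[x0 x0S] := prime_gt0 pS.
have leF x y : x \in S -> y \in S -> #|F x| <= #|F y|.
  move=> xS yS; have [a aH <-] := tr x y xS yS.
  rewrite -(card_imset (F x) (act_inj to a)) subset_leq_card //.
  apply/subsetP => _ /imsetP[z zF ->]; move: zF; rewrite !inE => /andP[zS /eqP e].
  by rewrite st //= (fH a z x).
have cF x : x \in S -> #|F x| = #|F x0| by move=> xS; apply/eqP; rewrite eqn_leq !leF.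
have : (#|S| = \sum_(z in f @: S) #|F x0|)%N.
  rewrite -sum1_card (partition_big_imset f) /=; apply: eq_bigr => z /imsetP[x xS ->].
  by rewrite -(cF x xS) -sum1dep_card.
rewrite sum_nat_const => e; have : #|F x0| %| #|S| by rewrite e dvdn_mull.
case/primeP: (pS) => _ h /h/orP[]/eqP c.
- left=> x y xS yS fxy; have /eqP/cards1P[z Fz] : #|F x| = 1%N by rewrite cF.
  have : x \in F x by rewrite inE xS eqxx.
  have : y \in F x by rewrite inE yS fxy eqxx.
  by rewrite Fz !inE => /eqP-> /eqP->.
- right=> x y xS yS; have FS : F x = S.
    by apply/eqP; rewrite eqEcard cF // c leqnn andbT; apply/subsetP => z; rewrite /F inE => /andP[].
  by move: (yS); rewrite -{1}FS inE => /andP[_ /eqP].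
Qed.

(** * Parameters of the design and comparison of its two kernels *)

Section Design.
Variables (aT : finGroupType) (T : finType) (G : graph T).
Variables (X : {group aT}) (to : {action aT &-> T}) (P : {set {set T}}).
Hypothesis HG : in_Ghat G X to P.
Hypothesis K3 : has_k G P 3.

Local Notation V := (vset G).
Local Notation Q := (quotient_graph G P).
Local Notation toB := (to^*)%act.
Local Notation pb := (pblock P).
Local Notation L := (blocks_at G P).
Local Notation XB B := ('N_X(B | to))%G.
Local Notation pts := (block_pts G P).

Let HX : acts_on_graph X to G := Ghat_acts HG.

Lemma pts_sub B C : pts B C \subset B.
Proof. by apply/subsetP => x; rewrite inE => /andP[]. Qed.

Lemma in_pts B C x : (x \in pts B C) = (x \in B) && (C \in L x).
Proof. by rewrite inE. Qed.

Lemma blocks_at_nbr B C x : B \in P -> x \in B -> C \in L x -> C \in nbr Q B.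
Proof. by move=> BP xB; apply: (subsetP (blocks_at_sub HG BP xB)). Qed.

Lemma has_v_card B : B \in P -> has_v P #|B|.
Proof. by move=> BP B' BP'; apply: (uniform_v HG). Qed.

Lemma has_r_card x : x \in V -> has_r G P #|L x|.
Proof. by move=> xV y yV; apply: (uniform_r HG). Qed.

Lemma has_b_card B : B \in P -> has_b G P #|nbr Q B|.
Proof. by move=> BP B' BP'; have [b vb _] := Ghat_val HG; rewrite !vb. Qed.

(** Any two ordered pairs of distinct elements are equivalent. The value 0 is returned when [S] has
    no such pair and the claim is empty. *)
Lemma two_trans_act2 (aT1 : finGroupType) (U : finType) (to1 : {action aT1 &-> U})
    (H : {group aT1}) (S : {set U}) (m : U -> U -> nat) :
  two_trans to1 H S ->
  (forall a x y, a \in H -> m (to1 x a) (to1 y a) = m x y) ->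
  exists l, {in S &, forall x y, x != y -> m x y = l}.
Proof.
move=> tt mH; case: (pickP [pred u : U * U | [&& u.1 \in S, u.2 \in S & u.1 != u.2]]).
  move=> [x y] /and3P[/= xS yS xy]; exists (m x y) => z t zS tS zt.
  by have [a aH [<- <-]] := tt _ _ _ _ xS yS zS tS xy zt; rewrite mH.
by move=> h; exists 0%N => x y xS yS xy; have := h (x, y); rewrite /= xS yS xy.
Qed.

Lemma constant_meet B : two_trans toB (XB B) (nbr Q B) ->
  exists l, {in nbr Q B &, forall C D, C != D -> #|pts B C :&: pts B D| = l}.
Proof.
move=> tt; apply: (two_trans_act2 tt) => a C D /stabB_P[aX aB].
rewrite -{1 2}aB !(pts_act HG) // -[RHS](card_imset _ (act_inj to a)).
by rewrite imsetI // => x y _ _ /act_inj.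
Qed.

(** The pairs of a point [x] of [C] and a further block [D] on [x] are counted by points and by
    blocks. *)
Lemma meet_count B C l v b r : B \in P -> C \in nbr Q B -> has_vbr G P v b r ->
  {in nbr Q B &, forall C D, C != D -> #|pts B C :&: pts B D| = l} ->
  (3 * (r - 1) = l * (b - 1))%N.
Proof.
move=> BP CN [_ hb hr] hl.
have := rel_count (pts B C) (nbr Q B :\ C) (fun x D => D \in L x).
rewrite (eq_bigr (fun=> (r - 1)%N)) => [|x]; last first.
  rewrite in_pts => /andP[xB CL]; rewrite -(hr x (block_sub HG BP xB)) (cardsD1 C (L x)) CL.
  rewrite addKn; apply: eq_card => D; rewrite in_setD1 in_set in_setD1 -andbA; congr (_ && _).
  by apply/andP/idP => [[]//|DL]; rewrite DL (blocks_at_nbr BP xB).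
rewrite sum_nat_const (card_pts3 K3); last by rewrite inE in CN.
move=> ->; rewrite (eq_bigr (fun=> l)) => [|D]; last first.
  rewrite in_setD1 => /andP[DC DN]; rewrite -(hl C D CN DN) 1?eq_sym //.
  by apply: eq_card => x; rewrite !inE; case: (x \in B); rewrite ?andbF.
by rewrite sum_nat_const mulnC -(hb B BP) (cardsD1 C (nbr Q B)) CN addKn.
Qed.

(** If two blocks shared three points, all blocks would have the same point set. Every point of [B]
    lies on some block, so that set would be [B], and [G] would be a multicover. *)
Lemma meet_lt3 B C D : two_trans toB (XB B) (nbr Q B) -> B \in P ->
  C \in nbr Q B -> D \in nbr Q B -> C != D -> #|pts B C :&: pts B D| < 3.
Proof.
move=> tt BP CN DN CD; have [l hl] := constant_meet tt; rewrite ltnNge; apply/negP => h3.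
have c3 E : E \in nbr Q B -> #|pts B E| = 3.
  by rewrite inE; apply: card_pts3.
have same E F : E \in nbr Q B -> F \in nbr Q B -> pts B E = pts B F.
  move=> EN FN; have [->//|EF] := eqVneq E F.
  have l3 : 3 <= #|pts B E :&: pts B F| by rewrite (hl E F) // -(hl C D).
  apply/eqP; rewrite eqEcard !c3 // leqnn andbT.
  suff <- : pts B E :&: pts B F = pts B E by apply: subsetIr.
  by apply/eqP; rewrite eqEcard subsetIl c3.
case: (Ghat_not_multicover HG) => B' C' BP' CN'.
have [a aX eB] := ((transitive_vset (quotient_acts HG)).1 (blocks_tr HG)).2 _ _ BP BP'.
rewrite (K3 BP' CN') -eB card_setact -(c3 C CN); congr #|pred_of_set _|.
apply/eqP; rewrite eqEsubset pts_sub; apply/subsetP => x xB.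
have [E EL] := blocks_at_nonempty HG (block_sub HG BP xB).
by rewrite (same C E CN (blocks_at_nbr BP xB EL)) in_pts xB.
Qed.

(* With blocks meeting in at most one point, the r blocks on a point x cover
   2 r further points. *)
Lemma meet1_bound B v b r : B \in P -> has_vbr G P v b r ->
  {in nbr Q B &, forall C D, C != D -> #|pts B C :&: pts B D| <= 1} -> (2 * r <= v - 1)%N.
Proof.
move=> BP [hv hb hr] hl; have [x xB] := block_nonempty HG BP.
have := rel_count (L x) (B :\ x) (fun C y => C \in L y).
rewrite (eq_bigr (fun=> 2)) => [|C CL]; last first.
  have CN := blocks_at_nbr BP xB CL; rewrite inE in CN.
  have := cardsD1 x (pts B C); rewrite in_pts xB CL (card_pts3 K3 CN) add1n => -[e].
  have -> // : [set y in B :\ x | C \in L y] = pts B C :\ x.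
  by apply/setP => y; rewrite in_set !in_setD1 in_pts andbA.
rewrite sum_nat_const mulnC (hr x (block_sub HG BP xB)) => ->.
rewrite -(hv B BP) (cardsD1 x B) xB addKn -sum1_card; apply: leq_sum => y.
rewrite in_setD1 => /andP[yx yB]; rewrite leqNgt; apply/negP => /card_gt1P[C [D [CL DL CD]]].
move: CL DL; rewrite inE => /andP[Cx Cy]; rewrite inE => /andP[Dx Dy].
have := hl C D (blocks_at_nbr BP xB Cx) (blocks_at_nbr BP xB Dx) CD.
rewrite leqNgt => /negP; apply; apply/card_gt1P; exists x, y.
by rewrite !in_setI !in_pts xB yB Cx Cy Dx Dy eq_sym.
Qed.

Lemma design_cases B : B \in P -> two_trans toB (XB B) (nbr Q B) ->
  exists v b r l, [/\ has_vbr G P v b r,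
    {in nbr Q B &, forall C D, C != D -> #|pts B C :&: pts B D| = l}
    & (v, b, r, l) \in [:: (4, 4, 3, 2); (6, 4, 2, 1); (7, 7, 3, 1); (3 * b, b, 1, 0)]%N].
Proof.
move=> BP tt; have [x xB] := block_nonempty HG BP.
have vbr : has_vbr G P #|B| #|nbr Q B| #|L x|.
  by split; [apply: has_v_card|apply: has_b_card|apply: has_r_card (block_sub HG BP xB)].
have [l hl] := constant_meet tt; have b2 := val_ge2 HG BP.
have /card_gt1P[C [D [CN DN CD]]] := b2.
have l3 := meet_lt3 tt BP CN DN CD; rewrite (hl C D) // in l3.
have e1 := meet_count BP CN vbr hl; have e2 := vr_3b HG K3 vbr.
exists #|B|, #|nbr Q B|, #|L x|, l; split=> //.
have r1 : 0 < #|L x|.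
  by have [E EL] := blocks_at_nonempty HG (block_sub HG BP xB); apply/card_gt0P; exists E.
have m1 : l <= 1 -> (2 * #|L x| <= #|B| - 1)%N.
  by move=> l1; apply: (meet1_bound BP vbr) => C' D' CN' DN' CD'; rewrite hl.
move: e1 e2 b2 r1 m1; rewrite {vbr}; move: #|B| #|nbr Q B| #|L x| => v b r e1 e2 b2 r1 m1.
rewrite !inE !xpair_eqE.
case: l l3 {hl} e1 m1 => [|[|[|//]]] _ e1 m1.
- have r1' : r = 1%N by lia.
  subst r.
  by apply/orP; right; apply/orP; right; apply/orP; right; rewrite !eqxx !andbT; apply/eqP; lia.
(* For [l = 1] one has [b = 3 r - 2] and [v r = 9 r - 6], so [r] divides 6; the bound [m1] excludes
   [(v, b, r) = (8, 16, 6)], and [b >= 2] excludes [r = 1]. *)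
- have v8 : v <= 8 by nia.
  do 9! [case: v v8 e2 m1 => [|v] // v8 e2 m1; try lia].
(* For [l = 2] one has [2 v r = 9 r - 3], so [r] divides 3, and [r = 1] would give [b = 1]. *)
- have v4 : v <= 4 by nia.
  do 5! [case: v v4 e2 m1 => [|v] // v4 e2 m1; try lia].
Qed.

Lemma vbr_unique v b r v' b' r' : has_vbr G P v b r -> has_vbr G P v' b' r' ->
  [/\ v = v', b = b' & r = r'].
Proof.
move=> [hv hb hr] [hv' hb' hr']; have [B BP] := P_nonempty HG.
have [x xB] := block_nonempty HG BP; have xV := block_sub HG BP xB.
by rewrite -(hv B BP) -(hv' B BP) -(hb B BP) -(hb' B BP) -(hr x xV) -(hr' x xV).
Qed.

Lemma design_meet B v b r : B \in P -> two_trans toB (XB B) (nbr Q B) -> has_vbr G P v b r ->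
  exists l, [/\
    {in nbr Q B &, forall C D, C != D -> #|pts B C :&: pts B D| = l}
    & (v, b, r, l) \in [:: (4, 4, 3, 2); (6, 4, 2, 1); (7, 7, 3, 1); (3 * b, b, 1, 0)]%N].
Proof.
move=> BP tt vbr; have [v' [b' [r' [l [vbr' hl mem]]]]] := design_cases BP tt.
by have [-> -> ->] := vbr_unique vbr vbr'; exists l.
Qed.

Lemma meet1_blocks_inj B : B \in P ->
  {in nbr Q B &, forall C D, C != D -> #|pts B C :&: pts B D| <= 1} ->
  (forall x, x \in V -> 2 <= #|L x|) -> {in B &, injective L}.
Proof.
move=> BP hl hr x y xB yB Lxy; apply/eqP; apply: contraT => xy.
have /card_gt1P[C [D [CL DL CD]]] := hr x (block_sub HG BP xB).
have := hl C D (blocks_at_nbr BP xB CL) (blocks_at_nbr BP xB DL) CD.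
rewrite leqNgt => /negP; case; apply/card_gt1P; exists x, y.
by rewrite !in_setI !in_pts xB yB -Lxy CL DL.
Qed.

Lemma meet_pts_inj B :
  {in nbr Q B &, forall C D, C != D -> #|pts B C :&: pts B D| < 3} ->
  {in nbr Q B &, injective (pts B)}.
Proof.
move=> hl C D CN DN e; apply/eqP; apply: contraT => CD; have := hl C D CN DN CD.
by rewrite -e setIid (card_pts3 K3) //; rewrite inE in CN.
Qed.

(** If [L x = L y] with [x] and [y] distinct, the block missed by [x] misses [y] too and holds at
    most two of the four points, although every block holds three. *)
Lemma missing1_blocks_inj B b : B \in P -> has_vbr G P 4 b b.-1 -> 1 < b ->
  {in B &, injective L}.
Proof.
move=> BP [hv hb hr] b1 x y xB yB Lxy; apply/eqP; apply: contraT => xy.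
have : #|nbr Q B :\: L x| = 1%N.
  have /setIidPr e := blocks_at_sub HG BP xB.
  by rewrite cardsD e hb // hr ?(block_sub HG BP xB) //; lia.
move/eqP/cards1P=> [C eC]; have : C \in nbr Q B :\: L x by rewrite eC set11.
rewrite in_setD => /andP[CL]; rewrite inE => /(card_pts3 K3) c3.
suff : #|pts B C| <= 2 by rewrite c3.
have <- : #|B :\ x :\ y| = 2.
  by have := cardsD1 x B; have := cardsD1 y (B :\ x);
     rewrite (hv B BP) xB !inE eq_sym xy yB /=; lia.
apply: subset_leq_card; apply/subsetP => z; rewrite in_pts => /andP[zB Cz].
rewrite !in_setD1 zB andbT; apply/andP; split; apply: contraNneq CL => ez; first by rewrite Lxy -ez.
by rewrite -ez.
Qed.

(** Fixing all points fixes each set [pts B C], hence each [C] when these sets differ; dually,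
    fixing all blocks fixes each [L x]. *)
Lemma kernelE B : B \in P -> {in B &, injective L} -> {in nbr Q B &, injective (pts B)} ->
  'C_X(B | to) = 'C_(XB B)(nbr Q B | toB).
Proof.
move=> BP Linj pinj; apply/setP => a; apply/setIP/setIP => -[aX /astabP fa].
  have aB : toB B a = B.
    apply/eqP; rewrite eqEcard card_setact leqnn andbT; apply/subsetP => _ /imsetP[x xB ->].
    by rewrite fa.
  have aS : a \in XB B by apply/stabB_P.
  split=> //; apply/astabP => C CN; have aCN : toB C a \in nbr Q B.
    by rewrite (acts_act (stabB_acts_nbr HG B)).
  apply: pinj => //; rewrite -{1}aB (pts_act HG) //; apply/setP => x.
  apply/idP/idP => [/imsetP[y yp ->]|xp]; first by rewrite fa ?(subsetP (pts_sub B C)).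
  by apply/imsetP; exists x; rewrite ?fa ?(subsetP (pts_sub B C)).
have /stabB_P[{}aX aB] := aX; split=> //; apply/astabP => x xB.
have xaB : to x a \in B by rewrite -aB mem_setactE.
apply: Linj => //; rewrite (blocks_at_setact HG) //; apply/setP => C.
apply/idP/idP => [/imsetP[D DL ->]|CL]; first by rewrite fa // (blocks_at_nbr BP xB).
by apply/imsetP; exists C; rewrite ?fa // (blocks_at_nbr BP xB).
Qed.

Lemma faithful_blocks : (forall B, B \in P -> {in B &, injective L}) -> [faithful X, on P | toB].
Proof.
move=> Linj; apply/faithfulP => a aX fa'.
have fa D : D \in P -> toB D a = D by move/fa'.
have /faithfulP := Ghat_faithful HG; apply=> // x xV /=.
have bP := block_in HG xV; have xb := mem_block HG xV.
have xab : to x a \in pb x by rewrite -(fa _ bP) mem_setactE.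
apply: (Linj _ bP) => //; rewrite (blocks_at_setact HG) //; apply/setP => C.
have LP D : D \in L x -> D \in P by rewrite inE => /andP[].
apply/idP/idP => [/imsetP[D DL ->]|CL]; first by rewrite fa // LP.
by apply/imsetP; exists C; rewrite ?fa // LP.
Qed.

End Design.

(** * From the induced groups to 2-arc-transitivity and back *)

Section LocalActions.
Variables (aT : finGroupType) (T : finType) (G : graph T).
Variables (X : {group aT}) (to : {action aT &-> T}) (P : {set {set T}}).
Hypothesis HG : in_Ghat G X to P.
Hypothesis K3 : has_k G P 3.

Local Notation V := (vset G).
Local Notation Q := (quotient_graph G P).
Local Notation toB := (to^*)%act.
Local Notation pb := (pblock P).
Local Notation L := (blocks_at G P).
Local Notation XB B := ('N_X(B | to))%G.
Local Notation pts := (block_pts G P).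

Let HX : acts_on_graph X to G := Ghat_acts HG.

Lemma kernel_block B : 'C_(XB B)(B | to) = 'C_X(B | to).
Proof. by rewrite /= -setIA (setIidPr (astab_sub to B)). Qed.

(** Parameters with [r >= 2] leave either [l <= 1], where two points share at most one block, or
    [(4,4,3)], where every point misses just one block. *)
Lemma arc2_blocks_inj r : arc_transitive X toB 2 Q -> has_r G P r -> 2 <= r ->
  forall B, B \in P -> {in B &, injective L}.
Proof.
move=> a2 hr r2 B BP; have tt := arc2_two_trans HG a2 (B := B).
have [v [b [r' [l [vbr hl mem]]]]] := design_cases HG K3 BP tt.
have [x xB] := block_nonempty HG BP; have xV := block_sub HG BP xB.
have [hv hb hr'] := vbr; have rr : r' = r by rewrite -(hr x xV) hr'.
move: mem; rewrite rr in vbr hr' *; rewrite !inE !xpair_eqE => mem.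
have : l <= 1 \/ [/\ v = 4, b = 4 & r = 3].
  by case/or4P: mem => /andP[/andP[/andP[/eqP e1 /eqP e2] /eqP e3] /eqP->]; [right|left|left|left].
case=> [l1|[e1 e2 e3]].
  apply: (meet1_blocks_inj HG BP) => [C D CN DN CD|y yV]; first by rewrite hl.
  by rewrite hr.
by apply: (missing1_blocks_inj HG K3 (b := 4) BP) => //; rewrite -{1}e1 -{1}e2 -e3.
Qed.

Lemma arc2_pts_inj B : arc_transitive X toB 2 Q -> B \in P -> {in nbr Q B &, injective (pts B)}.
Proof.
move=> a2 BP; apply: (meet_pts_inj K3) => C D CN DN CD.
exact: (meet_lt3 HG K3 (arc2_two_trans HG a2 (B := B))).
Qed.

Lemma arc2_kernel r B : arc_transitive X toB 2 Q -> has_r G P r -> 2 <= r -> B \in P ->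
  'C_X(B | to) = 'C_(XB B)(nbr Q B | toB).
Proof.
move=> a2 hr r2 BP; apply: (kernelE HG BP); first exact: (arc2_blocks_inj a2 hr r2 BP).
exact: arc2_pts_inj.
Qed.

Lemma arc2_faithful r : arc_transitive X toB 2 Q -> has_r G P r -> 2 <= r ->
  [faithful X, on P | toB].
Proof. by move=> a2 hr r2; apply: (faithful_blocks HG) => B; apply: arc2_blocks_inj hr r2 B. Qed.

(** This serves the converse, where 2-arc-transitivity is not yet known. Two blocks with the same
    three points would both miss the fourth point, leaving it on at most two blocks. *)
Lemma missing1_pts_inj B : B \in P -> has_vbr G P 4 4 3 -> {in nbr Q B &, injective (pts B)}.
Proof.
move=> BP [hv hb hr] C D CN DN e; apply/eqP; apply: contraT => CD.
have c3 : #|pts B C| = 3 by rewrite (card_pts3 K3) //; rewrite inE in CN.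
have : #|B :\: pts B C| = 1%N.
  by rewrite cardsD (setIidPr (pts_sub _ _ _ _)) hv // c3.
move/eqP/cards1P=> [x ex]; have : x \in B :\: pts B C by rewrite ex set11.
rewrite in_setD => /andP[xC xB]; have xD : x \notin pts B D by rewrite -e.
have : #|L x| <= #|nbr Q B :\ C :\ D|.
  apply: subset_leq_card; apply/subsetP => E EL; rewrite !in_setD1 (blocks_at_nbr HG BP xB EL) andbT.
  apply/andP; split; first by apply: contraNneq xD => <-; rewrite in_pts xB.
  by apply: contraNneq xC => <-; rewrite in_pts xB.
rewrite hr ?(block_sub HG BP xB) //.
have := cardsD1 C (nbr Q B); have := cardsD1 D (nbr Q B :\ C).
by rewrite (hb B BP) in_setD1 DN CN eq_sym CD /=; lia.
Qed.

Lemma case_a_arc2 B : B \in P -> case_a G X to P B -> arc_transitive X toB 2 Q.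
Proof.
move=> BP [vbr iso]; apply: (two_trans_arc2 HG BP).
have ke := kernelE HG BP (missing1_blocks_inj HG K3 BP vbr isT) (missing1_pts_inj BP vbr).
have [_ hb _] := vbr.
apply: (two_trans_of_order3 (stabB_acts_nbr HG B)); first exact: hb.
  exact: (stabB_nbr_tr HG).
by rewrite -ke; apply: A4_S4_order iso.
Qed.

(** Without the prime 3 the group on the four blocks has order dividing 8. The exponent 16 is a
    multiple of 8 congruent to 1 modulo 3, so it leaves elements of order 3 as they are. *)
Lemma power16 B a : #|nbr Q B| = 4 -> ~~ (3 %| #|XB B / 'C_(XB B)(nbr Q B | toB)|) ->
  a \in XB B -> a ^+ 16 \in 'C_(XB B)(nbr Q B | toB).
Proof.
move=> c4 n3 aX; have [e [rho [ei eS eT rE kr]]] := perm_rep (stabB_acts_nbr HG B) c4.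
have iso : XB B / 'C_(XB B)(nbr Q B | toB) \isog rho @* XB B by rewrite -kr; apply: first_isog.
rewrite (card_isog iso) in n3.
have d8 : #|rho @* XB B| %| 8.
  rewrite -(@Gauss_dvdl _ 8 3); last by rewrite coprime_sym prime_coprime.
  by rewrite -[(8 * 3)%N]card_Sym4 cardSg ?subsetT.
rewrite -kr; apply/kerP; first exact: groupX.
rewrite morphX //; have ra : rho a \in rho @* XB B by apply: mem_morphim.
by apply/eqP; rewrite -order_dvdn (dvdn_trans (order_dvdG ra)) // (dvdn_trans d8).
Qed.

(** It suffices that 3 divides the order of the group on the four blocks. Otherwise elements of
    order 3 in the group on [B] have representatives that fix every block, and these commute on each
    triple [pts B C], hence on [B], contrary to the structure of [A_4] and [S_4]. *)
Lemma case_b_arc2 B : B \in P -> case_b G X to P B -> arc_transitive X toB 2 Q.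
Proof.
move=> BP [[hv hb hr] iso]; apply: (two_trans_arc2 HG BP).
apply: (two_trans_of_order3 (stabB_acts_nbr HG B)); first exact: hb.
  exact: (stabB_nbr_tr HG).
apply: contraT => n3.
have nK : 'C_X(B | to) <| XB B by rewrite -kernel_block; apply: normal_astab (stabB_acts X to B).
have [u0 [v0 [uH vH u3 v3 nuv]]] := A4_S4_noncommuting iso.
(* The 16th power of a representative lies in the same coset and is trivial on the blocks. *)
have lift u1 : u1 \in (XB B / 'C_X(B | to))%g -> u1 ^+ 3 = 1 ->
    exists u, [/\ u \in 'C_(XB B)(nbr Q B | toB), u \in XB B, u ^+ 3 \in 'C_X(B | to)
       & coset 'C_X(B | to) u = u1].
  case/morphimP=> a aN aX /= -> a3; exists (a ^+ 16).
  have cK : coset 'C_X(B | to) (a ^+ 16) = coset 'C_X(B | to) a.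
    by rewrite morphX // -[16]/(3 * 5 + 1)%N expgD expgM a3 expg1n mul1g expg1.
  split=> //; first exact: power16 (hb B BP) n3 aX.
    exact: groupX.
  by apply: coset_idr; rewrite ?groupX // morphX ?groupX //= cK.
have [u [uK uX u3' ue]] := lift _ uH u3; have [v [vK vX v3' ve]] := lift _ vH v3.
case: nuv; rewrite -ue -ve; have /andP[_ /subsetP nKX] := nK.
rewrite -!morphM ?nKX //; apply/esym.
apply/rcoset_kercosetP; rewrite ?groupM ?nKX //.
rewrite mem_rcoset; have XBX : {subset XB B <= X} by apply/subsetP/subsetIl.
apply/setIP; split; first by rewrite !(groupM, groupV) ?XBX.
apply/astabP => x xB.
suff e : to x (v * u) = to x (u * v) by rewrite actM e actK.
have [C CL] := blocks_at_nonempty HG (block_sub HG BP xB).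
have xC : x \in pts B C by rewrite in_pts xB.
have CN := blocks_at_nbr HG BP xB CL.
(* Being trivial on the blocks, [u] and [v] preserve the three points of [pts B C], where their
   cubes are trivial. *)
apply: (@commute_on3 _ _ to ('C_(XB B)(nbr Q B | toB))%G (pts B C)) => //.
- apply: acts_onI => a y /setIP[/stabB_P[aX aB] /astabP/(_ C CN) aC]. move=> yC.
  by rewrite -aB -aC (pts_act HG) // mem_setactE.
- by rewrite inE in CN; apply: (card_pts3 K3).
- by move=> y /(subsetP (pts_sub _ _ _ _)) yB; move: v3' => /setIP[_ /astabP]; apply.
- by move=> y /(subsetP (pts_sub _ _ _ _)) yB; move: u3' => /setIP[_ /astabP]; apply.
Qed.

(** Seven is prime, so [L] is injective or constant on [B]; were it constant, each point would lie
    on all seven blocks, against [r = 3]. *)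
Lemma blocks_inj7 B : B \in P -> has_vbr G P 7 7 3 -> {in B &, injective L}.
Proof.
move=> BP [hv hb hr].
have [||||//|const] := @prime_fibres _ _ _ to (XB B) B L.
- by move=> x y; apply: (stabB_tr HG).
- move=> a x y /stabB_P[aX _] xB yB e.
  by rewrite !(blocks_at_setact HG) // e.
- by move=> a x /stabB_P[aX aB] xB; rewrite -aB mem_setactE.
- by rewrite hv.
have [x xB] := block_nonempty HG BP.
have : nbr Q B \subset L x.
  apply/subsetP => C; rewrite inE => BC; have /card_gt0P[y] : 0 < #|pts B C| by rewrite (card_pts3 K3).
  by rewrite in_pts => /andP[yB]; rewrite (const x y).
by move/subset_leq_card; rewrite (hb B BP) hr ?(block_sub HG BP xB).
Qed.

Lemma pts_inj7 B : B \in P -> has_vbr G P 7 7 3 -> {in nbr Q B &, injective (pts B)}.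
Proof.
move=> BP [hv hb hr].
have [||||//|const] := @prime_fibres _ _ _ toB (XB B) (nbr Q B) (pts B).
- by move=> C D; apply: (stabB_nbr_tr HG).
- move=> a C D /stabB_P[aX aB] CN DN e.
  by rewrite -aB !(pts_act HG) // e.
- by move=> a C aX CN; rewrite (acts_act (stabB_acts_nbr HG B)).
- by rewrite (hb B BP).
have /card_gt0P[C CN] : 0 < #|nbr Q B| by rewrite (hb B BP).
have : B \subset pts B C.
  apply/subsetP => x xB; have [D DL] := blocks_at_nonempty HG (block_sub HG BP xB).
  by rewrite (const C D) ?in_pts ?xB // (blocks_at_nbr HG BP xB).
by move/subset_leq_card; rewrite (hv B BP) (card_pts3 K3) //; rewrite inE in CN.
Qed.

Lemma case_c_arc2 B : B \in P -> case_c G X to P B -> arc_transitive X toB 2 Q.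
Proof.
move=> BP [vbr]; rewrite /stab_induced (kernelE HG BP (blocks_inj7 BP vbr) (pts_inj7 BP vbr)) => iso.
apply: (two_trans_arc2 HG BP); have [_ hb _] := vbr.
have [e [th lab]] := PSL_labelling (stabB_acts_nbr HG B) (hb B BP) (stabB_nbr_tr HG (B := B)) iso.
exact: (labelling_two_trans (stabB_acts_nbr HG B) lab).
Qed.

Lemma dtuple2E (U : finType) (S : {set U}) x y :
  ([tuple x; y] \in dtuple_on 2 S) = [&& x \in S, y \in S & x != y].
Proof. by rewrite inE memtE subset_all /= inE !andbT andbC -andbA. Qed.

Lemma transitive2_two_trans (gT : finGroupType) (U : finType) (tu : {action gT &-> U})
    (H : {group gT}) (S : {set U}) : [acts H, on S | tu] -> 1 < #|S| ->
  ([transitive^2 H, on S | tu] <-> two_trans tu H S).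
Proof.
move=> HS c2; split=> [tr x y x' y' xS yS xS' yS' xy xy'|tt].
  have xyD : [tuple x; y] \in dtuple_on 2 S by rewrite dtuple2E xS yS.
  have xyD' : [tuple x'; y'] \in dtuple_on 2 S by rewrite dtuple2E xS' yS'.
  have [a aH] := atransP2 tr xyD xyD'.
  by move/(congr1 val) => /= [-> ->]; exists a.
have /card_gt1P[x [y [xS yS xy]]] := c2.
apply/imsetP; exists [tuple x; y]; first by rewrite dtuple2E xS yS.
apply/setP => t; have [x' [y' ->]] := tuple2P t; rewrite dtuple2E; apply/idP/orbitP => [|[a aH]].
  case/and3P=> xS' yS' xy'; have [a aH [ax ay]] := tt x y x' y' xS yS xS' yS' xy xy'.
  by exists a => //; apply: val_inj; rewrite /= ax ay.
move/(congr1 val) => /= [<- <-].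
by rewrite !(acts_act HS) // xS yS (inj_eq (act_inj tu a)).
Qed.

Lemma case_d_arc2 B : B \in P -> case_d G X to P B -> arc_transitive X toB 2 Q.
Proof.
move=> BP [_ tr]; apply: (two_trans_arc2 HG BP).
exact/(transitive2_two_trans (stabB_acts_nbr HG B) (val_ge2 HG BP)).
Qed.

(* The third block on the common point of C and D. *)
Definition third_block (B C D : {set T}) : {set T} :=
  odflt set0 [pick E | [&& E != C, E != D
    & [exists x in B, [&& C \in L x, D \in L x & E \in L x]]]].

Lemma third_blockC B C D : third_block B C D = third_block B D C.
Proof.
congr odflt; apply: eq_pick => E /=; rewrite andbCA; do 2 congr (_ && _).
by apply: eq_existsb => x; congr (_ && _); rewrite andbCA.
Qed.

(** Since [C] and [D] have the single common point [x], the existential in [third_block] can only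
    refer to [x], and [r = 3] leaves one further block there. *)
Lemma third_blockP B C D x : B \in P -> has_r G P 3 ->
  {in nbr Q B &, forall C D, C != D -> #|pts B C :&: pts B D| = 1%N} ->
  x \in B -> C \in L x -> D \in L x -> C != D ->
  forall E, (E == third_block B C D) = [&& E \in L x, E != C & E != D].
Proof.
move=> BP hr h1 xB Cx Dx CD.
have ux y : y \in B -> C \in L y -> D \in L y -> y = x.
  move=> yB Cy Dy; have /eqP/cards1P[z ez] := h1 C D (blocks_at_nbr HG BP xB Cx) (blocks_at_nbr HG BP xB Dx) CD.
  have : y \in pts B C :&: pts B D by rewrite in_setI !in_pts yB Cy Dy.
  have : x \in pts B C :&: pts B D by rewrite in_setI !in_pts xB Cx Dx.
  by rewrite ez !in_set1 => /eqP-> /eqP->.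
have /eqP/cards1P[F eF] : #|L x :\ C :\ D| = 1%N.
  have := cardsD1 C (L x); have := cardsD1 D (L x :\ C).
  by rewrite in_setD1 Cx Dx eq_sym CD hr ?(block_sub HG BP xB) //=; lia.
have F1 E : (E == F) = [&& E \in L x, E != C & E != D].
  by rewrite -in_set1 -eF !in_setD1 andbC -andbA andbCA.
suff -> : third_block B C D = F by exact: F1.
rewrite /third_block; case: pickP => [E /and3P[EC ED h]|].
  have {h} /existsP[y /andP[yB /and3P[Cy Dy Ey]]] := h.
  by apply/eqP; rewrite /= F1 EC ED -(ux y) ?Ey.
have /esym := F1 F; rewrite eqxx => /and3P[Fx FC FD] /(_ F).
by rewrite FC FD /= => /existsP; case; exists x; rewrite xB Cx Dx.
Qed.

(** Any two blocks meet in one point, which lies on three blocks, so [third_block] is a Steiner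
    triple system on the seven blocks preserved by a 2-transitive group. *)
Lemma arc2_case_c B : B \in P -> arc_transitive X toB 2 Q -> has_vbr G P 7 7 3 ->
  stab_induced X to B \isog PSL 3 2.
Proof.
move=> BP a2 vbr; have [_ hb hr] := vbr; have tt := arc2_two_trans HG a2 (B := B).
have [l [hl mem]] := design_meet HG K3 BP tt vbr.
have l1 : l = 1%N by move: mem; rewrite !inE !xpair_eqE /= ?orbF => /eqP.
rewrite {}l1 {mem} in hl.
rewrite /stab_induced (arc2_kernel a2 hr isT BP).
have com C D : C \in nbr Q B -> D \in nbr Q B -> C != D -> exists x, [/\ x \in B, C \in L x & D \in L x].
  move=> CN DN CD; have /eqP/cards1P[x ex] := hl C D CN DN CD.
  have : x \in pts B C :&: pts B D by rewrite ex set11.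
  by rewrite in_setI !in_pts => /andP[/andP[xB Cx] /andP[_ Dx]]; exists x.
have tP := third_blockP BP hr hl.
have tPe C D x : x \in B -> C \in L x -> D \in L x -> C != D ->
    [/\ third_block B C D \in L x, third_block B C D != C & third_block B C D != D].
  by move=> xB Cx Dx CD; apply/and3P; rewrite -tP.
apply: (@steiner_two_trans_PSL _ _ toB (XB B) (nbr Q B) (third_block B)) => //.
- exact: (stabB_acts_nbr HG).
- exact: hb.
- move=> C D CN DN CD; have [x [xB Cx Dx]] := com C D CN DN CD.
  by have [h1 h2 _] := tPe _ _ _ xB Cx Dx CD; split=> //; apply: (blocks_at_nbr HG BP xB).
- by move=> C D; apply: third_blockC.
- move=> C D CN DN CD; have [x [xB Cx Dx]] := com C D CN DN CD.
  have [h1 h2 h3] := tPe _ _ _ xB Cx Dx CD; apply/esym/eqP; rewrite eq_sym in h2.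
  by rewrite (tP _ _ _ xB Cx h1 h2) Dx eq_sym CD eq_sym h3.
- move=> a C D aX CN DN CD; have [x [xB Cx Dx]] := com C D CN DN CD.
  have [h1 h2 h3] := tPe _ _ _ xB Cx Dx CD; move/stabB_P: aX => [aX aB].
  have xa : to x a \in B by rewrite -aB mem_setactE.
  apply/esym/eqP; rewrite (tP _ _ _ xa) ?(blocks_at_act HG) ?(inj_eq (act_inj toB a)) //.
  by rewrite h1 h2 h3.
Qed.

Lemma two_arc_transitive_cases B : B \in P ->
  arc_transitive X toB 2 Q <->
  [\/ case_a G X to P B, case_b G X to P B, case_c G X to P B | case_d G X to P B].
Proof.
move=> BP; split; last first.
  case; [exact: case_a_arc2|exact: case_b_arc2|exact: case_c_arc2|exact: case_d_arc2].
move=> a2; have tt := arc2_two_trans HG a2 (B := B).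
have [v [b [r [l [vbr hl]]]]] := design_cases HG K3 BP tt; have [hv hb hr] := vbr.
rewrite !inE !xpair_eqE => /or4P[]/andP[/andP[/andP[/eqP ev /eqP eb] /eqP er] _]; subst.
- apply: Or41; split=> //; rewrite /stab_induced (arc2_kernel a2 hr isT BP).
  exact: two_trans_A4_S4 (stabB_acts_nbr HG B) (hb B BP) tt.
- apply: Or42; split=> //; rewrite /stab_induced (arc2_kernel a2 hr isT BP).
  exact: two_trans_A4_S4 (stabB_acts_nbr HG B) (hb B BP) tt.
- by apply: Or43; split=> //; apply: arc2_case_c.
- apply: Or44; split; first by exists b; split=> //; have := val_ge2 HG BP; rewrite (hb B BP); lia.
  exact/(transitive2_two_trans (stabB_acts_nbr HG B) (val_ge2 HG BP)).
Qed.

End LocalActions.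

(** * The bipartite graphs between two blocks *)

(** A common model: equality, inequality and the full relation as [R] give the three possible graphs
    between two blocks. *)
Definition bip3 (R : rel 'I_3) : graph (bool * 'I_3)%type :=
  simple_graph setT (fun p q => (p.1 != q.1) && R p.2 q.2).

Lemma bip3_adjE (R : rel 'I_3) : symmetric R -> forall p q,
  adj (bip3 R) p q = (p.1 != q.1) && R p.2 q.2.
Proof.
move=> sR p q; rewrite simple_adjE !inE [q.1 == _]eq_sym [R q.2 _]sR orbb /=.
by rewrite andb_idl // => /andP[pq _]; apply: contraNneq pq => ->.
Qed.

Lemma bip3_3K2 : bip3 (fun i j => i == j) ~=g copies 3 (complete 2).
Proof.
exists (fun p => (p.2, if p.1 then ord0 else ord_max : 'I_2)); split.
- by move=> [[] i] [[] j] _ _ [] ->.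
- apply/setP => -[i j]; rewrite !inE /=; apply/imsetP.
  exists (j == ord0, i) => //=; congr pair.
  by case: j => [[|[|//]] ?]; apply: val_inj.
- move=> p q _ _; rewrite copies_adjE bip3_adjE => [|i j]; last exact: eq_sym.
  rewrite /= /sg_adj !inE /= andbC; congr (_ && _).
  by case: p.1; case: q.1.
Qed.

Lemma bip3_K33 : bip3 (fun _ _ => true) ~=g K33.
Proof.
exists id; split=> //; first by rewrite imset_id.
by move=> p q _ _; rewrite /= /sg_adj !andbT.
Qed.

Section Bipartite.
Variable T : finType.

(** Numbers the two sides compatibly with a perfect matching; it is applied to adjacency for valency
    1 and to non-adjacency for valency 2. *)
Lemma matching_enum n (A A' : {set T}) (M : rel T) : #|A| = n.+1 ->
  (forall x, x \in A -> #|[set y in A' | M x y]| = 1%N) ->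
  (forall y, y \in A' -> #|[set x in A | M x y]| = 1%N) ->
  exists e e' : 'I_n.+1 -> T, [/\ injective e, injective e', forall i, e i \in A,
    forall i, e' i \in A' & forall i j, M (e i) (e' j) = (i == j)].
Proof.
move=> cA h1 h2; have [e [f [eK eA fK]]] := enum_set_bij cA.
pose e' i := odflt (e i) [pick y in A' | M (e i) y].
have e'P i : e' i \in A' /\ M (e i) (e' i).
  rewrite /e'; case: pickP => [y /andP[]|none] //.
  have /card_gt0P[y] : 0 < #|[set y in A' | M (e i) y]| by rewrite h1.
  by rewrite inE none.
have u x x' y : x \in A -> x' \in A -> y \in A' -> M x y -> M x' y -> x = x'.
  move=> xA xA' yA Mx Mx'; have /eqP/cards1P[z ez] := h2 y yA.
  have : x \in [set x in A | M x y] by rewrite inE xA.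
  have : x' \in [set x in A | M x y] by rewrite inE xA'.
  by rewrite ez !in_set1 => /eqP-> /eqP->.
exists e, e'; split=> //.
- exact: can_inj eK.
- move=> i j e'ij; apply: (can_inj eK); have [iA Mi] := e'P i; have [jA Mj] := e'P j.
  by apply: (u _ _ (e' i)) => //; rewrite e'ij.
- by move=> i; have [] := e'P i.
- move=> i j; have [jA Mj] := e'P j; apply/idP/eqP => [Mij|->//].
  exact/(can_inj eK)/(u _ _ (e' j)).
Qed.

Variables (H : graph T) (A A' : {set T}).
Hypothesis cA : #|A| = 3.
Hypothesis cA' : #|A'| = 3.
Hypothesis dis : forall x, x \in A -> x \in A' -> False.
Hypothesis VH : vset H = A :|: A'.
Hypothesis bipA : forall x y, adj H x y -> x \in A -> y \in A'.
Hypothesis bipA' : forall x y, adj H x y -> x \in A' -> y \in A.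

Lemma bip3_giso (R : rel 'I_3) (e e' : 'I_3 -> T) : symmetric R ->
  injective e -> injective e' -> (forall i, e i \in A) -> (forall i, e' i \in A') ->
  (forall i j, adj H (e i) (e' j) = R i j) -> H ~=g bip3 R.
Proof.
move=> sR ei ei' eA eA' eR; apply: (giso_sym (false, ord0)).
have im (B : {set T}) (g : 'I_3 -> T) : #|B| = 3 -> injective g -> (forall i, g i \in B) ->
    g @: setT = B.
  move=> cB gi gB; apply/eqP; rewrite eqEcard card_imset // cardsT card_ord cB leqnn andbT.
  by apply/subsetP => _ /imsetP[i _ ->].
exists (fun p : bool * 'I_3 => if p.1 then e' p.2 else e p.2); split.
- move=> [[] i] [[] j] _ _ /= h.
  + by rewrite (ei' _ _ h).
  + by case: (@dis (e j)); rewrite ?eA // -h.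
  + by case: (@dis (e i)); rewrite ?eA // h.
  + by rewrite (ei _ _ h).
- apply/setP => x; rewrite VH -(im _ _ cA ei eA) -(im _ _ cA' ei' eA').
  apply/imsetP/setUP => [[[[] i] _ ->]|[] /imsetP[i _ ->]].
  + by right; apply: imset_f.
  + by left; apply: imset_f.
  + by exists (false, i).
  + by exists (true, i).
- move=> [[] i] [[] j] _ _; rewrite bip3_adjE //=.
  + by apply: contraTF (eA' j) => /bipA' /(_ (eA' i)) h; apply/negP => /dis; apply.
  + by rewrite adj_sym eR sR.
  + by apply: contraTF (eA j) => /bipA /(_ (eA i)) h; apply/negP => /dis; apply.
Qed.

Lemma regular_bip3 d : (forall x, x \in vset H -> #|nbr H x| = d) -> 0 < d ->
  [\/ d = 1%N /\ H ~=g copies 3 (complete 2), d = 2 /\ H ~=g K33_minus_3K2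
    | d = 3 /\ H ~=g K33].
Proof.
move=> vd d0.
have nA x : x \in A -> nbr H x \subset A'.
  by move=> xA; apply/subsetP => y; rewrite inE => /bipA; apply.
have nA' x : x \in A' -> nbr H x \subset A.
  by move=> xA; apply/subsetP => y; rewrite inE => /bipA'; apply.
have dA x : x \in A -> #|nbr H x| = d by move=> xA; rewrite vd // VH inE xA.
have dA' x : x \in A' -> #|nbr H x| = d by move=> xA; rewrite vd // VH inE xA orbT.
have d3 : d <= 3.
  have /card_gt0P[x xA] : 0 < #|A| by rewrite cA.
  by rewrite -(dA x xA) -cA' subset_leq_card ?nA.
have : [\/ d = 1%N, d = 2 | d = 3].
  by case: d d0 d3 {vd dA dA'} => [|[|[|[|//]]]] // _ _; [apply: Or31|apply: Or32|apply: Or33].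
case=> dE; rewrite dE in dA dA'.
- apply: Or31; split=> //; apply: giso_trans bip3_3K2.
  have [||e [e' [ei ei' eA eA' eM]]] := @matching_enum 2 A A' (adj H) cA.
  + move=> x xA; rewrite -(dA x xA); apply: eq_card => y; rewrite !inE.
    by apply: andb_idl => xy; apply: bipA xy xA.
  + move=> y yA; rewrite -(dA' y yA); apply: eq_card => x; rewrite !inE [adj H y x]adj_sym.
    by apply: andb_idl; rewrite adj_sym => xy; apply: bipA' xy yA.
  by apply: (bip3_giso _ ei ei') => // i j; apply: eq_sym.
- apply: Or32; split=> //.
  (* With valency 2 between sides of size 3, every vertex has exactly one non-neighbour on the other
     side. *)
  have [||e [e' [ei ei' eA eA' eM]]] := @matching_enum 2 A A' (fun x y => ~~ adj H x y) cA.
  + move=> x xA; have e1 : #|A' :\: nbr H x| = 1%N by rewrite cardsD (setIidPr (nA x xA)) dA // cA'.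
    by rewrite -[RHS]e1; apply: eq_card => y; rewrite !inE andbC.
  + move=> y yA; have e1 : #|A :\: nbr H y| = 1%N by rewrite cardsD (setIidPr (nA' y yA)) dA' // cA.
    by rewrite -[RHS]e1; apply: eq_card => x; rewrite !inE andbC adj_sym.
  apply: (@bip3_giso (fun i j => i != j) _ _ _ ei ei') => // [i j|i j]; first by rewrite eq_sym.
  by rewrite -eM negbK.
- apply: Or33; split=> //; apply: giso_trans bip3_K33.
  have [e [f [eK eA _]]] := enum_set_bij cA; have [e' [f' [eK' eA' _]]] := enum_set_bij cA'.
  apply: (bip3_giso _ (can_inj eK) (can_inj eK')) => // i j.
  have : e' j \in nbr H (e i) by have /eqP -> : nbr H (e i) == A' by rewrite eqEcard nA // dA // cA'.
  by rewrite inE.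
Qed.

End Bipartite.

Section Between.
Variables (aT : finGroupType) (T : finType) (G : graph T).
Variables (X : {group aT}) (to : {action aT &-> T}) (P : {set {set T}}).
Hypothesis HG : in_Ghat G X to P.
Hypothesis K3 : has_k G P 3.

Local Notation V := (vset G).
Local Notation Q := (quotient_graph G P).
Local Notation toB := (to^*)%act.
Local Notation pb := (pblock P).
Local Notation L := (blocks_at G P).
Local Notation XB B := ('N_X(B | to))%G.
Local Notation pts := (block_pts G P).

Let HX : acts_on_graph X to G := Ghat_acts HG.

(** The valency of [between G B C], read off at a flag; transitivity on flags makes it constant. *)
Definition has_d d := 0 < d /\ forall x C, C \in L x -> #|nbr G x :&: C| = d.

Lemma has_d_exists : exists d, has_d d.
Proof.
have [B BP] := P_nonempty HG; have [x xB] := block_nonempty HG BP.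
have [C CL] := blocks_at_nonempty HG (block_sub HG BP xB).
exists #|nbr G x :&: C|; split.
  have /(blocks_atP HG)[y xy yC] := CL; apply/card_gt0P; exists y.
  by rewrite !inE xy -yC (mem_block HG) ?(adj_vset_r xy).
move=> x' C' CL'; have [a aX [<- <-]] := flag_tr HG CL CL'.
rewrite -[RHS](card_imset _ (act_inj to a)); apply: eq_card => z; rewrite -(actKV to a z).
rewrite (mem_imset _ _ (act_inj to a)) !in_setI (mem_setactE to); congr (_ && _).
by rewrite !inE (acts_adj HX).
Qed.

Lemma nbr_block_eq (B C : {set T}) x : C \in P -> x \in B -> B \in P -> nbr G x :&: C = nbr G x :&: pts C B.
Proof.
move=> CP xB BP; apply/setP => y; rewrite !in_setI in_pts inE.
case xy : (adj G x y) => //=; apply/idP/andP => [yC|[]//]; split=> //.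
by apply/(blocks_atP HG); exists x; rewrite 1?adj_sym ?(block_eq HG BP).
Qed.

Variables (d : nat).
Hypothesis Hd : has_d d.

Lemma val_rd r : has_r G P r -> has_val G (r * d).
Proof.
move=> hr x xV; rewrite -(hr x xV) -sum1_card.
rewrite (partition_big pb (mem (L x))) /=; last first.
  by move=> y; rewrite inE => xy; apply/(blocks_atP HG); exists y.
rewrite -sum_nat_const; apply: eq_bigr => C CL; rewrite -((Hd).2 x C CL) -sum1_card.
apply: eq_bigl => y; rewrite in_setI; case yN : (y \in nbr G x) => //=.
have xy : adj G x y by move: yN; rewrite inE.
have CP : C \in P by move: CL; rewrite inE => /andP[].
apply/eqP/idP => [<-|yC]; first by rewrite (mem_block HG) ?(adj_vset_r xy).
exact: (block_eq HG CP yC).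
Qed.

Lemma between_cases B C : adj Q B C ->
  [\/ d = 1%N /\ between G B C ~=g copies 3 (complete 2),
      d = 2 /\ between G B C ~=g K33_minus_3K2 | d = 3 /\ between G B C ~=g K33].
Proof.
move=> BC; have BP := adj_vset BC; have CP := adj_vset_r BC; have CB : adj Q C B by rewrite adj_sym.
rewrite /between -(pts_nbrs G B CP) -(pts_nbrs G C BP).
have dis x : x \in pts B C -> x \in pts C B -> False.
  rewrite !in_pts => /andP[xB _] /andP[xC _]; have := adj_neq BC.
  by rewrite -(block_eq HG BP xB) (block_eq HG CP xC) eqxx.
have VE : vset (induced G (pts B C :|: pts C B)) = pts B C :|: pts C B.
  apply/setIidPr/subsetP => x; rewrite in_setU !in_pts => /orP[]/andP[xB _]; exact: (block_sub HG _ xB).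
have half B' C' x y : B' \in P -> C' \in P -> x \in pts B' C' ->
    (y \in pts B' C' :|: pts C' B') && adj G x y = (y \in nbr G x :&: C').
  move=> BP' CP'; rewrite in_pts => /andP[xB xC].
  rewrite (nbr_block_eq CP' xB BP') in_setI in_setU [y \in nbr _ _]inE andbC.
  case xy : (adj G x y) => //=; case yB : (y \in pts B' C') => //=.
  move: yB; rewrite in_pts => /andP[yB _]; have := adj_blocks HG xy.
  by rewrite (block_eq HG BP' xB) (block_eq HG BP' yB) eqxx.
have nB x : x \in pts B C -> nbr (induced G (pts B C :|: pts C B)) x = nbr G x :&: C.
  move=> xp; apply/setP => y; rewrite inE induced_adjE in_setU xp /=; exact: half.
have nC x : x \in pts C B -> nbr (induced G (pts B C :|: pts C B)) x = nbr G x :&: B.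
  move=> xp; apply/setP => y; rewrite inE induced_adjE in_setU xp orbT /= setUC; exact: half.
apply: (@regular_bip3 _ _ (pts B C) (pts C B)) => //.
- exact: (card_pts3 K3 BC).
- exact: (card_pts3 K3 CB).
- move=> x y xy xp; have : y \in nbr (induced G (pts B C :|: pts C B)) x by rewrite inE.
  rewrite nB // (nbr_block_eq CP _ BP) ?in_setI; first by case/andP.
  by move: xp; rewrite in_pts => /andP[].
- move=> x y xy xp; have : y \in nbr (induced G (pts B C :|: pts C B)) x by rewrite inE.
  rewrite nC // (nbr_block_eq BP _ CP) ?in_setI; first by case/andP.
  by move: xp; rewrite in_pts => /andP[].
- move=> x; rewrite VE in_setU => /orP[] xp; [rewrite nB //|rewrite nC //].
    by move: xp; rewrite in_pts => /andP[_ xC]; apply: (Hd).2.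
  by move: xp; rewrite in_pts => /andP[_ xC]; apply: (Hd).2.
- exact: (Hd).1.
Qed.

Lemma d_le3 : [\/ d = 1%N, d = 2 | d = 3].
Proof.
have [B BP] := P_nonempty HG; have /card_gt1P[C [_ [CN _ _]]] := val_ge2 HG BP.
rewrite inE in CN; case: (between_cases CN) => -[-> _]; [exact: Or31|exact: Or32|exact: Or33].
Qed.

(** Two subsets of size at least 2 in the three points of [pts C B] intersect. *)
Lemma common_nbr B C x x' : adj Q B C -> 2 <= d -> x \in pts B C -> x' \in pts B C ->
  exists2 y, adj G x y & adj G x' y.
Proof.
move=> BC d2 xp xp'; have BP := adj_vset BC; have CP := adj_vset_r BC.
have c2 z : z \in pts B C -> 2 <= #|nbr G z :&: pts C B|.
  by rewrite in_pts => /andP[zB zC]; rewrite -(nbr_block_eq CP zB BP) (Hd).2.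
have CB : adj Q C B by rewrite adj_sym.
have : 0 < #|(nbr G x :&: pts C B) :&: (nbr G x' :&: pts C B)|.
  have := cardsUI (nbr G x :&: pts C B) (nbr G x' :&: pts C B).
  have : #|(nbr G x :&: pts C B) :|: (nbr G x' :&: pts C B)| <= 3.
    by rewrite -(card_pts3 K3 CB) subset_leq_card // subUset !subsetIr.
  by have := c2 _ xp; have := c2 _ xp'; lia.
by case/card_gt0P=> y; rewrite !in_setI !inE => /andP[/andP[xy _] /andP[xy' _]]; exists y.
Qed.

(** Points of one [pts B C] are joined through common neighbours, the meeting sets link all of [B],
    and connectedness of the quotient links the blocks. *)
Lemma connected_d2 : 2 <= d ->
  (forall B C D, B \in P -> C \in nbr Q B -> D \in nbr Q B -> C != D ->
     exists x, x \in pts B C :&: pts B D) -> connected G.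
Proof.
move=> d2 meet; have sG : connect_sym (adj G) by apply: sym_connect_sym; apply: adj_sym.
have inpts B C x x' : adj Q B C -> x \in pts B C -> x' \in pts B C -> connect (adj G) x x'.
  move=> BC xp xp'; have [y xy xy'] := common_nbr BC d2 xp xp'.
  by apply: connect_trans (connect1 xy) _; rewrite sG; apply: connect1.
have inB B x x' : B \in P -> x \in B -> x' \in B -> connect (adj G) x x'.
  move=> BP xB xB'; have [C Cx] := blocks_at_nonempty HG (block_sub HG BP xB).
  have [D Dx] := blocks_at_nonempty HG (block_sub HG BP xB').
  have CN := blocks_at_nbr HG BP xB Cx; have DN := blocks_at_nbr HG BP xB' Dx.
  have xp : x \in pts B C by rewrite in_pts xB.
  have xp' : x' \in pts B D by rewrite in_pts xB'.
  have BC : adj Q B C by rewrite inE in CN.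
  have BD : adj Q B D by rewrite inE in DN.
  have [CD|CD] := eqVneq C D; first by apply: (inpts B C); rewrite // CD.
  have [y /setIP[y1 y2]] := meet B C D BP CN DN CD.
  exact: connect_trans (inpts _ _ _ _ BC xp y1) (inpts _ _ _ _ BD y2 xp').
move=> x y xV yV; have /connectP[p pp] := Ghat_connected HG (block_in HG xV) (block_in HG yV).
elim: p x xV pp => [|C p IH] x xV /= => [_ e|/andP[BC pp] e].
  by apply: (inB (pb x)); rewrite ?(mem_block HG) ?(block_in HG) // -e (mem_block HG).
have [u [w [uw pu pw]]] := quotient_adjP HG BC.
have uV := adj_vset uw; have wV := adj_vset_r uw.
apply: connect_trans (inB (pb x) x u _ _ _) _; rewrite ?(block_in HG) ?(mem_block HG) //.
  by rewrite -pu (mem_block HG).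
by apply: connect_trans (connect1 uw) _; apply: IH => //; rewrite pw.
Qed.

(** At [x] there is a 2-arc with both ends in one block, because [d >= 2], and one with ends in
    different blocks, because [r >= 2]; no element of [X] relates them. *)
Lemma not_arc2_d2 r : 2 <= d -> has_r G P r -> 2 <= r -> ~ arc_transitive X to 2 G.
Proof.
move=> d2 hr r2 [_ tr]; have [_ {}tr] := (transitive_Arc2 HX).1 tr.
have [B BP] := P_nonempty HG; have [x xB] := block_nonempty HG BP.
have xV := block_sub HG BP xB; have := r2; rewrite -(hr x xV) => /card_gt1P[C [D [Cx Dx CD]]].
have := d2; rewrite -((Hd).2 x C Cx) => /card_gt1P[y [y' [/setIP[yN yC] /setIP[yN' yC'] yy]]].
have /(blocks_atP HG)[z xz zD] := Dx; rewrite inE in yN; rewrite inE in yN'.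
have CP : C \in P by move: Cx; rewrite inE => /andP[].
have zV := adj_vset_r xz; have yV := adj_vset_r yN; have yV' := adj_vset_r yN'.
have yz : y != z by apply: contraNneq CD => e; rewrite -zD -e (block_eq HG CP yC).
have yx : adj G y x by rewrite adj_sym.
have [a aX [ya xa y'z]] := tr _ _ _ _ _ _ yx yN' yy yx xz yz.
case/eqP: CD; rewrite -zD -y'z (block_act HG) // (block_eq HG CP yC').
by rewrite -[in LHS](block_eq HG CP yC) -[in LHS]ya (block_act HG) // (block_eq HG CP yC).
Qed.

End Between.

(** * Case (d) *)

Section CaseD.
Variables (aT : finGroupType) (T : finType) (G : graph T).
Variables (X : {group aT}) (to : {action aT &-> T}) (P : {set {set T}}).
Hypothesis HG : in_Ghat G X to P.
Hypothesis K3 : has_k G P 3.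

Local Notation V := (vset G).
Local Notation Q := (quotient_graph G P).
Local Notation pb := (pblock P).
Local Notation L := (blocks_at G P).
Local Notation pts := (block_pts G P).

Variable b : nat.
Hypothesis vbr : has_vbr G P (3 * b) b 1.

Lemma blocks_at1 x C D : C \in L x -> D \in L x -> C = D.
Proof.
move=> Cx Dx; have [_ _ hr] := vbr.
have /eqP/cards1P[E e] := hr x (blocks_at_vset HG Cx).
by move: Cx Dx; rewrite e !in_set1 => /eqP-> /eqP->.
Qed.

(** The vertices whose edges run along the quotient edge [e]. As [r = 1], every vertex belongs to
    one such part and no edge leaves it. *)
Definition edge_part (e : {set {set T}}) : {set T} := [set x | [exists C in L x, e == [set pb x; C]]].

Lemma edge_partP e x : reflect (exists2 C, C \in L x & e = [set pb x; C]) (x \in edge_part e).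
Proof.
rewrite inE; apply: (iffP existsP) => [[C /andP[CL /eqP ->]]|[C CL ->]]; exists C => //.
by rewrite CL eqxx.
Qed.

Lemma edge_partE B C : adj Q B C -> edge_part [set B; C] = pts B C :|: pts C B.
Proof.
move=> BC; have BP := adj_vset BC; have CP := adj_vset_r BC; have nBC := adj_neq BC.
apply/setP => x; rewrite in_setU !in_pts; apply/edge_partP/orP => [[D Dx e]|].
  have nxD : pb x != D by apply: (adj_neq (blocks_at_adj HG Dx)).
  have xV := blocks_at_vset HG Dx; have xb := mem_block HG xV.
  have : pb x \in [set B; C] by rewrite e !inE eqxx.
  have : D \in [set B; C] by rewrite e !inE eqxx orbT.
  rewrite !in_set2 => /orP[]/eqP eD /orP[]/eqP ex.
  - by rewrite eD ex eqxx in nxD.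
  - by right; rewrite -ex xb -eD.
  - by left; rewrite -ex xb -eD.
  - by rewrite eD ex eqxx in nxD.
case=> /andP[xB Lx]; [exists C|exists B] => //; first by rewrite (block_eq HG BP xB).
by rewrite (block_eq HG CP xB) setUC.
Qed.

Lemma mem_edgesP (U : finType) (H : graph U) e :
  reflect (exists x y, adj H x y /\ e = [set x; y]) (e \in edges H).
Proof.
apply: (iffP imsetP) => [[[x y]]|[x [y [xy ->]]]]; first by rewrite inE => xy ->; exists x, y.
by exists (x, y); rewrite ?inE.
Qed.

Lemma quotient_copies (U : finType) (H : graph U) :
  (forall B C, adj Q B C -> H ~=g between G B C) -> copies #|edges Q| H ~=g G.
Proof.
move=> iso; apply: (copies_giso (part := edge_part)).
- move=> e _; apply/subsetP => x /edge_partP[C /(blocks_at_vset HG)]; done.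
- move=> x xV; have [C Cx] := blocks_at_nonempty HG xV; exists [set pb x; C].
    by apply/mem_edgesP; exists (pb x), C; rewrite (blocks_at_adj HG).
  by apply/edge_partP; exists C.
- by move=> e f x _ _ /edge_partP[C Cx ->] /edge_partP[D Dx ->]; rewrite (blocks_at1 Cx Dx).
- move=> e x y _ /edge_partP[C Cx ->] xy; apply/edge_partP; exists (pb x).
    by apply/(blocks_atP HG); exists x; rewrite // adj_sym.
  have -> : C = pb y by apply: blocks_at1 Cx _; apply/(blocks_atP HG); exists y.
  exact: setUC.
- move=> e /mem_edgesP[B [C [BC ->]]]; rewrite edge_partE //.
  by have := iso B C BC; rewrite /between -(pts_nbrs G B (adj_vset_r BC)) -(pts_nbrs G C (adj_vset BC)).
Qed.

(** For valency 1 the edges themselves are the components; [card_edges_d1] then expresses their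
    number as [3 e]. *)
Lemma matching_copies : has_val G 1 -> copies #|edges G| (complete 2) ~=g G.
Proof.
move=> v1.
have u x y z : adj G x y -> adj G x z -> y = z.
  move=> xy xz; have /eqP/cards1P[w e] := v1 x (adj_vset xy).
  have : y \in nbr G x by rewrite inE.
  have : z \in nbr G x by rewrite inE.
  by rewrite e !in_set1 => /eqP-> /eqP->.
apply: (copies_giso (part := id)).
- by move=> e /mem_edgesP[x [y [xy ->]]]; rewrite subUset !sub1set (adj_vset xy) (adj_vset_r xy).
- move=> x /(vertex_nbr HG)[y xy]; exists [set x; y]; rewrite ?in_set2 ?eqxx //.
  by apply/mem_edgesP; exists x, y.
- have eqe e x y : e \in edges G -> x \in e -> adj G x y -> e = [set x; y].
    case/mem_edgesP=> [s [t [st ->]]]; rewrite in_set2 => /orP[]/eqP-> h.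
      by rewrite (u _ _ _ h st).
    by rewrite adj_sym in st; rewrite (u _ _ _ h st) setUC.
  move=> e f x eE fE xe xf.
  have xV : x \in V.
    by move: xe eE => xe /mem_edgesP[s [t [st ee]]]; move: xe; rewrite ee in_set2 =>
      /orP[]/eqP->; rewrite ?(adj_vset st) ?(adj_vset_r st).
  have [y xy] := vertex_nbr HG xV.
  by rewrite (eqe e x y eE xe xy) (eqe f x y fE xf xy).
- move=> _ x y /mem_edgesP[s [t [st ->]]]; rewrite !in_set2 => /orP[]/eqP-> h.
    by rewrite (u _ _ _ h st) eqxx orbT.
  by rewrite adj_sym in st; rewrite (u _ _ _ h st) eqxx.
- move=> _ /mem_edgesP[s [t [st ->]]]; apply: (giso_sym s).
  have VE : V :&: [set s; t] = [set s; t].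
    by apply/setIidPr; rewrite subUset !sub1set (adj_vset st) (adj_vset_r st).
  apply: complete_giso; first by rewrite /= VE cards2 (adj_neq st).
  rewrite -[vset _]/(V :&: [set s; t]) VE => x y xs ys; rewrite induced_adjE xs ys /=; move: xs ys.
  by rewrite !in_set2 => /orP[]/eqP-> /orP[]/eqP->; rewrite ?eqxx // adj_sym.
Qed.

Lemma card_vertices v : has_v P v -> #|V| = (#|P| * v)%N.
Proof. by move=> hv; apply: card_uniform_partition (Ghat_partition HG). Qed.

Lemma card_edges_d1 : has_val G 1 -> #|edges G| = (3 * #|edges Q|)%N.
Proof.
move=> v1; have [hv hb _] := vbr.
by have := card_edges v1; have := card_edges hb; rewrite (card_vertices hv) /=; nia.
Qed.

Lemma case_d_cases B C : adj Q B C -> [\/ case_d1 G P B C, case_d2 G P B C | case_d3 G P B C].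
Proof.
move=> BC; have [d dd] := has_d_exists HG; have BV := adj_vset BC.
have [x xB] := block_nonempty HG BV.
have all_between B' C' := between_cases HG K3 dd (B := B') (C := C').
have sym (U : finType) (H : graph U) (u0 : U) :
    (forall B' C', adj Q B' C' -> between G B' C' ~=g H) -> G ~=g copies #|edges Q| H.
  move=> iso; have e0 : 0 < #|edges Q|.
    by apply/card_gt0P; exists [set B; C]; apply/mem_edgesP; exists B, C.
  apply: (giso_sym (Ordinal e0, u0)).
  by apply: quotient_copies => B' C' BC'; apply: (giso_sym x); apply: iso.
case: (all_between B C BC) => -[dE iso]; rewrite dE in dd all_between.
- apply: Or31; split=> //; have [_ _ hr] := vbr.
  have v1 := val_rd HG dd hr; rewrite -card_edges_d1 //.
  have [y xy] := vertex_nbr HG (block_sub HG BV xB).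
  have e0 : 0 < #|edges G|.
    by apply/card_gt0P; exists [set x; y]; apply/mem_edgesP; exists x, y.
  by apply: (giso_sym (Ordinal e0, ord0)); apply: matching_copies.
- apply: Or32; split=> //; apply: sym; first exact: (false, ord0).
  by move=> B' C' /all_between [] [].
- apply: Or33; split=> //; apply: sym; first exact: (false, ord0).
  by move=> B' C' /all_between [] [].
Qed.

End CaseD.

(** * Labelled vertices and 3-arcs of the quotient *)

Section Labelled.
Variables (aT : finGroupType) (T : finType) (G : graph T).
Variables (X : {group aT}) (to : {action aT &-> T}) (P : {set {set T}}).
Hypothesis HG : in_Ghat G X to P.
Hypothesis K3 : has_k G P 3.

Local Notation V := (vset G).
Local Notation Q := (quotient_graph G P).
Local Notation toB := (to^*)%act.
Local Notation pb := (pblock P).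
Local Notation L := (blocks_at G P).
Local Notation XB B := ('N_X(B | to))%G.
Local Notation pts := (block_pts G P).

Let HX : acts_on_graph X to G := Ghat_acts HG.
Let HQ := quotient_acts HG.

Variables (v r d : nat) (lab : T -> {set T} -> {set T}).
Hypothesis vbr : has_vbr G P v 4 r.
Hypothesis r2 : 2 <= r.
Hypothesis a2 : arc_transitive X toB 2 Q.
Hypothesis Hd : has_d G P d.
Hypothesis labA : forall a x C, a \in X -> C \in L x ->
  lab (to x a) (toB C a) = toB (lab x C) a.
Hypothesis labN : forall x C, C \in L x -> adj Q (pb x) (lab x C) /\ lab x C != C.
Hypothesis labI : forall x x' C, C \in L x -> C \in L x' -> pb x = pb x' ->
  lab x C = lab x' C -> x = x'.

Lemma adj_blocks_at x y : adj G x y -> pb y \in L x.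
Proof. by move=> xy; apply/(blocks_atP HG); exists y. Qed.

(** The three points of [pts B C] carry distinct labels among the three blocks adjacent to [B] other
    than [C], so all of these occur. *)
Lemma labS B C A : adj Q B C -> adj Q B A -> A != C ->
  exists x, [/\ x \in B, C \in L x & lab x C = A].
Proof.
move=> BC BA AC; have BP := adj_vset BC.
suff : A \in (lab^~ C) @: pts B C.
  by case/imsetP=> x; rewrite in_pts => /andP[xB Cx] ->; exists x.
have -> : (lab^~ C) @: pts B C = nbr Q B :\ C; last by rewrite !inE AC.
apply/eqP; rewrite eqEcard; apply/andP; split.
  apply/subsetP => _ /imsetP[x + ->]; rewrite in_pts => /andP[xB Cx].
  by have [h1 h2] := labN Cx; rewrite in_setD1 h2 inE -(block_eq HG BP xB).
rewrite card_in_imset ?(card_pts3 K3 BC).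
  have CN : C \in nbr Q B by rewrite inE.
  by have [_ hb _] := vbr; have := cardsD1 C (nbr Q B); rewrite (hb B BP) CN add1n => -[<-].
move=> x x'; rewrite !in_pts => /andP[xB Cx] /andP[xB' Cx'].
by apply: labI; rewrite ?(block_eq HG BP xB) ?(block_eq HG BP xB').
Qed.

Definition lab_arc x y := [tuple lab x (pb y); pb x; pb y; lab y (pb x)].

Definition lab_arcs : {set 4.-tuple {set T}} :=
  [set lab_arc p.1 p.2 | p in [set p : T * T | adj G p.1 p.2]].

Lemma lab_arcsP t : reflect (exists x y, adj G x y /\ t = lab_arc x y) (t \in lab_arcs).
Proof.
apply: (iffP imsetP) => [[[x y]]|[x [y [xy ->]]]].
  by rewrite inE => xy ->; exists x, y.
by exists (x, y); rewrite ?inE.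
Qed.

Lemma lab_arcs_sub : lab_arcs \subset Arc 3 Q.
Proof.
apply/subsetP => _ /lab_arcsP[x [y [xy ->]]]; rewrite arc3E.
have yx : adj G y x by rewrite adj_sym.
have [h1 h2] := labN (adj_blocks_at xy); have [h3 h4] := labN (adj_blocks_at yx).
by rewrite adj_sym h1 (quotient_adj HG xy) h3 h2 eq_sym h4.
Qed.

Lemma lab_arc_act a x y : a \in X -> adj G x y ->
  lab_arc (to x a) (to y a) = n_act toB (lab_arc x y) a.
Proof.
move=> aX xy; have yx : adj G y x by rewrite adj_sym.
rewrite nact4E /lab_arc !(block_act HG) ?(adj_vset xy) ?(adj_vset yx) //.
by rewrite !labA ?adj_blocks_at.
Qed.

Lemma lab_arcs_inv a t : a \in X -> t \in lab_arcs -> n_act toB t a \in lab_arcs.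
Proof.
move=> aX /lab_arcsP[x [y [xy ->]]]; rewrite -lab_arc_act //; apply/lab_arcsP.
by exists (to x a), (to y a); rewrite (acts_adj HX).
Qed.

Lemma lab_arcs_sp : self_paired_arcs lab_arcs.
Proof.
move=> _ /lab_arcsP[x [y [xy ->]]]; apply/lab_arcsP; exists y, x.
by rewrite adj_sym rev_tup4.
Qed.

Lemma lab_arcs_orbit : arc_orbit X toB Q lab_arcs.
Proof.
have [B BP] := P_nonempty HG; have [x xB] := block_nonempty HG BP.
have [y xy] := vertex_nbr HG (block_sub HG BP xB).
have tD : lab_arc x y \in lab_arcs by apply/lab_arcsP; exists x, y.
exists (lab_arc x y); first exact: (subsetP lab_arcs_sub).
apply/setP => t; apply/idP/orbitP => [/lab_arcsP[x' [y' [xy' ->]]]|[a aX <-]].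
  have [a aX [<- <-]] := arcs_tr HG xy xy'; exists a => //=.
  by rewrite lab_arc_act.
exact: lab_arcs_inv.
Qed.

(** The first three blocks determine [x] by [labI], and the possible last blocks are the labels of
    the neighbours of [x] in [C]. *)
Lemma lab_arcE x (A B C D : {set T}) : x \in B -> C \in L x -> lab x C = A -> adj Q B C ->
  ([tuple A; B; C; D] \in lab_arcs) = (D \in (lab^~ B) @: (nbr G x :&: C)).
Proof.
move=> xB Cx xA BC; have BP := adj_vset BC; have CP := adj_vset_r BC.
have xb := block_eq HG BP xB.
apply/lab_arcsP/imsetP => [[x' [y [xy /tuple4_inj[eA eB eC eD]]]]|[y]].
  have -> : x = x'.
    apply: (labI (C := C)); rewrite ?eC ?(adj_blocks_at xy) -?eC //; first by rewrite xb.
    by rewrite xA eA -eC.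
  exists y; last by rewrite eD -eB.
  by rewrite in_setI inE xy eC (mem_block HG) ?(adj_vset_r xy).
rewrite in_setI inE => /andP[xy yC] ->; exists x, y; split=> //.
by rewrite /lab_arc xb (block_eq HG CP yC) xA.
Qed.

Lemma card_lab_ext A B C : adj Q A B -> adj Q B C -> A != C ->
  #|[set D | [tuple A; B; C; D] \in lab_arcs]| = d.
Proof.
move=> AB BC AC; have BA : adj Q B A by rewrite adj_sym.
have BP := adj_vset BC; have CP := adj_vset_r BC.
have [x [xB Cx xA]] := labS BC BA AC.
rewrite -((Hd).2 x C Cx) -(card_in_imset (f := lab^~ B)).
  by apply: eq_card => D; rewrite inE (lab_arcE D xB Cx xA BC).
rewrite (nbr_block_eq HG CP xB BP) => y y'; rewrite !in_setI !in_pts.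
move=> /andP[_ /andP[yC By]] /andP[_ /andP[yC' By']] e.
by apply: labI e; rewrite // (block_eq HG CP yC) (block_eq HG CP yC').
Qed.

(** * Invariant sets of 3-arcs of the quotient with one extension of each 2-arc *)

Section UniqueExtensionOfQuotient.
Variable D : {set 4.-tuple {set T}}.
Hypothesis D3 : D \subset Arc 3 Q.
Hypothesis Dinv : forall a t, a \in X -> t \in D -> n_act toB t a \in D.
Hypothesis Dsp : self_paired_arcs D.
Hypothesis D1 : forall A B C, adj Q A B -> adj Q B C -> A != C ->
  #|[set E | [tuple A; B; C; E] \in D]| = 1%N.

Lemma unique_ext A B C : adj Q A B -> adj Q B C -> A != C -> exists E, [tuple A; B; C; E] \in D.
Proof.
move=> AB BC AC; have /eqP/cards1P[E e] := D1 AB BC AC; exists E.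
by move: (set11 E); rewrite -e inE.
Qed.

Lemma unique_ext_uniq A B C E E' : [tuple A; B; C; E] \in D -> [tuple A; B; C; E'] \in D -> E = E'.
Proof.
move=> h h'; have := subsetP D3 _ h; rewrite arc3E => /and5P[AB BC _ AC _].
have /eqP/cards1P[F e] := D1 AB BC AC.
have : E \in [set F] by rewrite -e inE.
have : E' \in [set F] by rewrite -e inE.
by rewrite !in_set1 => /eqP-> /eqP->.
Qed.

Lemma unique_ext_orbit : arc_orbit X toB Q D.
Proof.
have [[A [B [C [AB BC AC]]]] tr] := (transitive_Arc2 HQ).1 a2.2.
have [E h] := unique_ext AB BC AC; exists [tuple A; B; C; E]; first exact: (subsetP D3).
apply/setP => t; apply/idP/orbitP => [|[a aX <-]]; last exact: Dinv.
have [A' [B' [C' [E' ->]]]] := tuple4P t => h'.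
have := subsetP D3 _ h'; rewrite arc3E => /and5P[AB' BC' _ AC' _].
have [a aX [eA eB eC]] := tr _ _ _ _ _ _ AB BC AC AB' BC' AC'.
exists a => //=; have := Dinv aX h; rewrite nact4E eA eB eC => h''.
by rewrite (unique_ext_uniq h' h'').
Qed.

Let hb : has_val Q 4 := let: And3 _ h _ := vbr in h.

Lemma quotient_cycles : exists m n (E : {set {set {set {set T}}}}),
  cycle_orbit_for X toB m n Q D E /\ (Q ~=g complete 5 \/ near_ngonal_wrt n Q E).
Proof.
exact: (unique_extension_cycles HQ (Ghat_connected HG) (blocks_tr HG) a2.2 D3 Dinv Dsp
  unique_ext unique_ext_uniq hb).
Qed.

Lemma quotient_gimel : exists m n (E : {set {set {set {set T}}}}),
  [/\ gimel Q D ~=g copies m (cycle_graph n), cycle_orbit_for X toB m n Q D E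
    & Q ~=g complete 5 \/ near_ngonal_wrt n Q E].
Proof.
exact: (unique_extension_gimel HQ (Ghat_connected HG) (blocks_tr HG) a2.2 D3 Dinv Dsp
  unique_ext unique_ext_uniq hb).
Qed.

(** Unique extension spreads fixedness from [B] and its neighbours over the connected quotient, and
    [X] is faithful on the blocks. *)
Lemma unique_kernel B : B \in P -> 'C_(XB B)(nbr Q B | toB) = 1.
Proof.
move=> BP; apply/trivgP/subsetP => a /setIP[/stabB_P[aX aB] /astabP fN].
have /faithfulP ff : [faithful X, on P | toB].
  by have [_ _ hr] := vbr; apply: (arc2_faithful HG K3 a2 hr r2).
rewrite inE; apply/eqP; apply: ff => // C CP /=.
have := kernel_trivial (Ghat_connected HG) D3 Dinv Dsp unique_ext unique_ext_uniq aX BP aB.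
by apply=> // F BF; apply: fN; rewrite inE.
Qed.

End UniqueExtensionOfQuotient.

Lemma lab_d1 : d = 1%N -> forall A B C, adj Q A B -> adj Q B C -> A != C ->
  #|[set E | [tuple A; B; C; E] \in lab_arcs]| = 1%N.
Proof. by move=> d1 A B C AB BC AC; rewrite card_lab_ext. Qed.

Let D' := Arc 3 Q :\: lab_arcs.

Lemma co_lab_sub : D' \subset Arc 3 Q.
Proof. exact: subsetDl. Qed.

Lemma co_lab_inv a t : a \in X -> t \in D' -> n_act toB t a \in D'.
Proof.
move=> aX; rewrite !in_setD => /andP[tD tA]; apply/andP; split.
  apply: contra tD => /(lab_arcs_inv (groupVr aX)).
  suff -> : n_act toB (n_act toB t a) a^-1 = t by [].
  exact: (actK (to^* * 4)%act a t).
have [A [B [C [E eT]]]] := tuple4P t; move: tA; rewrite eT nact4E.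
rewrite [in X in X -> _]arc3E [in X in _ -> X]arc3E.
by rewrite !(acts_adj HQ) // !(inj_eq (act_inj toB a)).
Qed.

Lemma co_lab_sp : self_paired_arcs D'.
Proof.
move=> t; rewrite !in_setD => /andP[tD tA]; apply/andP; split.
  apply: contra tD => /lab_arcs_sp.
  suff -> : rev_tup (rev_tup t) = t by [].
  exact/val_inj/revK.
have [A [B [C [E eT]]]] := tuple4P t; move: tA; rewrite eT rev_tup4.
rewrite [in X in X -> _]arc3E [in X in _ -> X]arc3E.
by case/and5P=> h1 h2 h3 h4 h5; rewrite adj_sym h3 adj_sym h2 adj_sym h1 eq_sym h5 eq_sym h4.
Qed.

Lemma card_arc_ext A B C : adj Q A B -> adj Q B C -> A != C ->
  #|[set E | [tuple A; B; C; E] \in Arc 3 Q]| = 3.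
Proof.
move=> AB BC AC; have [_ hb _] := vbr; have CP := adj_vset_r BC.
have -> : [set E | [tuple A; B; C; E] \in Arc 3 Q] = nbr Q C :\ B.
  by apply/setP => E; rewrite inE arc3E !inE AB BC AC /= eq_sym andbC.
have BN : B \in nbr Q C by rewrite inE adj_sym.
by have := cardsD1 B (nbr Q C); rewrite (hb C CP) BN add1n => -[<-].
Qed.

(** A 2-arc of a tetravalent graph has three extensions, of which two belong to [lab_arcs] when
    [d = 2]. *)
Lemma co_lab_d2 : d = 2 -> forall A B C, adj Q A B -> adj Q B C -> A != C ->
  #|[set E | [tuple A; B; C; E] \in D']| = 1%N.
Proof.
move=> d2 A B C AB BC AC.
have -> : [set E | [tuple A; B; C; E] \in D'] = [set E | [tuple A; B; C; E] \in Arc 3 Q]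
    :\: [set E | [tuple A; B; C; E] \in lab_arcs].
  by apply/setP => E; rewrite !inE.
rewrite cardsD (setIidPr _) ?card_arc_ext ?card_lab_ext ?d2 //.
by apply/subsetP => E; rewrite !inE => /(subsetP lab_arcs_sub); rewrite inE.
Qed.

Lemma lab_d3 : d = 3 -> arc_transitive X toB 3 Q.
Proof.
move=> d3; split; first exact: (blocks_tr HG).
have eA : lab_arcs = Arc 3 Q.
  apply/eqP; rewrite eqEsubset lab_arcs_sub; apply/subsetP => t.
  have [A [B [C [E ->]]]] := tuple4P t => h; have := h; rewrite arc3E => /and5P[AB BC _ AC _].
  have : [set E | [tuple A; B; C; E] \in lab_arcs] == [set E | [tuple A; B; C; E] \in Arc 3 Q].
    rewrite eqEcard card_arc_ext ?card_lab_ext ?d3 // andbT.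
    by apply/subsetP => F; rewrite in_set => /(subsetP lab_arcs_sub); rewrite in_set.
  by move/eqP/setP/(_ E); rewrite [LHS]in_set [RHS]in_set h => ->.
have [t tA e] := lab_arcs_orbit; apply/imsetP; exists t => //.
by rewrite -eA.
Qed.

Hypothesis vr12 : (v * r = 12)%N.

Lemma card_X B : B \in P -> #|X| = (#|P| * #|XB B|)%N.
Proof. by move=> BP; rewrite (card_vertex_stab (G := Q) (blocks_tr HG) BP) stabB_setwise. Qed.

(** The product [v r] is 12 in both cases, as [4 * 3] and as [6 * 2], so one count of arcs serves
    them both. *)
Lemma card_arcs_G : #|Arc 1 G| = (#|P| * (12 * d))%N.
Proof.
have [hv _ hr] := vbr; rewrite (card_Arc1 (val_rd HG Hd hr)) (card_vertices HG hv).
by rewrite -vr12 !mulnA.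
Qed.

Lemma card_P_gt0 : 0 < #|P|.
Proof. by have [B BP] := P_nonempty HG; apply/card_gt0P; exists B. Qed.

Lemma XB_isog B gT (K : {group gT}) : B \in P -> 'C_(XB B)(nbr Q B | toB) = 1 ->
  stab_induced X to B \isog K -> XB B \isog K.
Proof.
move=> BP; have [_ _ hr] := vbr.
rewrite /stab_induced -(arc2_kernel HG K3 a2 hr r2 BP) => ->.
exact/isog_trans/quotient1_isog.
Qed.

(** In the list of parameters the intersection number is zero only together with [r = 1]. *)
Lemma blocks_meet B C D : B \in P -> C \in nbr Q B -> D \in nbr Q B -> C != D ->
  exists x, x \in pts B C :&: pts B D.
Proof.
move=> BP CN DN CD; have tt := arc2_two_trans HG a2 (B := B).
have [l [hl mem]] := design_meet HG K3 BP tt vbr; apply/card_gt0P; rewrite hl //.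
have r1 : r != 1%N by apply: contraTneq r2 => ->.
case: l mem {hl} => // ; rewrite !inE !xpair_eqE /= (negPf r1) !andbF.
by [].
Qed.

(** For [d] equal to 1 or 2 the kernel on the blocks is trivial, so the order of [X] is 12 or 24
    times [|P|]. Comparing this with the [12 d |P|] arcs of [G] and the [12 |P|] 2-arcs of the
    quotient decides regularity. *)
Lemma lab_cases B : B \in P ->
  stab_induced X to B \isog 'Alt_('I_4) \/ stab_induced X to B \isog 'Sym_('I_4) ->
  [\/ [/\ d = 1%N, 'C_(XB B)(nbr Q B | toB) = 1 &
       [/\ XB B \isog 'Alt_('I_4), arc_regular X to 1 G & arc_regular X toB 2 Q]
       \/ XB B \isog 'Sym_('I_4) /\ #|X| = (#|P| * 24)%N],
      [/\ d = 2, XB B \isog 'Sym_('I_4), connected G /\ arc_regular X to 1 G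
       & complement_cycles G X to P lab_arcs]
    | [/\ d = 3, connected G, s_transitive X to 1 G & arc_transitive X toB 3 Q]].
Proof.
move=> BP iso; have [hv hb hr] := vbr.
have c0 := card_P_gt0; have cX := card_X BP; have cA := card_arcs_G.
have cQ : #|Arc 2 Q| = (#|P| * 12)%N by rewrite (card_Arc2 hb) -mulnA.
case: (d_le3 HG K3 Hd) => dE.
- apply: Or31; have ker := unique_kernel lab_arcs_sub lab_arcs_inv lab_arcs_sp (lab_d1 dE) BP.
  split=> //; case: iso => /(XB_isog BP ker) iso; [left|right]; last first.
    by split=> //; rewrite cX (card_isog iso) card_Sym4.
  rewrite (card_isog iso) card_Alt4 in cX; split=> //; split; try exact: (Ghat_sym HG).
  + by apply: regular_of_card; [exact: (Ghat_sym HG).2|rewrite cX cA dE].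
  + exact: a2.
  + by apply: regular_of_card; [exact: a2.2|rewrite cX cQ].
- have ker := unique_kernel co_lab_sub co_lab_inv co_lab_sp (co_lab_d2 dE) BP.
  have con : connected G.
    by apply: (connected_d2 HG K3 Hd) => [|B' C' D'' ]; [rewrite dE|apply: blocks_meet].
  have isoS : XB B \isog 'Sym_('I_4).
    (* Transitivity on [24 |P|] arcs rules out the alternating group, which would leave only
       [12 |P|] elements. *)
    case: iso => /(XB_isog BP ker) // isoA; move: cX; rewrite (card_isog isoA) card_Alt4 => cX.
    have /imsetP[t tA e] := (Ghat_sym HG).2.
    have : #|Arc 1 G| <= #|X| by rewrite e leq_imset_card.
    by rewrite cX cA dE; lia.
  rewrite (card_isog isoS) card_Sym4 in cX.
  apply: Or32; split=> //.
    split=> //; split; first exact: (Ghat_sym HG).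
    by apply: regular_of_card; [exact: (Ghat_sym HG).2|rewrite cX cA dE].
  split; [exact: co_lab_sp|exact: (unique_ext_orbit co_lab_sub co_lab_inv (co_lab_d2 dE))|].
  have [m [n [E [cyc nn]]]] := quotient_cycles co_lab_sub co_lab_inv co_lab_sp (co_lab_d2 dE).
  exists m, n, E; split=> //; case: nn => [|nn]; [by left|by right; exists E].
- apply: Or33; split=> //; last exact: lab_d3.
    by apply: (connected_d2 HG K3 Hd) => [|B' C' D'' ]; [rewrite dE|apply: blocks_meet].
  by split; [exact: (Ghat_sym HG)|apply: (not_arc2_d2 HG Hd _ hr r2); rewrite dE].
Qed.

End Labelled.

(** * Case (a) *)

Section CaseA.
Variables (aT : finGroupType) (T : finType) (G : graph T).
Variables (X : {group aT}) (to : {action aT &-> T}) (P : {set {set T}}).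
Hypothesis HG : in_Ghat G X to P.
Hypothesis K3 : has_k G P 3.

Local Notation V := (vset G).
Local Notation Q := (quotient_graph G P).
Local Notation toB := (to^*)%act.
Local Notation pb := (pblock P).
Local Notation L := (blocks_at G P).
Local Notation XB B := ('N_X(B | to))%G.
Local Notation pts := (block_pts G P).

Let HX : acts_on_graph X to G := Ghat_acts HG.
Let HQ := quotient_acts HG.

Hypothesis vbr : has_vbr G P 4 4 3.
Hypothesis a2 : arc_transitive X toB 2 Q.

(** With [b = 4] and [r = 3] exactly one adjacent block is missed by [x], so the default value of
    the choice does not occur at vertices of [G]. *)
Definition missed_block (x : T) : {set T} :=
  odflt set0 [pick D in nbr Q (pb x) :\: L x].

Local Notation miss x := (missed_block x).
Local Notation lab := (fun x (_ : {set T}) => missed_block x).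

Lemma missed_blockE x D : x \in V -> (D == missed_block x) = (D \in nbr Q (pb x) :\: L x).
Proof.
move=> xV; have [_ hb hr] := vbr; have bP := block_in HG xV.
have /eqP/cards1P[E e] : #|nbr Q (pb x) :\: L x| = 1%N.
  by rewrite cardsD (setIidPr (blocks_at_sub HG bP (mem_block HG xV))) (hb _ bP) (hr _ xV).
rewrite /missed_block; case: pickP => [F|/(_ E)]; rewrite e in_set1; last by rewrite eqxx.
by move/eqP->; rewrite in_set1.
Qed.

Lemma missed_act a x C : a \in X -> C \in L x ->
  missed_block (to x a) = toB (missed_block x) a.
Proof.
move=> aX Cx; have xV := blocks_at_vset HG Cx; apply/esym/eqP; rewrite missed_blockE; last first.
  by rewrite (acts_act HX.1).
rewrite in_setD (blocks_at_act HG) // (block_act HG) // [_ \in nbr _ _]inE (acts_adj HQ) //.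
by have := missed_blockE (missed_block x) xV; rewrite eqxx in_setD [_ \in nbr _ _]inE => <-.
Qed.

Lemma missed_mem x : x \in V -> missed_block x \in nbr Q (pb x) :\: L x.
Proof. by move=> xV; rewrite -missed_blockE ?eqxx. Qed.

Lemma missed_nbr x C : C \in L x -> adj Q (pb x) (missed_block x) /\ missed_block x != C.
Proof.
move=> Cx; have := missed_mem (blocks_at_vset HG Cx).
rewrite in_setD [_ \in nbr _ _]inE => /andP[h ->]; split=> //.
by apply: contraNneq h => ->.
Qed.

Lemma missed_inj_V x x' : x \in V -> x' \in V -> pb x = pb x' -> miss x = miss x' -> x = x'.
Proof.
move=> xV xV' e m; have [_ _ hr] := vbr; have bP := block_in HG xV.
apply: (arc2_blocks_inj HG K3 a2 hr isT bP); first exact: mem_block HG _ xV.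
  by rewrite e; apply: mem_block HG _ xV'.
have LE y : y \in V -> L y = nbr Q (pb y) :\ miss y.
  move=> yV; apply/setP => D; rewrite in_setD1 (missed_blockE _ yV) in_setD.
  have sub := subsetP (blocks_at_sub HG (block_in HG yV) (mem_block HG yV)) D.
  by case h : (D \in L y); rewrite /= ?(sub h) // andbC andbN.
by rewrite (LE x xV) (LE x' xV') e m.
Qed.

Lemma missed_inj x x' C : C \in L x -> C \in L x' -> pb x = pb x' ->
  missed_block x = missed_block x' -> x = x'.
Proof.
move=> Cx Cx'; apply: missed_inj_V; [exact: (blocks_at_vset HG Cx)|exact: (blocks_at_vset HG Cx')].
Qed.

Local Notation D := (lab_arcs G P lab).

(** A vertex becomes the arc from its block to the block it misses; [labS] shows that every arc of
    the quotient arises. *)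
Lemma missed_Xi : G ~=g Xi Q D.
Proof.
apply: (label_giso (h := fun x => (pb x, miss x))).
- by move=> x y xV yV [e1 e2]; apply: missed_inj_V.
- apply/setP => -[B A].
  have -> : ((B, A) \in [set z : {set T} * {set T} | adj Q z.1 z.2]) = adj Q B A by rewrite in_set.
  apply/imsetP/idP => [[x xV [-> ->]]|BA].
    by have := missed_mem xV; rewrite in_setD => /andP[_]; rewrite inE.
  have [_ hb _] := vbr; have AN : A \in nbr Q B by rewrite inE.
  have /card_gt0P[C] : 0 < #|nbr Q B :\ A|.
    by have := cardsD1 A (nbr Q B); rewrite (hb B (adj_vset BA)) AN add1n => -[<-].
  rewrite in_setD1 => /andP[CA]; rewrite inE => BC.
  have AC : A != C by rewrite eq_sym.
  have [x [xB Cx <-]] := labS HG K3 vbr missed_nbr missed_inj BC BA AC.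
  have BP := adj_vset BC; exists x; first exact: (block_sub HG BP xB).
  by rewrite (block_eq HG BP xB).
- move=> x y xV yV /=; rewrite -[X in _ || X]/([tuple miss y; pb y; pb x; miss x] \in D).
  have -> : ([tuple miss y; pb y; pb x; miss x] \in D) = ([tuple miss x; pb x; pb y; miss y] \in D).
    by apply/idP/idP => /(@lab_arcs_sp _ G P lab); rewrite rev_tup4.
  rewrite orbb; apply/lab_arcsP/idP => [[x' [y' [xy' /tuple4_inj[e1 e2 e3 e4]]]]|xy].
    have xV' := adj_vset xy'; have yV' := adj_vset_r xy'.
    by rewrite (missed_inj_V xV xV' e2 e1) (missed_inj_V yV yV' e3 e4).
  by exists x, y.
Qed.

(** Fixing [x] fixes the block it misses, and fixing [y] and [z] fixes two blocks of [L x]; the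
    fourth block at [B] is then fixed as well, and the kernel is trivial. *)
Lemma arc2_stab_trivial B : B \in P -> has_d G P 1 -> 'C_(XB B)(nbr Q B | toB) = 1 ->
  forall x y z a, x \in B -> adj G x y -> adj G x z -> y != z -> a \in X ->
  to x a = x -> to y a = y -> to z a = z -> a = 1.
Proof.
move=> BP Hd ker x y z a xB xy xz yz aX ax ay az; have [_ hb hr] := vbr.
have xV := adj_vset xy; have bx := block_eq HG BP xB.
have yL := adj_blocks_at HG xy; have zL := adj_blocks_at HG xz.
have fb w : w \in V -> to w a = w -> toB (pb w) a = pb w.
  by move=> wV e; rewrite -[RHS](congr1 pb e) (block_act HG).
have CD : pb y != pb z.
  apply: contraNneq yz => e; have /eqP/cards1P[w ew] := Hd.2 x (pb y) yL.
  have : y \in nbr G x :&: pb y by rewrite in_setI inE xy (mem_block HG) ?(adj_vset_r xy).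
  have : z \in nbr G x :&: pb y by rewrite in_setI inE xz e (mem_block HG) ?(adj_vset_r xz).
  by rewrite ew !in_set1 => /eqP-> /eqP->.
have aB : toB B a = B by rewrite -bx fb.
have aC := fb y (adj_vset_r xy) ay; have aD := fb z (adj_vset_r xz) az.
have aL F : (toB F a \in L x) = (F \in L x) by rewrite -{1}ax (blocks_at_act HG).
have aN F : (toB F a \in nbr Q B) = (F \in nbr Q B).
  by rewrite (acts_act (stabB_acts_nbr HG B)) //; apply/stabB_P.
suff : a \in 'C_(XB B)(nbr Q B | toB) by rewrite ker => /set1P.
apply/setIP; split; first exact/stabB_P; apply/astabP => F FN.
have inj := act_inj toB a.
have [FL|FL] := boolP (F \in L x); last first.
  have m w : w \in nbr Q B -> w \notin L x -> w = miss x.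
    by move=> h1 h2; apply/eqP; rewrite missed_blockE // in_setD h2 bx.
  by rewrite (m F) // -[RHS](m (toB (miss x) a)) // -(m F FN FL) ?aN ?aL.
have [->//|FC] := eqVneq F (pb y); have [->//|FD] := eqVneq F (pb z).
have /eqP/cards1P[E e] : #|L x :\ pb y :\ pb z| = 1%N.
  have := cardsD1 (pb y) (L x); rewrite yL (hr x xV) add1n => -[c1].
  by have := cardsD1 (pb z) (L x :\ pb y); rewrite in_setD1 zL (eq_sym (pb z)) CD -c1 add1n => -[<-].
have : F \in L x :\ pb y :\ pb z by rewrite !in_setD1 FC FD.
have : toB F a \in L x :\ pb y :\ pb z.
  by rewrite !in_setD1 aL FL -{1}aD -{1}aC !(inj_eq inj) FC FD.
by rewrite e !in_set1 => /eqP-> /eqP->.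
Qed.

(** There are [4 * 3 * 2 = 24] 2-arcs for each block, as many in all as elements of [X]. Stabilisers
    are trivial, so one orbit fills the set and transitivity is a consequence. *)
Lemma arc2_regular_S4 : has_d G P 1 ->
  (forall B, B \in P -> 'C_(XB B)(nbr Q B | toB) = 1) ->
  #|X| = (#|P| * 24)%N -> arc_regular X to 2 G.
Proof.
move=> Hd ker cX; have [hv hb hr] := vbr.
have st t : t \in Arc 2 G -> 'C_X[t | to * 3] = 1.
  have [y [x [z ->]]] := tuple3P t; rewrite arc2E => /and3P[yx xz yz].
  apply/trivgP/subsetP => a /setIP[aX /astab1P]; rewrite /= nact3E => /tuple3_inj[ay ax az].
  have xV := adj_vset xz; have xy : adj G x y by rewrite adj_sym.
  by rewrite in_set1 (arc2_stab_trivial (block_in HG xV) Hd (ker _ (block_in HG xV))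
    (mem_block HG xV) xy xz yz aX ax ay az).
split=> //; split; first exact: (Ghat_sym HG).1.
have v3 := val_rd HG Hd hr.
have cA : #|Arc 2 G| = #|X|.
  by rewrite (card_Arc2 v3) (card_vertices HG hv) cX -!mulnA.
have /card_gt0P[t tA] : 0 < #|Arc 2 G|.
  by rewrite cA; apply/card_gt0P; exists 1; apply: group1.
apply/imsetP; exists t => //; apply/eqP; rewrite eq_sym eqEcard; apply/andP; split.
  apply/subsetP => _ /orbitP[a aX <-] /=.
  move: tA; have [x [y [z ->]]] := tuple3P t; rewrite nact3E !arc2E.
  by rewrite !(acts_adj HX) // (inj_eq (act_inj to a)).
by rewrite card_orbit st // indexg1 cA.
Qed.

Lemma case_a_conclusion B C : adj Q B C ->
  stab_induced X to B \isog 'Alt_('I_4) \/ stab_induced X to B \isog 'Sym_('I_4) ->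
  exists D : {set 4.-tuple {set T}},
    [/\ arc_orbit X toB Q D, self_paired_arcs D, G ~=g Xi Q D
      & [\/ case_a1 G X to P B C D, case_a2 G X to P B C D | case_a3 G X to P B C]].
Proof.
move=> BC iso; have BP := adj_vset BC; have [d Hd] := has_d_exists HG.
have [hv hb hr] := vbr; have val := val_rd HG Hd hr.
have btw := between_cases HG K3 Hd BC.
exists D; split; [exact: lab_arcs_orbit missed_act missed_nbr|exact: lab_arcs_sp|exact: missed_Xi|].
have := lab_cases HG K3 vbr isT a2 Hd missed_act missed_nbr missed_inj erefl BP iso.
have D3 := lab_arcs_sub HG missed_nbr; have Dinv := lab_arcs_inv HG missed_act.
have Dsp := @lab_arcs_sp _ G P lab.
case=> [[dE ker cA]|[dE isoS con comp]|[dE con st q3]].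
- have D1 := lab_d1 HG K3 vbr Hd missed_nbr missed_inj dE.
  have kers B' (BP' : B' \in P) := unique_kernel HG K3 vbr isT a2 D3 Dinv Dsp D1 BP'.
  rewrite dE in Hd val btw; apply: Or31; split=> //.
  + by case: btw => -[].
  + exact: (quotient_cycles HG vbr a2 D3 Dinv Dsp D1).
  + case: cA => [cA|[isoS cX]]; [by left|right; split=> //].
    exact: arc2_regular_S4.
- rewrite dE in val btw; apply: Or32; split=> //.
  by case: btw => -[].
- rewrite dE in val btw; apply: Or33; split=> //.
  by case: btw => -[].
Qed.

End CaseA.

(** * Case (b) *)

Section MidPath.
Variable W : finType.

(* Meant for #|S| = 2, where it is a 2-path; avoids ordering S. *)
Definition mid_path (t : W) (S : {set W}) : {set 3.-tuple W} :=
  [set [tuple p.1; t; p.2] | p in [set p : W * W | [&& p.1 \in S, p.2 \in S & p.1 != p.2]]].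

Lemma mid_pathE t x y : x != y -> mid_path t [set x; y] = path2 x t y.
Proof.
move=> xy; apply/setP => s; rewrite /path2 /path_of !inE rev_tup3.
apply/imsetP/orP => [[[u w]]|[]/eqP ->].
- rewrite inE /= !in_set2 => /and3P[/orP[]/eqP-> /orP[]/eqP-> uw] ->; rewrite ?eqxx in uw *; auto.
- by exists (x, y) => //; rewrite inE /= !in_set2 !eqxx xy !orbT.
- by exists (y, x) => //; rewrite inE /= !in_set2 !eqxx eq_sym xy !orbT.
Qed.

Lemma mid_path_inj t t' (S S' : {set W}) : #|S| = 2 -> #|S'| = 2 ->
  mid_path t S = mid_path t' S' -> t = t' /\ S = S'.
Proof.
move=> /eqP/cards2P[x [y [xy ->]]] /eqP/cards2P[x' [y' [xy' ->]]].
rewrite !mid_pathE // => /path2_inj[-> [[-> ->]|[-> ->]]]; split=> //.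
exact: setUC.
Qed.

Lemma mid_path_Path (G : graph W) t (S : {set W}) : #|S| = 2 -> S \subset nbr G t ->
  mid_path t S \in Path 2 G.
Proof.
move=> /eqP/cards2P[x [y [xy ->]]]; rewrite subUset !sub1set !inE => /andP[tx ty].
by rewrite mid_pathE //; apply/path2P; exists x, t, y; rewrite adj_sym.
Qed.

Lemma path2_mid (G : graph W) p : p \in Path 2 G ->
  exists t (S : {set W}), [/\ t \in vset G, #|S| = 2, S \subset nbr G t & p = mid_path t S].
Proof.
case/path2P=> [x [t [y [xt ty xy ->]]]]; exists t, [set x; y].
by rewrite (adj_vset ty) cards2 xy subUset !sub1set !inE adj_sym xt ty mid_pathE.
Qed.

Lemma mid_path_act (aT : finGroupType) (to : {action aT &-> W}) a t (S : {set W}) :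
  #|S| = 2 -> mid_path (to t a) (to^*%act S a) = (to * 3)^*%act (mid_path t S) a.
Proof.
move=> /eqP/cards2P[x [y [xy ->]]]; rewrite setact_set2 !mid_pathE ?(inj_eq (act_inj to a)) //.
rewrite /path2 /path_of !rev_tup3 [RHS]setactE imsetU !imset_set1.
by congr (_ :|: _); congr set1; rewrite -?nact3E.
Qed.

End MidPath.

Section CaseB.
Variables (aT : finGroupType) (T : finType) (G : graph T).
Variables (X : {group aT}) (to : {action aT &-> T}) (P : {set {set T}}).
Hypothesis HG : in_Ghat G X to P.
Hypothesis K3 : has_k G P 3.

Local Notation V := (vset G).
Local Notation Q := (quotient_graph G P).
Local Notation toB := (to^*)%act.
Local Notation pb := (pblock P).
Local Notation L := (blocks_at G P).
Local Notation XB B := ('N_X(B | to))%G.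
Local Notation pts := (block_pts G P).

Let HX : acts_on_graph X to G := Ghat_acts HG.
Let HQ := quotient_acts HG.

Hypothesis vbr : has_vbr G P 6 4 2.
Hypothesis a2 : arc_transitive X toB 2 Q.

Definition other_block (x : T) (C : {set T}) : {set T} :=
  odflt set0 [pick D in L x :\ C].

Lemma card_blocks_at x : x \in V -> #|L x| = 2.
Proof. by have [_ _ hr] := vbr; apply: hr. Qed.

Lemma other_blockE x C D : C \in L x -> (D == other_block x C) = (D \in L x :\ C).
Proof.
move=> Cx; have /eqP/cards1P[E e] : #|L x :\ C| = 1%N.
  by have := cardsD1 C (L x); rewrite Cx (card_blocks_at (blocks_at_vset HG Cx)) add1n => -[<-].
rewrite /other_block; case: pickP => [F|/(_ E)]; rewrite e in_set1; last by rewrite eqxx.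
by move/eqP->; rewrite in_set1.
Qed.

Lemma other_block_mem x C : C \in L x -> other_block x C \in L x :\ C.
Proof. by move=> Cx; rewrite -other_blockE ?eqxx. Qed.

Lemma blocks_at2 x C : C \in L x -> L x = [set C; other_block x C].
Proof.
move=> Cx; apply/setP => D; rewrite in_set2 (other_blockE _ Cx) in_setD1.
by case: eqVneq => [->|].
Qed.

Lemma other_act a x C : a \in X -> C \in L x ->
  other_block (to x a) (toB C a) = toB (other_block x C) a.
Proof.
move=> aX Cx; have := other_block_mem Cx; rewrite in_setD1 => /andP[h1 h2].
apply/esym/eqP; rewrite other_blockE ?(blocks_at_act HG) // in_setD1 (blocks_at_act HG) //.
by rewrite (inj_eq (act_inj toB a)) h1.
Qed.

Lemma other_nbr x C : C \in L x -> adj Q (pb x) (other_block x C) /\ other_block x C != C.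
Proof.
move=> Cx; have := other_block_mem Cx; rewrite in_setD1 => /andP[h1 h2]; split=> //.
exact: (blocks_at_adj HG h2).
Qed.

Lemma blocks_inj_V x x' : x \in V -> x' \in V -> pb x = pb x' -> L x = L x' -> x = x'.
Proof.
move=> xV xV' e; have [_ _ hr] := vbr.
apply: (arc2_blocks_inj HG K3 a2 hr isT (block_in HG xV)); first exact: mem_block HG _ xV.
by rewrite e; apply: mem_block HG _ xV'.
Qed.

Lemma other_inj x x' C : C \in L x -> C \in L x' -> pb x = pb x' ->
  other_block x C = other_block x' C -> x = x'.
Proof.
move=> Cx Cx' e o; have xV := blocks_at_vset HG Cx; have xV' := blocks_at_vset HG Cx'.
by apply: blocks_inj_V => //; rewrite (blocks_at2 Cx) (blocks_at2 Cx') o.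
Qed.

Local Notation D := (lab_arcs G P other_block).

Lemma nbr_sub x : x \in V -> L x \subset nbr Q (pb x).
Proof. by move=> xV; apply: (blocks_at_sub HG (block_in HG xV) (mem_block HG xV)). Qed.

Lemma card_unblocked x : x \in V -> #|nbr Q (pb x) :\: L x| = 2.
Proof.
move=> xV; have [_ hb _] := vbr.
by rewrite cardsD (setIidPr (nbr_sub xV)) (hb _ (block_in HG xV)) card_blocks_at.
Qed.

Lemma point_of_pair B (S : {set {set T}}) : B \in P -> #|S| = 2 -> S \subset nbr Q B ->
  exists x, [/\ x \in V, pb x = B & L x = S].
Proof.
move=> BP /eqP/cards2P[A [C [AC ->]]]; rewrite subUset !sub1set !inE => /andP[BA BC].
have [x [xB Cx oA]] := labS HG K3 vbr other_nbr other_inj BC BA AC.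
exists x; rewrite (block_eq HG BP xB) (block_sub HG BP xB); split=> //.
by rewrite (blocks_at2 Cx) oA setUC.
Qed.

(** Here and in [co_path] a vertex is named by a 2-path with its own block in the middle. The ends
    are the two blocks in [L x], which suits [gimel], or the two missed ones, which suits [Psi]. As
    the complement of a pair among four blocks is a pair, both namings exhaust [Path 2]. *)
Definition end_path x := mid_path (pb x) (L x).
Definition co_path x := mid_path (pb x) (nbr Q (pb x) :\: L x).

Lemma end_pathE x C : C \in L x -> end_path x = path2 (other_block x C) (pb x) C.
Proof.
move=> Cx; have := other_block_mem Cx; rewrite in_setD1 => /andP[h1 _].
by rewrite /end_path (blocks_at2 Cx) setUC mid_pathE.
Qed.

Lemma end_path_inj : {in V &, injective end_path}.
Proof.
move=> x y xV yV /mid_path_inj; rewrite !card_blocks_at // => -[] // e1 e2.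
exact: blocks_inj_V.
Qed.

Lemma co_path_inj : {in V &, injective co_path}.
Proof.
move=> x y xV yV /mid_path_inj; rewrite !card_unblocked // => -[] // e1 e2.
apply: blocks_inj_V => //; apply/setP => C.
have /setP/(_ C) := e2; rewrite !in_setD -e1.
have sx := subsetP (nbr_sub xV) C; have sy := subsetP (nbr_sub yV) C; rewrite -e1 in sy.
by case: (C \in nbr Q _) sx sy => [_ _|sx sy _]; rewrite ?andbT; [move/negb_inj|apply/idP/idP => [/sx|/sy]].
Qed.

Lemma end_path_image : end_path @: V = Path 2 Q.
Proof.
apply/setP => p; apply/imsetP/idP => [[x xV ->]|/path2_mid[B [S [BP cS SN ->]]]].
  by apply: mid_path_Path; rewrite ?card_blocks_at ?nbr_sub.
by have [x [xV <- <-]] := point_of_pair BP cS SN; exists x.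
Qed.

Lemma co_path_image : co_path @: V = Path 2 Q.
Proof.
have [_ hb _] := vbr; apply/setP => p.
apply/imsetP/idP => [[x xV ->]|/path2_mid[B [S [BP cS SN ->]]]].
  by apply: mid_path_Path; rewrite ?card_unblocked ?subsetDl.
have cS' : #|nbr Q B :\: S| = 2 by rewrite cardsD (setIidPr SN) (hb _ BP) cS.
have [x [xV eB e]] := point_of_pair BP cS' (subsetDl _ _); exists x => //.
by rewrite /co_path e eB setDDr setDv set0U (setIidPr SN).
Qed.

Lemma lab_adj_blocks x y : adj G x y ->
  [/\ pb y \in L x, pb x \in L y, x \in V & y \in V].
Proof.
move=> xy; have yx : adj G y x by rewrite adj_sym.
by rewrite (adj_blocks_at HG xy) (adj_blocks_at HG yx) (adj_vset xy) (adj_vset yx).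
Qed.

Lemma case_b_gimel : G ~=g gimel Q D.
Proof.
have D3 := lab_arcs_sub HG other_nbr; have Dsp := @lab_arcs_sp _ G P other_block.
exists end_path; split; [exact: end_path_inj|exact: end_path_image|].
move=> x y xV yV; apply/(gimel_adjP _ _ D3 Dsp)/idP => [|xy]; last first.
  have [Lx Ly _ _] := lab_adj_blocks xy.
  exists (other_block x (pb y)), (pb x), (pb y), (other_block y (pb x)); split.
  - by apply/lab_arcsP; exists x, y.
  - exact: end_pathE.
  - by rewrite (end_pathE Ly) path2_sym.
case=> [a0 [b0 [c0 [d0 [/lab_arcsP[x' [y' [xy' /tuple4_inj[-> -> -> ->]]]] e1 e2]]]]].
have [Lx Ly xV' yV'] := lab_adj_blocks xy'.
have -> : x = x' by apply: end_path_inj => //; rewrite e1 -end_pathE.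
have -> // : y = y' by apply: end_path_inj => //; rewrite e2 path2_sym -end_pathE.
Qed.

Definition co_pairs : {set {set 3.-tuple {set T}} * {set 3.-tuple {set T}}} :=
  [set (co_path p.1, co_path p.2) | p in [set p : T * T | adj G p.1 p.2]].

Lemma co_pairsP p q : reflect (exists x y, [/\ adj G x y, p = co_path x & q = co_path y])
  ((p, q) \in co_pairs).
Proof.
apply: (iffP imsetP) => [[[x y]]|[x [y [xy -> ->]]]]; first by rewrite inE => xy [-> ->]; exists x, y.
by exists (x, y); rewrite ?inE.
Qed.

Lemma case_b_Psi : G ~=g Psi Q co_pairs.
Proof.
have cE x y : x \in V -> y \in V -> ((co_path x, co_path y) \in co_pairs) = adj G x y.
  move=> xV yV; apply/co_pairsP/idP => [[x' [y' [xy e1 e2]]]|xy]; last by exists x, y.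
  by rewrite (co_path_inj xV (adj_vset xy) e1) (co_path_inj yV (adj_vset_r xy) e2).
apply: (label_giso (h := co_path)); [exact: co_path_inj|exact: co_path_image|].
by move=> x y xV yV; rewrite !cE // [adj G y x]adj_sym orbb.
Qed.

Lemma co_path_act a x : a \in X -> x \in V -> co_path (to x a) = (toB * 3)^*%act (co_path x) a.
Proof.
move=> aX xV; rewrite /co_path -mid_path_act ?card_unblocked // (block_act HG) //.
congr (mid_path _ _); rewrite -(setact_nbr _ HQ) // (blocks_at_setact HG) //.
by apply/setP => C; rewrite -(actKV toB a C) in_setD !(mem_setactE toB) in_setD.
Qed.

Lemma co_pairs_sp : self_paired co_pairs.
Proof. by move=> p q /co_pairsP[x [y [xy -> ->]]]; apply/co_pairsP; exists y, x; rewrite adj_sym. Qed.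

(** The block of [y] lies in [L x], so it is not an end of [co_path x]; this and its mirror image
    are the defining conditions of [Jset]. *)
Lemma co_pairs_J x y : adj G x y -> (co_path x, co_path y) \in Jset Q.
Proof.
move=> xy; have [Lx Ly xV yV] := lab_adj_blocks xy.
have /eqP/cards2P[A [B [AB eA]]] := card_unblocked xV.
have /eqP/cards2P[C [E [CE eC]]] := card_unblocked yV.
have nA F : (F \in [set A; B]) = (F \in nbr Q (pb x)) && (F \notin L x).
  by rewrite -eA in_setD andbC.
have nC F : (F \in [set C; E]) = (F \in nbr Q (pb y)) && (F \notin L y).
  by rewrite -eC in_setD andbC.
have [] : adj Q (pb x) A /\ adj Q (pb x) B.
  by have := nA A; have := nA B; rewrite !in_set2 !eqxx orbT !in_set
     => /esym/andP[-> _] /esym/andP[-> _].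
have [] : adj Q (pb y) C /\ adj Q (pb y) E.
  by have := nC C; have := nC E; rewrite !in_set2 !eqxx orbT !in_set
     => /esym/andP[-> _] /esym/andP[-> _].
move=> yC yE xA xB; rewrite inE.
apply/existsP; exists A; apply/existsP; exists (pb x); apply/existsP; exists B.
apply/existsP; exists C; apply/existsP; exists (pb y); apply/existsP; exists E.
rewrite /co_path eA eC !mid_pathE // eqxx !arc2E !in_setD nA nC Lx Ly !andbF.
by rewrite (adj_sym Q A) (adj_sym Q C) xA xB yC yE AB CE !inE (quotient_adj HG xy) adj_sym (quotient_adj HG xy).
Qed.

Lemma co_pairs_orbit : J_orbit Q X toB co_pairs.
Proof.
have [B BP] := P_nonempty HG; have [x xB] := block_nonempty HG BP.
have [y xy] := vertex_nbr HG (block_sub HG BP xB).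
exists (co_path x, co_path y); first exact: co_pairs_J.
apply/setP => -[p q]; apply/co_pairsP/orbitP => [[x' [y' [xy' -> ->]]]|[a aX]].
  have [a aX [<- <-]] := arcs_tr HG xy xy'; exists a => //.
  by rewrite !co_path_act ?(adj_vset xy) ?(adj_vset_r xy).
case=> <- <-; exists (to x a), (to y a); rewrite (acts_adj HX) //.
by rewrite !co_path_act ?(adj_vset xy) ?(adj_vset_r xy).
Qed.

Lemma case_b_conclusion B C : adj Q B C ->
  stab_induced X to B \isog 'Alt_('I_4) \/ stab_induced X to B \isog 'Sym_('I_4) ->
  exists (D : {set 4.-tuple {set T}})
         (L : {set {set 3.-tuple {set T}} * {set 3.-tuple {set T}}}),
    [/\ arc_orbit X toB Q D /\ self_paired_arcs D, J_orbit Q X toB L /\ self_paired L,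
        G ~=g gimel Q D, G ~=g Psi Q L
      & [\/ case_b1 G X to P B C D, case_b2 G X to P B C D | case_b3 G X to P B C]].
Proof.
move=> BC iso; have BP := adj_vset BC; have [d Hd] := has_d_exists HG.
have [hv hb hr] := vbr; have val := val_rd HG Hd hr.
have btw := between_cases HG K3 Hd BC.
have D3 := lab_arcs_sub HG other_nbr; have Dinv := lab_arcs_inv HG other_act.
have Dsp := @lab_arcs_sp _ G P other_block.
exists D, co_pairs; split.
- by split=> //; apply: lab_arcs_orbit other_act other_nbr.
- by split; [apply: co_pairs_orbit|apply: co_pairs_sp].
- exact: case_b_gimel.
- exact: case_b_Psi.
have := lab_cases HG K3 vbr isT a2 Hd other_act other_nbr other_inj erefl BP iso.
case=> [[dE ker cA]|[dE isoS con comp]|[dE con st q3]].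
- have D1 := lab_d1 HG K3 vbr Hd other_nbr other_inj dE.
  rewrite dE in Hd val btw; apply: Or31; split.
  + by case: btw => -[].
  + have [m [n [E [iso1 cyc nn]]]] := quotient_gimel HG vbr a2 D3 Dinv Dsp D1.
    by exists m, n, E; split=> //; apply: giso_trans case_b_gimel iso1.
  + case: cA => [cA|[isoS cX]]; [by left|right; split=> //].
    (* The graph has [12 |P|] arcs, half the order of [X]. *)
    case=> -[_ tr] /(card_of_regular tr); rewrite cX (card_Arc1 val) (card_vertices HG hv).
    by have := card_P_gt0 HG; lia.
- rewrite dE in val btw; apply: Or32; split=> //.
  by case: btw => -[].
- rewrite dE in val btw; apply: Or33; split=> //.
  by case: btw => -[].
Qed.

End CaseB.

(** * Case (c) *)

Section Stars.
Variable W : finType.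

Lemma mem_star (t u w : W) (L : {set W}) : ((u, w) \in star t L) = (u == t) && (w \in L).
Proof.
apply/imsetP/andP => [[s sL [-> ->]]|[/eqP-> wL]]; first by rewrite eqxx.
by exists w.
Qed.

Lemma star_inj (t t' : W) (L L' : {set W}) : L != set0 -> star t L = star t' L' -> t = t' /\ L = L'.
Proof.
case/set0Pn=> s sL e; have : (t, s) \in star t' L' by rewrite -e mem_star eqxx.
rewrite mem_star => /andP[/eqP tt' _]; split=> //; apply/setP => w.
by have /setP/(_ (t, w)) := e; rewrite !mem_star tt' eqxx.
Qed.

Lemma star_act (aT : finGroupType) (to : {action aT &-> W}) (t : W) (L : {set W}) a :
  (pair_action to)^*%act (star t L) a = star (to t a) (to^*%act L a).
Proof.
apply/setP => -[u w]; rewrite -(actKV to a u) -(actKV to a w) mem_star (mem_setactE to).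
rewrite (inj_eq (act_inj to a)) -mem_star.
exact: (mem_setactE (pair_action to) (star t L) a (to u a^-1, to w a^-1)).
Qed.

End Stars.

Lemma card_PSL32 : #|PSL 3 2| = 168.
Proof. by rewrite (card_isog PSL32_isog) card_GL32. Qed.

Section CaseC.
Variables (aT : finGroupType) (T : finType) (G : graph T).
Variables (X : {group aT}) (to : {action aT &-> T}) (P : {set {set T}}).
Hypothesis HG : in_Ghat G X to P.
Hypothesis K3 : has_k G P 3.

Local Notation V := (vset G).
Local Notation Q := (quotient_graph G P).
Local Notation toB := (to^*)%act.
Local Notation pb := (pblock P).
Local Notation L := (blocks_at G P).
Local Notation XB B := ('N_X(B | to))%G.
Local Notation pts := (block_pts G P).

Let HX : acts_on_graph X to G := Ghat_acts HG.
Let HQ := quotient_acts HG.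

Hypothesis vbr : has_vbr G P 7 7 3.
Hypothesis a2 : arc_transitive X toB 2 Q.

Let hr : has_r G P 3 := let: And3 _ _ h := vbr in h.

Definition point_star x := star (pb x) (L x).

Definition double_stars : {set {set {set T} * {set T}} * {set {set T} * {set T}}} :=
  [set (point_star p.1, point_star p.2) | p in [set p : T * T | adj G p.1 p.2]].

Lemma double_starsP p q : reflect (exists x y, [/\ adj G x y, p = point_star x & q = point_star y])
  ((p, q) \in double_stars).
Proof.
apply: (iffP imsetP) => [[[x y]]|[x [y [xy -> ->]]]]; first by rewrite inE => xy [-> ->]; exists x, y.
by exists (x, y); rewrite ?inE.
Qed.

Lemma point_star_inj : {in V &, injective point_star}.
Proof.
move=> x y xV yV /star_inj[|e1 e2]; first by have [C Cx] := blocks_at_nonempty HG xV; apply/set0Pn; exists C.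
apply: (arc2_blocks_inj HG K3 a2 hr isT (block_in HG xV)) => //; first exact: mem_block HG _ xV.
by rewrite e1; apply: mem_block HG _ yV.
Qed.

Lemma point_star_act a x : a \in X -> x \in V ->
  point_star (to x a) = (pair_action toB)^*%act (point_star x) a.
Proof. by move=> aX xV; rewrite [RHS]star_act -(block_act HG) // -(blocks_at_setact HG). Qed.

Lemma point_is_star x : x \in V -> is_star Q 3 (pb x) (L x).
Proof.
move=> xV; have bP := block_in HG xV; apply/and3P.
by split; [exact: bP|exact: (blocks_at_sub HG bP (mem_block HG xV))|rewrite (hr xV)].
Qed.

Lemma stars_of_points : stars_of double_stars = point_star @: V.
Proof.
apply/setP => s; apply/setUP/imsetP => [[]/imsetP[[p q] /double_starsP[x [y [xy -> ->]]] ->]|[x xV ->]].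
- by exists x; rewrite // (adj_vset xy).
- by exists y; rewrite // (adj_vset_r xy).
have [y xy] := vertex_nbr HG xV; left; apply/imsetP.
by exists (point_star x, point_star y) => //; apply/double_starsP; exists x, y.
Qed.

Lemma double_stars_orbit : DSt_orbit Q X toB 3 double_stars.
Proof.
have [B BP] := P_nonempty HG; have [x xB] := block_nonempty HG BP.
have [y xy] := vertex_nbr HG (block_sub HG BP xB).
have yx : adj G y x by rewrite adj_sym.
have xV := adj_vset xy; have yV := adj_vset yx.
exists (point_star x, point_star y).
  rewrite inE; apply/existsP; exists (pb x); apply/existsP; exists (L x).
  apply/existsP; exists (pb y); apply/existsP; exists (L y).
  by rewrite eqxx !point_is_star // (adj_blocks_at HG xy) (adj_blocks_at HG yx).
apply/setP => -[p q]; apply/double_starsP/orbitP => [[x' [y' [xy' -> ->]]]|[a aX]].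
  have [a aX [<- <-]] := arcs_tr HG xy xy'; exists a => //.
  by rewrite !point_star_act.
by case=> <- <-; exists (to x a), (to y a); rewrite (acts_adj HX) // !point_star_act.
Qed.

Lemma double_stars_sp : self_paired double_stars.
Proof.
by move=> p q /double_starsP[x [y [xy -> ->]]]; apply/double_starsP; exists y, x; rewrite adj_sym.
Qed.

(** The stabiliser of [x] preserves the block of [x] and the set [L x], and by [flag_tr] it is
    transitive on that set. *)
Lemma double_stars_symmetric : symmetric_stars Q X toB 3 (stars_of double_stars).
Proof.
have [B BP] := P_nonempty HG; have [x xB] := block_nonempty HG BP; have xV := block_sub HG BP xB.
exists (pb x), (L x); split; first exact: point_is_star.
  have [C Cx] := blocks_at_nonempty HG xV.
  apply: (transitiveI Cx) => [a D /setIP[_ /setIP[_ aL]]|D Dx]; first by rewrite (astabs_act _ aL).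
  have [a aX [xa Ca]] := flag_tr HG Cx Dx; exists a => //; apply/setIP; split.
    by apply/setIP; split=> //; apply/astab1P; rewrite -(block_act HG) // xa.
  by apply/setIP; split=> //; apply/astabsP => F; rewrite -{1}xa (blocks_at_act HG).
rewrite stars_of_points; apply/setP => s; apply/imsetP/orbitP => [[y yV ->]|[a aX <-]].
  have [a aX <-] := verts_tr HG xV yV; exists a => //; by rewrite point_star_act.
by exists (to x a); rewrite ?(acts_act HX.1) // point_star_act.
Qed.

Lemma case_c_Pi : G ~=g Pi double_stars.
Proof.
have cE x y : x \in V -> y \in V -> ((point_star x, point_star y) \in double_stars) = adj G x y.
  move=> xV yV; apply/double_starsP/idP => [[x' [y' [xy e1 e2]]]|xy]; last by exists x, y.
  by rewrite (point_star_inj xV (adj_vset xy) e1) (point_star_inj yV (adj_vset_r xy) e2).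
apply: (label_giso (h := point_star)); [exact: point_star_inj|by rewrite stars_of_points|].
by move=> x y xV yV; rewrite !cE // [adj G y x]adj_sym orbb.
Qed.

Lemma meet1 B C D : B \in P -> C \in nbr Q B -> D \in nbr Q B -> C != D ->
  #|pts B C :&: pts B D| = 1%N.
Proof.
move=> BP CN DN CD; have [l [hl mem]] := design_meet HG K3 BP (arc2_two_trans HG a2 (B := B)) vbr.
by rewrite hl //; move: mem; rewrite !inE !xpair_eqE /= ?orbF => /eqP.
Qed.

(** An element moving the 2-arc from [C] through the block of [x] to [D] onto the corresponding one
    at [x'] also moves the only common point of the two blocks, which is [x]. *)
Lemma line_pair_tr x C D x' C' D' : C \in L x -> D \in L x -> C != D ->
  C' \in L x' -> D' \in L x' -> C' != D' ->
  exists2 a, a \in X & [/\ to x a = x', toB C a = C' & toB D a = D'].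
Proof.
move=> Cx Dx CD Cx' Dx' CD'; have [_ tr] := (transitive_Arc2 HQ).1 a2.2.
have xV := blocks_at_vset HG Cx; have xV' := blocks_at_vset HG Cx'.
have CB : adj Q C (pb x) by rewrite adj_sym; apply: blocks_at_adj HG _ _ Cx.
have CB' : adj Q C' (pb x') by rewrite adj_sym; apply: blocks_at_adj HG _ _ Cx'.
have BD := blocks_at_adj HG Dx; have BD' := blocks_at_adj HG Dx'.
have [a aX [aC aB aD]] := tr _ _ _ _ _ _ CB BD CD CB' BD' CD'.
exists a => //; split=> //.
have CN : C' \in nbr Q (pb x') by rewrite inE adj_sym.
have DN : D' \in nbr Q (pb x') by rewrite inE.
have /eqP/cards1P[z ez] := meet1 (block_in HG xV') CN DN CD'.
have : x' \in pts (pb x') C' :&: pts (pb x') D'.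
  by rewrite in_setI !in_pts (mem_block HG) // Cx' Dx'.
have : to x a \in pts (pb x') C' :&: pts (pb x') D'.
  rewrite in_setI !in_pts -aB -aC -aD !(blocks_at_act HG) // (mem_setactE to) (mem_block HG) //.
  by rewrite Cx Dx.
by rewrite ez !in_set1 => /eqP-> /eqP->.
Qed.

(** For [d = 1] a neighbour of [x] is determined by its block, so a 2-arc centred at [x] amounts to
    an ordered pair of distinct blocks in [L x]. *)
Lemma case_c_arc2_d1 : has_d G P 1 -> arc_transitive X to 2 G.
Proof.
move=> Hd; split; first exact: (Ghat_sym HG).1.
have u x y z : adj G x y -> adj G x z -> pb y = pb z -> y = z.
  move=> xy xz e; have /eqP/cards1P[w ew] := Hd.2 x (pb y) (adj_blocks_at HG xy).
  have : y \in nbr G x :&: pb y by rewrite in_setI inE xy (mem_block HG) ?(adj_vset_r xy).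
  have : z \in nbr G x :&: pb y by rewrite in_setI inE xz e (mem_block HG) ?(adj_vset_r xz).
  by rewrite ew !in_set1 => /eqP-> /eqP->.
have val := val_rd HG Hd hr; rewrite muln1 in val.
apply/(transitive_Arc2 HX); split.
  have [B BP] := P_nonempty HG; have [x xB] := block_nonempty HG BP.
  have /card_gt1P[y [z [yN zN yz]]] : 1 < #|nbr G x| by rewrite val ?(block_sub HG BP xB).
  by exists y, x, z; move: yN zN; rewrite !inE adj_sym.
move=> y x z y' x' z' yx xz yz yx' xz' yz'.
have xy : adj G x y by rewrite adj_sym.
have xy' : adj G x' y' by rewrite adj_sym.
have CD : pb y != pb z by apply: contraNneq yz => /(u _ _ _ xy xz)->.
have CD' : pb y' != pb z' by apply: contraNneq yz' => /(u _ _ _ xy' xz')->.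
have [a aX [ax aC aD]] := line_pair_tr (adj_blocks_at HG xy) (adj_blocks_at HG xz) CD
  (adj_blocks_at HG xy') (adj_blocks_at HG xz') CD'.
exists a => //; split=> //.
  by apply: (u x') => //; rewrite -?ax ?(acts_adj HX) // (block_act HG) // (adj_vset yx).
by apply: (u x') => //; rewrite -?ax ?(acts_adj HX) // (block_act HG) // (adj_vset_r xz).
Qed.

(** There are [7 * 3 * 2 = 42] 2-arcs for each block, whereas the stabiliser of a block has at least
    168 elements. *)
Lemma case_c_not_regular B : B \in P -> stab_induced X to B \isog PSL 3 2 ->
  has_d G P 1 -> ~ arc_regular X to 2 G.
Proof.
move=> BP iso Hd [[_ tr] /(card_of_regular tr)]; have [hv _ _] := vbr.
rewrite (card_Arc2 (val_rd HG Hd hr)) (card_vertices HG hv) (card_X HG BP).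
have : 168 <= #|XB B| by rewrite -card_PSL32 -(card_isog iso); apply: leq_quotient.
by have := card_P_gt0 HG; nia.
Qed.

Lemma case_c_conclusion B C : adj Q B C -> stab_induced X to B \isog PSL 3 2 ->
  [\/ case_c1 G X to B C, case_c2 G X to B C | case_c3 G X to B C].
Proof.
move=> BC iso; have BP := adj_vset BC; have [d Hd] := has_d_exists HG.
have val := val_rd HG Hd hr; have btw := between_cases HG K3 Hd BC.
have con : 2 <= d -> connected G.
  move=> d2; apply: (connected_d2 HG K3 Hd d2) => B' C' D' BP' CN DN CD.
  by apply/card_gt0P; rewrite meet1.
have st : 2 <= d -> s_transitive X to 1 G.
  by move=> d2; split; [exact: (Ghat_sym HG)|exact: (not_arc2_d2 HG Hd d2 hr)].
case: btw => -[dE iso1]; rewrite dE in Hd val con st.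
- apply: Or31; split=> //; first exact: case_c_arc2_d1.
  exact: case_c_not_regular BP iso Hd.
- by apply: Or32; split=> //; [apply: con|apply: st].
- by apply: Or33; split=> //; [apply: con|apply: st].
Qed.

End CaseC.

(** The equivariant isomorphism carries the action on the neighbours of [f B] to that of the block
    stabiliser on the adjacent blocks, whose kernel is by [arc2_kernel] the kernel on the points of
    [B]. *)
Lemma case_c_local (aT : finGroupType) (W : finType) (S : graph W) (X : {group aT})
    (to : {action aT &-> W}) : acts_on_graph X to S ->
  can_occur case_c S X to -> forall x, x \in vset S -> local_group X to S x \isog PSL 3 2.
Proof.
move=> HX [aT' [T [G [X' [to' [P [HG K3 cases [phi [f [phX [fi fV fa] fact]]]]]]]]]] x.
rewrite -fV => /imsetP[B BP ->] {x}.
have a2 := case_c_arc2 HG K3 BP (cases B BP); have [[hv hb hr] iso] := cases B BP.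
have actB a C : a \in X -> C \in P -> to'^*%act C (phi a) \in P.
  by move=> aX CP; rewrite (block_act_in HG) // -phX mem_morphim.
have fN : f @: nbr (quotient_graph G P) B = nbr S (f B).
  apply/setP => w; apply/imsetP/idP => [[C CN ->]|wN].
    by move: CN; rewrite !inE => BC; rewrite fa ?(adj_vset_r BC).
  have : w \in f @: vset (quotient_graph G P).
    by rewrite fV; move: wN; rewrite inE => /adj_vset_r.
  by case/imsetP=> C CP e; exists C => //; move: wN; rewrite e !inE fa.
apply: isog_trans iso; rewrite /stab_induced (arc2_kernel HG K3 a2 hr isT BP).
have stE a : a \in X -> (phi a \in 'N_X'(B | to')) = (a \in 'C_X[f B | to]).
  move=> aX; apply/(stabB_P X' to' B (phi a))/setIP => [[_ e]|[_ /astab1P e]].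
    by split=> //; apply/astab1P; rewrite -fact // e.
  split; first by rewrite -phX mem_morphim.
  by apply: fi => //; [apply: actB|rewrite fact].
apply: (@quotient_image_isog _ _ X 'C_X[f B | to] ('C_('C_X[f B | to])(nbr S (f B) | to))
  'N_X'(B | to') ('C_('N_X'(B | to')%G)(nbr (quotient_graph G P) B | to'^*)) phi).
- exact: subsetIl.
- apply/setP => b; apply/morphimP/idP => [[a _ aC ->]|bN].
    by rewrite stE //; move: aC => /setIP[].
  have : b \in phi @* X by rewrite phX; move: bN => /setIP[].
  case/morphimP=> a aX _ e; exists a => //; by rewrite -stE // -e.
- exact: normal_astab (stabB_acts_nbr HG B).
- exact: subsetIl.
- move=> a aC; have aX : a \in X by move: aC => /setIP[].
  have aN : phi a \in 'N_X'(B | to') by rewrite stE.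
  apply/setIP/setIP => -[_ /astabP h]; split=> //; apply/astabP.
    by move=> w; rewrite -fN => /imsetP[C CN ->]; rewrite -fact // ?h //;
      move: CN; rewrite inE => /adj_vset_r.
  move=> C CN; have CP : C \in P by move: CN; rewrite inE => /adj_vset_r.
  apply: fi => //; first exact: actB.
  by rewrite fact // h // -fN imset_f.
Qed.

Theorem theorem4p1 (aT : finGroupType) (T : finType) (G : graph T)
    (X : {group aT}) (to : {action aT &-> T}) (P : {set {set T}})
    (B : {set T}) :
  in_Ghat G X to P -> B \in P -> has_k G P 3 ->
  let Q := quotient_graph G P in
  (arc_transitive X to^* 2 Q <->
     [\/ case_a G X to P B, case_b G X to P B, case_c G X to P B
       | case_d G X to P B]) /\
  (forall C : {set T}, C \in nbr Q B ->
   [/\ case_a G X to P B ->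
         [/\ exists D : {set 4.-tuple {set T}},
               [/\ arc_orbit X to^* Q D, self_paired_arcs D, G ~=g Xi Q D
                 & [\/ case_a1 G X to P B C D, case_a2 G X to P B C D
                     | case_a3 G X to P B C]],
             [faithful X, on P | to^*]
           & all_tetravalent_occur case_a],
       case_b G X to P B ->
         [/\ exists (D : {set 4.-tuple {set T}})
                    (L : {set {set 3.-tuple {set T}} * {set 3.-tuple {set T}}}),
               [/\ arc_orbit X to^* Q D /\ self_paired_arcs D,
                   J_orbit Q X to^* L /\ self_paired L,
                   G ~=g gimel Q D, G ~=g Psi Q L
                 & [\/ case_b1 G X to P B C D, case_b2 G X to P B C D
                     | case_b3 G X to P B C]],
             [faithful X, on P | to^*]
           & all_tetravalent_occur case_b],
       case_c G X to P B ->
         [/\ exists Th : {set {set {set T} * {set T}} * {set {set T} * {set T}}},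
               [/\ DSt_orbit Q X to^* 3 Th, self_paired Th,
                   symmetric_stars Q X to^* 3 (stars_of Th) & G ~=g Pi Th],
             [faithful X, on P | to^*],
             heptavalent_occur_iff case_c
           & [\/ case_c1 G X to B C, case_c2 G X to B C
               | case_c3 G X to B C]]
     & case_d G X to P B ->
         [\/ case_d1 G P B C, case_d2 G P B C | case_d3 G P B C]]).
Proof.
move=> HG BP K3 Q; split; first exact: two_arc_transitive_cases.
move=> C CN; have BC : adj Q B C by rewrite inE in CN.
split=> [ca|cb|cc|[[b [vbr _]] _]].
- have [vbr iso] := ca; have a2 := case_a_arc2 HG K3 BP ca; have [_ _ hr] := vbr.
  split; [exact: case_a_conclusion|exact: arc2_faithful a2 hr isT|exact: all_tetravalent_occur_a].
- have [vbr iso] := cb; have a2 := case_b_arc2 HG K3 BP cb; have [_ _ hr] := vbr.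
  split; [exact: case_b_conclusion|exact: arc2_faithful a2 hr isT|exact: all_tetravalent_occur_b].
- have [vbr iso] := cc; have a2 := case_c_arc2 HG K3 BP cc; have [_ _ hr] := vbr.
  split; [|exact: arc2_faithful a2 hr isT| |exact: (case_c_conclusion HG K3 vbr a2 BC iso)].
    exists (double_stars G P); split; [exact: (double_stars_orbit HG vbr)|exact: double_stars_sp| |].
      exact: (double_stars_symmetric HG vbr).
    exact: (case_c_Pi HG K3 vbr a2).
  move=> aT' W S X' to' HX conS val7 symS; split; first exact: case_c_local.
  exact: case_c_occurs.
- exact: (case_d_cases HG K3 vbr).
Qed.
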